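(* Let $d\ge3$, let $\varphi$ be the Gaussian free field on $\mathbb Z^d$ with excursion sets $E_\varphi^{\ge h}=\{x\in\mathbb Z^d:\varphi_x\ge h\}$, $h\in\mathbb R$, and let $h_*\in[0,\infty)$ be the percolation threshold of the excursion sets. For $u>0$ let $h(u)=h_*-u+1$ and let $\mathbb P^u$ be the law of $E_\varphi^{\ge h(u)}$. Then there exists $\overline u\in[1,\infty)$ such that the family $\mathbb P^u$, $u>\overline u$, satisfies conditions P1, P2, P3, S1 and S2 (listed in the context, with $a=\overline u$, $b=\infty$). In particular, there exists $\overline h\in(-\infty,h_*]$ such that for every $h\in(-\infty,\overline h)$, with $\mathcal S=E_\varphi^{\ge h}$ and $\mathbb P$ its law: (i) there exist $c=c(h)>0$ and $C=C(h)<\infty$ such that for all $R\ge1$, $\mathbb P[\text{for all }x,y\in\mathcal S_R\cap\mathrm B(R),\ \rho_{\mathcal S}(x,y)\le CR]\ge1-Ce^{-c(\log R)^{1+\Delta_S}}$, where $\Delta_S>0$ is the exponent from S1 at the parameter $u$ with $h(u)=h$; (ii) there exists a convex compact set $D\subset\mathbb R^d$ (depending on $h$) such that for each $\varepsilon\in(0,1)$ there is a $\mathbb P[\,\cdot\mid0\in\mathcal S_\infty]$-a.s. finite random variable $\tilde R_{\varepsilon}$ with $\mathcal S_\infty\cap(1-\varepsilon)R\cdot D\subseteq\mathrm B_{\mathcal S}(0,R)\subseteq\mathcal S_\infty\cap(1+\varepsilon)R\cdot D$ for all $R\ge\tilde R_{\varepsilon}$.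
   Context: Gaussian free field: $\varphi=(\varphi_x)_{x\in\mathbb Z^d}$, $d\ge 3$, is the centered Gaussian field with covariance $\mathbb E[\varphi_x\varphi_y]=g(x,y)$, the Green function of simple random walk on $\mathbb Z^d$ (expected number of visits to $y$ of the walk started at $x$). It is known that there is $h_*\in[0,\infty)$ such that for $h<h_*$, a.s. $E_\varphi^{\ge h}$ contains a unique infinite connected component, and for $h>h_*$, a.s. all connected components of $E_\varphi^{\ge h}$ are finite. Laws of random subsets of $\mathbb Z^d$ are identified with probability measures on $\{0,1\}^{\mathbb Z^d}$ through indicator functions. Notation. $\mathcal F$ is the product sigma-algebra on $\{0,1\}^{\mathbb Z^d}$, generated by the coordinate maps $\Psi_x(\xi)=\xi_x$. For $\xi\in\{0,1\}^{\mathbb Z^d}$, $\mathcal S=\{x\in\mathbb Z^d:\xi_x=1\}$, viewed as a graph with edges between vertices at $\ell^1$-distance $1$. For $r\in[0,\infty]$, $\mathcal S_r$ is the set of vertices of $\mathcal S$ in connected components of $\ell^1$-diameter $\ge r$; $\mathcal S_\infty$ is the set of vertices in infinite components. $\mathrm B(x,r)=\{y\in\mathbb Z^d:|x-y|_\infty\le\lfloor r\rfloor\}$, $\mathrm B(r)=\mathrm B(0,r)$. $\rho_{\mathcal S}$ is the graph distance in $\mathcal S$ ($\infty$ between different components), $\mathrm B_{\mathcal S}(x,r)=\{y\in\mathcal S:\rho_{\mathcal S}(x,y)\le r\}$. An event $G\in\mathcal F$ is increasing (resp. decreasing) if $\xi\in G$ and $\xi_y\le\xi'_y$ (resp. $\xi_y\ge\xi_y'$)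 for all $y$ imply $\xi'\in G$. Conditions on a family $(\mathbb P^u)_{u\in(a,b)}$ of probability measures on $(\{0,1\}^{\mathbb Z^d},\mathcal F)$: P1. For each $u\in(a,b)$, $\mathbb P^u$ is invariant and ergodic with respect to the lattice shifts (invariant under all shifts, ergodic under each nonzero shift). P2. For $u<u'$ in $(a,b)$ and any increasing $G\in\mathcal F$, $\mathbb P^u[G]\le\mathbb P^{u'}[G]$. P3. There exist $R_P,L_P<\infty$, $\varepsilon_P,\chi_P>0$ and a real-valued function $f_P$ with $f_P(L)\ge e^{(\log L)^{\varepsilon_P}}$ for all $L\ge L_P$, such that the following holds for every integer $L\ge1$, all $x_1,x_2\in\mathbb Z^d$, all decreasing events $A_i$ and increasing events $B_i$ in $\sigma(\Psi_y:y\in \mathrm B(x_i,10L))$, $i=1,2$, every integer $R\ge R_P$ and all $a<\widehat u<u<b$ with $u\ge(1+R^{-\chi_P})\widehat u$: if $|x_1-x_2|_\infty\ge R L$, then $\mathbb P^u[A_1\cap A_2]\le\mathbb P^{\widehat u}[A_1]\,\mathbb P^{\widehat u}[A_2]+e^{-f_P(L)}$ and $\mathbb P^{\widehat u}[B_1\cap B_2]\le\mathbb P^{u}[B_1]\,\mathbb P^{u}[B_2]+e^{-f_P(L)}$. S1. There is $f_S:(a,b)\times\mathbb Z_+\to\mathbb R$ such that for each $u\in(a,b)$ there are $\Delta_S=\Delta_S(u)>0$ and $R_S=R_S(u)<\infty$ with $f_S(u,R)\ge(\log R)^{1+\Delta_S}$ for all $R\ge R_S$, and for all $u\in(a,b)$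 and integers $R\ge1$: $\mathbb P^u[\mathcal S_R\cap\mathrm B(R)\ne\emptyset]\ge1-e^{-f_S(u,R)}$ and $\mathbb P^u[\text{all }x,y\in\mathcal S_{R/10}\cap\mathrm B(R)\text{ are connected to each other in }\mathcal S\cap\mathrm B(2R)]\ge1-e^{-f_S(u,R)}$. S2. $\eta(u)=\mathbb P^u[0\in\mathcal S_\infty]$ is positive and continuous on $(a,b)$. *)

(* Defs.v *)
From HB Require Import structures.
From mathcomp Require Import all_boot all_order all_algebra.
From mathcomp Require Import all_classical all_reals all_analysis measurable_realfun.

Set Implicit Arguments.
Unset Strict Implicit.
Unset Printing Implicit Defensive.

Import Order.TTheory GRing.Theory Num.Theory.
Import numFieldNormedType.Exports.

Local Open Scope classical_set_scope.
Local Open Scope ring_scope.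

Notation Zd d := 'rV[int]_d.

Section Lattice.
Context {d : nat}.
Implicit Types (x y z : Zd d) (A S C : set (Zd d)).

Definition l1_dist x y : nat := (\sum_(i < d) `|x 0%R i - y 0%R i|)%N.

Definition linf_dist x y : nat := \max_(i < d) `|x 0%R i - y 0%R i|%N.

Definition box (R : realType) x (r : R) : set (Zd d) :=
  [set y | (linf_dist x y)%:Z <= Num.floor r].

Definition adj x y : bool := l1_dist x y == 1%N.

(* [x :: p] is a nearest-neighbour path of [size p] steps from x to y whose
   vertices all lie in A *)
Definition path_in A x y (p : seq (Zd d)) : Prop :=
  [/\ path adj x p, last x p = y & forall z, z \in x :: p -> A z].

Definition connected_in A x y : Prop := exists p, path_in A x y p.

Definition component S x : set (Zd d) := [set y | connected_in S x y].

Definition is_component S C : Prop := exists2 x, S x & C = component S x.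

Definition l1_diam (R : realType) C : \bar R :=
  ereal_sup [set e | exists x y, [/\ C x, C y & e = (l1_dist x y)%:R%:E]].

Definition large_part (R : realType) S (r : R) : set (Zd d) :=
  [set x | S x /\ (r%:E <= l1_diam R (component S x))%E].

Definition infinite_part S : set (Zd d) :=
  [set x | S x /\ infinite_set (component S x)].

Definition graph_dist (R : realType) S x y : \bar R :=
  ereal_inf [set e | exists2 p, path_in S x y p & e = (size p)%:R%:E].

Definition graph_ball (R : realType) S x (r : R) : set (Zd d) :=
  [set y | S y /\ (graph_dist R S x y <= r%:E)%E].

End Lattice.

Section SimpleRandomWalk.
Context {d : nat}.
Implicit Types x y : Zd d.

Definition srw_step (s : 'I_d * bool) : Zd d := (-1) ^+ s.2 *: delta_mx 0 s.1.

(* probability that the walk started at x is at y after n independent uniform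
   steps: proportion of the (2d)^n sequences of steps leading from x to y *)
Definition srw_prob (R : realType) (n : nat) x y : R :=
  #|[pred s : {ffun 'I_n -> 'I_d * bool} | x + \sum_(k < n) srw_step (s k) == y]|%:R
  / ((2 * d) ^ n)%:R.

Definition green (R : realType) x y : \bar R :=
  (\sum_(0 <= n <oo) (srw_prob R n x y)%:E)%E.

End SimpleRandomWalk.

Section GaussianFreeField.
Context {R : realType} {disp : measure_display} {Omega : measurableType disp}.
Context (P : probability Omega R).

(* [normal_prob m 0] is not the Dirac mass at m, hence the case distinction *)
Definition is_gaussian (X : Omega -> R) : Prop :=
  exists m s : R, 0 <= s /\ forall A : set R, measurable A ->
    P (X @^-1` A) = if s == 0 then \d_m A else normal_prob m s A.

Definition is_gaussian_field (I : Type) (X : I -> Omega -> R) : Prop :=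
  forall (s : seq I) (c : I -> R),
    is_gaussian (fun w => \sum_(i <- s) c i * X i w).

Definition is_GFF d (phi : Zd d -> {RV P >-> R}) : Prop :=
  [/\ is_gaussian_field (fun x => phi x : Omega -> R),
      forall x, ('E_P[phi x] = 0)%E &
      forall x y, ('E_P[fun w => (phi x w * phi y w)%R] = green R x y)%E].

End GaussianFreeField.

(* [sigma_coord A] is the sigma-algebra generated by the coordinate maps
   xi |-> xi y, y in A; a boolean-valued map f generates the same sigma-algebra
   as the single event {f = true} *)
Definition cylinders d (A : set (Zd d)) : set (set (Zd d -> bool)) :=
  [set E | exists2 y, A y & E = [set xi : Zd d -> bool | xi y]].

Definition sigma_coord d (A : set (Zd d)) : set (set (Zd d -> bool)) :=
  <<s cylinders A >>.

Notation config d := (g_sigma_algebraType (@cylinders d setT)).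

Definition occupied d (xi : Zd d -> bool) : set (Zd d) := [set x | xi x].

Section Excursion.
Context {R : realType} {disp : measure_display} {Omega : measurableType disp}.
Context {P : probability Omega R} {d : nat}.
Variables (phi : Zd d -> {RV P >-> R}) (h : R).

Definition excursion (w : Omega) : config d := fun x => h <= phi x w.

Lemma measurable_excursion : measurable_fun setT excursion.
Proof.
apply: (@measurability _ _ Omega (config d) _ _ (cylinders setT)) => //.
move=> _ [_ [y _ ->] <-]; rewrite setTI.
have -> : excursion @^-1` [set xi : Zd d -> bool | xi y] = phi y @^-1` `[h, +oo[.
  by apply/seteqP; split=> w /=; rewrite in_itv/= andbT.
rewrite -[X in measurable X]setTI; exact: measurable_funPT.
Qed.

HB.instance Definition _ := isMeasurableFun.Build _ _ _ _ excursion
  measurable_excursion.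

Definition excursion_law : probability (config d) R := distribution P excursion.

End Excursion.

Section Conditions.
Context {d : nat} {R : realType}.
Variables (a b : \bar R) (Pr : R -> probability (config d) R).
Implicit Types (G : set (config d)) (x y z : Zd d) (xi : config d).

Definition range_ab : set R := [set u | (a < u%:E < b)%E].

Definition shift z xi : config d := fun x => xi (x + z).

Definition increasing G : Prop :=
  forall xi xi', G xi -> (forall y, xi y -> xi' y) -> G xi'.

Definition decreasing G : Prop :=
  forall xi xi', G xi -> (forall y, xi' y -> xi y) -> G xi'.

Definition P1 : Prop := forall u, range_ab u ->
  (forall z G, measurable G -> Pr u (shift z @^-1` G) = Pr u G) /\
  (forall z G, z != 0 -> measurable G -> shift z @^-1` G = G ->
     Pr u G = 0%E \/ Pr u G = 1%E).

Definition P2 : Prop := forall u u', range_ab u -> range_ab u' -> u < u' ->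
  forall G, measurable G -> increasing G -> (Pr u G <= Pr u' G)%E.

Definition P3 : Prop :=
  exists (R_P L_P eps_P chi_P : R) (f_P : nat -> R),
  [/\ 0 < eps_P, 0 < chi_P,
      forall L : nat, (1 <= L)%N -> L_P <= L%:R ->
        expR (ln L%:R `^ eps_P) <= f_P L &
      forall (L : nat) (x1 x2 : Zd d) (A1 A2 B1 B2 : set (config d))
             (N : nat) (u' u : R),
        (1 <= L)%N ->
        let F_ x := sigma_coord (box x (10 * L%:R : R)) in
        F_ x1 A1 -> F_ x2 A2 -> F_ x1 B1 -> F_ x2 B2 ->
        decreasing A1 -> decreasing A2 -> increasing B1 -> increasing B2 ->
        R_P <= N%:R ->
        range_ab u' -> range_ab u -> u' < u ->
        (1 + N%:R `^ (- chi_P)) * u' <= u ->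
        (N * L <= linf_dist x1 x2)%N ->
        (Pr u (A1 `&` A2) <= Pr u' A1 * Pr u' A2 + (expR (- f_P L))%:E)%E /\
        (Pr u' (B1 `&` B2) <= Pr u B1 * Pr u B2 + (expR (- f_P L))%:E)%E].

(* f_S and Delta_S are parameters because the bound on the chemical distance
   refers to the exponent Delta_S *)
Definition S1 (f_S : R -> nat -> R) (Delta_S : R -> R) : Prop :=
  (forall u, range_ab u -> 0 < Delta_S u /\
     exists R_S : R, forall N : nat, R_S <= N%:R ->
       ln N%:R `^ (1 + Delta_S u) <= f_S u N) /\
  (forall u (N : nat), range_ab u -> (1 <= N)%N ->
     ((1 - expR (- f_S u N))%:E <=
        Pr u [set xi | large_part (occupied xi) (N%:R : R)
                         `&` box 0 (N%:R : R) !=set0])%E /\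
     ((1 - expR (- f_S u N))%:E <=
        Pr u [set xi | let S := occupied xi in
          forall x y,
            (large_part S (N%:R / 10 : R) `&` box 0 (N%:R : R)) x ->
            (large_part S (N%:R / 10 : R) `&` box 0 (N%:R : R)) y ->
            connected_in (S `&` box 0 (2 * N%:R : R)) x y])%E).

Definition eta (u : R) : R :=
  fine (Pr u [set xi | infinite_part (occupied xi) 0]).

Definition S2 : Prop :=
  (forall u, range_ab u -> 0 < eta u) /\ {within range_ab, continuous eta}.

End Conditions.

Definition is_perc_threshold d (R : realType) disp (Omega : measurableType disp)
    (P : probability Omega R) (phi : Zd d -> {RV P >-> R}) (h_star : R) : Prop :=
  [/\ 0 <= h_star,
      forall h, h < h_star -> {ae P, forall w, exists! C,
        is_component (occupied (excursion phi h w)) C /\ infinite_set C} &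
      forall h, h_star < h -> {ae P, forall w, forall C,
        is_component (occupied (excursion phi h w)) C -> finite_set C}].

Section Conclusions.
Context {d : nat} {R : realType} (Q : probability (config d) R).

Definition cond_prob (A B : set (config d)) : R :=
  fine (Q (A `&` B)) / fine (Q B).

Definition chemical_distance_bound (Delta : R) : Prop :=
  exists c C : R, 0 < c /\ forall r : R, 1 <= r ->
    ((1 - C * expR (- c * ln r `^ (1 + Delta)))%:E <=
       Q [set xi | let S := occupied xi in
         forall x y,
           (large_part S r `&` box 0 r) x -> (large_part S r `&` box 0 r) y ->
           graph_dist R S x y <= (C * r)%:E])%E.

Definition dilate (t : R) (D : set 'rV[R]_d) : set (Zd d) :=
  [set x | exists2 v, D v & map_mx intr x = t *: v].

(* A random variable that is a.s. finite is a measurable map with values in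
   [-oo, +oo]; where it equals +oo the inclusions are not required. *)
Definition shape_theorem : Prop :=
  exists D : set 'rV[R]_d, [/\ convex_set D, compact D &
    forall eps : R, 0 < eps < 1 ->
      exists Rt : config d -> \bar R,
      [/\ measurable_fun [set: config d] Rt,
          cond_prob [set xi | Rt xi \is a fin_num]
            [set xi | infinite_part (occupied xi) 0] = 1 &
          forall (xi : config d) (r : R), infinite_part (occupied xi) 0 ->
            (Rt xi <= r%:E)%E ->
            let S := occupied xi in
            infinite_part S `&` dilate ((1 - eps) * r) D
              `<=` graph_ball S 0 r /\
            graph_ball S 0 r
              `<=` infinite_part S `&` dilate ((1 + eps) * r) D]].

End Conclusions.

(* Main.v *)
(* At a very low level h the excursion set S is well connected at all scales, and
   S1, S2, the chemical distance bound and the shape theorem all follow from one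
   event of overwhelming probability, [linking]: in a box of side N, every site has
   near it one that escapes to distance w, and any two escaping sites x, y are
   joined in S by a path of length at most 4 |x - y|_1 + w close to the hull of x
   and y, where w^2 <= N.

   Call a site closed when phi < h. A box is bad at scale k + 1 if it contains two
   separated bad boxes of scale k; a bad box of scale n thus carries 2^n separated
   closed sites, on which the sum of the field is a Gaussian of variance of order
   2^n (the Green function has bounded row sums over them), so for h very negative
   the union bound over trees gives probability exp (- c 2^n). Without a bad box at
   the top scale, every closed site lies in a ball of some scale that is isolated
   at that scale, and a lattice path is rerouted around these balls scale by scale.

   P2 is monotonicity in the level. For P1 and P3, the field on one box is
   decoupled from the field on a distant one by subtracting the balayage, a
   combination of field values with nonnegative weights of sum at most 1, whose
   variance is bounded by the Green function between the boxes; the Green function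
   is bounded by a superharmonic power of |x|^2 + K. Equality and independence of
   laws are reduced to equality of the cosine transforms of linear combinations.

   The chemical distance between the infinite-cluster sites nearest to x and y is a
   subadditive ergodic process. Kingman's theorem along each direction, together
   with the Lipschitz bound given by linking, yields uniform convergence to a norm,
   whose unit ball is the shape. *)

(* The growth of the scales is a compromise. Detours around the obstacles of level k must lengthen a
   path by a factor of only 1 + O(2^-k), so that all levels together cost a bounded factor; hence
   the ratio of consecutive scales is of order 2^k and the scale of level n is 2^O(n^2). This must
   remain slow enough for the 2^n closed leaves of a bad tree to win: at side N one has (ln N)^2 =
   O(n^4), far below 2^n. The resulting bound exp (- (ln N)^2) is where [Delta_S = 1] comes from. It
   is summable over dyadic N even against a factor N, which gives linking at all large dyadic scales
   at once, hence existence and uniqueness of the infinite cluster and integrability of passage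
   times.

   The cosine transform of a Gaussian is never computed: its multiplicativity, a consequence of
   rotation invariance, yields both independence and invariance of laws. A decay |x|^(-1/2) of the
   Green function, weaker than the true |x|^(2-d), suffices throughout and comes from one elementary
   barrier valid in every dimension d >= 3. *)
Require Import Defs.
From HB Require Import structures.
From mathcomp Require Import all_boot all_order all_algebra.
From mathcomp Require Import all_classical all_reals all_analysis measurable_realfun.
From mathcomp Require Import ring lra zify.

Set Implicit Arguments.
Unset Strict Implicit.
Unset Printing Implicit Defensive.

Import Order.TTheory GRing.Theory Num.Theory.
Import numFieldNormedType.Exports.

Local Open Scope classical_set_scope.
Local Open Scope ring_scope.

(** * Gaussian integrals *)

Section NormalIntegrals.
Context {R : realType}.
Notation mu := (@lebesgue_measure R).
Local Notation gauss := (normal_prob (0 : R) 1).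

Lemma ge0_integral_normal_prob (m s : R) (f : R -> \bar R) :
  measurable_fun setT f -> (forall x, 0 <= f x)%E ->
  (\int[normal_prob m s]_x f x = \int[mu]_x (f x * (normal_pdf m s x)%:E))%E.
Proof.
move=> mf f0.
rewrite -(Radon_Nikodym_SigmaFinite.change_of_variables (normal_prob_dominates m s))//.
have dom := normal_prob_dominates m s.
apply: ae_eq_integral => //.
- apply: emeasurable_funM => //; apply: (measurable_int mu).
  exact: Radon_Nikodym_SigmaFinite.f_integrable.
- apply: emeasurable_funM => //; apply/measurable_EFinP.
  exact: measurable_normal_pdf.
- apply: ae_eqe_mul2l; apply: integral_ae_eq => //.
  + exact: Radon_Nikodym_SigmaFinite.f_integrable.
  + by apply/measurable_EFinP; exact: measurable_normal_pdf.
  + by move=> E _ mE; rewrite -Radon_Nikodym_SigmaFinite.f_integral.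
Qed.

Lemma ge0_integral_affine (m s : R) (g : R -> R) : 0 < s ->
  continuous g -> (forall x, 0 <= g x) ->
  (\int[mu]_x (g x)%:E = \int[mu]_x (g (m + s * x) * s)%:E)%E.
Proof.
move=> s0 cg g0.
pose F (x : R^o) : R^o := m + s * x.
have dF (x : R) : is_derive (x : R^o) 1 F s.
  rewrite /F; apply: is_derive_eq; by rewrite add0r ?scaler0 ?add0r /GRing.scale /= mulr1 ?mul1r.
have F'E : F^`()%classic = cst s.
  by apply/funext => x; rewrite derive1E; have /@derive_val -> := dF x.
rewrite (@increasing_ge0_integration_by_substitutionT _ F g) //.
- by apply: eq_integral => x _; rewrite F'E.
- by move=> x y xy; rewrite /F ltrD2l ltr_pM2l.
- by rewrite F'E => x; exact: cst_continuous.
- by rewrite F'E; exact: is_cvg_cst.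
- by rewrite F'E; exact: is_cvg_cst.
- apply/cvgrNyPle => A; near=> x; rewrite /F -lerBrDl mulrC -ler_pdivlMr//.
- apply/cvgryPge => A; near=> x; rewrite /F -lerBlDl mulrC -ler_pdivrMr//.
Unshelve. all: end_near.
Qed.

Lemma normal_pdf_affine (m s x : R) : 0 < s ->
  normal_pdf m s (m + s * x) * s = normal_pdf 0 1 x.
Proof.
move=> s0; rewrite !normal_pdfE ?oner_eq0 ?gt_eqF// /normal_peak /normal_fun.
rewrite -[s ^+ 2 * pi *+ 2]mulrnAr sqrtrM ?sqr_ge0// sqrtr_sqr gtr0_norm//.
rewrite !expr1n !mul1r invfM subr0.
rewrite mulrC !mulrA divff ?gt_eqF// mul1r; congr (_ * _).
congr expR; rewrite -[s ^+ 2 *+ 2]mulr_natr; field; by rewrite gt_eqF.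
Qed.

Lemma ge0_integral_normal_affine (m s : R) (g : R -> R) : 0 < s ->
  continuous g -> (forall x, 0 <= g x) ->
  (\int[normal_prob m s]_x (g x)%:E = \int[gauss]_x (g (m + s * x))%:E)%E.
Proof.
move=> s0 cg g0.
have cga : continuous (fun x => g (m + s * x)).
  move=> x; apply: (@continuous_comp _ _ _ (fun x => m + s * x) g); last exact: cg.
  by apply: cvgD; [exact: cvg_cst|apply: cvgM; [exact: cvg_cst|exact: cvg_id]].
rewrite !ge0_integral_normal_prob; last first.
- by move=> x; rewrite lee_fin.
- by apply/measurable_EFinP; exact: continuous_measurable_fun.
- by move=> x; rewrite lee_fin.
- by apply/measurable_EFinP; exact: continuous_measurable_fun.
under eq_integral do rewrite -EFinM.
rewrite (@ge0_integral_affine m s) //; last 2 first.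
- by move=> x; apply: cvgM; [exact: cg|apply: continuous_normal_pdf; rewrite gt_eqF].
- by move=> x; rewrite mulr_ge0 ?normal_pdf_ge0.
by apply: eq_integral => x _; rewrite -mulrA normal_pdf_affine// EFinM.
Qed.

(** Detailed balance: the Gaussian autoregressive step from [x] to [a * x + b * y] is reversible for
    the standard normal law. Both sides are the density of a standard normal pair of correlation
    [a], which is symmetric in its arguments. *)
Lemma normal_pdf_conv (a b x z : R) : 0 < b -> a ^+ 2 + b ^+ 2 = 1 ->
  normal_pdf 0 1 x * normal_pdf (a * x) b z =
  normal_pdf 0 1 z * normal_pdf (a * z) b x.
Proof.
move=> b0 ab; rewrite !normal_pdfE ?oner_eq0 ?gt_eqF// /normal_fun.
rewrite mulrACA [RHS]mulrACA; congr (_ * _); rewrite -!expRD; congr expR.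
have b2 : b ^+ 2 = 1 - a ^+ 2 by rewrite -ab addrC addKr.
have n0 : 1 - a ^+ 2 != 0 by rewrite -b2 expf_neq0// gt_eqF.
rewrite !b2 -[(1 - a ^+ 2) *+ 2]mulr_natr; field; exact: n0.
Qed.

(** Stationarity of the autoregressive step, deduced from its reversibility: after exchanging the
    integrals by Tonelli, detailed balance turns the inner integral into the total mass of a normal
    density. This replaces a change of variables in the plane. *)
Lemma gauss_rotation (a b : R) (g : R -> R) : 0 < b -> a ^+ 2 + b ^+ 2 = 1 ->
  continuous g -> (forall x, 0 <= g x) ->
  (\int[gauss]_x \int[gauss]_y (g (a * x + b * y))%:E =
   \int[gauss]_z (g z)%:E)%E.
Proof.
move=> b0 ab cg g0.
have mg : measurable_fun setT g by exact: continuous_measurable_fun.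
have mpdf2 c : measurable_fun setT (fun p : R * R => normal_pdf (c * p.1) b p.2).
  have -> : (fun p : R * R => normal_pdf (c * p.1) b p.2) =
      (fun p : R * R => normal_pdf 0 b (p.2 - c * p.1)).
    apply/funext => p; rewrite !normal_pdfE ?gt_eqF// /normal_fun subr0//.
  apply: (measurableT_comp (measurable_normal_pdf _ _)).
  by apply: measurable_funB => //; apply: measurable_funM.
transitivity (\int[gauss]_x \int[mu]_z (g z * normal_pdf (a * x) b z)%:E)%E.
  apply: eq_integral => x _.
  rewrite -(@ge0_integral_normal_affine (a * x) b g)//.
  rewrite ge0_integral_normal_prob//; exact/measurable_EFinP.
have mF : measurable_fun setT (fun p : R * R => (g p.2 * normal_pdf (a * p.1) b p.2)%:E).
  apply/measurable_EFinP/measurable_funM => //.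
  exact: (measurableT_comp mg).
rewrite ge0_integral_normal_prob; last first.
- by move=> x; apply: integral_ge0 => z _; rewrite lee_fin mulr_ge0 ?normal_pdf_ge0.
- apply: (@measurable_fun_fubini_tonelli_F _ _ _ _ _ mu _ mF) => p.
  by rewrite lee_fin mulr_ge0 ?normal_pdf_ge0.
rewrite ge0_integral_normal_prob; last first.
- by move=> x; rewrite lee_fin.
- exact/measurable_EFinP.
transitivity (\int[mu]_x \int[mu]_z (g z * normal_pdf (a * x) b z * normal_pdf 0 1 x)%:E)%E.
  apply: eq_integral => x _; rewrite -ge0_integralZr//.
  - apply/measurable_EFinP/measurable_funM => //; exact: measurable_normal_pdf.
  - by move=> z _; rewrite lee_fin mulr_ge0 ?normal_pdf_ge0.
  - by rewrite lee_fin normal_pdf_ge0.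
pose F3 (p : R * R) := (g p.2 * normal_pdf (a * p.1) b p.2 * normal_pdf 0 1 p.1)%:E.
have mF3 : measurable_fun setT F3.
  apply/measurable_EFinP/measurable_funM; first exact/measurable_EFinP.
  by apply: (measurableT_comp (measurable_normal_pdf _ _)).
have F30 p : (0 <= F3 p)%E by rewrite lee_fin !mulr_ge0 ?normal_pdf_ge0.
have := @fubini_tonelli _ _ _ _ _ mu mu F3 mF3 F30.
rewrite /fubini_F /F3 /= => ->.
apply: eq_integral => z _.
under eq_integral => x _ do
  rewrite -mulrA [normal_pdf (_ * x) _ _ * _]mulrC normal_pdf_conv// EFinM EFinM muleA.
rewrite ge0_integralZl//; last 3 first.
- apply/measurable_EFinP; exact: measurable_normal_pdf.
- by move=> x _; rewrite lee_fin normal_pdf_ge0.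
- by rewrite -EFinM lee_fin mulr_ge0 ?normal_pdf_ge0.
by rewrite integral_normal_pdf mule1.
Qed.

Lemma gauss_mgf (t : R) :
  (\int[gauss]_x (expR (t * x))%:E = (expR (t ^+ 2 / 2))%:E)%E.
Proof.
have me : measurable_fun setT (fun x : R => expR (t * x)).
  by apply: (measurableT_comp (@measurable_expR R)); apply: measurable_funM.
rewrite ge0_integral_normal_prob; last first.
- by move=> x; rewrite lee_fin expR_ge0.
- exact/measurable_EFinP.
transitivity (\int[mu]_x ((expR (t ^+ 2 / 2))%:E * (normal_pdf t 1 x)%:E))%E.
  apply: eq_integral => x _; rewrite -!EFinM; congr EFin.
  rewrite !normal_pdfE ?oner_eq0// /normal_fun mulrCA [RHS]mulrCA; congr (_ * _).
  by rewrite -!expRD expr1n; congr expR; field.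
rewrite ge0_integralZl//.
- by rewrite integral_normal_pdf mule1.
- apply/measurable_EFinP; exact: measurable_normal_pdf.
- by move=> x _; rewrite lee_fin normal_pdf_ge0.
Qed.

End NormalIntegrals.

Section GaussianMoments.
Context {R : realType}.
Notation mu := (@lebesgue_measure R).
Local Notation gauss := (normal_prob (0 : R) 1).

Lemma integrable_bounded d (T : measurableType d) (m : {finite_measure set T -> \bar R})
    (f : T -> R) (M : R) : measurable_fun setT f -> (forall x, `|f x| <= M) ->
  m.-integrable setT (EFin \o f).
Proof.
move=> mf fM; apply: measurable_bounded_integrable => //.
  exact: fin_num_fun_lty.
exists M; split; first exact: num_real.
by move=> x Mx y _; apply: le_trans (ltW Mx).
Qed.

Lemma ge0_integral_lebesgueN (f : R -> \bar R) :
  measurable_fun setT f -> (forall x, 0 <= f x)%E ->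
  (\int[mu]_x f (- x)%R = \int[mu]_x f x)%E.
Proof.
move=> mf f0.
have mN : measurable_fun setT (-%R : R -> measurableTypeR R) by [].
transitivity (\int[pushforward mu (-%R : R -> measurableTypeR R)]_x f x)%E.
  by rewrite ge0_integral_pushforward.
by apply: eq_measure_integral => /= A mA _; exact: lebesgue_measureN.
Qed.

Lemma ge0_integral_gaussN (f : R -> \bar R) :
  measurable_fun setT f -> (forall x, 0 <= f x)%E ->
  (\int[gauss]_x f (- x)%R = \int[gauss]_x f x)%E.
Proof.
move=> mf f0; rewrite !ge0_integral_normal_prob//; last exact: measurableT_comp mf _.
rewrite -(@ge0_integral_lebesgueN (fun x => f x * (normal_pdf 0 1 x)%:E)%E).
- apply: eq_integral => x _; congr (_ * (_)%:E)%E.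
  by rewrite !normal_pdfE ?oner_eq0// /normal_fun !subr0 sqrrN.
- apply: emeasurable_funM => //; apply/measurable_EFinP; exact: measurable_normal_pdf.
- by move=> x; rewrite mule_ge0// lee_fin normal_pdf_ge0.
Qed.

(** Its value is 1, but it is carried as an unevaluated positive constant [kappa]: the ratio of the
    variance of a Gaussian variable to the square of its scale parameter. *)
Definition gauss_mom2 : R := \int[gauss]_x (x ^+ 2).

Lemma sqr_le_expR (x : R) : x ^+ 2 <= 2 * (expR x + expR (- x)).
Proof.
have key (y : R) : 0 <= y -> y ^+ 2 <= 2 * (expR y + expR (- y)).
  move=> y0; have := @expR_ge1Dxn _ y 1 y0; have := expR_ge0 (- y).
  by rewrite (_ : (2`!)%:R = 2 :> R)//; lra.
have [x0|x0] := leP 0 x; first exact: key.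
by have := key (- x); rewrite opprK sqrrN addrC; apply; rewrite oppr_ge0 ltW.
Qed.

Lemma integrable_gauss_expR (t : R) :
  gauss.-integrable setT (EFin \o (fun x => expR (t * x))).
Proof.
apply/integrableP; split.
  apply/measurable_EFinP; apply: (measurableT_comp (@measurable_expR R)).
  exact: measurable_funM.
under eq_integral do rewrite /= ger0_norm ?expR_ge0//.
by rewrite gauss_mgf ltry.
Qed.

Lemma integrable_gauss_sqr : gauss.-integrable setT (EFin \o (fun x : R => x ^+ 2)).
Proof.
have iexp : gauss.-integrable setT (fun x : R => (2 * (expR (1 * x) + expR ((-1) * x)))%:E).
  exact: (integrableZl measurableT 2 (integrableD measurableT
    (integrable_gauss_expR 1) (integrable_gauss_expR (-1)))).
apply: (le_integrable _ _ _ iexp) => //.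
- by apply/measurable_EFinP; apply: measurable_funX.
- move=> x _ /=; rewrite lee_fin mul1r mulN1r ger0_norm ?sqr_ge0// ger0_norm.
    exact: sqr_le_expR.
  by rewrite mulr_ge0// addr_ge0 ?expR_ge0.
Qed.

Lemma integrable_gauss_id : gauss.-integrable setT (EFin \o (fun x : R => x)).
Proof.
have ie : gauss.-integrable setT (fun x : R => (x ^+ 2)%:E + (cst 1 x)%:E)%E.
  apply: integrableD => //; first exact: integrable_gauss_sqr.
  by apply: (@integrable_bounded _ _ _ (cst 1) 1) => // x; rewrite normr1.
apply: (le_integrable _ _ _ ie) => //.
- exact/measurable_EFinP.
- move=> x _ /=; rewrite lee_fin [X in _ <= X]ger0_norm ?addr_ge0 ?sqr_ge0//.
  by rewrite ler_norml; apply/andP; split; nra.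
Qed.

Lemma integral_gauss_odd (f : R -> R) : measurable_fun setT f ->
  gauss.-integrable setT (EFin \o f) -> (forall x, f (- x) = - f x) ->
  \int[gauss]_x f x = 0.
Proof.
move=> mf fi fN.
have mE : measurable_fun setT (EFin \o f) by exact/measurable_EFinP.
have e : (\int[gauss]_x (EFin \o f)^\+ x = \int[gauss]_x (EFin \o f)^\- x)%E.
  rewrite -(@ge0_integral_gaussN ((EFin \o f)^\+)%E); last 2 first.
  - exact: measurable_funepos.
  - by move=> x; exact: funepos_ge0.
  by apply: eq_integral => x _; rewrite funeposE funenegE /= fN EFinN.
rewrite /Rintegral integralE e subee//.
apply: integrable_fin_num => //; exact: integrable_funeneg.
Qed.

Lemma integral_gauss_id : \int[gauss]_x x = 0.
Proof. by apply: integral_gauss_odd => //; exact: integrable_gauss_id. Qed.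

(** Uses [1 - expR (- x ^+ 2) <= x ^+ 2], whose left side has mean 1 - 3^(-1/2). *)
Lemma gauss_mom2_gt0 : 0 < gauss_mom2.
Proof.
(* [expR (- x ^+ 2)] times the standard density is [s] times the centered normal density of
   deviation [s], because 1 + 1/2 = 1 / (2 s^2). *)
pose s : R := (Num.sqrt 3)^-1.
have s0 : 0 < s by rewrite invr_gt0 sqrtr_gt0.
have s2 : s ^+ 2 = 3^-1 by rewrite exprVn sqr_sqrtr.
have s1 : s < 1.
  by rewrite -(@ltr_pXn2r _ 2) ?nnegrE ?(ltW s0)// s2 expr1n invf_lt1 ?ltr1n.
have aux (y : R) : - y + - y / 2 = - y / (3^-1 *+ 2) by rewrite -mulr_natr; field.
have mG : measurable_fun setT (fun x : R => expR (- x ^+ 2)).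
  by apply: (measurableT_comp (@measurable_expR R)); apply: measurableT_comp => //;
    apply: measurable_funX.
have Gi : gauss.-integrable setT (EFin \o (fun x : R => expR (- x ^+ 2))).
  apply: (@integrable_bounded _ _ _ _ 1) => // x.
  by rewrite ger0_norm ?expR_ge0// -expR0 ler_expR oppr_le0 sqr_ge0.
have GE : \int[gauss]_x (expR (- x ^+ 2)) = s.
  rewrite /Rintegral ge0_integral_normal_prob; last first.
  - by move=> x; rewrite lee_fin expR_ge0.
  - exact/measurable_EFinP.
  transitivity (fine (\int[mu]_x (s%:E * (normal_pdf 0 s x)%:E))%E).
    congr fine; apply: eq_integral => x _; rewrite -!EFinM; congr EFin.
    rewrite !normal_pdfE ?oner_eq0 ?gt_eqF// /normal_peak /normal_fun !subr0.
    rewrite -[s ^+ 2 * pi *+ 2]mulrnAr sqrtrM ?sqr_ge0// sqrtr_sqr gtr0_norm//.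
    rewrite !expr1n !mul1r invfM mulrCA -expRD !mulrA divff ?gt_eqF// mul1r.
    by rewrite s2 -aux.
  rewrite ge0_integralZl//.
  - by rewrite integral_normal_pdf mule1.
  - apply/measurable_EFinP; exact: measurable_normal_pdf.
  - by move=> x _; rewrite lee_fin normal_pdf_ge0.
  - by rewrite lee_fin ltW.
have : \int[gauss]_x (1 - expR (- x ^+ 2)) <= gauss_mom2.
  apply: le_Rintegral => //; last first.
  - by move=> x _; have := expR_ge1Dx (- x ^+ 2); lra.
  - exact: integrable_gauss_sqr.
  - apply: (@integrable_bounded _ _ _ _ 1); first exact: measurable_funB.
    move=> x; have := expR_ge0 (- x ^+ 2); have : expR (- x ^+ 2) <= 1.
      by rewrite -expR0 ler_expR oppr_le0 sqr_ge0.
    by move=> ? ?; rewrite ler_norml; lra.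
rewrite RintegralB//; last first.
  by apply: (@integrable_bounded _ _ _ (cst 1) 1) => // x; rewrite normr1.
have -> : \int[gauss]_x 1 = 1 :> R.
  rewrite Rintegral_cst// mul1r.
  by have /= -> := @probability_setT _ _ _ (gauss : probability _ _).
by rewrite GE; lra.
Qed.

End GaussianMoments.

Section GaussianVariables.
Context {R : realType}.
Local Notation gauss := (normal_prob (0 : R) 1).
Local Notation kappa := (@gauss_mom2 R).

Definition normal_cos (s : R) : R := \int[gauss]_z cos (s * z).

Lemma measurable_cos : measurable_fun setT (@cos R).
Proof. by apply: continuous_measurable_fun; exact: continuous_cos. Qed.

Lemma measurable_sin : measurable_fun setT (@sin R).
Proof. by apply: continuous_measurable_fun; exact: continuous_sin. Qed.

Lemma norm_cos_le1 (x : R) : `|cos x| <= 1.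
Proof. by rewrite ler_norml cos_geN1 cos_le1. Qed.

Lemma norm_sin_le1 (x : R) : `|sin x| <= 1.
Proof. by rewrite ler_norml sin_geN1 sin_le1. Qed.

Lemma integrable_gauss_bounded (f : R -> R) (M : R) : measurable_fun setT f ->
  (forall x, `|f x| <= M) -> gauss.-integrable setT (EFin \o f).
Proof. by move=> mf fM; apply: (@integrable_bounded _ _ _ _ _ M). Qed.

Lemma prob_Rintegral_cst d (T : measurableType d) (m : probability T R) (c : R) :
  \int[m]_x c = c.
Proof.
by rewrite Rintegral_cst//; have /= -> := @probability_setT _ _ _ m; rewrite mulr1.
Qed.

Lemma prob_Rintegral_bound d (T : measurableType d) (m : probability T R)
    (f : T -> R) (M : R) : measurable_fun setT f -> (forall x, `|f x| <= M) ->
  `|\int[m]_x f x| <= M.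
Proof.
move=> mf fM.
have fi : m.-integrable setT (EFin \o f) by exact: (integrable_bounded _ mf fM).
have ci c : m.-integrable setT (EFin \o (cst c : T -> R)).
  exact: (@integrable_bounded _ _ _ _ (cst c) `|c|).
rewrite ler_norml; apply/andP; split.
  rewrite -(prob_Rintegral_cst m (- M)); apply: le_Rintegral => //; first exact: ci.
  by move=> x _; have := fM x; rewrite ler_norml => /andP[].
rewrite -(prob_Rintegral_cst m M); apply: le_Rintegral => //; first exact: ci.
by move=> x _; have := fM x; rewrite ler_norml => /andP[].
Qed.

(** Adding 1 makes a function bounded by 1 nonnegative; identities proved for nonnegative integrands
    thus pass to cosines. *)
Lemma Rintegral_ge0_eq d1 d2 (T1 : measurableType d1) (T2 : measurableType d2)
    (m1 : probability T1 R) (m2 : probability T2 R) (f1 : T1 -> R) (f2 : T2 -> R) :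
  measurable_fun setT f1 -> measurable_fun setT f2 ->
  (forall x, `|f1 x| <= 1) -> (forall x, `|f2 x| <= 1) ->
  (\int[m1]_x (1 + f1 x)%:E = \int[m2]_x (1 + f2 x)%:E)%E ->
  \int[m1]_x f1 x = \int[m2]_x f2 x.
Proof.
move=> mf1 mf2 b1 b2 e.
have i1 : m1.-integrable setT (EFin \o f1) by exact: (integrable_bounded _ mf1 b1).
have i2 : m2.-integrable setT (EFin \o f2) by exact: (integrable_bounded _ mf2 b2).
have c1 : m1.-integrable setT (EFin \o (cst 1 : T1 -> R)).
  by apply: (@integrable_bounded _ _ _ _ _ 1) => // x; rewrite normr1.
have c2 : m2.-integrable setT (EFin \o (cst 1 : T2 -> R)).
  by apply: (@integrable_bounded _ _ _ _ _ 1) => // x; rewrite normr1.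
have : \int[m1]_x (cst 1 x + f1 x) = \int[m2]_x (cst 1 x + f2 x).
  by rewrite /Rintegral; congr fine.
by rewrite !RintegralD// /cst !prob_Rintegral_cst => /addrI.
Qed.

Lemma continuous_affine (m s : R) : continuous (fun z : R => m + s * z).
Proof.
by move=> x; apply: cvgD; [exact: cvg_cst|apply: cvgM; [exact: cvg_cst|exact: cvg_id]].
Qed.

Lemma normal_cos_shift (s b : R) :
  \int[gauss]_z cos (s * z + b) = cos b * normal_cos s.
Proof.
have mcs : measurable_fun setT (fun z : R => cos (s * z)).
  by apply: (measurableT_comp measurable_cos); exact: measurable_funM.
have msn : measurable_fun setT (fun z : R => sin (s * z)).
  by apply: (measurableT_comp measurable_sin); exact: measurable_funM.
have ics : gauss.-integrable setT (EFin \o (fun z => cos (s * z))).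
  by apply: (integrable_gauss_bounded mcs) => x; exact: norm_cos_le1.
have isn : gauss.-integrable setT (EFin \o (fun z => sin (s * z))).
  by apply: (integrable_gauss_bounded msn) => x; exact: norm_sin_le1.
transitivity (\int[gauss]_z (cos b * cos (s * z) - sin b * sin (s * z))).
  by apply: eq_Rintegral => z _; rewrite cosD mulrC [sin _ * _]mulrC.
have iZc : gauss.-integrable setT (EFin \o (fun z => cos b * cos (s * z))).
  exact: (integrableZl measurableT (cos b) ics).
have iZs : gauss.-integrable setT (EFin \o (fun z => sin b * sin (s * z))).
  exact: (integrableZl measurableT (sin b) isn).
rewrite RintegralB// !RintegralZl//.
by rewrite [X in _ - _ * X]integral_gauss_odd ?mulr0 ?subr0// => x; rewrite mulrN sinN.
Qed.

(** Write [s1 = s * a] and [s2 = s * b] with [(a, b)] on the unit circle and apply rotation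
    invariance to [1 + cos (s * z)]. The addition formula factors the inner integral because the
    sine integrates to zero. *)
Lemma normal_cosM (s1 s2 s : R) : 0 <= s1 -> 0 <= s2 -> 0 <= s ->
  s ^+ 2 = s1 ^+ 2 + s2 ^+ 2 -> normal_cos s = normal_cos s1 * normal_cos s2.
Proof.
move=> s10 s20 s0 ss.
have nc0 : normal_cos 0 = 1.
  rewrite /normal_cos; transitivity (\int[gauss]_z (1 : R)).
    by apply: eq_Rintegral => z _; rewrite mul0r cos0.
  exact: prob_Rintegral_cst.
have [s2z|s2n] := eqVneq s2 0.
  by rewrite s2z nc0 mulr1; congr normal_cos; apply/eqP;
    rewrite -(@eqrXn2 _ 2)// ss s2z expr0n addr0.
have s2p : 0 < s2 by rewrite lt_def s2n.
have sp : 0 < s.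
  by rewrite -(@ltr_pXn2r _ 2) ?nnegrE// expr0n ss ltr_wpDl ?sqr_ge0 ?exprn_gt0.
pose a := s1 / s; pose b := s2 / s.
have b0 : 0 < b by rewrite divr_gt0.
have ab : a ^+ 2 + b ^+ 2 = 1.
  by rewrite /a /b !expr_div_n -mulrDl -ss divff// expf_neq0 ?gt_eqF.
have cg : continuous (fun z : R => 1 + cos (s * z)).
  move=> x; apply: cvgD; first exact: cvg_cst.
  apply: (continuous_comp (f := fun z => s * z)); last exact: continuous_cos.
  by apply: cvgM; [exact: cvg_cst|exact: cvg_id].
have g0 x : 0 <= 1 + cos (s * x) by rewrite -lerBlDl sub0r cos_geN1.
have mcs (t : R) c : measurable_fun setT (fun z : R => cos (t * z + c)).
  by apply: (measurableT_comp measurable_cos); apply: measurable_funD => //.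
have mcs0 (t : R) : measurable_fun setT (fun z : R => cos (t * z)).
  by apply: (measurableT_comp measurable_cos); exact: measurable_funM.
have inner x : (\int[gauss]_y (1 + cos (s * (a * x + b * y)))%:E =
    (1 + normal_cos s2 * cos (s1 * x))%:E)%E.
  rewrite (_ : (fun y => _) = (fun y : R => (1 + cos (s2 * y + s1 * x))%:E)); last first.
    apply/funext => y; congr (1 + cos _)%:E.
    by rewrite /a /b; field; rewrite gt_eqF.
  have := normal_cos_shift s2 (s1 * x).
  have i1 : gauss.-integrable setT (EFin \o (cst 1 : R -> R)).
    by apply: (@integrable_bounded _ _ _ _ _ 1) => // y; rewrite normr1.
  have i2 : gauss.-integrable setT (EFin \o (fun z => cos (s2 * z + s1 * x))).
    by apply: (integrable_gauss_bounded (mcs _ _)) => y; exact: norm_cos_le1.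
  move=> h.
  have e1 : (\int[gauss]_y (cos (s2 * y + s1 * x))%:E = (normal_cos s2 * cos (s1 * x))%:E)%E.
    by rewrite [normal_cos s2 * _]mulrC -h /Rintegral fineK//; exact: integrable_fin_num.
  under eq_integral do rewrite EFinD.
  rewrite integralD// e1 integral_cst// mul1e EFinD; congr (_ + _)%E.
  exact: (@probability_setT _ _ _ (gauss : probability _ _)).
have nc1 t : `|normal_cos t| <= 1.
  by apply: prob_Rintegral_bound => [|y]; [exact: mcs0|exact: norm_cos_le1].
have := gauss_rotation b0 ab cg g0.
under eq_integral do rewrite inner.
move=> /esym e.
have {}e := @Rintegral_ge0_eq _ _ _ _ gauss gauss _ _ _ _ _ _ e.
rewrite /normal_cos e //.
- rewrite mulrC RintegralZl//.
  by apply: (integrable_gauss_bounded (mcs0 _)) => y; exact: norm_cos_le1.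
- exact: mcs0.
- by apply: measurable_funM => //; exact: mcs0.
- by move=> x; exact: norm_cos_le1.
- by move=> x; rewrite normrM mulr_ile1 ?norm_cos_le1.
Qed.

Section AffineGaussian.
Context {disp : measure_display} {Omega : measurableType disp}.
Context (P : probability Omega R).

(** The law of [m + s * Z] with [Z] standard normal, tested on continuous nonnegative functions.
    This form includes the degenerate case [s = 0], where [normal_prob m 0] is not the Dirac
    mass. *)
Definition affine_normal (W : Omega -> R) (m s : R) : Prop :=
  0 <= s /\ forall g : R -> R, continuous g -> (forall x, 0 <= g x) ->
    (\int[P]_w (g (W w))%:E = \int[gauss]_z (g (m + s * z))%:E)%E.

Lemma ge0_integral_law (W : Omega -> R) (nu : {measure set (measurableTypeR R) -> \bar R}) (f : R -> \bar R) :
  measurable_fun setT W ->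
  (forall A : set R, measurable A -> P (W @^-1` A) = nu A) ->
  measurable_fun setT f -> (forall x, 0 <= f x)%E ->
  (\int[P]_w f (W w) = \int[nu]_x f x)%E.
Proof.
move=> mW WE mf f0.
transitivity (\int[pushforward P (W : Omega -> measurableTypeR R)]_x f x)%E.
  by rewrite ge0_integral_pushforward.
by apply: eq_measure_integral => A mA _; exact: WE.
Qed.

Lemma dirac_affine (W : Omega -> R) (m : R) : measurable_fun setT W ->
  (forall A : set R, measurable A -> P (W @^-1` A) = \d_m A) -> affine_normal W m 0.
Proof.
move=> mW WE; split=> // g cg g0.
have mg : measurable_fun setT (EFin \o g).
  by apply/measurable_EFinP; exact: continuous_measurable_fun.
rewrite (@ge0_integral_law W (dirac (m : measurableTypeR R)) (EFin \o g))//.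
rewrite integral_dirac// diracT mul1e.
under eq_integral do rewrite mul0r addr0.
rewrite integral_cst//.
by have /= -> := @probability_setT _ _ _ (gauss : probability _ _); rewrite mule1.
Qed.

Lemma is_gaussian_affine (W : Omega -> R) : measurable_fun setT W ->
  is_gaussian P W -> exists m s, affine_normal W m s.
Proof.
move=> mW [m [s [s0 WE]]]; exists m, s.
have [sz|sn] := eqVneq s 0.
  by rewrite sz; apply: dirac_affine => // A mA; rewrite WE// sz eqxx.
split => // g cg g0.
have mg : measurable_fun setT (EFin \o g).
  by apply/measurable_EFinP; exact: continuous_measurable_fun.
have sp : 0 < s by rewrite lt_def sn.
rewrite -ge0_integral_normal_affine//.
rewrite (@ge0_integral_law W (normal_prob m s) (EFin \o g))//.
by move=> A mA; rewrite WE// (negbTE sn).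
Qed.

Lemma affine_normal_integrable (W : Omega -> R) m s (g : R -> R) :
  measurable_fun setT W -> affine_normal W m s -> continuous g ->
  gauss.-integrable setT (EFin \o (fun z => g (m + s * z))) ->
  P.-integrable setT (EFin \o (fun w => g (W w))) /\
  \int[P]_w g (W w) = \int[gauss]_z g (m + s * z).
Proof.
move=> mW [s0 WE] cg ig.
have mg : measurable_fun setT g by exact: continuous_measurable_fun.
have ci (h : R -> R) : continuous h -> (forall x, 0 <= h x) -> (forall x, h x <= `|g x|) ->
    P.-integrable setT (EFin \o (fun w => h (W w))) /\
    \int[P]_w h (W w) = \int[gauss]_z h (m + s * z).
  move=> ch h0 hg; split; last by rewrite /Rintegral WE.
  apply/integrableP; split.
    apply/measurable_EFinP; apply: measurableT_comp => //.
    exact: continuous_measurable_fun.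
  under eq_integral do rewrite /= ger0_norm//.
  rewrite WE//.
  case/integrableP: ig => mig; apply: le_lt_trans.
  apply: ge0_le_integral => //.
  - by move=> x _; rewrite lee_fin.
  - apply/measurable_EFinP; apply: continuous_measurable_fun => x.
    by apply: continuous_comp; [exact: continuous_affine|exact: ch].
  - by apply: measurableT_comp.
  - by move=> x _ /=; rewrite lee_fin.
(* The positive and negative parts of a continuous function are continuous and at most its absolute
   value, so the nonnegative case applies to each. *)
pose gp x := (`|g x| + g x) / 2; pose gn x := (`|g x| - g x) / 2.
have gE x : g x = gp x - gn x by rewrite /gp /gn; lra.
have nb x : - `|g x| <= g x <= `|g x| by rewrite -ler_norml.
have cnorm : continuous (fun x => `|g x|) by move=> x; apply: cvg_norm; exact: cg.
have cgp : continuous gp.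
  by move=> x; apply: cvgM; [apply: cvgD; [exact: cnorm|exact: cg]|exact: cvg_cst].
have cgn : continuous gn.
  by move=> x; apply: cvgM; [apply: cvgB; [exact: cnorm|exact: cg]|exact: cvg_cst].
have p0 x : 0 <= gp x by have := nb x; rewrite /gp; lra.
have n0 x : 0 <= gn x by have := nb x; rewrite /gn; lra.
have pg x : gp x <= `|g x| by have := nb x; rewrite /gp; lra.
have ng x : gn x <= `|g x| by have := nb x; rewrite /gn; lra.
have [ip ep] := ci gp cgp p0 pg.
have [in_ en] := ci gn cgn n0 ng.
split.
  rewrite (_ : _ \o _ = (EFin \o (fun w => gp (W w))) \- (EFin \o (fun w => gn (W w))))%E.
    exact: integrableB.
  by apply/funext => w /=; rewrite gE.
have gi (h : R -> R) : continuous h -> (forall x, 0 <= h x) -> (forall x, h x <= `|g x|) ->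
    gauss.-integrable setT (EFin \o (fun z => h (m + s * z))).
  move=> ch h0 hg; apply: (le_integrable _ _ _ ig) => //.
    apply/measurable_EFinP; apply: continuous_measurable_fun => x.
    by apply: (continuous_comp (f := fun z => m + s * z)); [exact: continuous_affine|exact: ch].
  by move=> x _ /=; rewrite lee_fin ger0_norm.
have igp := gi _ cgp p0 pg.
have ign := gi _ cgn n0 ng.
transitivity (\int[P]_w (gp (W w) - gn (W w))).
  by apply: eq_Rintegral => w _.
rewrite RintegralB// ep en -RintegralB//.
by apply: eq_Rintegral => z _; rewrite -gE.
Qed.

Lemma affine_normal_mean (W : Omega -> R) m s : measurable_fun setT W ->
  affine_normal W m s -> P.-integrable setT (EFin \o W) /\ \int[P]_w W w = m.
Proof.
move=> mW Wms.
have im : gauss.-integrable setT (EFin \o (fun z : R => m)).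
  exact: (@integrable_gauss_bounded _ `|m|).
have iz : gauss.-integrable setT (EFin \o (fun z : R => s * z)).
  exact: (integrableZl measurableT s integrable_gauss_id).
have [||iW ->] := @affine_normal_integrable W m s id mW Wms.
- by move=> x.
- exact: (integrableD measurableT im iz).
split=> //.
by rewrite RintegralD// prob_Rintegral_cst RintegralZl ?integral_gauss_id ?mulr0 ?addr0//;
  exact: integrable_gauss_id.
Qed.

Lemma affine_normal_mom2 (W : Omega -> R) s : measurable_fun setT W ->
  affine_normal W 0 s -> P.-integrable setT (EFin \o (fun w => W w ^+ 2)) /\
  \int[P]_w (W w ^+ 2) = s ^+ 2 * kappa.
Proof.
move=> mW Wms.
have iz : gauss.-integrable setT (EFin \o (fun z : R => s ^+ 2 * z ^+ 2)).
  exact: (integrableZl measurableT (s ^+ 2) integrable_gauss_sqr).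
have [||iW ->] := @affine_normal_integrable W 0 s (fun x => x ^+ 2) mW Wms.
- by move=> x; exact: exprn_continuous.
- by rewrite (_ : (fun z => _) = (fun z => s ^+ 2 * z ^+ 2))//; apply/funext => z;
    rewrite add0r exprMn.
split=> //; rewrite -RintegralZl//; last exact: integrable_gauss_sqr.
by apply: eq_Rintegral => z _; rewrite add0r exprMn.
Qed.

Lemma affine_normal_cos (W : Omega -> R) s b : measurable_fun setT W ->
  affine_normal W 0 s -> \int[P]_w cos (W w + b) = cos b * normal_cos s.
Proof.
move=> mW [s0 WE]; rewrite -normal_cos_shift.
apply: (@Rintegral_ge0_eq _ _ _ _ P gauss).
- by apply: (measurableT_comp measurable_cos); exact: measurable_funD.
- by apply: (measurableT_comp measurable_cos); apply: measurable_funD => //; exact: measurable_funM.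
- by move=> x; exact: norm_cos_le1.
- by move=> x; exact: norm_cos_le1.
rewrite (WE (fun x => 1 + cos (x + b))).
- by under eq_integral do rewrite add0r.
- move=> x; apply: cvgD; first exact: cvg_cst.
  apply: (continuous_comp (f := fun z => z + b)); last exact: continuous_cos.
  by apply: cvgD; [exact: cvg_id|exact: cvg_cst].
- by move=> x; rewrite -lerBlDl sub0r cos_geN1.
Qed.

Lemma affine_normal_tail (W : Omega -> R) s (V a : R) : measurable_fun setT W ->
  affine_normal W 0 s -> 0 < V -> s ^+ 2 * kappa <= V -> 0 <= a ->
  (P [set w | (W w <= - a)%R] <= (expR (- (a ^+ 2 * kappa) / (2 * V)))%:E)%E.
Proof.
move=> mW [s0 WE] V0 sV a0; have k0 := @gauss_mom2_gt0 R.
(* Chernoff bound: minimizer of [- t * a + t ^+ 2 * (V / kappa) / 2], where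
   [s ^+ 2 <= V / kappa]. *)
pose t := a * kappa / V.
have t0 : 0 <= t by apply: divr_ge0; [apply: mulr_ge0 => //|]; exact: ltW.
have mS : measurable [set w | (W w <= - a)%R].
  rewrite (_ : [set w | _] = W @^-1` `]-oo, (- a)%R]).
    by rewrite -[X in measurable X]setTI; exact: mW.
  by apply/seteqP; split => w /=; rewrite in_itv.
have -> : P [set w | (W w <= - a)%R] = (\int[P]_w (\1_[set w | (W w <= - a)%R] w)%:E)%E.
  by rewrite integral_indic ?setIT.
have ce c : continuous (fun x : R => expR (c * x)).
  move=> x; apply: (continuous_comp (f := fun z => c * z)); last exact: continuous_expR.
  by apply: cvgM; [exact: cvg_cst|exact: cvg_id].
apply: le_trans (_ : \int[P]_w ((expR (- (t * a)))%:E * (expR (- t * W w))%:E) <= _)%E.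
  apply: ge0_le_integral => //.
  - by apply/measurable_EFinP; exact: measurable_indic.
  - apply/measurable_EFinP; apply: measurable_funM => //.
    by apply: measurableT_comp => //; apply: measurable_funM.
  move=> w _; rewrite -EFinM lee_fin -expRD indicE; case: (boolP (w \in _)) => /=; last first.
    by rewrite expR_ge0.
  rewrite inE /= => Wa; rewrite -[X in X <= _]expR0 ler_expR; nra.
rewrite ge0_integralZl//; last first.
  by apply/measurable_EFinP; apply: measurableT_comp => //; apply: measurable_funM.
rewrite (WE (fun x => expR (- t * x)))//.
under eq_integral do rewrite add0r mulrA.
rewrite gauss_mgf -EFinM -expRD lee_fin ler_expR exprMn sqrrN.
have -> : - (a ^+ 2 * kappa) / (2 * V) = - (t * a) + t * a / 2.
  by rewrite /t; field; rewrite gt_eqF.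
rewrite lerD2l ler_pM2r ?invr_gt0//.
have -> : t ^+ 2 * s ^+ 2 = (t * a) * ((s ^+ 2 * kappa) / V).
  by rewrite /t; field; rewrite gt_eqF.
by apply: ler_piMr; [exact: mulr_ge0|rewrite ler_pdivrMr// mul1r].
Qed.

(** Zero mean and nonzero second moment exclude the Dirac case; the other normal laws are dominated
    by Lebesgue measure. *)
Lemma gaussian_no_atom (W : Omega -> R) (h : R) : measurable_fun setT W ->
  is_gaussian P W -> \int[P]_w W w = 0 -> \int[P]_w (W w ^+ 2) != 0 ->
  P [set w | W w = h] = 0%E.
Proof.
move=> mW [m [s [s0 WE]]] W1 W2.
have mW2 : measurable_fun setT (fun w => W w ^+ 2) by apply: measurable_funX.
have [sz|sn] := eqVneq s 0.
  exfalso; move/eqP: W2; apply.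
  have am : affine_normal W m 0.
    by apply: dirac_affine => // A mA; rewrite WE// sz eqxx.
  have [_ m0] := affine_normal_mean mW am.
  have mz : m = 0 by rewrite -m0.
  have {}am : affine_normal W 0 0 by rewrite -{1}mz.
  by have [_ ->] := affine_normal_mom2 mW am; rewrite expr0n mul0r.
rewrite (_ : [set w | _] = W @^-1` [set h])//.
rewrite WE// (negbTE sn).
have /null_content_dominatesP := normal_prob_dominates m s.
apply => //; exact: lebesgue_measure_set1.
Qed.

End AffineGaussian.
End GaussianVariables.

(** * Cosine transforms determine orthant probabilities *)

Section StepApproximation.
Context {R : realType}.

(* The exponents make n (2 t)^n tend to 0 or to infinity according as t < 1/2 or not;
   used at t = (1 - cos (a z + c)) / 2 to recover the sign of a cosine from its powers. *)
Definition step_poly (n : nat) (t : R) : R := (1 - t ^+ n) ^+ (n * 2 ^ n).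

Lemma bernoulli_ineq (x : R) (n : nat) : -1 <= x -> 1 + x *+ n <= (1 + x) ^+ n.
Proof.
move=> x1; elim: n => [|n IH]; first by rewrite mulr0n addr0 expr0.
have h : 0 <= 1 + x by lra.
rewrite exprS; apply: le_trans (ler_wpM2l h IH).
have : 0 <= x ^+ 2 * n%:R by rewrite mulr_ge0 ?sqr_ge0.
move=> h2; rewrite (_ : (1 + x) * (1 + x *+ n) = 1 + x *+ n.+1 + x ^+ 2 * n%:R) ?lerDl//.
by rewrite mulrS -mulr_natr; ring.
Qed.

Lemma cvg_mulrn_expr (r : R) : 0 <= r < 1 -> r ^+ n *+ n @[n --> \oo] --> 0.
Proof.
move=> /andP[r0 r1]; have [->|rn0] := eqVneq r 0.
  apply/cvgrPdist_lt => e e0; near=> n; rewrite sub0r normrN expr0n.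
  have -> : (n == 0%N) = false by apply/negbTE; rewrite -lt0n; near: n; exact: nbhs_infty_gt.
  by rewrite mul0rn normr0.
have rp : 0 < r by rewrite lt_def rn0.
pose s := Num.sqrt r.
have sp : 0 < s by rewrite sqrtr_gt0.
have ss : s ^+ 2 = r by rewrite sqr_sqrtr.
have s1 : s < 1.
  by rewrite -(@ltr_pXn2r _ 2) ?nnegrE ?(ltW sp)// ss expr1n.
pose K := (s^-1 - 1)^-1.
have K0 : 0 < s^-1 - 1 by rewrite subr_gt0 invf_gt1.
have bd n : r ^+ n *+ n <= s ^+ n * K.
  have : 1 + (s^-1 - 1) *+ n <= (1 + (s^-1 - 1)) ^+ n.
    by apply: bernoulli_ineq; lra.
  have -> : 1 + (s^-1 - 1) = s^-1 by lra.
  rewrite exprVn => h.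
  have sn0 : 0 < s ^+ n by rewrite exprn_gt0.
  have : (s^-1 - 1) *+ n <= (s ^+ n)^-1 by lra.
  rewrite -ss -exprM mulnC exprM expr2 -mulrnAr ler_pM2l// /K => h2.
  rewrite -[leRHS]mul1r ler_pdivlMr// mulrnAl -mulrnAr.
  by move: h2; rewrite -(ler_pM2l sn0) mulfV ?gt_eqF.
apply: (@squeeze_cvgr _ _ _ _ (fun=> 0) (fun n => s ^+ n * K)).
- by near=> n; rewrite bd andbT mulrn_wge0// exprn_ge0.
- exact: cvg_cst.
- rewrite -[X in _ --> X](mul0r K); apply: cvgM; last exact: cvg_cst.
  by apply: cvg_expr; rewrite ger0_norm// ltW.
Unshelve. all: end_near.
Qed.

Lemma step_poly_itv n (t : R) : 0 <= t <= 1 -> 0 <= step_poly n t <= 1.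
Proof.
move=> /andP[t0 t1]; have tn : 0 <= t ^+ n <= 1 by rewrite exprn_ge0// exprn_ile1.
by rewrite /step_poly exprn_ge0 ?exprn_ile1//; lra.
Qed.

(** Below 1/2, the Bernoulli inequality gives at least 1 - n (2t)^n; from 1/2 on, 1 - x <= exp (-x)
    gives at most exp (- n (2t)^n) <= exp (-n). *)
Lemma cvg_step_poly (t : R) : 0 <= t <= 1 ->
  step_poly n t @[n --> \oo] --> ((t < 2^-1)%R%:R : R).
Proof.
move=> t01; have /andP[t0 t1] := t01; case: ltP => th.
  have r01 : 0 <= 2 * t < 1 by lra.
  apply: (@squeeze_cvgr _ _ _ _ (fun n => 1 - (2 * t) ^+ n *+ n) (fun=> 1)).
  - near=> n; have /andP[_ ->] := step_poly_itv n t01; rewrite andbT.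
    have tn : 0 <= t ^+ n <= 1 by rewrite exprn_ge0// exprn_ile1.
    rewrite /step_poly; apply: le_trans (bernoulli_ineq (n * 2 ^ n) (x := - t ^+ n) _).
      by rewrite exprMn mulrC -natrX mulr_natr -mulrnA mulNrn mulnC.
    by lra.
  - rewrite -[X in _ --> X]subr0; apply: cvgB; first exact: cvg_cst.
    exact: cvg_mulrn_expr.
  - exact: cvg_cst.
have e01 : 0 <= expR (- 1 : R) < 1.
  by rewrite expR_ge0 /= -[ltRHS]expR0 ltr_expR; lra.
apply: (@squeeze_cvgr _ _ _ _ (fun=> 0) (fun n => expR (-1) ^+ n)).
- near=> n; have /andP[-> _] := step_poly_itv n t01; rewrite /step_poly.
  have tn : 0 <= t ^+ n <= 1 by rewrite exprn_ge0// exprn_ile1.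
  apply: le_trans (_ : expR (- t ^+ n) ^+ (n * 2 ^ n) <= _).
    by rewrite lerXn2r ?nnegrE ?expR_ge0 ?expR_ge1Dx//; lra.
  rewrite -!expRM_natl ler_expR natrM natrX mulrN mulrN mulr1 lerN2 -mulrA -exprMn.
  by rewrite ler_peMr// exprn_ege1//; lra.
- exact: cvg_cst.
- by apply: cvg_expr; rewrite ger0_norm; lra.
Unshelve. all: end_near.
Qed.

Lemma bounded_cvg_Rintegral d (T : measurableType d) (P : probability T R)
    (f_ : nat -> T -> R) (f : T -> R) (M : R) :
  (forall n, measurable_fun setT (f_ n)) -> measurable_fun setT f ->
  (forall n x, `|f_ n x| <= M) -> (forall x, f_ n x @[n --> \oo] --> f x) ->
  \int[P]_x f_ n x @[n --> \oo] --> \int[P]_x f x.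
Proof.
move=> mf_ mf fM cf.
have iM : P.-integrable setT (EFin \o cst M).
  exact: (@integrable_bounded _ _ _ _ (cst M) `|M|).
have [||||| fi _ c] := @dominated_convergence _ _ _ P setT measurableT
  (fun n => EFin \o f_ n) (EFin \o f) (EFin \o cst M).
- by move=> n; exact/measurable_EFinP.
- exact/measurable_EFinP.
- by apply: aeW => x _; apply: cvg_EFin; [exact: nearW|exact: cf].
- exact: iM.
- by apply: aeW => x n _ /=; rewrite lee_fin.
apply: fine_cvg; rewrite fineK; last exact: integrable_fin_num.
exact: c.
Qed.

End StepApproximation.

Section CharacteristicFunctionUniqueness.
Context {R : realType} {d1 d2 : measure_display}.
Context {O1 : measurableType d1} {O2 : measurableType d2}.
Context (P1 : probability O1 R) (P2 : probability O2 R) (I : Type).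
Context (X : I -> O1 -> R) (Y : I -> O2 -> R).
Hypothesis mX : forall i, measurable_fun setT (X i).
Hypothesis mY : forall i, measurable_fun setT (Y i).

Definition lincomb (T : Type) (Z : I -> T -> R) (s : seq (I * R)) (w : T) : R :=
  \sum_(p <- s) p.2 * Z p.1 w.

Lemma measurable_lincomb d (T : measurableType d) (Z : I -> T -> R) s :
  (forall i, measurable_fun setT (Z i)) -> measurable_fun setT (lincomb Z s).
Proof.
by move=> mZ; apply: measurable_sum => p; apply: measurable_funM.
Qed.

Let mcos d (T : measurableType d) (Z : I -> T -> R) (mZ : forall i, measurable_fun setT (Z i)) s b :
  measurable_fun setT (fun w => cos (lincomb Z s w + b)).
Proof.
apply: (measurableT_comp measurable_cos); apply: measurable_funD => //.
exact: measurable_lincomb.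
Qed.

Hypothesis cosE : forall s b,
  \int[P1]_w cos (lincomb X s w + b) = \int[P2]_w cos (lincomb Y s w + b).

(* Pairs of observables whose products with cosines of linear combinations have
   the same mean. The class is stable under multiplication by such cosines and
   under bounded limits, hence reaches the indicators of orthants. *)
Definition cos_equal (F : O1 -> R) (G : O2 -> R) : Prop :=
  [/\ measurable_fun setT F, measurable_fun setT G,
      exists M : R, (forall w, `|F w| <= M) /\ (forall w, `|G w| <= M) &
      forall s b, \int[P1]_w (F w * cos (lincomb X s w + b)) =
                  \int[P2]_w (G w * cos (lincomb Y s w + b))].

Lemma cos_equal_ext F G F' G' : F =1 F' -> G =1 G' -> cos_equal F G -> cos_equal F' G'.
Proof. by move=> /funext -> /funext ->. Qed.

Lemma cos_equal1 : cos_equal (fun=> 1) (fun=> 1).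
Proof.
split=> //; first by exists 1; rewrite normr1.
move=> s b; under eq_Rintegral do rewrite mul1r.
by rewrite cosE; apply: eq_Rintegral => w _; rewrite mul1r.
Qed.

Let icos d (T : measurableType d) (P : probability T R) (Z : I -> T -> R)
    (mZ : forall i, measurable_fun setT (Z i)) (F : T -> R) (M : R) s b :
  measurable_fun setT F -> (forall w, `|F w| <= M) ->
  P.-integrable setT (EFin \o (fun w => F w * cos (lincomb Z s w + b))).
Proof.
move=> mF FM; apply: (@integrable_bounded _ _ _ _ _ M).
  by apply: measurable_funM => //; exact: mcos.
by move=> w; rewrite normrM -[X in _ <= X]mulr1 ler_pM// norm_cos_le1.
Qed.

Lemma cos_equal_lin (a : R) F G F' G' : cos_equal F G -> cos_equal F' G' ->
  cos_equal (fun w => F w + a * F' w) (fun w => G w + a * G' w).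
Proof.
move=> [mF mG [M [FM GM]] e] [mF' mG' [M' [FM' GM']] e']; split.
- by apply: measurable_funD => //; exact: measurable_funM.
- by apply: measurable_funD => //; exact: measurable_funM.
- exists (M + `|a| * M'); split=> w; apply: le_trans (ler_normD _ _) _;
    by apply: lerD => //; rewrite normrM ler_wpM2l.
move=> s b.
have H d (T : measurableType d) (P : probability T R) (Z : I -> T -> R)
    (mZ : forall i, measurable_fun setT (Z i)) (f f' : T -> R) :
    measurable_fun setT f -> measurable_fun setT f' ->
    (forall w, `|f w| <= M) -> (forall w, `|f' w| <= M') ->
    \int[P]_w ((f w + a * f' w) * cos (lincomb Z s w + b)) =
    \int[P]_w (f w * cos (lincomb Z s w + b)) +
    a * \int[P]_w (f' w * cos (lincomb Z s w + b)).
  move=> mf mf' fM fM'.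
  have i1 := icos P mZ s b mf fM; have i2 := icos P mZ s b mf' fM'.
  rewrite -RintegralZl// -RintegralD//; last exact: (integrableZl measurableT a i2).
  by apply: eq_Rintegral => w _; rewrite mulrDl mulrA.
by rewrite !H// e e'.
Qed.

(** A product of two cosines is half the sum of the cosines of the sum and of the difference, so the
    new factor is absorbed by prepending [(i, t)] or [(i, - t)] to the linear combination. *)
Lemma cos_equal_cos i (t c : R) F G : cos_equal F G ->
  cos_equal (fun w => F w * cos (t * X i w + c)) (fun w => G w * cos (t * Y i w + c)).
Proof.
move=> [mF mG [M [FM GM]] e].
have mc d (T : measurableType d) (Z : I -> T -> R) :
    (forall i, measurable_fun setT (Z i)) ->
    measurable_fun setT (fun w => cos (t * Z i w + c)).
  move=> mZ; apply: (measurableT_comp measurable_cos).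
  by apply: measurable_funD => //; exact: measurable_funM.
split.
- by apply: measurable_funM => //; exact: mc.
- by apply: measurable_funM => //; exact: mc.
- by exists M; split=> w; rewrite normrM -[X in _ <= X]mulr1 ler_pM// norm_cos_le1.
move=> s b.
have H d (T : measurableType d) (P : probability T R) (Z : I -> T -> R)
    (mZ : forall i, measurable_fun setT (Z i)) (f : T -> R) :
    measurable_fun setT f -> (forall w, `|f w| <= M) ->
    \int[P]_w (f w * cos (t * Z i w + c) * cos (lincomb Z s w + b)) =
    2^-1 * (\int[P]_w (f w * cos (lincomb Z ((i, t) :: s) w + (b + c))) +
            \int[P]_w (f w * cos (lincomb Z ((i, - t) :: s) w + (b - c)))).
  move=> mf fM.
  have i1 := icos P mZ ((i, t) :: s) (b + c) mf fM.
  have i2 := icos P mZ ((i, - t) :: s) (b - c) mf fM.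
  rewrite -RintegralD// -RintegralZl//; last exact: (integrableD measurableT i1 i2).
  apply: eq_Rintegral => w _; rewrite /lincomb !big_cons /= -/(lincomb Z s w).
  have -> : t * Z i w + lincomb Z s w + (b + c) =
    (lincomb Z s w + b) + (t * Z i w + c) by ring.
  have -> : - t * Z i w + lincomb Z s w + (b - c) =
    (lincomb Z s w + b) - (t * Z i w + c) by ring.
  move: (t * Z i w + c) (lincomb Z s w + b) => A B.
  by rewrite cosD cosB; field.
by rewrite !H// !e.
Qed.

Lemma cos_equal_lim (F_ : nat -> O1 -> R) (G_ : nat -> O2 -> R) (F : O1 -> R) (G : O2 -> R) (M : R) :
  (forall n, cos_equal (F_ n) (G_ n)) ->
  (forall n w, `|F_ n w| <= M) -> (forall n w, `|G_ n w| <= M) ->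
  (forall w, F_ n w @[n --> \oo] --> F w) -> (forall w, G_ n w @[n --> \oo] --> G w) ->
  cos_equal F G.
Proof.
move=> FG FM GM cF cG.
have mF : measurable_fun setT F.
  apply: (measurable_fun_cvg (h := F_)) => //; first by move=> n; case: (FG n).
have mG : measurable_fun setT G.
  apply: (measurable_fun_cvg (h := G_)) => //; first by move=> n; case: (FG n).
have lb (f_ : nat -> R) f : (forall n, `|f_ n| <= M) -> f_ n @[n --> \oo] --> f -> `|f| <= M.
  move=> fM /cvg_norm cf; rewrite -(cvg_lim _ cf)//; apply: limr_le.
    by apply/cvg_ex; eexists; exact: cf.
  exact: nearW.
split=> //.
  by exists M; split=> w; [apply: lb (cF w) => n|apply: lb (cG w) => n].
move=> s b.
have H d (T : measurableType d) (P : probability T R) (Z : I -> T -> R)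
    (mZ : forall i, measurable_fun setT (Z i)) (f_ : nat -> T -> R) (f : T -> R) :
    (forall n, measurable_fun setT (f_ n)) -> measurable_fun setT f ->
    (forall n w, `|f_ n w| <= M) -> (forall w, f_ n w @[n --> \oo] --> f w) ->
    \int[P]_w (f_ n w * cos (lincomb Z s w + b)) @[n --> \oo] -->
    \int[P]_w (f w * cos (lincomb Z s w + b)).
  move=> mf_ mf fM cf; apply: (@bounded_cvg_Rintegral _ _ _ _ _ _ M).
  - by move=> n; apply: measurable_funM => //; exact: mcos.
  - by apply: measurable_funM => //; exact: mcos.
  - by move=> n w; rewrite normrM -[X in _ <= X]mulr1 ler_pM// norm_cos_le1.
  - by move=> w; apply: cvgM => //; exact: cvg_cst.
have h1 := H _ _ P1 X mX F_ F (fun n => let: And4 a _ _ _ := FG n in a) mF FM cF.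
have h2 := H _ _ P2 Y mY G_ G (fun n => let: And4 _ a _ _ := FG n in a) mG GM cG.
have e : (fun n => \int[P1]_w (F_ n w * cos (lincomb X s w + b))) =
    (fun n => \int[P2]_w (G_ n w * cos (lincomb Y s w + b))).
  by apply/funext => n; case: (FG n).
by rewrite e in h1; exact: (cvg_unique _ h1 h2).
Qed.

(** Affine in a cosine, with values in [0, 1], and below 1/2 exactly where the cosine is positive:
    the threshold of [step_poly]. *)
Let ramp (Z : R) (a c : R) : R := (1 - cos (a * Z + c)) / 2.

Lemma ramp_itv Z a c : 0 <= ramp Z a c <= 1.
Proof.
have := cos_le1 (a * Z + c); have := cos_geN1 (a * Z + c).
by rewrite /ramp; lra.
Qed.

Lemma cos_equal_ramp i (a c : R) k F G : cos_equal F G ->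
  cos_equal (fun w => F w * ramp (X i w) a c ^+ k) (fun w => G w * ramp (Y i w) a c ^+ k).
Proof.
elim: k F G => [|k IH] F G FG.
  by apply: cos_equal_ext FG => w; rewrite expr0 mulr1.
have h := cos_equal_lin (-1) FG (cos_equal_cos i a c FG).
have {}h := IH _ _ (cos_equal_lin (-2^-1) h h).
by apply: cos_equal_ext h => w; rewrite exprS [RHS]mulrA; congr (_ * _); rewrite /ramp; field.
Qed.

Lemma cos_equal_step i (a c : R) n F G : cos_equal F G ->
  cos_equal (fun w => F w * step_poly n (ramp (X i w) a c))
            (fun w => G w * step_poly n (ramp (Y i w) a c)).
Proof.
rewrite /step_poly; elim: (n * 2 ^ n)%N F G => [|k IH] F G FG.
  by apply: cos_equal_ext FG => w; rewrite expr0 mulr1.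
have h := IH _ _ (cos_equal_lin (-1) FG (cos_equal_ramp i a c n FG)).
by apply: cos_equal_ext h => w; rewrite exprS [RHS]mulrA; congr (_ * _); ring.
Qed.

Lemma cos_equal_pos i (a c : R) F G : cos_equal F G ->
  cos_equal (fun w => F w * (0 < cos (a * X i w + c))%R%:R)
            (fun w => G w * (0 < cos (a * Y i w + c))%R%:R).
Proof.
move=> FG; have [_ _ [M [FM GM]] _] := FG.
have st n z : `|step_poly n (ramp z a c)| <= 1.
  by have /andP[h0 h1] := step_poly_itv n (ramp_itv z a c); rewrite ger0_norm.
have cv z : step_poly n (ramp z a c) @[n --> \oo] --> ((0 < cos (a * z + c))%R%:R : R).
  have -> : (0 < cos (a * z + c)) = (ramp z a c < 2^-1).
    by rewrite /ramp; apply/idP/idP; lra.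
  exact: cvg_step_poly (ramp_itv _ _ _).
apply: (@cos_equal_lim (fun n w => F w * step_poly n (ramp (X i w) a c))
  (fun n w => G w * step_poly n (ramp (Y i w) a c)) _ _ M).
- by move=> n; exact: cos_equal_step.
- by move=> n w; rewrite normrM -[X in _ <= X]mulr1 ler_pM.
- by move=> n w; rewrite normrM -[X in _ <= X]mulr1 ler_pM.
- by move=> w; apply: cvgM; [exact: cvg_cst|exact: cv].
- by move=> w; apply: cvgM; [exact: cvg_cst|exact: cv].
Qed.

(** A half-line is recovered from periodic functions by stretching the period: once [n] exceeds |z -
    h| / pi, the argument lies within half a period of 0, where the sine has the sign of [z - h]. *)
Lemma cvg_sin_pos (h z : R) :
  ((0 < sin ((z - h) / n.+1%:R))%R%:R : R) @[n --> \oo] --> ((h < z)%R%:R : R).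
Proof.
apply: (@cvg_near_cst _ _ _ _ _ _).
near=> n; suff -> : (0 < sin ((z - h) / n.+1%:R)) = (h < z) by [].
apply/idP/idP; last first.
  move=> hz; apply: sin_gt0_pi.
  rewrite divr_gt0 ?subr_gt0//= ltr_pdivrMr// mulrC -ltr_pdivrMr ?pi_gt0//.
  apply: lt_trans (_ : n%:R < _); last by rewrite ltr_nat.
  by near: n; exact: nbhs_infty_gtr.
apply: contraTT; rewrite -!leNgt => zh.
rewrite -[_ / _]opprK sinN oppr_le0; apply: sin_ge0_pi.
rewrite -mulNr opprB divr_ge0 ?subr_ge0//= ler_pdivrMr// mulrC -ler_pdivrMr ?pi_gt0//.
apply: le_trans (_ : n%:R <= _); last by rewrite ler_nat.
by near: n; exact: nbhs_infty_ger.
Unshelve. all: end_near.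
Qed.

Lemma cos_equal_gt i (h : R) F G : cos_equal F G ->
  cos_equal (fun w => F w * (h < X i w)%R%:R) (fun w => G w * (h < Y i w)%R%:R).
Proof.
move=> FG; have [_ _ [M [FM GM]] _] := FG.
have sc (n : nat) z : sin ((z - h) / n.+1%:R) =
    cos (n.+1%:R^-1 * z + (- (h / n.+1%:R) - pi / 2)).
  have -> : n.+1%:R^-1 * z + (- (h / n.+1%:R) - pi / 2) = (z - h) / n.+1%:R - pi / 2 by ring.
  by rewrite cosB cos_pihalf sin_pihalf mulr0 add0r mulr1.
apply: (@cos_equal_lim
  (fun n w => F w * (0 < cos (n.+1%:R^-1 * X i w + (- (h / n.+1%:R) - pi / 2)))%R%:R)
  (fun n w => G w * (0 < cos (n.+1%:R^-1 * Y i w + (- (h / n.+1%:R) - pi / 2)))%R%:R) _ _ M).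
- by move=> n; exact: cos_equal_pos.
- by move=> n w; rewrite normrM -[X in _ <= X]mulr1 ler_pM//; case: ltP; rewrite ?normr1 ?normr0.
- by move=> n w; rewrite normrM -[X in _ <= X]mulr1 ler_pM//; case: ltP; rewrite ?normr1 ?normr0.
- move=> w; apply: cvgM; first exact: cvg_cst.
  by under eq_cvg do rewrite -sc; exact: cvg_sin_pos.
- move=> w; apply: cvgM; first exact: cvg_cst.
  by under eq_cvg do rewrite -sc; exact: cvg_sin_pos.
Qed.

Lemma cvg_gt_ge (h z : R) : ((h - n.+1%:R^-1 < z)%R%:R : R) @[n --> \oo] --> ((h <= z)%R%:R : R).
Proof.
apply: cvg_near_cst; have [hz|zh] := leP h z.
  near=> n; suff -> : (h - n.+1%:R^-1 < z) by [].
  by rewrite ltrBlDr; apply: le_lt_trans hz _; rewrite ltrDl invr_gt0.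
have hz : 0 < h - z by rewrite subr_gt0.
near=> n; suff -> : (h - n.+1%:R^-1 < z) = false by [].
apply/negbTE; rewrite -leNgt lerBrDr -lerBrDl.
apply: ltW; near: n; exact: (near_infty_natSinv_lt (PosNum hz)).
Unshelve. all: end_near.
Qed.

Lemma cos_equal_ge i (h : R) F G : cos_equal F G ->
  cos_equal (fun w => F w * (h <= X i w)%R%:R) (fun w => G w * (h <= Y i w)%R%:R).
Proof.
move=> FG; have [_ _ [M [FM GM]] _] := FG.
apply: (@cos_equal_lim (fun n w => F w * (h - n.+1%:R^-1 < X i w)%R%:R)
  (fun n w => G w * (h - n.+1%:R^-1 < Y i w)%R%:R) _ _ M).
- by move=> n; exact: cos_equal_gt.
- by move=> n w; rewrite normrM -[X in _ <= X]mulr1 ler_pM//; case: ltP; rewrite ?normr1 ?normr0.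
- by move=> n w; rewrite normrM -[X in _ <= X]mulr1 ler_pM//; case: ltP; rewrite ?normr1 ?normr0.
- by move=> w; apply: cvgM; [exact: cvg_cst|exact: cvg_gt_ge].
- by move=> w; apply: cvgM; [exact: cvg_cst|exact: cvg_gt_ge].
Qed.

Lemma cos_equal_orthant (s : seq (I * R)) :
  cos_equal (fun w => (all (fun p => p.2 <= X p.1 w) s)%:R)
            (fun w => (all (fun p => p.2 <= Y p.1 w) s)%:R).
Proof.
elim: s => [|p s IH] /=; first exact: cos_equal1.
have h := cos_equal_ge p.1 p.2 IH.
by apply: cos_equal_ext h => w; rewrite mulrC -natrM mulnb.
Qed.

Lemma orthant_equal (s : seq (I * R)) :
  P1 [set w | all (fun p => p.2 <= X p.1 w) s] =
  P2 [set w | all (fun p => p.2 <= Y p.1 w) s].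
Proof.
(* With the empty combination and phase 0 the cosine is identically 1. *)
have [m1 m2 _ /(_ [::] 0)] := cos_equal_orthant s.
have H d (T : measurableType d) (P : probability T R) (Z : I -> T -> R) :
    measurable_fun setT (fun w => (all (fun p => p.2 <= Z p.1 w) s)%:R : R) ->
    (\int[P]_w ((all (fun p => p.2 <= Z p.1 w) s)%:R * cos (lincomb Z [::] w + 0)))%:E =
    P [set w | all (fun p => p.2 <= Z p.1 w) s].
  move=> mZ; have mS : measurable [set w | all (fun p => p.2 <= Z p.1 w) s].
    rewrite -[X in measurable X]setTI.
    rewrite (_ : [set w | _] =
      (fun w => (all (fun p => p.2 <= Z p.1 w) s)%:R : R) @^-1` [set 1]).
      exact: mZ.
    by apply/seteqP; split=> w /=; case: all => //= /eqP; rewrite eq_sym oner_eq0.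
  transitivity (\int[P]_w (\1_[set w | all (fun p => p.2 <= Z p.1 w) s] w)%:E)%E.
    rewrite -[RHS]fineK; last first.
      by rewrite integral_indic// setIT fin_num_measure.
    congr EFin; apply: eq_Rintegral => w _.
    by rewrite /lincomb big_nil addr0 cos0 mulr1 indicE mem_setE.
  by rewrite integral_indic// setIT.
by rewrite -!H// => ->.
Qed.

End CharacteristicFunctionUniqueness.

(** * Lattice distances, random walk and Green function *)

Section LatticeMetric.
Context {d : nat}.
Implicit Types x y z : Zd d.

Lemma linf_leP x y (n : nat) :
  reflect (forall i, (`|x 0%R i - y 0%R i| <= n)%N) (linf_dist x y <= n)%N.
Proof.
apply: (iffP (bigmax_leqP _ _ _)) => [h i|h i _]; [exact: h|exact: h].
Qed.

Lemma linf_coord x y i : (`|x 0%R i - y 0%R i| <= linf_dist x y)%N.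
Proof. by move: i; apply/linf_leP. Qed.

Lemma linf_distC x y : linf_dist x y = linf_dist y x.
Proof. by apply: eq_bigr => i _; rewrite distnC. Qed.

Lemma linf_dist0 x : linf_dist x x = 0%N.
Proof. by apply/eqP; rewrite -leqn0; apply/linf_leP => i; rewrite subrr. Qed.

Lemma linf_triangle y x z : (linf_dist x z <= linf_dist x y + linf_dist y z)%N.
Proof.
apply/linf_leP => i; apply: leq_trans (leq_add (linf_coord x y i) (linf_coord y z i)).
by lia.
Qed.

Lemma linf_distD x y z : linf_dist (x + z) (y + z) = linf_dist x y.
Proof. by apply: eq_bigr => i _; rewrite !mxE opprD addrACA subrr addr0. Qed.

Lemma linf_eq0 x y : linf_dist x y = 0%N -> x = y.
Proof.
move=> e; apply/rowP => i; have := linf_coord x y i; rewrite e leqn0 absz_eq0 subr_eq0.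
by move/eqP.
Qed.

Lemma linf_le_l1 x y : (linf_dist x y <= l1_dist x y)%N.
Proof. by apply/linf_leP => i; rewrite /l1_dist (bigD1 i)//= leq_addr. Qed.

Lemma l1_le_linf x y : (l1_dist x y <= d * linf_dist x y)%N.
Proof.
rewrite /l1_dist -[X in (_ <= X * _)%N](card_ord d) -sum_nat_const.
by apply: leq_sum => i _; exact: linf_coord.
Qed.

Lemma l1_distC x y : l1_dist x y = l1_dist y x.
Proof. by apply: eq_bigr => i _; rewrite distnC. Qed.

Lemma l1_distD x y z : l1_dist (x + z) (y + z) = l1_dist x y.
Proof. by apply: eq_bigr => i _; rewrite !mxE opprD addrACA subrr addr0. Qed.

Lemma l1_triangle y x z : (l1_dist x z <= l1_dist x y + l1_dist y z)%N.
Proof. by rewrite /l1_dist -big_split /=; apply: leq_sum => i _; lia. Qed.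

Lemma adjC x y : adj x y = adj y x.
Proof. by rewrite /adj l1_distC. Qed.

Lemma adj_linf x y : adj x y -> (linf_dist x y <= 1)%N.
Proof. by move=> /eqP h; rewrite -h linf_le_l1. Qed.

Lemma adjD x y z : adj (x + z) (y + z) = adj x y.
Proof. by rewrite /adj l1_distD. Qed.

Definition ball_seq (x : Zd d) (n : nat) : seq (Zd d) :=
  [seq x + \row_i ((f i : nat)%:Z - n%:Z) | f : {ffun 'I_d -> 'I_(n.*2.+1)}].

Lemma size_ball_seq x n : size (ball_seq x n) = (n.*2.+1 ^ d)%N.
Proof. by rewrite size_image card_ffun !card_ord. Qed.

Lemma mem_ball_seq x n y : (y \in ball_seq x n) = (linf_dist x y <= n)%N.
Proof.
apply/idP/linf_leP => [/fintype.imageP[f _ ->] i|h].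
  rewrite !mxE; have := ltn_ord (f i);
    move: (x 0 i) (f i : nat) => a b; lia.
have hl i : (`|(y 0%R i - x 0%R i + n%:Z)%R| < n.*2.+1)%N by have := h i; lia.
apply/fintype.imageP; exists [ffun i => Ordinal (hl i)] => //.
by apply/rowP => i; rewrite !mxE ffunE /=; have := h i; lia.
Qed.

Lemma uniq_ball_seq x n : uniq (ball_seq x n).
Proof.
rewrite /ball_seq map_inj_uniq ?enum_uniq// => f g /addrI /rowP e; apply/ffunP => i.
by apply/val_inj => /=; have := e i; rewrite !mxE; lia.
Qed.

End LatticeMetric.

Section Walk.
Context {R : realType} {d : nat}.
Hypothesis d_gt0 : (0 < d)%N.
Implicit Types (x y z : Zd d) (f : Zd d -> R).

Local Notation nd := ((2 * d)%:R : R).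

Definition nbr_avg f x : R := (\sum_(s : 'I_d * bool) f (x + srw_step s)) / nd.

Lemma card_steps : #|{: 'I_d * bool}| = (2 * d)%N.
Proof. by rewrite card_prod card_ord card_bool mulnC. Qed.

Lemma nd_gt0 : 0 < nd.
Proof. by rewrite ltr0n muln_gt0. Qed.

Lemma srw_prob0 x y : srw_prob R 0 x y = (x == y)%:R.
Proof.
rewrite /srw_prob expn0 divr1; congr (_%:R).
have c1 : #|{: {ffun 'I_0 -> 'I_d * bool}}| = 1%N by rewrite card_ffun card_ord expn0.
case: (eqVneq x y) => xy.
  by rewrite -[RHS]c1; apply: eq_card => s; rewrite !inE big_ord0 addr0 xy eqxx.
by apply: eq_card0 => s; rewrite !inE big_ord0 addr0 (negbTE xy).
Qed.

Lemma srw_probS n x y : srw_prob R n.+1 x y = nbr_avg (fun z => srw_prob R n z y) x.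
Proof.
rewrite /nbr_avg /srw_prob -mulr_suml -mulrA -invfM -natrM mulnC -expnSr -natr_sum.
congr (_%:R / _).
(* [h] prepends a first step to a sequence of [n] steps; being a bijection, it turns the count of
   longer walks into a sum over the first step. *)
pose h (p : ('I_d * bool) * {ffun 'I_n -> 'I_d * bool}) : {ffun 'I_n.+1 -> 'I_d * bool} :=
  [ffun i => if unlift ord0 i is Some j then p.2 j else p.1].
have hinj : injective h.
  move=> [a f] [b g] /ffunP hE; congr (_, _).
    by have := hE ord0; rewrite !ffunE unlift_none.
  by apply/ffunP => j; have := hE (lift ord0 j); rewrite !ffunE liftK.
have hsum p : \sum_(k < n.+1) srw_step (h p k) = srw_step p.1 + \sum_(k < n) srw_step (p.2 k).
  rewrite big_ord_recl /h ffunE unlift_none; congr (_ + _).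
  by apply: eq_bigr => k _; rewrite ffunE liftK.
have hsurj (s : {ffun 'I_n.+1 -> 'I_d * bool}) : exists p, h p = s.
  exists (s ord0, [ffun j => s (lift ord0 j)]); apply/ffunP => i; rewrite ffunE.
  by case: unliftP => [j|] -> //=; rewrite ffunE.
pose Q (p : ('I_d * bool) * {ffun 'I_n -> 'I_d * bool}) := x + srw_step p.1 + \sum_(k < n) srw_step (p.2 k) == y.
transitivity #|(h @: [set p | Q p])%SET|.
  apply: eq_card => s; rewrite [LHS]inE; apply/idP/imsetP.
    have [p <-] := hsurj s; rewrite hsum addrA => hp; exists p => //.
    by rewrite inE.
  by case=> p; rewrite inE /Q -addrA -hsum => hp ->.
rewrite card_imset//.
rewrite -sum1_card (eq_bigl Q); last by move=> p; rewrite inE.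
rewrite -(pair_big_dep xpredT (fun a (f : {ffun 'I_n -> 'I_d * bool}) => Q (a, f)) (fun _ _ => 1%N)) /=.
apply: eq_bigr => a _; rewrite -sum1_card; apply: eq_bigl => f.
by rewrite !inE.
Qed.

Lemma srw_prob_ge0 n x y : 0 <= srw_prob R n x y.
Proof. by rewrite /srw_prob divr_ge0. Qed.

Lemma srw_prob_transl n x y z : srw_prob R n (x + z) (y + z) = srw_prob R n x y.
Proof.
rewrite /srw_prob; congr (_%:R / _); apply: eq_card => s; rewrite !inE.
by rewrite addrAC (inj_eq (addIr z)).
Qed.

Lemma srw_prob_sym n x y : srw_prob R n x y = srw_prob R n y x.
Proof.
rewrite /srw_prob; congr (_%:R / _).
pose neg (s : {ffun 'I_n -> 'I_d * bool}) := [ffun k => ((s k).1, ~~ (s k).2)].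
have negK : involutive neg by move=> s; apply/ffunP => k; rewrite !ffunE /= negbK; case: (s k).
have negsum s : \sum_(k < n) srw_step (neg s k) = - \sum_(k < n) srw_step (s k) :> Zd d.
  rewrite -sumrN; apply: eq_bigr => k _; rewrite ffunE /srw_step /=.
  by case: (s k) => i [] /=; rewrite ?expr0 ?expr1 scaleN1r scale1r ?opprK.
rewrite -(card_imset _ (can_inj negK)); apply: eq_card => s.
rewrite inE; apply/imsetP/idP => [[t]|].
  by rewrite inE => /eqP h ->; rewrite negsum -h addrK.
move=> /eqP h; exists (neg s); last by rewrite negK.
by rewrite inE negsum -h addrK.
Qed.

Lemma le_nbr_avg f g x : (forall z, f z <= g z) -> nbr_avg f x <= nbr_avg g x.
Proof. by move=> fg; rewrite ler_pM2r ?invr_gt0 ?nd_gt0// ler_sum. Qed.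

Lemma nbr_avgZ (a : R) f x : nbr_avg (fun z => a * f z) x = a * nbr_avg f x.
Proof. by rewrite /nbr_avg -mulr_sumr mulrA. Qed.

Lemma nbr_avg_cst (c : R) x : nbr_avg (fun=> c) x = c.
Proof.
by rewrite /nbr_avg sumr_const card_steps -[c *+ _]mulr_natr mulfK// gt_eqF// nd_gt0.
Qed.

Lemma nbr_avg_sum (T : Type) (s : seq T) (F : T -> Zd d -> R) x :
  nbr_avg (fun z => \sum_(t <- s) F t z) x = \sum_(t <- s) nbr_avg (F t) x.
Proof.
rewrite /nbr_avg exchange_big /= -mulr_suml; congr (_ / _).
Qed.

(* A nonnegative superharmonic function, strictly so at y, dominates the Green
   function with pole y. *)
Lemma srw_prob_sum_le f y c N x : 0 < c -> (forall z, 0 <= f z) ->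
  (forall z, nbr_avg f z + c * (z == y)%:R <= f z) ->
  \sum_(n < N) srw_prob R n x y <= f x / c.
Proof.
move=> c0 f0 sf; rewrite ler_pdivlMr// mulrC.
elim: N x => [|N IH] x; first by rewrite big_ord0 mulr0.
apply: le_trans (sf x); rewrite big_ord_recl srw_prob0 mulrDr addrC lerD2r.
rewrite /bump /=; under eq_bigr do rewrite srw_probS.
rewrite -(nbr_avg_sum (index_enum 'I_N) (fun i z => srw_prob R i z y)) -nbr_avgZ.
exact: le_nbr_avg.
Qed.

Definition sqnorm x : R := \sum_(i < d) ((x 0 i)%:~R) ^+ 2.

Lemma sqnorm_ge0 x : 0 <= sqnorm x.
Proof. by apply: sumr_ge0 => i _; exact: sqr_ge0. Qed.

Lemma sqr_le_sqnorm x i : ((x 0 i)%:~R) ^+ 2 <= sqnorm x.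
Proof.
by rewrite /sqnorm (bigD1 i)//= lerDl sumr_ge0// => j _; exact: sqr_ge0.
Qed.

Lemma sqnorm_step x (s : 'I_d * bool) :
  sqnorm (x + srw_step s) = sqnorm x + 1 + 2 * (-1) ^+ s.2 * (x 0 s.1)%:~R.
Proof.
rewrite /sqnorm (bigD1 s.1)//= [in RHS](bigD1 s.1)//=.
rewrite (eq_bigr (fun i => ((x 0 i)%:~R) ^+ 2)); last first.
  by move=> i is1; rewrite /srw_step !mxE (negbTE is1) andbF mulr0 addr0.
rewrite /srw_step !mxE !eqxx /= mulr1 rmorphD /=.
by case: s.2; rewrite /= ?expr0 ?expr1 ?rmorphN ?rmorph1; ring.
Qed.

(** The term 64 * 65 comes from 64 (1 + 2a) <= a^2 + 64 * 65, which keeps the relative increment of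
    [sqnorm + K] over a step at most 1/64; the term [d] gives 2d + 8 |x|^2 <= 8 (|x|^2 + K). *)
Definition barrier_const : R := 64 * 65 + d%:R.

Local Notation K := barrier_const.

Lemma barrier_const_gt0 : 0 < K.
Proof. by rewrite /barrier_const ltr_wpDr// mulr_gt0. Qed.

(* (1+y)^(-1/4) <= 1 - y/4 + 11/64 y^2 for small y, slightly above the
   Taylor coefficient 10/64 and below the threshold 12/64 that d = 3 allows *)
Lemma quartic_bound (y : R) : `|y| <= 1 / 64 ->
  1 <= (1 - y / 4 + 11 / 64 * y ^+ 2) ^+ 4 * (1 + y).
Proof.
rewrite ler_norml => /andP[y1 y2].
have y2b : 0 <= y ^+ 2 <= 1 / 64 by rewrite sqr_ge0 expr2 /=; nra.
have y3b : - (1 / 64) <= y * y ^+ 2 <= 1 / 64 by apply/andP; split; nra.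
pose c := 1 - y / 2 + 25 / 64 * y ^+ 2.
have c0 : 0 <= c by rewrite /c; lra.
have h1 : c <= (1 - y / 4 + 11 / 64 * y ^+ 2) ^+ 2.
  rewrite -subr_ge0 (_ : _ - c = y ^+ 2 * (1 / 64 - 11 / 128 * y + (11 / 64 * y) ^+ 2)).
    by rewrite mulr_ge0 ?sqr_ge0// addr_ge0 ?sqr_ge0//; lra.
  by rewrite /c; field.
have h2 : 1 <= c ^+ 2 * (1 + y).
  rewrite -subr_ge0 (_ : _ - 1 = y ^+ 2 * (1 / 32 + 41 / 64 * y +
    (25 / 64 * (25 / 64) - 25 / 64) * y ^+ 2 + 25 / 64 * (25 / 64) * (y * y ^+ 2))).
    by rewrite mulr_ge0 ?sqr_ge0//; lra.
  by rewrite /c; field.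
apply: le_trans h2 _; rewrite ler_pM2r; last lra.
by rewrite (exprM _ 2 2) lerXn2r ?nnegrE ?sqr_ge0.
Qed.

(** Comparable to |x|^(-1/2) at infinity. The exponent 1/4 of |x|^2 is below the critical (d - 2)/2
    in every dimension d >= 3, which leaves room for strict superharmonicity. *)
Definition barrier x : R := (Num.sqrt (Num.sqrt (sqnorm x + K)))^-1.

Let sK_gt0 x : 0 < sqnorm x + K.
Proof. by rewrite ltr_wpDl ?sqnorm_ge0 ?barrier_const_gt0. Qed.

Lemma barrier_gt0 x : 0 < barrier x.
Proof. by rewrite invr_gt0 !sqrtr_gt0. Qed.

Let barrier4 x : barrier x ^+ 4 * (sqnorm x + K) = 1.
Proof.
rewrite /barrier exprVn (exprM _ 2 2) sqr_sqrtr ?sqrtr_ge0// sqr_sqrtr ?(ltW (sK_gt0 _))//.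
by rewrite mulVf// gt_eqF.
Qed.

Lemma barrier_step x (s : 'I_d * bool) :
  forall y : R, y = (1 + 2 * (-1) ^+ s.2 * (x 0 s.1)%:~R) / (sqnorm x + K) ->
  barrier (x + srw_step s) <= barrier x * (1 - y / 4 + 11 / 64 * y ^+ 2).
Proof.
move=> y yD; set S := sqnorm x + K.
have S0 : 0 < S by exact: sK_gt0.
have yE : y * S = 1 + 2 * (-1) ^+ s.2 * (x 0 s.1)%:~R by rewrite yD divfK ?gt_eqF.
have y64 : `|y| <= 1 / 64.
  rewrite yD normrM normfV [`|S|]gtr0_norm// ler_pdivrMr//.
  apply: le_trans (ler_normD _ _) _; rewrite normr1 !normrM normrX normrN normr1 expr1n mulr1.
  have := sqr_le_sqnorm x s.1; rewrite -real_normK ?num_real//.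
  rewrite [`|2|]ger0_norm// /S /barrier_const.
  have : 0 <= d%:R :> R by [].
  set a := `|_|; move=> h1 h2.
  have := sqr_ge0 (a - 64); rewrite sqrrB; lra.
have y1 : 0 < 1 + y by move: y64; rewrite ler_norml => /andP[]; lra.
have SE : sqnorm (x + srw_step s) + K = S * (1 + y).
  by rewrite mulrDr mulr1 [S * y]mulrC yE sqnorm_step /S; ring.
set b := 1 - y / 4 + 11 / 64 * y ^+ 2.
have b0 : 0 < b.
  rewrite /b; have := sqr_ge0 y; move: y64; rewrite ler_norml => /andP[]; lra.
rewrite -(@ler_pXn2r _ 4) ?nnegrE ?mulr_ge0 ?(ltW (barrier_gt0 _)) ?(ltW b0)//.
have p0 : 0 < sqnorm (x + srw_step s) + K by exact: sK_gt0.
rewrite -(ler_pM2r p0) barrier4 SE exprMn mulrACA barrier4 mul1r.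
exact: quartic_bound.
Qed.

(** On average the linear term gains 1/(4S) and the quadratic term loses at most 11/64 * 8/(6S) =
    11/(48S), where 6 <= 2d since d >= 3. The difference 1/(48S) exceeds the claimed 1/(200S). *)
Lemma barrier_superharmonic x : (3 <= d)%N ->
  nbr_avg barrier x + barrier x / (200 * (sqnorm x + K)) <= barrier x.
Proof.
move=> d3; set S := sqnorm x + K; have S0 : 0 < S by exact: sK_gt0.
pose y (s : 'I_d * bool) := (1 + 2 * (-1) ^+ s.2 * (x 0 s.1)%:~R) / S.
have h1 : nbr_avg barrier x <=
    barrier x * ((\sum_(s : 'I_d * bool) (1 - y s / 4 + 11 / 64 * y s ^+ 2)) / nd).
  rewrite /nbr_avg mulrA mulr_sumr ler_pM2r ?invr_gt0 ?nd_gt0//.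
  by apply: ler_sum => s _; exact: barrier_step.
have sumy : \sum_s y s = nd / S.
  rewrite -mulr_suml; congr (_ / _).
  rewrite -(pair_bigA _ (fun i (b : bool) => 1 + 2 * (-1) ^+ b * (x 0 i)%:~R)) /=.
  rewrite (eq_bigr (fun=> 2)); last by move=> i _; rewrite big_bool /= expr0 expr1; ring.
  by rewrite sumr_const card_ord natrM mulr_natr.
have sumy2 : \sum_s y s ^+ 2 = (nd + 8 * sqnorm x) / S ^+ 2.
  rewrite (eq_bigr (fun s : 'I_d * bool => (1 + 2 * (-1) ^+ s.2 * (x 0 s.1)%:~R) ^+ 2 / S ^+ 2)); last first.
    by move=> s _; rewrite /y expr_div_n.
  rewrite -mulr_suml; congr (_ / _).
  rewrite -(pair_bigA _ (fun i (b : bool) => (1 + 2 * (-1) ^+ b * (x 0 i)%:~R) ^+ 2)) /=.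
  rewrite (eq_bigr (fun i => 2 + 8 * ((x 0 i)%:~R) ^+ 2)); last first.
    by move=> i _; rewrite big_bool /= expr0 expr1; ring.
  by rewrite big_split /= sumr_const card_ord -mulr_sumr natrM mulr_natr.
have n0 : nd != 0 by rewrite gt_eqF// nd_gt0.
have sumE : (\sum_(s : 'I_d * bool) (1 - y s / 4 + 11 / 64 * y s ^+ 2)) / nd =
    1 - S^-1 / 4 + 11 / 64 * ((nd + 8 * sqnorm x) / S ^+ 2) / nd.
  rewrite !big_split /= sumr_const card_steps -mulr_sumr sumy2 sumrN -mulr_suml sumy.
  have d0 : d%:R != 0 :> R by rewrite pnatr_eq0 -lt0n.
  by field; rewrite ?d0 ?gt_eqF.
rewrite sumE in h1.
apply: le_trans (_ : barrier x * (1 - (200 * S)^-1) + barrier x / (200 * S) <= _); last first.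
  by rewrite mulrBr mulr1 subrK.
rewrite lerD2r; apply: le_trans h1 _; rewrite ler_pM2l ?barrier_gt0//.
have d3R : 3 <= d%:R :> R by rewrite (ler_nat R 3).
have e1 : nd + 8 * sqnorm x <= 8 * S.
  by rewrite /S /barrier_const natrM; have := sqnorm_ge0 x; lra.
have e2 : (nd + 8 * sqnorm x) / S ^+ 2 <= 8 / S.
  by rewrite ler_pdivrMr ?exprn_gt0// expr2 mulrA divfK ?gt_eqF.
have e3 : (nd + 8 * sqnorm x) / S ^+ 2 / nd <= 8 / S / 6.
  apply: ler_pM => //; last by rewrite lef_pV2 ?posrE ?nd_gt0// natrM; lra.
  by rewrite divr_ge0 ?exprn_ge0 ?(ltW S0)// addr_ge0// mulr_ge0// sqnorm_ge0.
have Si : 0 < S^-1 by rewrite invr_gt0.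
rewrite invfM; lra.
Qed.

Definition green_const : R := 200 * K.

Lemma srw_prob_sum_barrier N x : (3 <= d)%N ->
  \sum_(n < N) srw_prob R n x 0 <= green_const / barrier 0 * barrier x.
Proof.
move=> d3; have K0 := barrier_const_gt0.
have s0 : sqnorm 0 = 0.
  by rewrite /sqnorm big1// => i _; rewrite mxE expr0n.
have b0 := barrier_gt0 0.
have c0 : 0 < barrier 0 / green_const by rewrite divr_gt0 ?mulr_gt0.
have -> : green_const / barrier 0 * barrier x = barrier x / (barrier 0 / green_const).
  by rewrite invf_div mulrC.
apply: srw_prob_sum_le => //[z|z]; first exact: ltW (barrier_gt0 z).
apply: le_trans (barrier_superharmonic z d3); rewrite lerD2l.
case: eqVneq => [->|_]; last first.
  by rewrite mulr0 divr_ge0 ?mulr_ge0 ?(ltW (barrier_gt0 _)) ?(ltW (sK_gt0 _)).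
by rewrite mulr1 s0 add0r.
Qed.

End Walk.

Section Green.
Context {R : realType} {d : nat}.
Hypothesis d3 : (3 <= d)%N.
Implicit Types (x y z : Zd d) (f : Zd d -> R).

Let d0 : (0 < d)%N. Proof. exact: leq_trans d3. Qed.

Definition greenR x y : R := fine (green R x y).

Local Notation psum y N x := (\sum_(n < N) srw_prob R n x y).

Definition green_bound : R := @green_const R d / barrier (0 : Zd d).

Lemma green_bound_ge0 : 0 <= green_bound.
Proof.
by rewrite divr_ge0 ?(ltW (barrier_gt0 _))// mulr_ge0// ltW// barrier_const_gt0.
Qed.

Lemma psum_le_barrier N x y : psum y N x <= green_bound * barrier (x - y).
Proof.
have -> : psum y N x = psum 0 N (x - y).
  by apply: eq_bigr => n _; rewrite -(srw_prob_transl n (x - y) 0 y) subrK add0r.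
exact: srw_prob_sum_barrier.
Qed.

Lemma green_cvg x y : psum y N x @[N --> \oo] --> greenR x y.
Proof.
have nd : nondecreasing_seq (fun N => psum y N x).
  by apply/nondecreasing_seqP => N; rewrite big_ord_recr /= lerDl srw_prob_ge0.
have cv : cvgn (fun N => psum y N x).
  apply: nondecreasing_is_cvgn => //; exists (green_bound * barrier (x - y)).
  by move=> _ [N _ <-]; exact: psum_le_barrier.
rewrite /greenR /green.
have -> : (\sum_(0 <= n <oo) (srw_prob R n x y)%:E)%E = (limn (fun N => psum y N x))%:E.
  rewrite -EFin_lim//; congr (limn _); apply/funext => N /=.
  by rewrite big_mkord sumEFin.
exact: cv.
Qed.

Lemma greenE x y : green R x y = (greenR x y)%:E.
Proof.
have cv := @green_cvg x y.
rewrite -(cvg_lim _ cv)// -EFin_lim; last by apply/cvg_ex; exists (greenR x y).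
by congr (limn _); apply/funext => N /=; rewrite big_mkord sumEFin.
Qed.

Lemma greenR_ge_psum N x y : psum y N x <= greenR x y.
Proof.
rewrite -(cvg_lim _ (@green_cvg x y))//; apply: nondecreasing_cvgn_le.
  by apply/nondecreasing_seqP => n; rewrite big_ord_recr /= lerDl srw_prob_ge0.
by apply/cvg_ex; exists (greenR x y); exact: green_cvg.
Qed.

Lemma greenR_ge0 x y : 0 <= greenR x y.
Proof. by have := greenR_ge_psum 0 x y; rewrite big_ord0. Qed.

Lemma greenR_diag x : 1 <= greenR x x.
Proof. by have := greenR_ge_psum 1 x x; rewrite big_ord1 srw_prob0 eqxx. Qed.

Lemma greenR_le_barrier x y : greenR x y <= green_bound * barrier (x - y).
Proof.
rewrite -(cvg_lim _ (@green_cvg x y))//; apply: limr_le.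
  by apply/cvg_ex; exists (greenR x y); exact: green_cvg.
by apply: nearW => N; exact: psum_le_barrier.
Qed.

Lemma greenR_sym x y : greenR x y = greenR y x.
Proof.
by congr fine; congr (limn _); apply/funext => N; apply: eq_bigr => n _; rewrite srw_prob_sym.
Qed.

Lemma greenR_transl x y z : greenR (x + z) (y + z) = greenR x y.
Proof.
by congr fine; congr (limn _); apply/funext => N; apply: eq_bigr => n _; rewrite srw_prob_transl.
Qed.

Lemma greenR_harmonic x y : greenR x y = (x == y)%:R + nbr_avg (greenR^~ y) x.
Proof.
have h1 := @green_cvg x y; rewrite -(cvg_shiftS _) in h1.
apply: (cvg_unique _ h1) => //.
rewrite /= (_ : (fun N => \sum_(n0 < N.+1) srw_prob R n0 x y) =
  (fun N => (x == y)%:R + nbr_avg (fun z => psum y N z) x)); last first.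
  apply/funext => N; rewrite big_ord_recl /= srw_prob0; congr (_ + _).
  rewrite (nbr_avg_sum (index_enum 'I_N) (fun i z => srw_prob R i z y)).
  by apply: eq_bigr => i _; rewrite -srw_probS.
apply: cvgD; first exact: cvg_cst.
apply: cvgM; last exact: cvg_cst.
by apply: cvg_big => [|s _]; first exact: add_continuous; exact: green_cvg.
Qed.

Lemma barrier_le_linf x (n : nat) : (0 < n)%N -> (n <= linf_dist x 0)%N ->
  barrier x <= (Num.sqrt n%:R)^-1 :> R.
Proof.
move=> n0 nx; rewrite /barrier lef_pV2 ?posrE ?sqrtr_gt0 ?ltr0n//; last first.
  by rewrite ltr_wpDl ?sqnorm_ge0 ?barrier_const_gt0.
have [i xi] : exists i, (n <= `|x 0%R i|)%N.
  apply/existsP; rewrite -[X in is_true X]negbK negb_exists; apply/negP => /forallP h.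
  suff : (linf_dist x 0 <= n.-1)%N by rewrite leqNgt -ltnS prednK// ltnS nx.
  apply/bigmax_leqP => i _; have := h i; rewrite -ltnNge mxE subr0.
  by rewrite -{1}(prednK n0) ltnS.
have : n%:R ^+ 2 <= sqnorm x + @barrier_const R d.
  apply: le_trans (_ : ((x 0 i)%:~R) ^+ 2 <= _).
    by rewrite -[leRHS]real_normK ?num_real// -intr_norm -abszE ler_pXn2r ?nnegrE// ler_nat.
  by apply: le_trans (sqr_le_sqnorm x i) _; rewrite lerDl ltW// barrier_const_gt0.
by move=> h; apply: ler_wsqrtr; move/(@ler_wsqrtr R): h; rewrite sqrtr_sqr ger0_norm.
Qed.

Lemma greenR_le_linf x y (n : nat) : (0 < n)%N -> (n <= linf_dist x y)%N ->
  greenR x y <= green_bound / Num.sqrt n%:R.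
Proof.
move=> n0 nxy; apply: le_trans (greenR_le_barrier x y) _.
apply: ler_wpM2l; first exact: green_bound_ge0.
apply: barrier_le_linf => //; apply: leq_trans nxy _.
by rewrite /linf_dist; under [X in (_ <= X)%N]eq_bigr do rewrite !mxE subr0.
Qed.

Lemma greenR_le_max x y : greenR x y <= green_bound.
Proof.
apply: le_trans (greenR_le_barrier x y) _.
rewrite -[leRHS]mulr1; apply: ler_wpM2l; first exact: green_bound_ge0.
rewrite /barrier invf_le1; last first.
  by rewrite !sqrtr_gt0 ltr_wpDl ?sqnorm_ge0 ?barrier_const_gt0.
have h : 1 <= sqnorm (x - y) + @barrier_const R d.
  by rewrite /barrier_const; have := @sqnorm_ge0 R _ (x - y); have := ler0n R d; lra.
by rewrite -[X in X <= _]sqrtr1 ler_wsqrtr// -[X in X <= _]sqrtr1 ler_wsqrtr.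
Qed.

End Green.

(** * Maximum principle and balayage *)

Section Potential.
Context {R : realType} {d : nat}.
Hypothesis d3 : (3 <= d)%N.
Implicit Types (x y z : Zd d) (u f : Zd d -> R).

Let d0 : (0 < d)%N. Proof. exact: leq_trans d3. Qed.

Lemma seq_argmax (T : eqType) (s : seq T) (f : T -> R) (x0 : T) : x0 \in s ->
  exists2 x : T, x \in s & forall y : T, y \in s -> f y <= f x.
Proof.
elim: s x0 => // a s IH x0 _; case: s IH => [_|b s IH].
  by exists a; rewrite ?inE// => y; rewrite inE => /eqP ->.
have [x xs xm] := IH b (mem_head _ _).
have [h|h] := leP (f a) (f x).
  exists x; first by rewrite inE xs orbT.
  by move=> y; rewrite inE => /orP[/eqP ->//|/xm].
exists a; first exact: mem_head.
by move=> y; rewrite inE => /orP[/eqP ->//|/xm yx]; apply: le_trans yx (ltW h).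
Qed.

Definition vanishing u := forall e : R, 0 < e -> exists n : nat,
  forall x, (n <= linf_dist x 0)%N -> `|u x| <= e.

(** A value above [c] would force a positive maximum, attained because [u] vanishes at infinity.
    Among the maximizers, all in a finite box, take one of largest first coordinate: subharmonicity
    makes its neighbor in that direction a maximizer too. *)
Lemma max_principle (B : {pred Zd d}) u (c : R) : 0 <= c ->
  (forall x, x \notin B -> u x <= nbr_avg u x) -> (forall x, x \in B -> u x <= c) ->
  vanishing u -> forall x, u x <= c.
Proof.
move=> c0 sub uB van x0; rewrite leNgt; apply/negP => ux0.
have p0 : 0 < u x0 by exact: le_lt_trans ux0.
have [n far] : exists n : nat, forall x, (n <= linf_dist x 0)%N -> u x < u x0.
  have [|n h] := van (u x0 / 2); first by rewrite divr_gt0.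
  by exists n => x /h; move/(le_trans (ler_norm _)); lra.
have inbox x : u x0 <= u x -> x \in ball_seq 0 n.
  rewrite mem_ball_seq leqNgt linf_distC; apply: contraTN => h; rewrite -ltNge.
  exact/far/ltnW.
have [m ms mm] := seq_argmax u (inbox _ (lexx _)).
have M x : u x <= u m.
  have [/inbox/mm//|/ltW h] := leP (u x0) (u x).
  by apply: le_trans h (mm _ (inbox _ (lexx _))).
pose S := [seq x <- ball_seq 0 n | u x == u m].
have mS : m \in S by rewrite mem_filter eqxx.
pose i0 : 'I_d := Ordinal d0.
have [y yS ym] := seq_argmax (fun x => (x 0 i0)%:~R : R) mS.
have uy : u y = u m by move: yS; rewrite mem_filter => /andP[/eqP].
have yB : y \notin B.
  by apply/negP => /uB; rewrite uy leNgt (lt_le_trans ux0)// M.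
pose s0 : 'I_d * bool := (i0, false).
have us : u (y + srw_step s0) = u m.
  apply/eqP; rewrite eq_le M /= leNgt; apply/negP => lt.
  have := sub y yB; rewrite uy leNgt => /negP; apply.
  rewrite -[ltRHS](@nbr_avg_cst R d d0 (u m) y) ltr_pM2r ?invr_gt0 ?nd_gt0//.
  rewrite (bigD1 s0)//= [ltRHS](bigD1 s0)//=; apply: ltr_leD => //.
  by apply: ler_sum => s _; exact: M.
have yS' : y + srw_step s0 \in S.
  by rewrite mem_filter us eqxx /= inbox// us M.
have := ym _ yS'; rewrite ler_int /srw_step !mxE !eqxx expr0.
by move: (y 0 i0) => a; lia.
Qed.

Lemma vanishingD u v : vanishing u -> vanishing v -> vanishing (fun x => u x + v x).
Proof.
move=> hu hv e e0; have [|n1 h1] := hu (e / 2); first by rewrite divr_gt0.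
have [|n2 h2] := hv (e / 2); first by rewrite divr_gt0.
exists (maxn n1 n2) => x; rewrite geq_max => /andP[/h1 a /h2 b].
by apply: le_trans (ler_normD _ _) _; lra.
Qed.

Lemma vanishingZ (a : R) u : vanishing u -> vanishing (fun x => a * u x).
Proof.
move=> hu e e0; have h : 0 < `|a| + 1 by rewrite ltr_wpDl.
have [|n1 h1] := hu (e / (`|a| + 1)); first by rewrite divr_gt0.
exists n1 => x /h1; rewrite normrM ler_pdivlMr// => le.
by have := normr_ge0 (u x); nra.
Qed.

Lemma vanishing_sum (I : Type) (s : seq I) (F : I -> Zd d -> R) :
  (forall i, vanishing (F i)) -> vanishing (fun x => \sum_(i <- s) F i x).
Proof.
move=> hF; elim: s => [|i s IH].
  by move=> e e0; exists 0%N => x _; rewrite big_nil normr0 ltW.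
move=> e e0; have [n h] := vanishingD (hF i) IH e0; exists n => x /h.
by rewrite big_cons.
Qed.

Lemma greenR_vanishing z : vanishing (fun x => greenR x z : R).
Proof.
move=> e e0.
pose n := (Num.truncn ((@green_bound R d / e) ^+ 2)).+1.
exists (n + linf_dist z 0)%N => x nx.
rewrite ger0_norm ?greenR_ge0//.
have nxz : (n <= linf_dist x z)%N by have := linf_triangle z x 0; lia.
apply: le_trans (@greenR_le_linf R d d3 x z n isT nxz) _.
have q0 : 0 < Num.sqrt n%:R :> R by rewrite sqrtr_gt0 ltr0n.
rewrite ler_pdivrMr// -ler_pdivrMl// mulrC.
have g0 : 0 <= @green_bound R d / e by rewrite divr_ge0 ?green_bound_ge0// ltW.
rewrite -[leLHS]ger0_norm// -sqrtr_sqr ler_wsqrtr// ltW//.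
exact: truncnS_gt.
Qed.

(** Nonsingularity of the Green matrix on a finite set. The potential of [v] is zero on [B],
    harmonic off [B] and vanishes at infinity, hence is zero by the maximum principle applied to it
    and to its opposite; its Laplacian then returns [v]. *)
Lemma green_eq0 (B : seq (Zd d)) (v : Zd d -> R) : uniq B ->
  (forall x, x \in B -> \sum_(z <- B) v z * greenR x z = 0) -> forall z, z \in B -> v z = 0.
Proof.
move=> uB h; pose u x := \sum_(z <- B) v z * greenR x z.
have lap x : u x = \sum_(z <- B) v z * (x == z)%:R + nbr_avg u x.
  rewrite (nbr_avg_sum B (fun z x => v z * greenR x z)) -big_split; apply: eq_bigr => z _.
  by rewrite nbr_avgZ {1}(greenR_harmonic d3) mulrDr.
have van : vanishing u.
  by apply: vanishing_sum => z; apply: vanishingZ; exact: greenR_vanishing.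
have lap0 x : x \notin B -> u x = nbr_avg u x.
  move=> xB; rewrite {1}lap big_seq big1 ?add0r// => z zB.
  by case: eqVneq => [xz|_]; [rewrite xz zB in xB|rewrite mulr0].
have u0 x : u x = 0.
  apply/eqP; rewrite eq_le; apply/andP; split.
    by apply: (@max_principle (mem B)) => // y yB; [rewrite -lap0|rewrite /u h].
  have vanN : vanishing (fun x => -1 * u x) by exact: vanishingZ.
  have : -1 * u x <= 0.
    apply: (@max_principle (mem B) (fun x => -1 * u x)) => // y yB.
      by rewrite nbr_avgZ -lap0.
    by rewrite /u h// mulr0.
  by rewrite mulN1r oppr_le0.
move=> z zB; have := lap z; rewrite u0 (_ : nbr_avg u z = 0) ?addr0; last first.
  by rewrite /nbr_avg big1 ?mul0r.
rewrite (bigD1_seq z)//= eqxx mulr1 big1 ?addr0// => w wz.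
by rewrite eq_sym (negbTE wz) mulr0.
Qed.

(* The weights a are the hitting distribution of B for the walk started at y. *)
Lemma green_balayage (B : seq (Zd d)) y : uniq B ->
  exists a : Zd d -> R, [/\ forall z, z \in B -> 0 <= a z, \sum_(z <- B) a z <= 1 &
    forall w, w \in B -> \sum_(z <- B) a z * greenR z w = greenR y w].
Proof.
move=> uB; pose n := size B; pose z (i : 'I_n) := nth 0 B i.
have zB i : z i \in B by exact: mem_nth.
have zinj : injective z.
  by move=> i j /eqP; rewrite nth_uniq// => /eqP /val_inj.
have sumB (F : Zd d -> R) : \sum_(w <- B) F w = \sum_i F (z i).
  by rewrite (big_nth 0) big_mkord.
have inB w : w \in B -> exists i, w = z i.
  by move=> wB; have h : (index w B < n)%N by [rewrite index_mem];
    exists (Ordinal h); rewrite /z nth_index.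
pose G : 'M[R]_n := \matrix_(i, j) greenR (z i) (z j).
have Gu : G \in unitmx.
  rewrite -row_free_unit -kermx_eq0; apply/rowV0P => v /sub_kermxP vG.
  pose v' w := \sum_i v 0 i * (w == z i)%:R.
  have v'E i : v' (z i) = v 0 i.
    rewrite /v' (bigD1 i)//= eqxx mulr1 big1 ?addr0// => j ji.
    by rewrite (inj_eq zinj) eq_sym (negbTE ji) mulr0.
  apply/rowP => j; rewrite mxE -v'E; apply: (green_eq0 (v := v') uB) => // x xB.
  have [k ->] := inB x xB.
  have e : \sum_j v 0 j * G j k = 0.
    by have := congr1 (fun M : 'rV_n => M 0 k) vG; rewrite !mxE.
  rewrite sumB -[RHS]e.
  by apply: eq_bigr => i _; rewrite v'E mxE greenR_sym.
pose H := invmx G.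
(* As a function of [x], [a x j] is harmonic off [B], equals the indicator of [z j] on [B] and
   vanishes at infinity; the maximum principle gives both its sign and the bound on the sum over
   [j]. *)
pose a x (j : 'I_n) := \sum_i greenR x (z i) * H i j.
have aB k j : a (z k) j = (k == j)%:R.
  have := congr1 (fun M : 'M[R]_n => M k j) (mulmxV Gu); rewrite !mxE => <-.
  by apply: eq_bigr => i _; rewrite mxE.
have aG x k : \sum_j a x j * greenR (z j) (z k) = greenR x (z k).
  have := congr1 (fun M : 'M[R]_n => (\row_i greenR x (z i) *m M) 0 k) (mulVmx Gu).
  rewrite mulmxA mulmx1 !mxE => <-; apply: eq_bigr => j _.
  by rewrite !mxE; congr (_ * _); apply: eq_bigr => i _; rewrite mxE.
have harm x (c : 'I_n -> R) : x \notin B ->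
    \sum_i c i * greenR x (z i) = nbr_avg (fun x => \sum_i c i * greenR x (z i)) x.
  move=> xB; rewrite (nbr_avg_sum (index_enum 'I_n) (fun i x => c i * greenR x (z i))).
  apply: eq_bigr => i _; rewrite nbr_avgZ; congr (_ * _).
  rewrite greenR_harmonic//; case: eqVneq => [xz|]; last by rewrite add0r.
  by rewrite xz zB in xB.
have van (c : 'I_n -> R) : vanishing (fun x => \sum_i c i * greenR x (z i)).
  by apply: vanishing_sum => i; apply: vanishingZ; exact: greenR_vanishing.
have a0 x j : 0 <= a x j.
  rewrite -oppr_le0; pose u x := \sum_i (- H i j) * greenR x (z i).
  have uE x' : - a x' j = u x'.
    by rewrite /u /a -sumrN; apply: eq_bigr => i _; rewrite mulNr mulrC.
  rewrite uE; apply: (@max_principle (mem B) u) => //.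
  - by move=> w wB; rewrite /u -harm.
  - move=> w /inB[k ->]; rewrite -uE aB oppr_le0; exact: ler0n.
  - exact: van.
have asum x : \sum_j a x j <= 1.
  pose c i := \sum_j H i j; pose u x := \sum_i c i * greenR x (z i).
  have uE x' : \sum_j a x' j = u x'.
    rewrite /u /a exchange_big /=; apply: eq_bigr => i _.
    by rewrite -mulr_sumr mulrC.
  rewrite uE; apply: (@max_principle (mem B) u) => //.
  - by move=> w wB; rewrite /u -harm.
  - move=> w /inB[k ->]; rewrite -uE (bigD1 k)//= aB eqxx big1 ?addr0// => j jk.
    by rewrite aB eq_sym (negbTE jk).
  - exact: van.
pose a' w := \sum_i a y i * (w == z i)%:R.
have a'E i : a' (z i) = a y i.
  rewrite /a' (bigD1 i)//= eqxx mulr1 big1 ?addr0// => j ji.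
  by rewrite (inj_eq zinj) eq_sym (negbTE ji) mulr0.
exists a'; split.
- by move=> w /inB[i ->]; rewrite a'E.
- by rewrite sumB; under eq_bigr do rewrite a'E; exact: asum.
- move=> w /inB[k ->]; rewrite sumB -aG; apply: eq_bigr => i _.
  by rewrite a'E.
Qed.

End Potential.

(** * Linear combinations of the field *)

Section GFF.
Context {R : realType} {d : nat}.
Context {disp : measure_display} {Omega : measurableType disp}.
Context {P : probability Omega R} {phi : Zd d -> {RV P >-> R}}.
Hypothesis d3 : (3 <= d)%N.
Hypothesis hphi : is_GFF phi.
Implicit Types (x y z : Zd d) (s t : seq (Zd d * R)).

Local Notation kappa := (@gauss_mom2 R).

Definition lc s : Omega -> R := lincomb (fun x => phi x : Omega -> R) s.

Definition gcov s t : R := \sum_(p <- s) \sum_(q <- t) p.2 * q.2 * greenR p.1 q.1.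

Lemma measurable_lc s : measurable_fun setT (lc s).
Proof. by apply: measurable_lincomb => x; exact: measurable_funPT. Qed.

Lemma lc_cat s t w : lc (s ++ t) w = lc s w + lc t w.
Proof. by rewrite /lc /lincomb big_cat. Qed.

Lemma gcov_catl s1 s2 t : gcov (s1 ++ s2) t = gcov s1 t + gcov s2 t.
Proof. by rewrite /gcov big_cat. Qed.

Lemma gcovC s t : gcov s t = gcov t s.
Proof.
rewrite /gcov exchange_big; apply: eq_bigr => p _; apply: eq_bigr => q _.
by rewrite greenR_sym [q.2 * p.2]mulrC.
Qed.

Lemma gcov_catr s1 s2 t : gcov t (s1 ++ s2) = gcov t s1 + gcov t s2.
Proof. by rewrite gcovC gcov_catl !(gcovC t). Qed.

Lemma lc_gaussian s : is_gaussian P (lc s).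
Proof.
have [gf _ _] := hphi.
(* [is_gaussian_field] attaches coefficients to indices, so the coefficients of a repeated site are
   first summed. *)
have := gf (undup (map fst s)) (fun x => \sum_(p <- s | p.1 == x) p.2).
rewrite (_ : (fun w => _) = lc s)//; apply/funext => w.
rewrite /lc /lincomb; under eq_bigr do rewrite mulr_suml big_mkcond.
rewrite exchange_big /= big_seq [RHS]big_seq; apply: eq_bigr => p ps.
rewrite (bigD1_seq p.1) ?undup_uniq ?mem_undup ?map_f//= eqxx big1 ?addr0// => x.
by rewrite eq_sym => /negbTE ->.
Qed.

(** Squares are integrable because the Green function is finite on the diagonal, and a product is at
    most the sum of the squares. *)
Lemma integrable_phi2 x y : P.-integrable setT (EFin \o (fun w => phi x w * phi y w)).
Proof.
have sq z : P.-integrable setT (EFin \o (fun w => phi z w * phi z w)).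
  apply/integrableP; split.
    by apply/measurable_EFinP; apply: measurable_funM.
  under eq_integral do rewrite /= ger0_norm -?expr2 ?sqr_ge0//.
  have [_ _ /(_ z z)] := hphi; rewrite unlock => h.
  by under eq_integral do rewrite expr2; rewrite h greenE// ltry.
have i2 := integrableD measurableT (sq x) (sq y).
apply: (le_integrable measurableT _ _ i2).
  by apply/measurable_EFinP; apply: measurable_funM.
move=> w _ /=; rewrite lee_fin [leRHS]ger0_norm ?addr_ge0 -?expr2 ?sqr_ge0//.
have := sqr_ge0 (phi x w + phi y w); have := sqr_ge0 (phi x w - phi y w).
by rewrite ler_norml !expr2 => ? ?; nra.
Qed.

Lemma integral_phi2 x y : \int[P]_w (phi x w * phi y w) = greenR x y.
Proof.
have [_ _ /(_ x y)] := hphi; rewrite unlock => h.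
by rewrite /Rintegral h.
Qed.

Lemma lc_affine s : exists2 m, exists v, affine_normal P (lc s) m v & \int[P]_w lc s w = m.
Proof.
have [m [v h]] := is_gaussian_affine (measurable_lc s) (lc_gaussian s).
by exists m; [exists v|case: (affine_normal_mean (measurable_lc s) h)].
Qed.

Lemma integrable_lc s : P.-integrable setT (EFin \o lc s).
Proof.
have [m [v h] _] := lc_affine s.
by case: (affine_normal_mean (measurable_lc s) h).
Qed.

Lemma integral_lc s : \int[P]_w lc s w = 0.
Proof.
elim: s => [|p s IH].
  under eq_Rintegral do rewrite /lc /lincomb big_nil.
  exact: prob_Rintegral_cst.
have i1 : P.-integrable setT (EFin \o phi p.1).
  have := integrable_lc [:: (p.1, 1)]; rewrite (_ : lc _ = phi p.1)//.
  by apply/funext => w; rewrite /lc /lincomb big_seq1 mul1r.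
under eq_Rintegral do rewrite /lc /lincomb big_cons.
rewrite RintegralD//; last 2 first.
- exact: (integrableZl measurableT p.2 i1).
- exact: integrable_lc.
rewrite RintegralZl// IH addr0; have [_ /(_ p.1) h _] := hphi.
by rewrite /Rintegral; move: h; rewrite unlock => ->; rewrite mulr0.
Qed.

Lemma lc_mul s t : P.-integrable setT (EFin \o (fun w => lc s w * lc t w)) /\
  \int[P]_w (lc s w * lc t w) = gcov s t.
Proof.
have base p t' : P.-integrable setT (EFin \o (fun w => p.2 * phi p.1 w * lc t' w)) /\
    \int[P]_w (p.2 * phi p.1 w * lc t' w) = \sum_(q <- t') p.2 * q.2 * greenR p.1 q.1.
  elim: t' => [|q t' [ii ie]].
    have e : (fun w => p.2 * phi p.1 w * lc [::] w) = cst 0.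
      by apply/funext => w; rewrite /lc /lincomb big_nil mulr0.
    rewrite e big_nil; split; last exact: prob_Rintegral_cst.
    by apply: (@integrable_bounded _ _ _ _ (cst 0) 0) => // w; rewrite normr0.
  have e : (fun w => p.2 * phi p.1 w * lc (q :: t') w) =
      (fun w => p.2 * q.2 * (phi p.1 w * phi q.1 w) + p.2 * phi p.1 w * lc t' w).
    by apply/funext => w; rewrite /lc /lincomb big_cons; ring.
  have i1 := integrableZl measurableT (p.2 * q.2) (integrable_phi2 p.1 q.1).
  rewrite e big_cons; split; first exact: (integrableD measurableT i1 ii).
  by rewrite RintegralD// ie RintegralZl ?integral_phi2//; exact: integrable_phi2.
elim: s => [|p s [ii ie]].
  have e : (fun w => lc [::] w * lc t w) = cst 0.
    by apply/funext => w; rewrite /lc /lincomb big_nil mul0r.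
  rewrite e /gcov big_nil; split; last exact: prob_Rintegral_cst.
  by apply: (@integrable_bounded _ _ _ _ (cst 0) 0) => // w; rewrite normr0.
have e : (fun w => lc (p :: s) w * lc t w) =
    (fun w => p.2 * phi p.1 w * lc t w + lc s w * lc t w).
  by apply/funext => w; rewrite {1}/lc /lincomb big_cons mulrDl.
have [i1 e1] := base p t.
rewrite e /gcov big_cons; split; first exact: (integrableD measurableT i1 ii).
by rewrite RintegralD// e1 ie.
Qed.

Lemma lc_normal s : exists2 v, affine_normal P (lc s) 0 v & v ^+ 2 * kappa = gcov s s.
Proof.
have [m [v h] me] := lc_affine s; rewrite integral_lc in me; rewrite -me in h.
exists v => //; have [_ <-] := affine_normal_mom2 (measurable_lc s) h.
by rewrite -(lc_mul s s).2; apply: eq_Rintegral => w _; rewrite expr2.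
Qed.

Lemma lc_tail s (V a : R) : 0 < V -> gcov s s <= V -> 0 <= a ->
  (P [set w | (lc s w <= - a)%R] <= (expR (- (a ^+ 2 * kappa) / (2 * V)))%:E)%E.
Proof.
have [v h e] := lc_normal s; rewrite -e => V0 sV a0.
exact: affine_normal_tail (measurable_lc s) h V0 sV a0.
Qed.

Lemma lc_opp s w : lc [seq (p.1, - p.2) | p <- s] w = - lc s w.
Proof.
by rewrite /lc /lincomb big_map -sumrN; apply: eq_bigr => p _; rewrite mulNr.
Qed.

Lemma gcov_opp s : gcov [seq (p.1, - p.2) | p <- s] [seq (p.1, - p.2) | p <- s] = gcov s s.
Proof.
rewrite /gcov big_map; apply: eq_bigr => p _; rewrite big_map; apply: eq_bigr => q _.
by rewrite mulrNN.
Qed.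

Lemma lc_tail2 s (V a : R) : 0 < V -> gcov s s <= V -> 0 <= a ->
  (P [set w | (a <= `|lc s w|)%R] <= 2%:E * (expR (- (a ^+ 2 * kappa) / (2 * V)))%:E)%E.
Proof.
move=> V0 sV a0.
have h1 := lc_tail V0 sV a0.
have h2 : (P [set w | (a <= lc s w)%R] <= (expR (- (a ^+ 2 * kappa) / (2 * V)))%:E)%E.
  have -> : [set w | (a <= lc s w)%R] =
      [set w | (lc [seq (p.1, - p.2) | p <- s] w <= - a)%R].
    by apply/seteqP; split=> w /=; rewrite lc_opp lerN2.
  by apply: lc_tail => //; rewrite gcov_opp.
have m1 : measurable [set w | (lc s w <= - a)%R].
  by rewrite -[X in measurable X]setTI; exact: measurable_fun_le (measurable_lc s) (measurable_cst _).
have m2 : measurable [set w | (a <= lc s w)%R].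
  by rewrite -[X in measurable X]setTI; exact: measurable_fun_le (measurable_cst _) (measurable_lc s).
have -> : [set w | (a <= `|lc s w|)%R] = [set w | (lc s w <= - a)%R] `|` [set w | (a <= lc s w)%R].
  apply/seteqP; split=> w /=; rewrite ler_normr lerNr.
    by move=> /orP[]; [right|left].
  by case=> ->; rewrite ?orbT.
apply: le_trans (measureU2 _ m1 m2) _.
by rewrite -[2]natr1 -EFinM mulrDl !mul1r EFinD leeD.
Qed.

(** The transform depends on the combination only through [gcov s s], so equality of covariances
    gives equality of laws. *)
Lemma lc_cos s b : \int[P]_w cos (lc s w + b) =
  cos b * normal_cos (Num.sqrt (gcov s s / kappa)).
Proof.
have [v h e] := lc_normal s; rewrite (affine_normal_cos b (measurable_lc s) h).
by rewrite -e mulfK ?gt_eqF ?gauss_mom2_gt0// sqrtr_sqr ger0_norm//; case: h.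
Qed.

Lemma gcov_ge0 s : 0 <= gcov s s.
Proof.
have [v _ <-] := lc_normal s.
by rewrite mulr_ge0 ?sqr_ge0// ltW// gauss_mom2_gt0.
Qed.

Lemma phi_no_atom x h : P [set w | phi x w = h] = 0%E.
Proof.
have e : lc [:: (x, 1)] = phi x.
  by apply/funext => w; rewrite /lc /lincomb big_seq1 mul1r.
have g := lc_gaussian [:: (x, 1)]; have i0 := integral_lc [:: (x, 1)].
rewrite !e in g i0; apply: gaussian_no_atom => //.
under eq_Rintegral do rewrite expr2.
rewrite integral_phi2 gt_eqF//; apply: lt_le_trans (greenR_diag d3 x).
exact: ltr01.
Qed.

Section Independence.
Context {I J : Type} (U : I -> seq (Zd d * R)) (V : J -> seq (Zd d * R)).
Hypothesis UV0 : forall i j, gcov (U i) (V j) = 0.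

Definition scale_lc (a : R) s := [seq (p.1, a * p.2) | p <- s].

Lemma lc_scale a s w : lc (scale_lc a s) w = a * lc s w.
Proof.
by rewrite /lc /lincomb big_map mulr_sumr; apply: eq_bigr => p _; rewrite mulrA.
Qed.

Lemma gcov_scale a s t : gcov (scale_lc a s) t = a * gcov s t.
Proof.
rewrite /gcov big_map mulr_sumr; apply: eq_bigr => p _.
by rewrite mulr_sumr; apply: eq_bigr => q _; rewrite !mulrA.
Qed.

Let lpart (s : seq ((I + J) * R)) := flatten
  [seq (if p.1 is inl i then scale_lc p.2 (U i) else [::]) | p <- s].
Let rpart (s : seq ((I + J) * R)) := flatten
  [seq (if p.1 is inr j then scale_lc p.2 (V j) else [::]) | p <- s].

Let cov0 (s s' : seq ((I + J) * R)) : gcov (lpart s) (rpart s') = 0.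
Proof.
elim: s => [|[[i|j] c] s IH]; first by rewrite /gcov big_nil.
- rewrite /lpart /= gcov_catl IH addr0 gcov_scale.
  suff -> : gcov (U i) (rpart s') = 0 by rewrite mulr0.
  elim: s' {IH} => [|[[i'|j'] c'] s' IH]; first by rewrite gcovC /gcov big_nil.
    by rewrite /rpart /= -/(rpart s').
  by rewrite /rpart /= gcov_catr -/(rpart s') IH addr0 gcovC gcov_scale gcovC UV0 mulr0.
- by rewrite /lpart /= -/(lpart s).
Qed.

Let X (k : I + J) w := match k with inl i => lc (U i) w | inr j => lc (V j) w end.
Let Y (k : I + J) (w : Omega * Omega) :=
  match k with inl i => lc (U i) w.1 | inr j => lc (V j) w.2 end.

Let XE (s : seq ((I + J) * R)) w : lincomb X s w = lc (lpart s) w + lc (rpart s) w.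
Proof.
elim: s => [|[[i|j] c] s IH].
- by rewrite /lc /lincomb !big_nil addr0.
- by rewrite /lincomb big_cons -/(lincomb X s w) IH /lpart /rpart /= lc_cat lc_scale addrA.
- by rewrite /lincomb big_cons -/(lincomb X s w) IH /lpart /rpart /= lc_cat lc_scale addrCA.
Qed.

Let YE (s : seq ((I + J) * R)) w : lincomb Y s w = lc (lpart s) w.1 + lc (rpart s) w.2.
Proof.
elim: s => [|[[i|j] c] s IH].
- by rewrite /lc /lincomb !big_nil addr0.
- by rewrite /lincomb big_cons -/(lincomb Y s w) IH /lpart /rpart /= lc_cat lc_scale addrA.
- by rewrite /lincomb big_cons -/(lincomb Y s w) IH /lpart /rpart /= lc_cat lc_scale addrCA.
Qed.

Let mX k : measurable_fun setT (X k).
Proof. by case: k => k; exact: measurable_lc. Qed.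

Let mY k : measurable_fun setT (Y k).
Proof.
by case: k => k; apply: (measurableT_comp (measurable_lc _)).
Qed.

(** Independence is phrased as equality in law of the joint family on [Omega] with the family built
    from two independent copies on [P \x P]. Without cross covariance the variance of the sum
    splits, and [normal_cosM] factors the transform in the same way as Fubini. *)
Let cosXY (s : seq ((I + J) * R)) b : \int[P]_w cos (lincomb X s w + b) =
  \int[(P \x P)%E]_w cos (lincomb Y s w + b).
Proof.
have k0 := @gauss_mom2_gt0 R.
pose A := lpart s; pose B := rpart s.
have AB : gcov (A ++ B) (A ++ B) = gcov A A + gcov B B.
  by rewrite gcov_catl !gcov_catr (gcovC B A) !cov0 addr0 add0r.
transitivity (cos b * normal_cos (Num.sqrt (gcov (A ++ B) (A ++ B) / kappa))).
  by rewrite -lc_cos; apply: eq_Rintegral => w _; rewrite XE lc_cat.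
rewrite (@normal_cosM _ (Num.sqrt (gcov A A / kappa)) (Num.sqrt (gcov B B / kappa))) ?sqrtr_ge0//; last first.
  rewrite !sqr_sqrtr ?divr_ge0 ?gcov_ge0 ?(ltW k0)//.
  by rewrite AB mulrDl.
have mcB : measurable_fun setT (fun w : Omega * Omega => cos (lincomb Y s w + b)).
  apply: (measurableT_comp measurable_cos); apply: measurable_funD => //.
  by apply: measurable_lincomb; exact: mY.
have iY : (P \x P)%E.-integrable setT (EFin \o (fun w => cos (lincomb Y s w + b))).
  apply: measurable_bounded_integrable => //.
    by have /= -> := @probability_setT _ _ _ (P \x P)%E; rewrite ltry.
  exists 1; split; first exact: num_real.
  by move=> y y1 w _; apply: le_trans (ltW y1); exact: norm_cos_le1.
rewrite /Rintegral -(integral12_prod_meas1 iY) /fubini_F /=.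
have inner w1 : (\int[P]_w2 (cos (lincomb Y s (w1, w2) + b))%:E =
    (normal_cos (Num.sqrt (gcov B B / kappa)) * cos (lc A w1 + b))%:E)%E.
  rewrite mulrC -lc_cos /Rintegral fineK; last first.
    apply: integrable_fin_num => //.
    apply: (@integrable_bounded _ _ _ _ (fun w => cos (lc B w + (lc A w1 + b))) 1).
      by apply: (measurableT_comp measurable_cos); apply: measurable_funD => //; exact: measurable_lc.
    by move=> w; exact: norm_cos_le1.
  by apply: eq_integral => w2 _; rewrite YE /=; congr (cos _)%:E; ring.
under eq_integral do rewrite inner.
have mA : measurable_fun setT (fun w => cos (lc A w + b)).
  by apply: (measurableT_comp measurable_cos); apply: measurable_funD => //; exact: measurable_lc.
transitivity (\int[P]_w (normal_cos (Num.sqrt (gcov B B / kappa)) * cos (lc A w + b))) => //.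
rewrite RintegralZl//; last by apply: (integrable_bounded _ mA) => w; exact: norm_cos_le1.
by rewrite lc_cos; ring.
Qed.

Lemma lc_indep (s : seq (I * R)) (t : seq (J * R)) :
  P ([set w | all (fun p => (p.2 <= lc (U p.1) w)%R) s] `&`
     [set w | all (fun p => (p.2 <= lc (V p.1) w)%R) t]) =
  (P [set w | all (fun p => (p.2 <= lc (U p.1) w)%R) s] *
   P [set w | all (fun p => (p.2 <= lc (V p.1) w)%R) t])%E.
Proof.
pose st : seq ((I + J) * R) := [seq (inl p.1, p.2) | p <- s] ++ [seq (inr p.1, p.2) | p <- t].
have := orthant_equal mX mY cosXY st.
rewrite (_ : [set w | all _ st] = [set w | all (fun p => p.2 <= lc (U p.1) w) s] `&`
     [set w | all (fun p => p.2 <= lc (V p.1) w) t]); last first.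
  by apply/seteqP; split=> w /=; rewrite all_cat !all_map => /andP.
move=> ->.
rewrite (_ : [set w | all _ st] = [set w | all (fun p => p.2 <= lc (U p.1) w) s] `*`
     [set w | all (fun p => p.2 <= lc (V p.1) w) t]); last first.
  by apply/seteqP; split=> w /=; rewrite all_cat !all_map => /andP.
have mo (K : Type) (W : K -> seq (Zd d * R)) (r : seq (K * R)) :
    measurable [set w | all (fun p => p.2 <= lc (W p.1) w) r].
  elim: r => [|p r IH]; first by rewrite (_ : [set w | _] = setT)//; apply/seteqP; split.
  rewrite (_ : [set w | _] = [set w | p.2 <= lc (W p.1) w] `&`
    [set w | all (fun p => p.2 <= lc (W p.1) w) r]).
    apply: measurableI => //; rewrite -[X in measurable X]setTI.
    exact: measurable_fun_le (measurable_cst _) (measurable_lc _).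
  by apply/seteqP; split=> w /= /andP.
exact: product_measure1E.
Qed.

End Independence.

Lemma phi_shift (z : Zd d) (s : seq (Zd d * R)) :
  P [set w | all (fun p => p.2 <= phi p.1 w) s] =
  P [set w | all (fun p => p.2 <= phi (p.1 + z) w) s].
Proof.
pose sh t := [seq (p.1 + z, p.2) | p <- t] : seq (Zd d * R).
have shE t w : lincomb (fun x => phi (x + z) : Omega -> R) t w = lc (sh t) w.
  by rewrite /lc /lincomb big_map.
have covE t : gcov (sh t) (sh t) = gcov t t.
  rewrite /gcov big_map; apply: eq_bigr => p _; rewrite big_map; apply: eq_bigr => q _.
  by rewrite greenR_transl.
apply: (@orthant_equal _ _ _ _ _ P P _ (fun x => phi x : Omega -> R)
  (fun x => phi (x + z) : Omega -> R)) => [x|x|t b]; try exact: measurable_funPT.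
transitivity (\int[P]_w cos (lc (sh t) w + b)).
  by rewrite !lc_cos covE.
by apply: eq_Rintegral => w _; rewrite shE.
Qed.

End GFF.

(** * Events on configurations: generation, locality, independence *)

Section ConfigSpace.
Context {d : nat}.
Implicit Types (G : set (config d)) (s : seq (Zd d)).

Definition orthant s : set (config d) := [set xi : Zd d -> bool | all xi s].

Definition orthants : set (set (config d)) := [set E | exists s, E = orthant s].

Lemma orthant_cat s t : orthant (s ++ t) = orthant s `&` orthant t.
Proof. by apply/seteqP; split=> xi; rewrite /orthant /= all_cat => /andP. Qed.

Lemma orthants_setI : setI_closed orthants.
Proof. by move=> _ _ [s ->] [t ->]; exists (s ++ t); rewrite orthant_cat. Qed.

Lemma measurable_site (y : Zd d) : measurable ([set xi : Zd d -> bool | xi y] : set (config d)).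
Proof. by apply: sub_sigma_algebra; exists y. Qed.

Lemma measurable_orthant s : measurable (orthant s).
Proof.
elim: s => [|y s IH].
  by rewrite (_ : orthant [::] = setT)//; apply/seteqP; split.
rewrite -cat1s orthant_cat; apply: measurableI => //.
rewrite (_ : orthant [:: y] = [set xi : Zd d -> bool | xi y]); first exact: measurable_site.
by apply/seteqP; split=> xi; rewrite /orthant /= ?andbT.
Qed.

(** The pi-lambda argument with the pi-system of finite sets of open sites; closed sites are reached
    through complements. *)
Lemma config_dynkin (H : set (set (config d))) : dynkin H ->
  (forall s, H (orthant s)) -> forall G, measurable G -> H G.
Proof.
move=> dH Hs G mG.
have : <<s orthants >> G.
  move: G mG; apply: smallest_sub; first exact: smallest_sigma_algebra.
  move=> _ [y _ ->]; apply: sub_sigma_algebra; exists [:: y].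
  by apply/seteqP; split=> xi; rewrite /orthant /= ?andbT.
rewrite -(setI_closed_g_dynkin_g_sigma_algebra orthants_setI); apply.
by split=> // _ [s ->].
Qed.

Lemma sigma_coord_measurable (A : set (Zd d)) G : sigma_coord A G -> measurable G.
Proof.
apply: sub_sigma_algebra2 => _ [y _ ->]; by exists y.
Qed.

Lemma sigma_coord_dep (A : set (Zd d)) G : sigma_coord A G ->
  forall xi xi', (forall y, A y -> xi y = xi' y) -> G xi -> G xi'.
Proof.
pose H : set (set (Zd d -> bool)) := [set G | forall xi xi' : Zd d -> bool,
  (forall y, A y -> xi y = xi' y) -> G xi -> G xi'].
suff : <<s cylinders A >> `<=` H by move=> h /h.
apply: smallest_sub.
  split=> //.
  - by move=> B HB xi xi' e [_ nB]; split=> // /(HB xi' xi) nB'; apply: nB; apply: nB' => y /e.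
  - by move=> F HF xi xi' e [n _ Fn]; exists n => //; exact: HF e Fn.
by move=> _ [y Ay ->] xi xi' e /=; rewrite e.
Qed.

(** Monotonicity tested on the sites of [s] alone, because the decoupling compares two fields only
    on a finite box. *)
Definition incr_on s G := forall xi xi' : config d, G xi -> (forall y, y \in s -> xi y -> xi' y) -> G xi'.
Definition decr_on s G := forall xi xi' : config d, G xi -> (forall y, y \in s -> xi' y -> xi y) -> G xi'.

Lemma increasing_on (A : set (Zd d)) s G : sigma_coord A G -> (forall y, A y -> y \in s) ->
  increasing G -> incr_on s G.
Proof.
move=> GA As Gi xi xi' Gxi h.
(* Agrees with [xi] on [s], which contains the sites the event looks at, and with [xi'] elsewhere,
   so that monotonicity applies from [xi2] to [xi']. *)
pose xi2 : config d := fun y => if y \in s then xi y else xi' y.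
have : G xi2 by apply: (sigma_coord_dep GA) Gxi => y /As; rewrite /xi2 => ->.
by move=> /Gi; apply => y; rewrite /xi2; case: ifP => // /h.
Qed.

Lemma decreasing_on (A : set (Zd d)) s G : sigma_coord A G -> (forall y, A y -> y \in s) ->
  decreasing G -> decr_on s G.
Proof.
move=> GA As Gi xi xi' Gxi h.
pose xi2 : config d := fun y => if y \in s then xi y else xi' y.
have : G xi2 by apply: (sigma_coord_dep GA) Gxi => y /As; rewrite /xi2 => ->.
by move=> /Gi; apply => y; rewrite /xi2; case: ifP => // /h.
Qed.

Lemma incr_onC s G : incr_on s G -> decr_on s (~` G).
Proof. by move=> h xi xi' nG e /h G'; apply: nG; apply: G'. Qed.

Lemma measurable_field disp (Omega : measurableType disp) (R : realType)
    (X : Zd d -> Omega -> R) (h : R) : (forall x, measurable_fun setT (X x)) ->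
  measurable_fun setT ((fun w x => h <= X x w) : Omega -> config d).
Proof.
move=> mX; apply: (@measurability _ _ Omega (config d) _ _ (cylinders setT)) => //.
move=> _ [_ [y _ ->] <-]; rewrite setTI.
rewrite -[X in measurable X]setTI.
exact: measurable_fun_le (measurable_cst _) (mX y).
Qed.

Section IndependenceExtension.
Context {disp : measure_display} {Omega : measurableType disp} {R : realType}.
Context (P : probability Omega R) (eta : Omega -> config d).
Hypothesis meta : measurable_fun setT eta.

Let mpre G : measurable G -> measurable (eta @^-1` G).
Proof. by move=> mG; rewrite -[X in measurable X]setTI; exact: meta. Qed.

Lemma indep_extension (F : set Omega) : measurable F ->
  (forall s, P ((eta @^-1` orthant s) `&` F) = (P (eta @^-1` orthant s) * P F)%E) ->
  forall G, measurable G -> P ((eta @^-1` G) `&` F) = (P (eta @^-1` G) * P F)%E.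
Proof.
move=> mF hs G mG.
have fin A : P A \is a fin_num -> True by [].
pose H := [set G : set (config d) | measurable G /\
  P ((eta @^-1` G) `&` F) = (P (eta @^-1` G) * P F)%E].
suff : H G by case.
apply: config_dynkin mG; last first.
  by move=> s; split; [exact: measurable_orthant|exact: hs].
split.
- by split=> //; rewrite preimage_setT setTI; have /= -> := probability_setT P; rewrite mul1e.
- move=> A [mA e]; split; first exact: measurableC.
  have mA' := mpre mA.
  have fPA : P (eta @^-1` A) \is a fin_num by exact: fin_num_measure.
  have fPF : P F \is a fin_num by exact: fin_num_measure.
  have fPAF : P (eta @^-1` A `&` F) \is a fin_num.
    by apply: fin_num_measure; exact: measurableI.
  have := measureDI P mF mA'.
  move=> hD; rewrite -preimage_setC [(~` _) `&` F]setIC -setDE.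
  have {hD} : P (F `\` eta @^-1` A) = (P F - P (eta @^-1` A `&` F))%E.
    by rewrite hD setIC addeK.
  by move=> ->; rewrite probability_setC// muleBl// mul1e e.
- move=> A_ tA HA; split; first by apply: bigcup_measurable => n _; case: (HA n).
  rewrite preimage_bigcup setI_bigcupl.
  have mA n : measurable (eta @^-1` A_ n) by apply: mpre; case: (HA n).
  have tA1 : trivIset setT (fun n => eta @^-1` A_ n).
    by apply/trivIsetP => i j _ _ ij; rewrite -preimage_setI; move/trivIsetP: tA => ->.
  have tA2 : trivIset setT (fun n => eta @^-1` A_ n `&` F).
    apply/trivIsetP => i j _ _ ij; rewrite setIACA setIid.
    by move/trivIsetP: tA1 => ->//; rewrite set0I.
  rewrite measure_bigcup//; last by move=> n _; exact: measurableI.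
  rewrite measure_bigcup// muleC -[P F]fineK ?fin_num_measure// -nneseriesZl//.
  apply: eq_eseriesr => n _; rewrite fineK ?fin_num_measure//.
  by case: (HA n) => _ e; rewrite muleC; exact: e.
Qed.

End IndependenceExtension.

Lemma indep_fields disp (Omega : measurableType disp) (R : realType)
    (P : probability Omega R) (eta1 eta2 : Omega -> config d) :
  measurable_fun setT eta1 -> measurable_fun setT eta2 ->
  (forall s t, P ((eta1 @^-1` orthant s) `&` (eta2 @^-1` orthant t)) =
    (P (eta1 @^-1` orthant s) * P (eta2 @^-1` orthant t))%E) ->
  forall G1 G2, measurable G1 -> measurable G2 ->
    P ((eta1 @^-1` G1) `&` (eta2 @^-1` G2)) = (P (eta1 @^-1` G1) * P (eta2 @^-1` G2))%E.
Proof.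
move=> m1 m2 h G1 G2 mG1 mG2.
have pre (eta : Omega -> config d) : measurable_fun setT eta -> forall G, measurable G -> measurable (eta @^-1` G).
  by move=> me G mG; rewrite -[X in measurable X]setTI; exact: me.
apply: (indep_extension m1 (pre _ m2 _ mG2)) => // s.
rewrite setIC muleC; apply: (indep_extension m2 (pre _ m1 _ (measurable_orthant s))) => // t.
by rewrite setIC muleC.
Qed.

Lemma config_law_unique (R : realType) (Q1 Q2 : probability (config d) R) :
  (forall s, Q1 (orthant s) = Q2 (orthant s)) -> forall G, measurable G -> Q1 G = Q2 G.
Proof.
move=> h G mG.
pose H := [set G : set (config d) | measurable G /\ Q1 G = Q2 G].
suff : H G by case.
apply: config_dynkin mG; last by move=> s; split; [exact: measurable_orthant|].
split.
- by split=> //; have /= -> := probability_setT Q1; have /= -> := probability_setT Q2.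
- by move=> A [mA e]; split; [exact: measurableC|rewrite !probability_setC// e].
- move=> A_ tA HA; have mA n : measurable (A_ n) by case: (HA n).
  split; first exact: bigcup_measurable.
  by rewrite !measure_bigcup//; apply: eq_eseriesr => n _; case: (HA n).
Qed.

End ConfigSpace.

(** * Decoupling distant boxes *)

Section Decoupling.
Context {R : realType} {d : nat}.
Context {disp : measure_display} {Omega : measurableType disp}.
Context {P : probability Omega R} {phi : Zd d -> {RV P >-> R}}.
Hypothesis d3 : (3 <= d)%N.
Hypothesis hphi : is_GFF phi.
Implicit Types (x y z : Zd d) (G : set (config d)).

Local Notation kappa := (@gauss_mom2 R).
Local Notation exc h := (excursion phi h).
Local Notation lcp := (lc (phi := phi)).

Definition lc_field (U : Zd d -> seq (Zd d * R)) (h : R) (w : Omega) : config d :=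
  fun x => h <= lcp (U x) w.

Lemma measurable_lc_field U h : measurable_fun setT (lc_field U h).
Proof. by apply: measurable_field => x; exact: measurable_lc. Qed.

Lemma measurable_exc h : measurable_fun setT (exc h).
Proof. exact: measurable_excursion. Qed.

Lemma exc_pre h G : measurable G -> measurable (exc h @^-1` G).
Proof. by move=> mG; rewrite -[X in measurable X]setTI; exact: measurable_exc. Qed.

Lemma lc_field_indep (U V : Zd d -> seq (Zd d * R)) (h1 h2 : R) :
  (forall x y, gcov (U x) (V y) = 0) ->
  forall G1 G2, measurable G1 -> measurable G2 ->
  P ((lc_field U h1 @^-1` G1) `&` (lc_field V h2 @^-1` G2)) =
  (P (lc_field U h1 @^-1` G1) * P (lc_field V h2 @^-1` G2))%E.
Proof.
move=> UV; apply: indep_fields; [exact: measurable_lc_field|exact: measurable_lc_field|].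
move=> s t; have := lc_indep d3 hphi UV [seq (x, h1) | x <- s] [seq (x, h2) | x <- t].
have e (W : Zd d -> seq (Zd d * R)) (r : seq (Zd d)) h :
    [set w | all (fun p => (p.2 <= lcp (W p.1) w)%R) [seq (x, h) | x <- r]] =
    lc_field W h @^-1` orthant r.
  by apply/seteqP; split=> w; rewrite /= /orthant /= all_map.
by rewrite !e.
Qed.

(* V y is phi y minus its balayage on B1, so it is orthogonal to the field on B1;
   the part removed has variance at most M on B2. *)
Lemma residual_field (B1 B2 : seq (Zd d)) (M delta : R) :
  uniq B1 -> 0 < M -> 0 <= delta ->
  (forall z y, z \in B1 -> y \in B2 -> greenR y z <= M) ->
  exists (V : Zd d -> seq (Zd d * R)) (N : set Omega),
  [/\ measurable N,
      (P N <= ((size B2)%:R * 2 * expR (- (delta ^+ 2 * kappa) / (2 * M)))%:E)%E,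
      forall w y, ~ N w -> y \in B2 -> `|phi y w - lcp (V y) w| < delta &
      forall z y, z \in B1 -> gcov [:: (z, 1)] (V y) = 0].
Proof.
move=> uB1 M0 dl0 hM.
have [a ha] := choice (fun y => @green_balayage R d d3 B1 y uB1).
pose H y := [seq (z, a y z) | z <- B1].
pose V y := (y, 1) :: [seq (p.1, - p.2) | p <- H y].
pose N := \big[setU/set0]_(y <- B2) [set w | (delta <= `|lcp (H y) w|)%R].
have mH y : measurable [set w | (delta <= `|lcp (H y) w|)%R].
  have mA : measurable_fun setT (fun w => `|lcp (H y) w|).
    by apply: measurableT_comp => //; exact: measurable_lc.
  rewrite -[X in measurable X]setTI.
  exact: (measurable_fun_le measurableT (measurable_cst delta) mA).
have VE y w : phi y w - lcp (V y) w = lcp (H y) w.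
  have e : lcp (V y) w = phi y w - lcp (H y) w.
    by rewrite -(lc_opp (H y) w) /lc /lincomb /V big_cons /= mul1r.
  by rewrite e; lra.
exists V, N; split.
- exact: bigsetU_measurable.
- rewrite -mulrA EFinM.
  elim: B2 hM @N => [|y B2 IH] hM N; first by rewrite /N big_nil measure0 mul0e.
  rewrite /N big_cons; apply: le_trans (measureU2 _ _ _) _ => //.
    exact: bigsetU_measurable.
  rewrite /= -natr1 EFinD addeC ge0_muleDl// mul1e leeD//; last first.
    by apply: IH => z y' zB yB; apply: hM => //; rewrite inE yB orbT.
  rewrite EFinM; apply: (lc_tail2 d3 hphi) => //.
  have [a0 a1 aG] := ha y.
  rewrite /gcov big_map; under eq_bigr do rewrite big_map.
  apply: le_trans (_ : \sum_(z <- B1) a y z * M <= _); last first.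
    by rewrite -mulr_suml ler_piMl// ltW.
  rewrite big_seq [leRHS]big_seq; apply: ler_sum => z zB /=.
  under eq_bigr do rewrite -mulrA [greenR z _](greenR_sym).
  rewrite -mulr_sumr (aG z zB); apply: ler_wpM2l; first exact: a0.
  by apply: hM => //; exact: mem_head.
- move=> w y nN yB; rewrite VE ltNge; apply/negP => h; apply: nN.
  by rewrite /N -bigcup_seq; exists y.
- move=> z y zB; rewrite /gcov big_seq1 /V big_cons -map_comp big_map /=.
  have [_ _ aG] := ha y.
  rewrite !mul1r (greenR_sym z y) -(aG z zB) -big_split big1// => z' _.
  by rewrite /= mul1r mulNr (greenR_sym z z') subrr.
Qed.

Local Notation err B2 M delta :=
  ((size B2)%:R * 2 * expR (- (delta ^+ 2 * kappa) / (2 * M)) : R).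

(** Two exchanges on [B2], each off an event of probability at most [err]: the field at level [l] is
    replaced by the residual field at an intermediate level [c], independent of the field on [B1],
    and the residual field is then replaced by the field at level [l']. The effect of the exchanges
    on [G2] is kept abstract so that increasing and decreasing events share the proof. *)
Lemma decouple (B1 B2 : seq (Zd d)) (M delta l l' c : R) G1 G2 :
  uniq B1 -> 0 < M -> 0 <= delta ->
  (forall z y, z \in B1 -> y \in B2 -> greenR y z <= M) ->
  measurable G1 -> (forall xi xi' : config d, (forall y, y \in B1 -> xi y = xi' y) -> G1 xi -> G1 xi') ->
  measurable G2 ->
  (forall (f g : Zd d -> R), (forall y, y \in B2 -> `|f y - g y| < delta) ->
    (G2 (fun y => l <= f y) -> G2 (fun y => c <= g y)) /\
    (G2 (fun y => c <= g y) -> G2 (fun y => l' <= f y))) ->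
  (P (exc l @^-1` (G1 `&` G2)) <=
   P (exc l @^-1` G1) * P (exc l' @^-1` G2) + (2 * err B2 M delta)%:E)%E.
Proof.
move=> uB1 M0 dl0 hM mG1 dG1 mG2 hG2.
have [V [N [mN PN hN ort]]] := residual_field uB1 M0 dl0 hM.
(* Empty off [B1], so that orthogonality holds at every pair of sites. *)
pose U z : seq (Zd d * R) := if z \in B1 then [:: (z, 1)] else [::].
have UV x y : gcov (U x) (V y) = 0.
  by rewrite /U; case: ifPn => [/ort//|_]; rewrite /gcov big_nil.
have ind := lc_field_indep l c UV mG1 mG2.
have EG1 w : (lc_field U l @^-1` G1) w <-> (exc l @^-1` G1) w.
  have h y : y \in B1 -> lc_field U l w y = exc l w y.
    by move=> yB; rewrite /lc_field /U yB /lc /lincomb big_seq1 mul1r.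
  by split=> /=; apply: dG1 => y /h.
have {}EG1 : lc_field U l @^-1` G1 = exc l @^-1` G1 by apply/seteqP; split=> w; rewrite EG1.
set e := err _ _ _ in PN *.
have mE := measurable_lc_field V c.
have mid : measurable (lc_field V c @^-1` G2).
  by rewrite -[X in measurable X]setTI; exact: mE.
have s1 : (P (exc l @^-1` (G1 `&` G2)) <= P (exc l @^-1` G1) * P (lc_field V c @^-1` G2) + e%:E)%E.
  rewrite -EG1 -ind EG1.
  apply: le_trans (_ : P ((exc l @^-1` G1 `&` lc_field V c @^-1` G2) `|` N) <= _)%E.
    apply: le_measure; rewrite ?inE; [|apply: measurableU => //|].
    - by apply: exc_pre; exact: measurableI.
    - by apply: measurableI => //; exact: exc_pre.
    move=> w [g1 g2]; have [nw|nw] := pselect (N w); [by right|left; split=> //].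
    by have [h _] := hG2 (phi^~ w) (fun y => lcp (V y) w) (fun y => hN w y nw); exact: h.
  apply: le_trans (measureU2 _ _ _) _ => //; first by apply: measurableI => //; exact: exc_pre.
  by rewrite leeD2l.
have s2 : (P (lc_field V c @^-1` G2) <= P (exc l' @^-1` G2) + e%:E)%E.
  apply: le_trans (_ : P ((exc l' @^-1` G2) `|` N) <= _)%E.
    apply: le_measure; rewrite ?inE//; first by apply: measurableU => //; exact: exc_pre.
    move=> w g2; have [nw|nw] := pselect (N w); [by right|left].
    by have [_ h] := hG2 (phi^~ w) (fun y => lcp (V y) w) (fun y => hN w y nw); exact: h.
  apply: le_trans (measureU2 _ _ _) _ => //; first exact: exc_pre.
  by rewrite leeD2l.
apply: le_trans s1 _; rewrite mulr_natl mulr2n EFinD addeA leeD2r//.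
apply: le_trans (_ : P (exc l @^-1` G1) * (P (exc l' @^-1` G2) + e%:E) <= _)%E.
  by rewrite lee_wpmul2l.
have e0 : (0 <= e%:E)%E by rewrite lee_fin !mulr_ge0 ?expR_ge0.
rewrite ge0_muleDr// leeD2l// -[leRHS]mul1e lee_wpmul2r//.
by apply: probability_le1; exact: exc_pre.
Qed.

Lemma decouple_incr (B1 B2 : seq (Zd d)) (M delta l : R) G1 G2 :
  uniq B1 -> 0 < M -> 0 <= delta ->
  (forall z y, z \in B1 -> y \in B2 -> greenR y z <= M) ->
  measurable G1 -> (forall xi xi' : config d, (forall y, y \in B1 -> xi y = xi' y) -> G1 xi -> G1 xi') ->
  measurable G2 -> incr_on B2 G2 ->
  (P (exc l @^-1` (G1 `&` G2)) <=
   P (exc l @^-1` G1) * P (exc (l - 2 * delta) @^-1` G2) + (2 * err B2 M delta)%:E)%E.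
Proof.
move=> uB1 M0 dl0 hM mG1 dG1 mG2 iG2; apply: (@decouple B1 B2 M delta l (l - 2 * delta) (l - delta)) => //.
move=> f g fg; split=> h; apply: (iG2 _ _ h) => y /fg; rewrite ltr_norml => /andP[]; lra.
Qed.

Lemma decouple_decr (B1 B2 : seq (Zd d)) (M delta l : R) G1 G2 :
  uniq B1 -> 0 < M -> 0 <= delta ->
  (forall z y, z \in B1 -> y \in B2 -> greenR y z <= M) ->
  measurable G1 -> (forall xi xi' : config d, (forall y, y \in B1 -> xi y = xi' y) -> G1 xi -> G1 xi') ->
  measurable G2 -> decr_on B2 G2 ->
  (P (exc l @^-1` (G1 `&` G2)) <=
   P (exc l @^-1` G1) * P (exc (l + 2 * delta) @^-1` G2) + (2 * err B2 M delta)%:E)%E.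
Proof.
move=> uB1 M0 dl0 hM mG1 dG1 mG2 iG2; apply: (@decouple B1 B2 M delta l (l + 2 * delta) (l + delta)) => //.
move=> f g fg; split=> h; apply: (iG2 _ _ h) => y /fg; rewrite ltr_norml => /andP[]; lra.
Qed.

Lemma exc_mono (l l' : R) w (x : Zd d) : l <= l' -> exc l' w x -> exc l w x.
Proof. by move=> h; apply: le_trans. Qed.

Lemma exc_increasing (l l' : R) G : l <= l' -> measurable G -> increasing G ->
  (P (exc l' @^-1` G) <= P (exc l @^-1` G))%E.
Proof.
move=> ll mG iG; apply: le_measure; rewrite ?inE; [exact: exc_pre|exact: exc_pre|].
by move=> w /iG; apply => y; exact: exc_mono.
Qed.

Lemma exc_decreasing (l l' : R) G : l <= l' -> measurable G -> decreasing G ->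
  (P (exc l @^-1` G) <= P (exc l' @^-1` G))%E.
Proof.
move=> ll mG iG; apply: le_measure; rewrite ?inE; [exact: exc_pre|exact: exc_pre|].
by move=> w /iG; apply => y; exact: exc_mono.
Qed.

End Decoupling.

Lemma box_nat (R : realType) d (x : Zd d) n y : box x (n%:R : R) y <-> (linf_dist x y <= n)%N.
Proof.
rewrite /box /=; have -> : n%:R = n%:Z%:~R :> R by rewrite -pmulrn.
by rewrite intrKfloor lez_nat.
Qed.

(** * Sprinkling and the conditions P2 and P3 *)

Section Asymptotics.
Context {R : realType}.

(** The decoupling error in P3 is of the form 4 (20L + 1)^d exp (- c sqrt L). With t = ln L >= 16
    one has sqrt t <= t/4, so exp (sqrt t) is at most E = L^(1/4), while sqrt L = E^2 and the
    logarithmic term is O(E). *)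
Lemma sqrt_beats_subexp (c : R) (d : nat) : 0 < c ->
  exists N : nat, forall L : nat, (N <= L)%N -> (1 <= L)%N ->
    expR (ln L%:R `^ 2^-1) <=
      c * Num.sqrt L%:R - ln (4 * ((20 * L).+1%:R ^+ d)).
Proof.
move=> c0; pose K : R := `|ln 4| + d%:R * ln 21; pose K' := 1 + K + 4 * d%:R.
have ln21 : 0 <= ln 21 :> R by apply: ln_ge0; lra.
have K0 : 0 <= K by rewrite addr_ge0// mulr_ge0.
have K'0 : 0 <= K' by rewrite !addr_ge0// mulr_ge0.
pose T := Num.max 16 (4 * (K' / c)).
exists (Num.truncn (expR T)).+1 => L NL L1.
have eTL : expR T <= L%:R.
  apply: le_trans (ltW (truncnS_gt _)) _; by rewrite ler_nat.
have L0 : 0 < L%:R :> R by rewrite ltr0n.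
set t := ln L%:R.
have tT : T <= t by rewrite -(expRK T) ler_ln// posrE expR_gt0.
have t16 : 16 <= t by apply: le_trans tT; rewrite le_max lexx.
have tK : 4 * (K' / c) <= t by apply: le_trans tT; rewrite le_max lexx orbT.
rewrite powR12_sqrt; last by lra.
set s := Num.sqrt t.
have s0 : 0 <= s by exact: sqrtr_ge0.
have ss : s ^+ 2 = t by rewrite sqr_sqrtr//; lra.
have st : s <= t / 4.
  have : 4 <= s by rewrite leNgt; apply/negP => s4; nra.
  by rewrite -ss; nra.
pose E := expR (t / 4).
have E1 : t / 4 <= E by apply: le_trans (expR_ge1Dx _); lra.
have EK : K' <= c * E by rewrite mulrC -ler_pdivrMr//; lra.
have sE : expR s <= E by rewrite ler_expR.
have LE : Num.sqrt L%:R = E ^+ 2.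
  rewrite -(lnK L0) -/t /E -expRM_natl -[in LHS](_ : expR (t / 2) ^+ 2 = expR t).
    by rewrite sqrtr_sqr ger0_norm ?expR_ge0//; congr expR; lra.
  by rewrite -expRM_natl; congr expR; lra.
have lnb : ln (4 * ((20 * L).+1%:R ^+ d)) <= K + d%:R * t.
  have h20 : 0 < (20 * L).+1%:R :> R by rewrite ltr0n.
  rewrite lnM ?posrE ?exprn_gt0// lnXn// /K -addrA lerD ?ler_norm// -mulrDr -[_ *+ d]mulr_natl.
  rewrite ler_wpM2l// -lnM ?posrE// ler_ln ?posrE ?mulr_gt0//.
  have : 1 <= L%:R :> R by rewrite (ler_nat R 1).
  by rewrite -natr1 natrM; lra.
have E11 : 1 <= E by lra.
have d0 : 0 <= d%:R :> R by [].
have dt : d%:R * t <= 4 * d%:R * E by nra.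
have KE : K <= K * E by nra.
have KEE : K' * E <= c * E * E by rewrite ler_wpM2r//; lra.
rewrite LE expr2 mulrA; rewrite /K' in KEE; nra.
Qed.
End Asymptotics.

Section MonotoneAndDecoupling.
Context {R : realType} {d : nat}.
Context {disp : measure_display} {Omega : measurableType disp}.
Context {P : probability Omega R} {phi : Zd d -> {RV P >-> R}}.
Hypothesis d3 : (3 <= d)%N.
Hypothesis hphi : is_GFF phi.
Variable h_star : R.

Local Notation kappa := (@gauss_mom2 R).
Local Notation exc h := (excursion phi h).
Local Notation hh u := (h_star - u + 1 : R).
Local Notation Pr := (fun u : R => excursion_law phi (hh u)).

Lemma gff_P2 (a b : \bar R) : P2 a b Pr.
Proof.
move=> u u' _ _ uu' G mG iG; apply: (@exc_increasing _ _ _ _ P phi) => //.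
by rewrite lerD2r lerD2l lerN2 ltW.
Qed.

Let cP : R := kappa / (16 * @green_bound R d).

(** The level is shifted by [2 * delta = u - u'], and [u' >= 1] turns the multiplicative gap into
    delta >= N^(-1/4) / 2. The Green function between the boxes is of order (N L)^(-1/2), so the
    exponent delta^2 / M is at least of order sqrt L: the choice [chi_P = 1/4] is what cancels N. *)
Lemma gff_P3 (a : R) : 1 <= a -> P3 a%:E +oo Pr.
Proof.
move=> a1; have k0 := @gauss_mom2_gt0 R.
have gb0 : 0 < @green_bound R d.
  by apply: lt_le_trans (greenR_le_max d3 0 0); apply: lt_le_trans (greenR_diag d3 0).
have c0 : 0 < cP by rewrite divr_gt0// mulr_gt0.
have [LP hLP] := sqrt_beats_subexp d c0.
pose f (L : nat) : R := cP * Num.sqrt L%:R - ln (4 * ((20 * L).+1%:R ^+ d)).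
(* With [N >= 40], boxes of radius [10 * L] around points at distance [N * L] keep a gap of at least
   half that distance. *)
exists 40, LP%:R, 2^-1, 4^-1, f; split=> //.
  by move=> L L1; rewrite ler_nat => /hLP; exact.
move=> L x1 x2 A1 A2 B1 B2 N u' u L1 F_ FA1 FA2 FB1 FB2 dA1 dA2 iB1 iB2 N40 ru' ru uu' spr dist.
rewrite (ler_nat R 40) in N40.
have u'1 : 1 <= u' by move: ru'; rewrite /range_ab /= => /andP[]; rewrite !lte_fin; lra.
pose S (x : Zd d) := ball_seq x (10 * L).
have FS x y : box x (10 * L%:R : R) y -> y \in S x.
  by rewrite -natrM => /box_nat; rewrite mem_ball_seq.
have sep (z y : Zd d) : z \in S x1 -> y \in S x2 -> ((N * L) %/ 2 <= linf_dist y z)%N.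
  rewrite !mem_ball_seq => h1 h2.
  have t1 := linf_triangle z x1 x2; have t2 := linf_triangle y z x2.
  have e : (linf_dist x1 x2 <= 10 * L + (linf_dist y z + 10 * L))%N.
    by move: t1 t2 h1 h2; rewrite (linf_distC z y) (linf_distC y x2); clear; lia.
  move: e dist N40 L1; clear; move: (linf_dist x1 x2) (linf_dist y z) => p q; nia.
pose n := ((N * L) %/ 2)%N.
have n0 : (0 < n)%N by rewrite divn_gt0//; nia.
pose M := @green_bound R d / Num.sqrt n%:R.
have qn : 0 < Num.sqrt n%:R :> R by rewrite sqrtr_gt0 ltr0n.
have M0 : 0 < M by rewrite divr_gt0.
have hM z y : z \in S x1 -> y \in S x2 -> greenR y z <= M.
  by move=> h1 h2; apply: greenR_le_linf => //; exact: sep.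
pose delta := (u - u') / 2.
have dl0 : 0 <= delta by rewrite divr_ge0// subr_ge0 ltW.
have err_le : 2 * ((size (S x2))%:R * 2 * expR (- (delta ^+ 2 * kappa) / (2 * M))) <= expR (- f L).
  have Npos : 0 < N%:R :> R by rewrite ltr0n; lia.
  have q0 : 0 < Num.sqrt N%:R :> R by rewrite sqrtr_gt0.
  set p := N%:R `^ (- 4^-1) in spr.
  have p0 : 0 <= p by exact: powR_ge0.
  have pp : p ^+ 2 * Num.sqrt N%:R = 1.
    rewrite -powR12_sqrt ?ler0n// /p -powR_mulrn ?powR_ge0// -powRrM -powRD ?(gt_eqF Npos) ?implybT//.
    by rewrite (_ : _ + _ = 0) ?powRr0//; lra.
  have dp : p / 2 <= delta by rewrite /delta; nra.
  have d2 : p ^+ 2 / 4 <= delta ^+ 2 by nra.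
  have nNL : Num.sqrt N%:R * Num.sqrt L%:R <= 2 * Num.sqrt n%:R :> R.
    rewrite -sqrtrM ?ler0n// -natrM -[2](@ger0_norm R)// -sqrtr_sqr -sqrtrM ?sqr_ge0//.
    rewrite ler_sqrt ?mulr_ge0// -natrX -natrM ler_nat.
    have : (39 < N * L)%N by move: N40 L1; clear; nia.
    by rewrite /n; clear; move: (N * L)%N => m; lia.
  have key : cP * Num.sqrt L%:R <= delta ^+ 2 * kappa / (2 * M).
    have -> : delta ^+ 2 * kappa / (2 * M) = cP * (8 * delta ^+ 2 * Num.sqrt n%:R).
      by rewrite /cP /M; field; rewrite !gt_eqF.
    rewrite ler_pM2l//.
    have : p ^+ 2 * (Num.sqrt N%:R * Num.sqrt L%:R) <= p ^+ 2 * (2 * Num.sqrt n%:R).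
      by rewrite ler_wpM2l// sqr_ge0.
    rewrite mulrA pp mul1r => h; apply: le_trans h _.
    have := ltW qn; nra.
  rewrite /f opprB expRD lnK ?posrE ?mulr_gt0 ?exprn_gt0 ?ltr0n// size_ball_seq.

  have -> : ((10 * L).*2.+1 ^ d)%:R = (20 * L).+1%:R ^+ d :> R.
    rewrite natrX (_ : (10 * L).*2.+1 = (20 * L).+1)//.
    by rewrite -muln2 mulnAC.
  rewrite mulNr; set e1 := expR _; set e2 := expR _.
  have : e1 <= e2 by rewrite ler_expR lerN2.
  have : 0 <= (20 * L).+1%:R ^+ d :> R by exact: exprn_ge0.
  nra.
have mS x (G : set (config d)) : F_ x G -> measurable G by exact: sigma_coord_measurable.
have dS x (G : set (config d)) : F_ x G -> forall xi xi' : config d, (forall y, y \in S x -> xi y = xi' y) -> G xi -> G xi'.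
  by move=> FG xi xi' e; apply: (sigma_coord_dep FG) => y /FS; exact: e.
split.
- have := decouple_decr d3 hphi (hh u) (uniq_ball_seq x1 (10 * L)) M0 dl0 hM (mS _ _ FA1) (dS _ _ FA1)
    (mS _ _ FA2) (decreasing_on FA2 (FS x2) dA2).
  have -> : hh u + 2 * delta = hh u' by rewrite /delta; lra.
  move=> h; apply: le_trans h _; apply: leeD; last by rewrite lee_fin.
  apply: lee_wpmul2r => //; apply: exc_decreasing => //; last exact: mS FA1.
  by rewrite lerD2r lerD2l lerN2 ltW.
- have := decouple_incr d3 hphi (hh u') (uniq_ball_seq x1 (10 * L)) M0 dl0 hM (mS _ _ FB1) (dS _ _ FB1)
    (mS _ _ FB2) (increasing_on FB2 (FS x2) iB2).
  have -> : hh u' - 2 * delta = hh u by rewrite /delta; lra.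
  move=> h; apply: le_trans h _; apply: leeD; last by rewrite lee_fin.
  apply: lee_wpmul2r => //; apply: exc_increasing => //; last exact: mS FB1.
  by rewrite lerD2r lerD2l lerN2 ltW.
Qed.

End MonotoneAndDecoupling.

(** * Stationarity and mixing *)

Section RealProbability.
Context {R : realType} {disp : measure_display} {T : measurableType disp}.
Variable Q : probability T R.
Implicit Types A B : set T.

Definition pr A : R := fine (Q A).

Lemma prE A : measurable A -> Q A = (pr A)%:E.
Proof. by move=> mA; rewrite fineK// fin_num_measure. Qed.

Lemma pr_ge0 A : 0 <= pr A. Proof. exact: fine_ge0. Qed.

Lemma pr_le1 A : measurable A -> pr A <= 1.
Proof. by move=> mA; rewrite -lee_fin -prE// probability_le1. Qed.

Lemma pr_set0 : pr set0 = 0. Proof. by rewrite /pr measure0. Qed.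

Lemma pr_setT : pr setT = 1. Proof. by rewrite /pr; have /= -> := @probability_setT _ _ _ Q. Qed.

Lemma pr_le A B : measurable A -> measurable B -> A `<=` B -> pr A <= pr B.
Proof. by move=> mA mB AB; rewrite -lee_fin -!prE// le_measure// inE. Qed.

Lemma prU A B : measurable A -> measurable B -> A `&` B = set0 -> pr (A `|` B) = pr A + pr B.
Proof.
move=> mA mB AB; apply: EFin_inj; rewrite EFinD -!prE//; last exact: measurableU.
by apply: measureU.
Qed.

Lemma prU_le A B : measurable A -> measurable B -> pr (A `|` B) <= pr A + pr B.
Proof.
move=> mA mB; rewrite -lee_fin EFinD -!prE//; last exact: measurableU.
exact: measureU2.
Qed.

Lemma prDI A B : measurable A -> measurable B -> pr A = pr (A `&` B) + pr (A `&` ~` B).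
Proof.
move=> mA mB; rewrite -prU.
- by rewrite -setIUr setUv setIT.
- exact: measurableI.
- by apply: measurableI => //; exact: measurableC.
- by rewrite setIACA setICr setI0.
Qed.

Lemma prC A : measurable A -> pr (~` A) = 1 - pr A.
Proof. by move=> mA; rewrite -pr_setT (prDI measurableT mA) !setTI addrAC subrr add0r. Qed.

Lemma pr_sub A B : measurable A -> measurable B -> A `<=` B -> pr B - pr A = pr (B `&` ~` A).
Proof. by move=> mA mB AB; rewrite (prDI mB mA) setIC (setIidl AB) addrAC subrr add0r. Qed.

Lemma pr_bigcup_le (I : eqType) (s : seq I) (F : I -> set T) : (forall i, measurable (F i)) ->
  pr (\big[setU/set0]_(i <- s) F i) <= \sum_(i <- s) pr (F i).
Proof.
move=> mF; elim: s => [|i s IH]; first by rewrite !big_nil pr_set0.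
rewrite !big_cons; apply: le_trans (prU_le _ _) _ => //; first exact: bigsetU_measurable.
by rewrite lerD2l.
Qed.

Lemma pr_cvg_nincr (F : nat -> set T) : (forall n, measurable (F n)) -> nonincreasing_seq F ->
  (fun n => pr (F n)) @ \oo --> pr (\bigcap_n F n).
Proof.
move=> mF dF; apply: fine_cvg; rewrite -prE; last exact: bigcap_measurable.
apply: nonincreasing_cvg_mu => //; last exact: bigcap_measurable.
by rewrite -ge0_fin_numE// fin_num_measure.
Qed.

Lemma pr_cvg_ndecr (F : nat -> set T) : (forall n, measurable (F n)) -> nondecreasing_seq F ->
  (fun n => pr (F n)) @ \oo --> pr (\bigcup_n F n).
Proof.
move=> mF dF; apply: fine_cvg; rewrite -prE; last exact: bigcup_measurable.
by apply: nondecreasing_cvg_mu => //; exact: bigcup_measurable.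
Qed.

End RealProbability.

Section Mixing.
Context {R : realType} {d : nat}.
Variable Q : probability (config d) R.
Hypothesis inv : forall z G, measurable G -> Q (Defs.shift z @^-1` G) = Q G.
Implicit Types (G : set (config d)) (z : Zd d).

Local Notation p := (pr Q).

Lemma measurable_shift z : measurable_fun setT (Defs.shift z : config d -> config d).
Proof.
apply: (@measurability _ _ (config d) (config d) _ _ (cylinders setT)) => //.
by move=> _ [_ [y _ ->] <-]; rewrite setTI; exact: measurable_site.
Qed.

Lemma shift_pre z G : measurable G -> measurable (Defs.shift z @^-1` G).
Proof. by move=> mG; rewrite -[X in measurable X]setTI; exact: measurable_shift. Qed.

Lemma pr_shift z G : measurable G -> p (Defs.shift z @^-1` G) = p G.
Proof. by move=> mG; rewrite /pr inv. Qed.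

(** The orthant of [t] is first replaced by an arbitrary event through a Dynkin class; for invariant
    [G] this makes [G] independent of every orthant, and [indep_extension] then makes it independent
    of itself. *)
Lemma ergodic_of_mixing z :
  (forall s t, (fun n => p (orthant s `&` Defs.shift (z *+ n) @^-1` orthant t)) @ \oo -->
     p (orthant s) * p (orthant t)) ->
  forall G, measurable G -> Defs.shift z @^-1` G = G -> Q G = 0%E \/ Q G = 1%E.
Proof.
move=> mix.
have mO (s : seq (Zd d)) := measurable_orthant s.
have mixing s F : measurable F ->
    (fun n => p (orthant s `&` Defs.shift (z *+ n) @^-1` F)) @ \oo --> p (orthant s) * p F.
  pose H : set (set (config d)) := [set F | measurable F /\
    (fun n => p (orthant s `&` Defs.shift (z *+ n) @^-1` F)) @ \oo --> p (orthant s) * p F].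
  move=> mF; suff : H F by case.
  move: F mF; apply: config_dynkin; last by move=> t; split.
  split.
  - split=> //; under eq_fun do rewrite preimage_setT setIT.
    by rewrite pr_setT mulr1; exact: cvg_cst.
  - move=> F [mF cF]; split; first exact: measurableC.
    rewrite (_ : (fun n => _) = (fun n => p (orthant s) - p (orthant s `&` Defs.shift (z *+ n) @^-1` F))).
      by rewrite prC// mulrBr mulr1; apply: cvgB => //; exact: cvg_cst.
    apply/funext => n; rewrite preimage_setC [p (orthant s)](prDI Q (mO s) (shift_pre (z *+ n) mF)).
    by rewrite addrAC subrr add0r.
  - move=> F tF hF; have mF i : measurable (F i) by case: (hF i).
    have mU : measurable (\bigcup_i F i) by exact: bigcup_measurable.
    split=> //; pose Uk k := \big[setU/set0]_(i < k) F i.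
    have mUk k : measurable (Uk k) by exact: bigsetU_measurable.
    have cUk k : (fun n => p (orthant s `&` Defs.shift (z *+ n) @^-1` Uk k)) @ \oo --> p (orthant s) * p (Uk k).
      elim: k => [|k IH].
        rewrite /Uk big_ord0 pr_set0 mulr0; under eq_fun do rewrite preimage_set0 setI0 pr_set0.
        exact: cvg_cst.
      have dj : Uk k `&` F k = set0.
        rewrite /Uk big_distrl /=; apply: big1 => i _.
        by move/trivIsetP: tF; apply => //; rewrite neq_ltn ltn_ord.
      rewrite (_ : Uk k.+1 = Uk k `|` F k); last by rewrite /Uk big_ord_recr.
      rewrite (prU Q) // mulrDr.
      rewrite (_ : (fun n => _) = (fun n => p (orthant s `&` Defs.shift (z *+ n) @^-1` Uk k) +
                                       p (orthant s `&` Defs.shift (z *+ n) @^-1` F k))).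
        by apply: cvgD => //; have [] := hF k.
      apply/funext => n; rewrite preimage_setU setIUr (prU Q)//.
      + by apply: measurableI => //; exact: shift_pre.
      + by apply: measurableI => //; exact: shift_pre.
      + apply/seteqP; split=> // xi [[_ a] [_ b]].
        by have : (Uk k `&` F k) (Defs.shift (z *+ n) xi) by []; rewrite dj.
    have UkU k : Uk k `<=` \bigcup_i F i by exact: bigsetU_bigcup.
    apply/cvgrPdist_le => e e0.
    have e3 : 0 < e / 3 by lra.
    have cU : (fun k => p (Uk k)) @ \oo --> p (\bigcup_i F i).
      have -> : \bigcup_i F i = \bigcup_k Uk k.
        apply/seteqP; split=> xi [k _ hk]; last exact: UkU hk.
        by exists k.+1 => //; rewrite /Uk big_ord_recr; right.
      apply: (@pr_cvg_ndecr _ _ _ Q Uk mUk).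
      by move=> i j ij; apply/subsetPset; exact: subset_bigsetU.
    have [k hk] : exists k, `|p (\bigcup_i F i) - p (Uk k)| <= e / 3.
      move/cvgrPdist_le : cU => /(_ _ e3)[k _ hk].
      by exists k; apply: hk => /=.
    have := cUk k; move/cvgrPdist_le => /(_ _ e3)[N _ hN].
    exists N => // n Nn; have := hN n Nn; rewrite /=.
    have pk : p (\bigcup_i F i) - p (Uk k) <= e / 3.
      by apply: le_trans hk; exact: ler_norm.
    have k0 : 0 <= p (\bigcup_i F i) - p (Uk k) by rewrite (pr_sub Q)// pr_ge0.
    have [m1 m2] : measurable (orthant s `&` Defs.shift (z *+ n) @^-1` Uk k) /\
        measurable (orthant s `&` Defs.shift (z *+ n) @^-1` (\bigcup_i F i)).
      by split; apply: measurableI => //; exact: shift_pre.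
    have s12 : orthant s `&` Defs.shift (z *+ n) @^-1` Uk k `<=`
        orthant s `&` Defs.shift (z *+ n) @^-1` (\bigcup_i F i).
      by move=> xi [h1 h2]; split=> //; exact: (UkU k _ h2).
    have d0 := pr_le Q m1 m2 s12.
    (* Shift invariance bounds the error of truncating the union by a quantity free of [n], which
       allows the limits in [n] and [k] to be exchanged. *)
    have d1 : p (orthant s `&` Defs.shift (z *+ n) @^-1` (\bigcup_i F i)) -
              p (orthant s `&` Defs.shift (z *+ n) @^-1` Uk k) <= p (\bigcup_i F i) - p (Uk k).
      rewrite (pr_sub Q)// (pr_sub Q)//.
      have mD : measurable (\bigcup_i F i `&` ~` Uk k) by apply: measurableI => //; exact: measurableC.
      rewrite -(pr_shift (z *+ n) mD); apply: pr_le.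
      - by apply: measurableI => //; exact: measurableC.
      - exact: shift_pre.
      - by move=> xi [[? ?] h]; split=> // ?; apply: h.
    have sO : p (orthant s) * (p (\bigcup_i F i) - p (Uk k)) <= p (\bigcup_i F i) - p (Uk k).
      by apply: ler_piMl => //; exact: pr_le1.
    have sO0 : 0 <= p (orthant s) * (p (\bigcup_i F i) - p (Uk k)) by rewrite mulr_ge0// pr_ge0.
    move: (p _) (p _) (p _) (p _) (p _) k0 pk d0 d1 sO sO0 => a b c x y.
    rewrite !ler_norml => k0 pk d0 d1 sO sO0 /andP[h1 h2]; apply/andP; split; nra.
move=> G mG iG.
have iGn n : Defs.shift (z *+ n) @^-1` G = G.
  elim: n => [|n IH].
    apply/seteqP; split=> xi /=; rewrite (_ : Defs.shift _ xi = xi)//; apply/funext => x;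
      by rewrite /Defs.shift mulr0n addr0.
  rewrite -[RHS]IH -[in RHS]iG; apply/seteqP; split=> xi /=;
    rewrite (_ : Defs.shift (z *+ n.+1) xi = Defs.shift z (Defs.shift (z *+ n) xi))//; apply/funext => x;
    by rewrite /Defs.shift mulrSr addrA [x + _ + _]addrAC.
have key s : p (orthant s `&` G) = p (orthant s) * p G.
  have := mixing s G mG; under eq_fun do rewrite iGn.
  by move=> /cvg_lim <- //; rewrite lim_cst.
have := @indep_extension d _ _ R Q id _ G mG.
have mid : measurable_fun setT (id : config d -> config d) by exact: measurable_id.
move=> /(_ mid) h.
have {h} : Q (G `&` G) = (Q G * Q G)%E.
  have /= h2 := h _ G mG; apply: h2 => s.
  have mI : measurable (orthant s `&` G) by exact: measurableI.
  by rewrite (prE Q mI) key EFinM -!prE.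
rewrite setIid (prE Q mG) -EFinM => -[/eqP]; rewrite -subr_eq0 -{1}[pr Q G]mulr1 -mulrBr mulf_eq0 subr_eq0.
by case/orP => /eqP e; [left; rewrite e|right; rewrite -e].
Qed.

End Mixing.

Section Stationarity.
Context {R : realType} {d : nat}.
Context {disp : measure_display} {Omega : measurableType disp}.
Context {P : probability Omega R} {phi : Zd d -> {RV P >-> R}}.
Hypothesis d3 : (3 <= d)%N.
Hypothesis hphi : is_GFF phi.
Implicit Types (x y z : Zd d) (G : set (config d)).

Local Notation kappa := (@gauss_mom2 R).
Local Notation exc h := (excursion phi h).
Local Notation Q h := (excursion_law phi h).

Lemma excursion_lawE h G : Q h G = P (exc h @^-1` G).
Proof. by []. Qed.

Lemma exc_orthant h (s : seq (Zd d)) :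
  exc h @^-1` orthant s = [set w | all (fun p : Zd d * R => p.2 <= phi p.1 w) [seq (x, h) | x <- s]].
Proof. by apply/seteqP; split=> w; rewrite /= /orthant /= all_map. Qed.

Lemma shift_orthant z (s : seq (Zd d)) : Defs.shift z @^-1` orthant s = orthant [seq x + z | x <- s].
Proof. by apply/seteqP; split=> w; rewrite /= /orthant /= all_map. Qed.

Lemma excursion_shift h z G : measurable G -> Q h (Defs.shift z @^-1` G) = Q h G.
Proof.
move=> mG; pose S : config d -> config d := Defs.shift z.
have mS : measurable_fun setT S by exact: measurable_shift.
have mC : measurable_fun setT (S \o exc h) by apply: measurableT_comp => //; exact: measurable_exc.
pose f : {mfun Omega >-> config d} := mfun_Sub (mem_set mC).
have := @config_law_unique d R (distribution P f) (Q h) _ G mG; apply => s.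
transitivity (P (exc h @^-1` (S @^-1` orthant s))) => //.
rewrite shift_orthant excursion_lawE !exc_orthant (phi_shift d3 hphi z [seq (x, h) | x <- s]).
by congr (P _); apply/seteqP; split=> w; rewrite /= !all_map.
Qed.

(** For each site the events decrease to the coincidence of the field with [h], which is null since
    the field has no atom; [s] is finite. *)
Lemma level_cont h (s : seq (Zd d)) (e : R) : 0 < e -> exists2 delta, 0 < delta &
  pr P (\big[setU/set0]_(x <- s) [set w | `|phi x w - h| <= delta]) <= e.
Proof.
move=> e0; pose F (x : Zd d) (n : nat) := [set w | `|phi x w - h| <= n.+1%:R^-1].
have mF x n : measurable (F x n).
  have mA : measurable_fun setT (fun w => `|phi x w - h|).
    by apply: measurableT_comp => //; apply: measurable_funB => //; exact: measurable_funPT.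
  by rewrite -[X in measurable X]setTI; exact: (measurable_fun_le measurableT mA (measurable_cst _)).
have cF x : (fun n => pr P (F x n)) @ \oo --> (0 : R).
  have -> : (0 : R) = pr P (\bigcap_n F x n).
    rewrite /pr (_ : \bigcap_n F x n = [set w | phi x w = h]) ?phi_no_atom//.
    apply/seteqP; split=> w /=; last by move=> hw n _; rewrite /F /= hw subrr normr0 invr_ge0.
    move=> hw; apply/eqP; rewrite -subr_eq0 -normr_le0; apply/ler_addgt0Pl => r r0; rewrite addr0.
    have [n hn] : exists n : nat, n.+1%:R^-1 <= r.
      exists (Num.truncn r^-1); rewrite -[leRHS]invrK lef_pV2 ?posrE ?invr_gt0 ?ltr0n//.
      by apply: ltW; exact: truncnS_gt.
    by apply: le_trans hn; exact: hw.
  apply: pr_cvg_nincr => // n m nm; apply/subsetPset => w /= h1; apply: le_trans h1 _.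
  by rewrite lef_pV2 ?posrE ?ltr0n// ler_nat.
have cS : (fun n => \sum_(x <- s) pr P (F x n)) @ \oo --> (0 : R).
  elim: (s) => [|x s' IH].
    by under eq_fun do rewrite big_nil; exact: cvg_cst.
  under eq_fun do rewrite big_cons.
  have := cvgD (cF x) IH; rewrite addr0; exact.
move/cvgrPdist_le : cS => /(_ _ e0)[n _ hn].
exists n.+1%:R^-1; first by rewrite invr_gt0.
apply: le_trans (pr_bigcup_le P s (fun x => mF x n)) _.
have := hn n (leqnn n); rewrite /= sub0r normrN; apply: le_trans; exact: ler_norm.
Qed.

Lemma orthant_level_cont h (s : seq (Zd d)) (e : R) : 0 < e -> exists2 delta, 0 < delta &
  pr (Q (h - delta)) (orthant s) <= pr (Q h) (orthant s) + e /\
  pr (Q h) (orthant s) <= pr (Q (h + delta)) (orthant s) + e.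
Proof.
move=> e0; have [dl dl0 hd] := level_cont h s e0; exists dl => //.
set N := \big[setU/set0]_(x <- s) _ in hd.
have mN : measurable N.
  apply: bigsetU_measurable => x _.
  have mA : measurable_fun setT (fun w => `|phi x w - h|).
    by apply: measurableT_comp => //; apply: measurable_funB => //; exact: measurable_funPT.
  by rewrite -[X in measurable X]setTI; exact: (measurable_fun_le measurableT mA (measurable_cst _)).
have mO l : measurable (exc l @^-1` orthant s) by apply: exc_pre; exact: measurable_orthant.
have key l l' : (l' <= l + dl) -> (h - dl <= l) -> (l' <= h + dl) ->
    pr (Q l) (orthant s) <= pr (Q l') (orthant s) + e.
  move=> h1 h2 h3; apply: le_trans (_ : pr P ((exc l' @^-1` orthant s) `|` N) <= _).
    rewrite -[leLHS]/(pr P (exc l @^-1` orthant s)).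
    apply: pr_le => //; first exact: measurableU.
    move=> w hw; have [nw|nw] := pselect (N w); [by right|left].
    apply/allP => x xs; move/allP: (hw) => /(_ x xs); rewrite /excursion => hx.
    rewrite leNgt; apply/negP => hx'; apply: nw; rewrite /N -bigcup_seq; exists x => //=.
    by rewrite ler_norml; apply/andP; split; lra.
  by apply: le_trans (prU_le P (mO _) mN) _; rewrite lerD2l.
by split; apply: key; lra.
Qed.

(** Only [expR (- t) <= 1 / t] is used; [M] is chosen so that the exponent [t] satisfies
    [t * e = 4 * (n + 1)]. *)
Lemma gcov_small (e delta : R) (n : nat) : 0 < e -> 0 < delta -> exists2 M, 0 < M &
  2 * (n%:R * 2 * expR (- (delta ^+ 2 * kappa) / (2 * M))) <= e.
Proof.
move=> e0 d0; have k0 := @gauss_mom2_gt0 R.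
have n0 : 0 < n%:R + 1 :> R by apply: ltr_wpDl.
pose M := e * (delta ^+ 2 * kappa) / (8 * (n%:R + 1)).
have dk : 0 < delta ^+ 2 * kappa by rewrite mulr_gt0// exprn_gt0.
have M0 : 0 < M by rewrite divr_gt0 ?mulr_gt0.
exists M => //; set t := delta ^+ 2 * kappa / (2 * M).
have t0 : 0 < t by rewrite divr_gt0// mulr_gt0.
have tE : t * e = 4 * (n%:R + 1) by rewrite /t /M; field; rewrite !gt_eqF.
rewrite mulNr -/t expRN.
have et : t <= expR t by apply: le_trans (expR_ge1Dx _); lra.
have : (expR t)^-1 <= t^-1 by rewrite lef_pV2 ?posrE ?expR_gt0.
have tV : t^-1 * (4 * (n%:R + 1)) = e by rewrite -tE mulKf// gt_eqF.
have : 0 <= n%:R :> R by [].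
have : 0 < t^-1 by rewrite invr_gt0.
set a := t^-1 in tV *; set b := (expR t)^-1; nra.
Qed.

Lemma linf_shift_ge (x y z : Zd d) n : z != 0 -> (n <= linf_dist (x + z *+ n) y + linf_dist x y)%N.
Proof.
move=> z0; have [i zi] : exists i, z 0 i != 0.
  apply/existsP; apply: contraNT z0; rewrite negb_exists => /forallP h.
  by apply/eqP/matrixP => a i; rewrite ord1 mxE; apply/eqP; have := h i; rewrite negbK.
have c1 := linf_coord (x + z *+ n) y i; have c2 := linf_coord x y i.
apply: leq_trans (leq_add c1 c2); rewrite mxE mulmxnE.
move: (x 0 i) (y 0 i) (z 0 i) zi => a b c c0; rewrite -mulr_natr natz; nia.
Qed.

(** Decoupling the increasing orthant gives the upper bound, decoupling its decreasing complement
    the lower one. The shifted levels are brought back to [h] by continuity of orthant probabilities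
    in the level. *)
Lemma orthant_mixing h (s t : seq (Zd d)) z : z != 0 ->
  (fun n => pr (Q h) (orthant s `&` Defs.shift (z *+ n) @^-1` orthant t)) @ \oo -->
     pr (Q h) (orthant s) * pr (Q h) (orthant t).
Proof.
move=> z0; apply/cvgrPdist_le => e e0.
have e2 : 0 < e / 2 by lra.
have [dl dl0 [up lo]] := orthant_level_cont h t e2.
have [M M0 hM] := gcov_small (size t) e2 (divr_gt0 dl0 (ltr0n _ 2)).
pose C := (\sum_(x <- t) \sum_(y <- s) linf_dist x y)%N.
have CP x y : x \in t -> y \in s -> (linf_dist x y <= C)%N.
  move=> xt ys; rewrite /C (big_rem x xt) /= (big_rem y ys) /=; lia.
have gb0 : 0 <= @green_bound R d by exact: green_bound_ge0.
pose N := ((Num.truncn ((@green_bound R d / M) ^+ 2)).+1 + C).+1.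
exists N => // n /= Nn.
pose B1 := undup s; pose B2 := [seq x + z *+ n | x <- t].
have hG a b : a \in B1 -> b \in B2 -> greenR b a <= M.
  rewrite mem_undup => aB /mapP[x xt ->].
  have h1 := linf_shift_ge x a n z0; have h2 := CP _ _ xt aB.
  have m0 : (0 < n - C)%N by move: Nn; rewrite /N; clear; lia.
  apply: le_trans (greenR_le_linf d3 m0 _) _; first by move: h1 h2; clear; lia.
  rewrite ler_pdivrMr ?sqrtr_gt0 ?ltr0n// mulrC -ler_pdivrMr//.
  have q0 : 0 <= @green_bound R d / M by rewrite divr_ge0// ltW.
  rewrite -(ger0_norm q0) -sqrtr_sqr ler_sqrt ?ler0n//.
  by apply: le_trans (ltW (truncnS_gt _)) _; rewrite ler_nat; move: Nn; rewrite /N; set r := Num.Def.trunc _; clearbody r; clear; lia.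
have uB : uniq B1 by exact: undup_uniq.
have mO (r : seq (Zd d)) := measurable_orthant r.
have dep (xi xi' : config d) : (forall y, y \in B1 -> xi y = xi' y) -> orthant s xi -> orthant s xi'.
  move=> hx /allP h1; apply/allP => x xs; rewrite -hx ?mem_undup//; exact: h1.
have inc : incr_on B2 (orthant B2).
  by move=> xi xi' /allP h1 h2; apply/allP => x xB; apply: h2 => //; exact: h1.
have dl2 : 0 <= dl / 2 by lra.
have sB : size B2 = size t by rewrite size_map.
have EO l : pr (Q l) (orthant B2) = pr (Q l) (orthant t).
  by rewrite /B2 -shift_orthant /pr excursion_shift.
have U := decouple_incr d3 hphi h uB M0 dl2 hG (mO s) dep (mO B2) inc.
have L := decouple_decr d3 hphi h uB M0 dl2 hG (mO s) dep (measurableC (mO B2)) (incr_onC inc).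
have mC := measurableC (mO B2).
have dd : 2 * (dl / 2) = dl by lra.
rewrite dd sB -!excursion_lawE in U L.
rewrite !prE// -?EFinM -?EFinD ?lee_fin ?EO in U; last exact: measurableI.
rewrite !prE// -?EFinM -?EFinD ?lee_fin in L; last exact: measurableI.
rewrite (prC _ (mO B2)) ?EO in L.
have D := prDI (Q h) (mO s) (mO B2).
rewrite shift_orthant -/B2.
have p0 := pr_ge0 (Q h) (orthant s); have p1 := pr_le1 (Q h) (mO s).
move: U L D p0 p1 up lo; move: (pr _ _) (pr _ _) (pr _ _) (pr _ _) (pr _ _) (pr _ _) => a b c a' b' c' U L D p0 p1 up lo.
by rewrite ler_norml; apply/andP; split; nra.
Qed.

Theorem gff_P1 (h_star : R) (a b : \bar R) : P1 a b (fun u : R => Q (h_star - u + 1)).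
Proof.
move=> u _; split; first by move=> z G; exact: excursion_shift.
move=> z G z0 mG iG; apply: (@ergodic_of_mixing R d (Q (h_star - u + 1)) _ z) => //.
  by move=> z' G'; exact: excursion_shift.
by move=> s t; exact: orthant_mixing.
Qed.

End Stationarity.

Section Splitting.
Variable T : eqType.

Lemma split_first (a : pred T) s : has a s ->
  exists s1 x s2, [/\ s = s1 ++ x :: s2, a x & ~~ has a s1].
Proof.
elim: s => //= x s IH; case ax: (a x) => /=; first by exists [::], x, s.
move=> /IH[s1 [y [s2 [-> ay ns]]]].
by exists (x :: s1), y, s2; rewrite /= ax.
Qed.

Lemma split_last (a : pred T) s : has a s ->
  exists s1 x s2, [/\ s = s1 ++ x :: s2, a x & ~~ has a s2].
Proof.
rewrite -has_rev => /split_first[s1 [x [s2 [e ax n1]]]].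
exists (rev s2), x, (rev s1); split=> //; last by rewrite has_rev.
by rewrite -(revK s) e rev_cat rev_cons cat_rcons.
Qed.
Lemma mem_cons_cat (w x : T) p q : (w \in x :: p ++ q) = (w \in x :: p) || (w \in q).
Proof. by rewrite -cat_cons mem_cat. Qed.
End Splitting.

(** * Rerouting paths around isolated obstacles *)

Section Paths.
Context {d : nat}.
Implicit Types (x y z u v a b : Zd d) (A : set (Zd d)).

Definition between a b v : Prop := forall i,
  ((a 0 i <= v 0 i <= b 0 i) || (b 0 i <= v 0 i <= a 0 i))%R.

Definition set_coord a i (c : int) : Zd d := \row_j if j == i then c else a 0 j.

Lemma set_coordE a i c j : set_coord a i c 0 j = if j == i then c else a 0 j.
Proof. by rewrite mxE. Qed.

Lemma l1_set_coord a b i c :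
  (l1_dist (set_coord a i c) b + `|a 0%R i - b 0%R i| = `|c - b 0%R i| + l1_dist a b)%N.
Proof.
rewrite /l1_dist (bigD1 i)//= [in RHS](bigD1 i)//= set_coordE eqxx.
rewrite (eq_bigr (fun j => `|a 0%R j - b 0%R j|%N)); first by lia.
by move=> j /negPf ji; rewrite set_coordE ji.
Qed.

Lemma l1_dist_id a : l1_dist a a = 0%N.
Proof. by apply: big1 => i _; rewrite subrr. Qed.

Lemma mono_path a b : exists p, [/\ path adj a p, last a p = b, size p = l1_dist a b &
  forall v, v \in a :: p -> between a b v].
Proof.
have [n] := ubnP (l1_dist a b); elim: n a => // n IH a; rewrite ltnS => ln.
have [->|ab] := eqVneq a b.
  by exists [::]; rewrite l1_dist_id; split=> // v; rewrite inE => /eqP -> i; rewrite lexx.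
have [i abi] : exists i, a 0 i != b 0 i.
  apply/existsP; apply: contraNT ab; rewrite negb_exists => /forallP h.
  by apply/eqP/matrixP => k i; rewrite ord1; have := h i; rewrite negbK => /eqP.
pose c := if (a 0 i < b 0 i)%R then a 0 i + 1 else a 0 i - 1.
pose a' := set_coord a i c.
have l' : (l1_dist a' b).+1 = l1_dist a b.
  have := l1_set_coord a b i c; rewrite -/a' /c; move: abi.
  by move: (l1_dist _ _) (l1_dist _ _) (a 0 i) (b 0 i) => p q s t; case: ifP; lia.
have aa' : adj a a'.
  rewrite /adj l1_distC; apply/eqP; have := l1_set_coord a a i c; rewrite -/a' l1_dist_id /c.
  by move: (l1_dist _ _) (a 0 i) => p s; case: ifP; lia.
have [|p [h1 h2 h3 h4]] := IH a'; first by move: l' ln; clear; lia.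
have baa v : between a' b v -> between a b v.
  move=> h j; have := h j; rewrite set_coordE; case: eqP => // -> ; rewrite /c; move: abi.
  by move: (a 0 i) (b 0 i) (v 0 i) => s t r; case: ifP; lia.
exists (a' :: p); split=> //=; [by rewrite aa'|by rewrite h3|].
move=> v; rewrite inE => /predU1P[->|/h4/baa//] i'.
by move: (a 0 i') (b 0 i') => s t; lia.
Qed.

Lemma path_in_cat A x y z p q : path_in A x y p -> path_in A y z q -> path_in A x z (p ++ q).
Proof.
move=> [h1 h2 h3] [g1 g2 g3]; split; [by rewrite cat_path h1 h2|by rewrite last_cat h2|].
move=> v; rewrite -cat_cons mem_cat => /orP[/h3//|vq]; apply: g3.
by rewrite inE vq orbT.
Qed.

Lemma path_in_sub A B x y p : A `<=` B -> path_in A x y p -> path_in B x y p.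
Proof. by move=> AB [h1 h2 h3]; split=> // z /h3 /AB. Qed.

Lemma path_in_rev A x y p : path_in A x y p -> exists2 q, path_in A y x q & size q = size p.
Proof.
move=> [h1 h2 h3]; exists (rev (belast x p)); last by rewrite size_rev size_belast.
split.
- rewrite -h2 rev_path; apply: sub_path h1 => u v; by rewrite /= adjC.
- by case: (p) h2 => [<-//|a p' _]; rewrite /= rev_cons last_rcons.
- move=> z; rewrite inE mem_rev => /predU1P[->|zb]; first by rewrite -h2; apply/h3/mem_last.
  by apply: h3; apply: mem_belast zb.
Qed.

Lemma linf_shift_path x p v : path adj x p -> v \in p -> (linf_dist x v <= size p)%N.
Proof.
elim: p x => //= y p IH x /andP[xy h]; rewrite inE => /predU1P[->|vp].
  by apply: leq_trans (adj_linf xy) _.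
apply: leq_trans (linf_triangle y x v) _.
by have := IH _ h vp; have := adj_linf xy; lia.
Qed.

Section Sphere.
Variables (z : Zd d) (s : nat).
Local Notation sphere := [set v | linf_dist z v = s].

Lemma sphere_coord u : (0 < s)%N -> linf_dist z u = s -> exists i, `|z 0%R i - u 0%R i|%N = s.
Proof.
move=> s0 e; apply: contrapT => h.
have : (linf_dist z u <= s.-1)%N.
  apply/linf_leP => i; have := linf_coord z u i; rewrite e => hi.
  have : `|z 0%R i - u 0%R i|%N <> s by move=> e'; apply: h; exists i.
  by move: hi s0; clear; lia.
by rewrite e; move: s0; clear; lia.
Qed.

(** Both points lie on one face, since they share the extreme coordinate [i]; a monotone path
    between them keeps that coordinate and stays in the ball. *)
Lemma sphere_segment u v i : (0 < s)%N -> linf_dist z u = s -> linf_dist z v = s ->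
  `|z 0%R i - u 0%R i|%N = s -> v 0 i = u 0 i ->
  exists2 p, path_in sphere u v p & (size p <= 2 * d * s)%N.
Proof.
move=> s0 zu zv zui vui; have [p [h1 h2 h3 h4]] := mono_path u v; exists p.
- split=> // w /h4 b; apply/eqP; rewrite eqn_leq; apply/andP; split.
    apply/linf_leP => j; have := b j; have := linf_coord z u j; have := linf_coord z v j.
    by rewrite zu zv; move: (z 0 j) (u 0 j) (v 0 j) (w 0 j) => a b' c e; lia.
  apply: leq_trans (linf_coord z w i); rewrite -zui.
  by have := b i; rewrite vui; move: (z 0 i) (u 0 i) (w 0 i) => a b' e; lia.
- rewrite h3; apply: leq_trans (l1_le_linf _ _) _.
  have := linf_triangle z u v; rewrite (linf_distC u z) zu zv => h.
  by rewrite mulnAC mulnC leq_mul2r; apply/orP; right; move: h; clear; lia.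
Qed.

(** If the extreme coordinates of [u] and [u'] differ, one corner joins their faces. If they
    coincide, the points may be on opposite faces, and the path first moves to a face of another
    coordinate, available because [1 < d]. At most three segments of length [2 * d * s] are used. *)
Lemma sphere_path u u' : (1 < d)%N -> (0 < s)%N -> linf_dist z u = s -> linf_dist z u' = s ->
  exists2 p, path_in sphere u u' p & (size p <= 6 * d * s)%N.
Proof.
move=> d1 s0 zu zu'.
have [i hi] := sphere_coord s0 zu; have [j hj] := sphere_coord s0 zu'.
have two v i1 i2 : i1 != i2 -> linf_dist z v = s -> `|z 0%R i1 - v 0%R i1|%N = s -> `|z 0%R i2 - u' 0%R i2|%N = s ->
    exists2 p, path_in sphere v u' p & (size p <= 4 * d * s)%N.
  move=> i12 zv h1 h2; pose v' := set_coord u' i1 (v 0 i1).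
  have zv' : linf_dist z v' = s.
    apply/eqP; rewrite eqn_leq; apply/andP; split.
      apply/linf_leP => k; rewrite set_coordE; case: eqP => [->|_]; first by rewrite h1.
      by rewrite -zu'; exact: linf_coord.
    by apply: leq_trans (linf_coord z v' i1); rewrite set_coordE eqxx h1.
  have [|p pv sp] := sphere_segment s0 zv zv' h1; first by rewrite set_coordE eqxx.
  have [| |q qv sq] := sphere_segment (i := i2) s0 zv' zu'.
  - by rewrite set_coordE eq_sym (negPf i12).
  - by rewrite set_coordE eq_sym (negPf i12).
  exists (p ++ q); first exact: path_in_cat pv qv.
  by rewrite size_cat; move: sp sq; clear; lia.
have [ij|/two h] := eqVneq i j; last first.
  have [p h1 h2] := h u zu hi hj; exists p => //; move: h2; clear; lia.
have [k ki] : exists k : 'I_d, k != i.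
  have o1 : (0 < d)%N by apply: ltnW.
  case: (eqVneq (Ordinal o1) i) => [e|]; last by exists (Ordinal o1).
  by exists (Ordinal d1); rewrite -e.
pose v := set_coord u k (z 0 k + s%:Z).
have zvk : `|z 0%R k - v 0%R k|%N = s by rewrite set_coordE eqxx; clear; lia.
have zv : linf_dist z v = s.
  apply/eqP; rewrite eqn_leq; apply/andP; split; last by rewrite -{1}zvk; exact: linf_coord.
  apply/linf_leP => l; case: (eqVneq l k) => [->|lk]; first by rewrite zvk.
  by rewrite set_coordE (negPf lk) -zu; exact: linf_coord.
have [|p pv sp] := sphere_segment s0 zu zv hi; first by rewrite set_coordE eq_sym (negPf ki).
clear hi.
rewrite ij in ki; have [q qv sq] := two v k j ki zv zvk hj.
exists (p ++ q); first exact: path_in_cat pv qv.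
by rewrite size_cat; move: sp sq; clear; lia.
Qed.
End Sphere.

Section Reroute.
Variables (Z : set (Zd d)) (s M : nat).
Hypothesis d1 : (1 < d)%N.
Hypothesis sep : forall z z', Z z -> Z z' -> z <> z' -> (2 * s + M + 3 <= linf_dist z z')%N.

Definition hit : set (Zd d) := [set v | exists2 z, Z z & (linf_dist z v <= s)%N].

Lemma hit_same z z' u v : Z z -> Z z' -> (linf_dist z u <= s.+1)%N -> (linf_dist u v <= M)%N ->
  (linf_dist z' v <= s)%N -> z = z'.
Proof.
move=> Zz Zz' zu uv zv; apply: contrapT => zz; have := sep Zz Zz' zz.
have t1 := linf_triangle u z z'; have t2 := linf_triangle v u z'.
rewrite (linf_distC v z') in t2; move: t1 t2 zu uv zv; clear; lia.
Qed.

(** Each detour runs on the sphere of radius [s.+1] from the last site before a ball to the first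
    site after the last visit to it. The parameter [a] counts initial steps known to be free: by
    separation, [M] steps are free after a detour, so every detour but the first is paid for by [M]
    steps of [p]. *)
Lemma reroute_from n : forall p x (a : nat), (size p <= n)%N -> path adj x p -> ~ hit x -> ~ hit (last x p) ->
  (a <= M)%N -> (forall v, v \in take a p -> ~ hit v) ->
  exists p' k, [/\ path_in (~` hit) x (last x p) p',
    forall v, v \in x :: p' -> exists2 v0, v0 \in x :: p & (linf_dist v v0 <= 2 * s + 2)%N,
    (size p' <= size p + k * (6 * d * s.+1))%N & (k * M + a <= size p + M)%N].
Proof.
elim: n => [|n IH] p x a sp pp nx ny aM na.
  have -> : p = [::] by apply/eqP; rewrite -size_eq0 -leqn0.
  exists [::], 0%N; split=> //=; first by split=> // z; rewrite inE => /eqP ->.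
  by move=> v vx; exists v; rewrite ?linf_dist0.
have [hp|hp] := boolP (has (fun v => `[< hit v >]) p); last first.
  exists p, 0%N; split=> //; last 2 first.
  - by rewrite mul0n addn0.
  - by rewrite mul0n add0n; move: aM; clear; lia.
  - split=> // v; rewrite inE => /predU1P[->//|vp] hv; move/negP: hp; apply; apply/hasP.
    by exists v => //; apply/asboolP.
  - by move=> v vx; exists v; rewrite ?linf_dist0.
have [p1 [v [p2 [ep /asboolP[z Zz zv] n1]]]] := split_first hp.
have n1' w : w \in p1 -> ~ hit w.
  by move=> wp hw; move/negP: n1; apply; apply/hasP; exists w => //; apply/asboolP.
have ap1 : (a <= size p1)%N.
  rewrite leqNgt; apply/negP => h; apply: (na v); last by exists z.
  rewrite ep -cat_rcons take_cat size_rcons ltnNge h /= mem_cat mem_rcons inE eqxx.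
  by [].
move: pp ny sp; rewrite ep cat_path last_cat size_cat /= => /and3P[pp1 adv pp2] ny sp.
set u := last x p1 in adv *.
have zu : linf_dist z u = s.+1.
  have : ~ (linf_dist z u <= s)%N.
    move=> h; have hu : hit u by exists z.
    by have := mem_last x p1; rewrite inE -/u => /predU1P[e|/n1']; [apply: nx; rewrite -e|].
  have := linf_triangle v z u; have := adj_linf adv; rewrite (linf_distC v u).
  by move: zv; clear; lia.
have hz : has (fun w => (linf_dist z w <= s)%N) (v :: p2) by rewrite /= zv.
(* Cutting at the last visit rather than at the first exit ensures that this ball is not met
   again. *)
have [q1 [v' [q2 [eq zv' nq2]]]] := split_last hz.
have lq : last v p2 = last v' q2.
  by have := congr1 (last v) eq; rewrite last_cat.
have aq : path adj v' q2.
  have : path adj u (v :: p2) by rewrite /= adv.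
  by rewrite eq cat_path /= => /and3P[].
have sq : (size q2 <= size p2)%N by have := congr1 size eq; rewrite size_cat /=; clear; lia.
case: q2 eq nq2 lq aq sq => [|u' q3] eq nq2 lq aq sq.
  by exfalso; apply: ny; rewrite lq; exists z.
rewrite /= negb_or -ltnNge in nq2; case/andP: nq2 => su' nq3.
case/andP: aq => vu' aq3.
have zu' : linf_dist z u' = s.+1.
  have := linf_triangle v' z u'; have := adj_linf vu'; move: zv' su'; clear; lia.
have nu' : ~ hit u'.
  move=> [z' Zz' h]; have := hit_same Zz Zz' _ (_ : (linf_dist u' u' <= M)%N) h.
  rewrite zu' linf_dist0 leqnn => /(_ erefl erefl) e; move: h; rewrite -e zu'; clear; lia.
have [||||q' [k [hq1 hq2 hq3 hq4]]] := IH q3 u' M _ aq3 nu'.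
- by move: sq sp; rewrite /=; clear; lia.
- by rewrite -[last u' q3]/(last v' (u' :: q3)) -lq.
- by [].
- move=> w wq [z' Zz' h].
  have uw : (linf_dist u' w <= M)%N.
    have tp : path adj u' (take M q3) by exact: take_path.
    by apply: leq_trans (linf_shift_path tp wq) _; rewrite size_take; case: ltnP.
  have e := hit_same Zz Zz' (_ : (linf_dist z u' <= s.+1)%N) uw h.
  rewrite zu' leqnn in e; have {}e := e erefl.
  move/hasP: nq3; apply; exists w; first exact: mem_take wq.
  by rewrite e.
have [r hr sr] := sphere_path d1 (ltn0Sn s) zu zu'.
have lp : last v p2 = last u' q3 by rewrite lq.
have sph w : linf_dist z w = s.+1 -> ~ hit w.
  move=> zw [z' Zz' h].
  have e := hit_same Zz Zz' (_ : (linf_dist z w <= s.+1)%N) (_ : (linf_dist w w <= M)%N) h.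
  rewrite zw linf_dist0 leqnn in e; have {}e := e erefl erefl; move: h; rewrite -e zw; clear; lia.
exists (p1 ++ r ++ q'), k.+1; split.
- rewrite /= lp; apply: (path_in_cat (y := u)).
    by split=> // w; rewrite inE => /predU1P[->//|/n1'].
  by apply: path_in_cat hq1; apply: path_in_sub hr => w; exact: sph.
- move=> w; rewrite mem_cons_cat => /orP[wp|].
    exists w; last by rewrite linf_dist0.
    by rewrite mem_cons_cat wp.
  rewrite mem_cat => /orP[wr|wq].
    exists u; first by rewrite mem_cons_cat mem_last.
    have [_ _ /(_ w)] := hr; rewrite inE wr orbT => /(_ erefl) /= zw.
    have := linf_triangle z w u; rewrite (linf_distC w z) zw zu; clear; lia.
  have [|w0 w0q h] := hq2 w; first by rewrite inE wq orbT.
  exists w0 => //; rewrite mem_cons_cat; apply/orP; right.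
  by rewrite eq mem_cat in_cons w0q !orbT.
- rewrite !size_cat /= mulSn; move: sr hq3 sq; rewrite /=; move: (6 * d * s.+1)%N => E.
  by move: (k * E)%N => kE; clear; lia.
- rewrite mulSn; move: hq4 ap1 sq; rewrite /=; move: (k * M)%N; clear; lia.
Qed.

Lemma reroute p x : path adj x p -> ~ hit x -> ~ hit (last x p) ->
  exists p' k, [/\ path_in (~` hit) x (last x p) p',
    forall v, v \in x :: p' -> exists2 v0, v0 \in x :: p & (linf_dist v v0 <= 2 * s + 2)%N,
    (size p' <= size p + k * (6 * d * s.+1))%N & (k * M <= size p + M)%N].
Proof.
move=> pp nx ny; have [|p' [k [h1 h2 h3 h4]]] := @reroute_from _ p x 0 (leqnn _) pp nx ny (leq0n _).
  by move=> v; rewrite take0.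
by exists p', k; split=> //; rewrite addn0 in h4.
Qed.

End Reroute.
End Paths.

(** * Sparse obstacles on several scales *)

Section Levels.
Context {d : nat}.
Implicit Types (x y z u v : Zd d).
Variables (Zs : nat -> set (Zd d)) (L : nat -> nat) (T n : nat).
Hypothesis d1 : (1 < d)%N.
Hypothesis T0 : (0 < T)%N.
Hypothesis L0 : L 0 = 1%N.
Hypothesis grow : forall k, (96 * d * T * 2 ^ k * L k <= L k.+1)%N.
Hypothesis sepL : forall k z z', (k < n)%N -> Zs k z -> Zs k z' -> z <> z' ->
  (L k.+1 <= linf_dist z z')%N.

(* The obstacles of level k are balls of radius T * L k about points of Zs k, which
   are L k.+1 apart: each level is sparse compared with its own size. *)
Definition cored k := hit (Zs k) (T * L k).

Definition outer : set (Zd d) := [set v | forall k, (k < n)%N -> ~ cored k v].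

Lemma grow1 k : (192 * (T * L k) <= L k.+1)%N.
Proof.
apply: leq_trans (grow k); rewrite mulnA leq_mul2r; apply/orP; right.
have h : (2 * 1 <= d * 2 ^ k)%N by apply: leq_mul => //; rewrite expn_gt0.
have : (2 * 1 * T <= d * 2 ^ k * T)%N by rewrite leq_mul2r h orbT.
by move: (2 ^ k)%N => q; clear; nia.
Qed.

Lemma L_gt0 k : (0 < L k)%N.
Proof. by elim: k => [|k IH]; [rewrite L0|apply: leq_trans (grow1 k); rewrite !muln_gt0 T0 IH]. Qed.

Lemma LT_ge k : (L k <= T * L k)%N. Proof. exact: leq_pmull. Qed.

Lemma grow2 k : (192 * L k <= L k.+1)%N.
Proof. by apply: leq_trans (grow1 k); rewrite leq_mul2l LT_ge. Qed.

Lemma L_mono k m : (k <= m)%N -> (L k <= L m)%N.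
Proof.
move=> /subnK <-; elim: (m - k)%N => // i IH; apply: leq_trans IH _; rewrite addSn.
by apply: leq_trans (grow2 _); rewrite leq_pmull.
Qed.

Lemma sum_L k : (8 * \sum_(0 <= i < k) L i <= L k)%N.
Proof.
elim: k => [|k IH]; first by rewrite big_geq.
by rewrite big_nat_recr//=; have := grow2 k; move: IH; clear; lia.
Qed.

(** Induction on the number of levels. Before the first ball of the top level and after the last
    visit to it, the path sees only lower levels and moves little. It cannot reach a second ball of
    the top level, since these are too far apart; the total is a small multiple of the radius of one
    ball, below the next scale. *)
Lemma cored_diam m : (m <= n)%N -> forall p x, path adj x p ->
  (forall v, v \in x :: p -> exists2 k, (k < m)%N & cored k v) ->
  (linf_dist x (last x p) <= L m)%N.
Proof.
elim: m => [|m IH] mn p x pp hU; first by have [] := hU x (mem_head _ _).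
have {}IH := IH (ltnW mn).
have lower q u : path adj u q -> (forall v, v \in u :: q -> v \in x :: p) ->
    (forall v, v \in u :: q -> ~ cored m v) -> (linf_dist u (last u q) <= L m)%N.
  move=> pq sub nm; apply: IH => // v vq; have [k] := hU v (sub v vq).
  rewrite ltnS leq_eqVlt => /predU1P[->|km]; first by move/(nm v vq).
  by exists k.
have lower1 q u v r : path adj u (q ++ v :: r) -> (forall w, w \in q -> w \in x :: p) ->
    (forall w, w \in q -> ~ cored m w) -> (linf_dist u v <= L m + 2)%N.
  case: q => [|a q] /=; first by move=> /andP[/adj_linf h _] _ _; move: h; clear; lia.
  rewrite cat_path /= => /and3P[ua pq /andP[lv _]] sub nm.
  have h := lower _ _ pq sub nm; have t1 := linf_triangle a u v; have t2 := linf_triangle (last a q) a v.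
  by have := adj_linf ua; have := adj_linf lv; move: h t1 t2; clear; lia.
have g := grow1 m; have gT := LT_ge m; have Lm := L_gt0 m.
have [hm|hm] := boolP (has (fun v => `[< cored m v >]) (x :: p)); last first.
  apply: leq_trans (_ : L m <= _)%N; last exact: L_mono.
  apply: lower => // v vp cv; move/hasP: hm; apply; exists v => //; exact/asboolP.
have [p1 [v [p2 [ep /asboolP[z Zz zv] n1]]]] := split_first hm.
have n1' w : w \in p1 -> ~ cored m w.
  by move=> wp hw; move/hasP: n1; apply; exists w => //; apply/asboolP.
have sub1 w : w \in p1 -> w \in x :: p by move=> h; rewrite ep mem_cat h.
have xv : (linf_dist x v <= L m + 2)%N.
  case: p1 ep n1 n1' sub1 => [|a p1] /= ep n1 n1' sub1.
    by case: ep => <- _; rewrite linf_dist0.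
  case: ep => e1 e2; rewrite e2 in pp; apply: (lower1 p1 x v p2 pp) => w wp.
    by have := sub1 w; rewrite inE wp orbT => /(_ erefl).
  by apply: n1'; rewrite inE wp orbT.
have pv2 : path adj v p2.
  by case: p1 ep {n1 n1' sub1} => [[<- <-]//|a p1 [_ e]]; move: pp; rewrite e cat_path /= => /and3P[].
have lv : last x p = last v p2.
  by have := congr1 (last x) ep; rewrite last_cat.
have sub2 w : w \in v :: p2 -> w \in x :: p by move=> h; rewrite ep mem_cat h orbT.
have hz : has (fun w => (linf_dist z w <= T * L m)%N) (v :: p2) by rewrite /= zv.
have [q1 [v' [q2 [eq zv' nq2]]]] := split_last hz.
have lq : last v p2 = last v' q2 by have := congr1 (last v) eq; rewrite last_cat.
have pv' : path adj v' q2.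
  by case: q1 eq => [[<- <-]//|a q1 [_ e]]; move: pv2; rewrite e cat_path /= => /and3P[].
have sub3 w : w \in q2 -> w \in x :: p.
  by move=> h; apply: sub2; rewrite eq mem_cat inE h !orbT.
have nq w : w \in q2 -> ~ cored m w.
  move=> wq cw.
  have hq : has (fun v => `[< cored m v >]) q2 by apply/hasP; exists w => //; exact/asboolP.
  have [r1 [v1 [r2 [er /asboolP[z' Zz' zv1] nr1]]]] := split_first hq.
  have zz : z <> z'.
    move=> e; move/hasP: nq2; apply; exists v1; first by rewrite er mem_cat mem_head orbT.
    by rewrite e.
  have := sepL mn Zz Zz' zz.
  have vv : (linf_dist v' v1 <= L m + 2)%N.
    apply: (lower1 r1 _ _ r2); first by rewrite -er.
      by move=> u ur; apply: sub3; rewrite er mem_cat ur.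
    by move=> u ur cu; move/hasP: nr1; apply; exists u => //; exact/asboolP.
  have t1 := linf_triangle v' z z'; have t2 := linf_triangle v1 v' z'.
  rewrite (linf_distC v1 z') in t2.
  by move: vv zv' zv1 t1 t2 g gT Lm; clear; lia.
have vl : (linf_dist v' (last v' q2) <= L m + 2)%N.
  case: q2 pv' nq sub3 {nq2 lq eq} => [|a q2]; first by rewrite /= linf_dist0.
  rewrite /= => /andP[va pa] nq sub3; have h := lower _ _ pa sub3 nq.
  apply: leq_trans (linf_triangle a v' _) _; rewrite addnC; apply: leq_add; first exact: h.
  exact: leq_trans (adj_linf va) _.
rewrite lv lq; have t1 := linf_triangle v x (last v' q2); have t2 := linf_triangle v' v (last v' q2).
have t3 := linf_triangle z v v'; rewrite (linf_distC v z) in t3.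
by move: xv zv zv' vl t1 t2 t3 g gT Lm; clear; lia.
Qed.

(** The sites of the path before its first outer one all lie in obstacles, so [cored_diam] keeps
    them within [L n] of the start. *)
Lemma escape_outer x p : path adj x p -> (L n < linf_dist x (last x p))%N ->
  exists p1 p2, [/\ p = p1 ++ p2, outer (last x p1) &
    forall v, v \in x :: p1 -> (linf_dist x v <= (L n).+1)%N].
Proof.
move=> pp far.
have ho : has (fun v => `[< outer v >]) (x :: p).
  apply/negP => /negP/hasPn h; move: far; rewrite ltnNge => /negP; apply; apply: cored_diam => // v vp.
  have /asboolPn := h v vp; rewrite /outer /= => /existsNP[k /not_implyP[kn /contrapT ck]].
  by exists k.
have [p1 [v [p2 [ep /asboolP ov n1]]]] := split_first ho.
have n1' w : w \in p1 -> exists2 k, (k < n)%N & cored k w.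
  move=> wp; apply: contrapT => hw; move/hasP: n1; apply; exists w => //; apply/asboolP.
  by move=> k kn ck; apply: hw; exists k.
case: p1 ep n1 n1' => [|a p1] [ex ep] n1 n1'.
  exists [::], p; rewrite /= ex; split=> // w; rewrite inE => /eqP ->.
  by rewrite linf_dist0.
move: n1'; rewrite -ex => n1'; exists (rcons p1 v), p2; rewrite cat_rcons last_rcons; split=> // w.
have pp1 : path adj x (rcons p1 v) by move: pp; rewrite ep -cat_rcons cat_path => /andP[].
have h1 w' : w' \in x :: p1 -> (linf_dist x w' <= L n)%N.
  move=> wp; move: pp1 n1'; case: (splitPl wp) => q1 q2 <- pp1 n1'.
  apply: cored_diam => //; first by move: pp1; rewrite rcons_cat cat_path => /andP[].
  by move=> u uq; apply: n1'; rewrite mem_cons_cat uq.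
rewrite -rcons_cons mem_rcons inE => /predU1P[->|/h1 h]; last exact: leq_trans h _.
apply: leq_trans (linf_triangle (last x p1) x v) _.
move: pp1; rewrite rcons_path => /andP[_ /adj_linf a1].
by apply: leq_trans (leq_add (h1 _ (mem_last x p1)) a1) _; rewrite addn1.
Qed.

Lemma near_outer x : exists2 y, outer y & (linf_dist x y <= (L n).+1)%N.
Proof.
have i0 : 'I_d by exact: (Ordinal d1).
pose y := set_coord x i0 (x 0 i0 + (L n).+1%:Z).
have xy : linf_dist x y = (L n).+1.
  apply/eqP; rewrite eqn_leq; apply/andP; split.
    apply/linf_leP => j; rewrite set_coordE; case: eqP => [->|_]; move: (x 0 _) => a; clear; lia.
  by apply: leq_trans (linf_coord _ _ i0); rewrite set_coordE eqxx; move: (x 0 _) => a; clear; lia.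
have [p [h1 h2 h3 _]] := mono_path x y.
have [|p1 [p2 [_ o h]]] := escape_outer h1; first by rewrite h2 xy.
by exists (last x p1) => //; apply: h; exact: mem_last.
Qed.

Let K := (12 * d * T)%N.

(** Levels are treated from the coarsest down, so that later detours are small compared with the
    clearance already gained: the clearance from level [j] loses only the displacements of the finer
    levels. The length bound, cleared of denominators, has factor 1 + 2^-k. *)
Lemma link_stage x y k : outer x -> outer y -> (k <= n)%N -> exists p,
  [/\ path adj x p, last x p = y,
   forall v j z, v \in x :: p -> (k <= j < n)%N -> Zs j z ->
     (T * L j < linf_dist z v + \sum_(k <= i < j) (2 * (T * L i) + 2))%N,
   forall v, v \in x :: p -> exists2 v0, between x y v0 &
     (linf_dist v v0 <= \sum_(k <= i < n) (2 * (T * L i) + 2))%N &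
   (size p * 2 ^ k <= (2 ^ k).+1 * (l1_dist x y + 2 * K * \sum_(k <= i < n) L i))%N].
Proof.
move=> ox oy kn; rewrite -(subKn kn); elim: (n - k)%N (leq_subr k n) => [|m IH] mn.
  have [p [h1 h2 h3 h4]] := mono_path x y; exists p; rewrite subn0; split=> //.
  - by move=> v j z _ /andP[h h']; move: (leq_ltn_trans h h'); rewrite ltnn.
  - by move=> v /h4 b; exists v; rewrite ?linf_dist0.
  - by rewrite h3 big_geq// muln0 addn0 mulnC leq_mul2r; apply/orP; right.
have [p [p1 p2 p3 p4 p5]] := IH (ltnW mn); clear IH.
have e : (n - m = (n - m.+1).+1)%N by move: mn; clear; lia.
set i := (n - m.+1)%N in e *; rewrite e in p3 p4 p5.
have i_n : (i < n)%N by rewrite /i; move: mn; clear; lia.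
have sum_r (f : nat -> nat) j : (i < j)%N -> (\sum_(i <= a < j) f a = f i + \sum_(i.+1 <= a < j) f a)%N.
  by move=> ij; rewrite big_ltn.
have g := grow1 i; have gT := LT_ge i; have Li := L_gt0 i.
(* Length of path guaranteed free between two obstacles of level [i]. *)
pose M := (L i.+1 - 2 * (T * L i) - 3)%N.
have sep z z' : Zs i z -> Zs i z' -> z <> z' -> (2 * (T * L i) + M + 3 <= linf_dist z z')%N.
  move=> Zz Zz' zz; apply: leq_trans (sepL i_n Zz Zz' zz).
  by rewrite /M; move: g gT Li; clear; lia.
have [||q [N [q1 q2 q3 q4]]] := reroute d1 sep p1.
- exact: ox.
- by rewrite p2; exact: oy.
rewrite p2 in q1; have [r1 r2 r3] := q1.
exists q; split=> //.
- move=> v j z vq /andP[]; rewrite leq_eqVlt => /predU1P[<-|ij] jn Zz.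
    rewrite big_geq// addn0 ltnNge; apply/negP => h.
    by apply: (r3 v vq); exists z.
  have [v0 v0p v0v] := q2 v vq.
  have := p3 v0 j z v0p; rewrite ij jn => /(_ erefl Zz).
  rewrite sum_r//; have := linf_triangle v z v0.
  by move: v0v; clear; move: (\sum_(_ <= _ < _) _)%N => s; lia.
- move=> v vq; have [v0 v0p v0v] := q2 v vq; have [v1 v1b v1v] := p4 v0 v0p.
  exists v1 => //; rewrite sum_r//; have := linf_triangle v0 v v1.
  by move: v0v v1v; clear; move: (\sum_(_ <= _ < _) _)%N => s; lia.
- rewrite sum_r//; move: p5 q3 q4; rewrite expnS; set S := (\sum_(_ <= _ < _) _)%N.
  have gi := grow i; have q0 : (0 < 2 ^ i)%N by rewrite expn_gt0.
  have KE : (6 * d * (T * L i).+1 <= K * L i)%N.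
    by rewrite /K; move: gT Li; clear; nia.
  have KL : (8 * (K * L i) * 2 ^ i <= L i.+1)%N by apply: leq_trans gi; rewrite /K; clear; nia.
  have ML : (L i.+1 <= 2 * M)%N by rewrite /M; move: g gT Li; clear; lia.
  move=> p5 q3 q4.
  set A := (l1_dist x y + 2 * K * S)%N in p5.
  have -> : (l1_dist x y + 2 * K * (L i + S) = A + 2 * (K * L i))%N by rewrite /A; clear; lia.
  have q3' : (size q <= size p + N * (K * L i))%N.
    by apply: leq_trans q3 _; rewrite leq_add2l leq_mul2l KE orbT.
  move: p5 q3' q4 KL ML q0; move: (K * L i)%N (2 ^ i)%N (L i.+1) (size p) (size q) => E Q L' sp sq.
  clear; move=> p5 q3 q4 KL ML Q0.
  (* Up to the additive [2 * E], the detours multiply the length by at most 1 + 1/(4Q), and (1 +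
     1/(2Q)) (1 + 1/(4Q)) <= 1 + 1/Q. *)
  have h1 : (4 * (N * E) * Q <= sp + 8 * E * Q)%N.
    case: N q4 {q3} => [|k] q4; first by clear; lia.
    have kM : (k * M <= sp)%N by move: q4; rewrite mulSn; move: (k * M)%N; clear; lia.
    have : (k * (8 * E * Q) <= k * (2 * M))%N by rewrite leq_mul2l (leq_trans KL ML) orbT.
    by move: kM; clear; nia.
  have h2 : (sp * (4 * Q + 1) <= 4 * (Q + 1) * A)%N.
    rewrite -(@leq_pmul2l (2 * Q)) ?muln_gt0//; nia.
  have h3 : (4 * ((sp + N * E) * Q) <= 4 * ((Q + 1) * (A + 2 * E)))%N by move: h1 h2; clear; nia.
  rewrite -addn1; apply: leq_trans (_ : (sp + N * E) * Q <= _)%N; first by rewrite leq_mul2r q3 orbT.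
  by rewrite -(@leq_pmul2l 4).
Qed.

(** At level 0 the length factor is 2, and the displacements caused by levels below [k] add up to at
    most half of [T * L k], which leaves the other half as clearance. *)
Lemma link_outer x y : outer x -> outer y -> exists p,
  [/\ path_in [set v | forall k z, (k < n)%N -> Zs k z -> (T * L k < 2 * linf_dist z v)%N] x y p,
   (size p <= 2 * l1_dist x y + 4 * K * L n)%N &
   forall v, v \in x :: p -> exists2 v0, between x y v0 & (linf_dist v v0 <= T * L n)%N].
Proof.
move=> ox oy; have [p [p1 p2 p3 p4 p5]] := link_stage ox oy (leq0n n).
have sumT k : (2 * \sum_(0 <= i < k) (2 * (T * L i) + 2) <= T * L k)%N.
  apply: leq_trans (_ : T * (8 * \sum_(0 <= i < k) L i) <= _)%N; last by rewrite leq_mul2l sum_L orbT.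
  rewrite !big_distrr /=; apply: leq_sum => i _.
  by have := LT_ge i; have := L_gt0 i; move: (L i) => l; clear; nia.
exists p; split.
- split=> // v vp k z kn Zz; have := p3 v k z vp; rewrite leq0n kn => /(_ erefl Zz).
  by have := sumT k; move: (\sum_(_ <= _ < _) _)%N => s; clear; lia.
- move: p5; rewrite expn0 muln1 => h; apply: leq_trans h _.
  by have := sum_L n; move: (\sum_(_ <= _ < _) _)%N => s; clear; nia.
- move=> v vp; have [v0 b h] := p4 v vp; exists v0 => //; apply: leq_trans h _.
  by have := sumT n; move: (\sum_(_ <= _ < _) _)%N => s; clear; lia.
Qed.

End Levels.

Lemma rem_bound0 (a b : int) (l : nat) : 0 <= a - b < l%:Z -> (`|(0 - (a - b))%R| <= 2 * l)%N.
Proof. lia. Qed.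

Lemma rem_bound1 (a a' b : int) (l : nat) : 0 <= a - b < l%:Z -> (`|(a - a')%R| < l)%N ->
  (`|(0 - (a' - b))%R| <= 2 * l)%N.
Proof. lia. Qed.

Lemma rem_bound2 (a b : int) (l : nat) : 0 <= a - b < l%:Z -> (`|(b - a)%R| <= l)%N.
Proof. lia. Qed.

(** * The hierarchy of closed sites *)

Section Hierarchy.
Context {d : nat}.
Implicit Types (x y z u v w c : Zd d) (X : set (Zd d)).

(** The factor 2^k makes the relative costs of the levels summable, and 2^(d + 12) >= 96 * 36 * d
    supplies the constant of [scale_grow], where 36 is the radius factor [T] of
    [no_tree_linking]. *)
Definition ell k : nat := 2 ^ (k + (d + 12)).
Definition scale k : nat := \prod_(0 <= i < k) ell i.

Lemma scale0 : scale 0 = 1%N. Proof. by rewrite /scale big_geq. Qed.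

Lemma scaleS k : scale k.+1 = (ell k * scale k)%N.
Proof. by rewrite /scale big_nat_recr//= mulnC. Qed.

Lemma ell_grow k : (96 * d * 36 * 2 ^ k <= ell k)%N.
Proof.
rewrite /ell expnD mulnC leq_mul2l; apply/orP; right.
rewrite expnD mulnC mulnA [leqRHS]mulnC; apply: leq_mul; first by [].
by apply: ltnW; exact: ltn_expl.
Qed.

Lemma scale_grow k : (96 * d * 36 * 2 ^ k * scale k <= scale k.+1)%N.
Proof. by rewrite scaleS leq_mul2r ell_grow orbT. Qed.

Lemma ell_ge k : (64 <= ell k)%N.
Proof. by rewrite /ell (_ : 64 = 2 ^ 6)%N// leq_exp2l// addnA; lia. Qed.

Lemma scale_gt0 k : (0 < scale k)%N.
Proof. by elim: k => [|k IH]; rewrite ?scale0// scaleS muln_gt0 IH expn_gt0. Qed.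

Lemma scale_ge16 k : (16 ^ k <= scale k)%N.
Proof.
elim: k => [|k IH]; first by rewrite scale0.
rewrite scaleS expnS; apply: leq_mul => //; apply: leq_trans (ell_ge k); by [].
Qed.

Lemma linf_mulrn x y n : linf_dist (x *+ n) (y *+ n) = (linf_dist x y * n)%N.
Proof.
apply/eqP; rewrite eqn_leq; apply/andP; split.
  apply/linf_leP => i; rewrite !mulmxnE -mulrnBl -mulr_natr abszM natz leq_mul2r.
  by rewrite linf_coord orbT.
case: n => [|n]; first by rewrite muln0.
have : (linf_dist x y <= linf_dist (x *+ n.+1) (y *+ n.+1) %/ n.+1)%N.
  apply/linf_leP => i; rewrite leq_divRL//; apply: leq_trans (linf_coord _ _ i).
  by rewrite !mulmxnE -mulrnBl -[X in (_ <= `|X|)%N]mulr_natr abszM natz.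
by rewrite leq_divRL.
Qed.

(* [hb X k w]: at scale [k] the box of [w] contains a binary tree of [2 ^ k]
   well separated points of [X] *)
Fixpoint hb X k : set (Zd d) :=
  if k is k'.+1 then
    [set w | exists v1 v2, [/\ (linf_dist 0 v1 <= 2 * ell k')%N, (linf_dist 0 v2 <= 2 * ell k')%N,
      (16 <= linf_dist v1 v2)%N, hb X k' (w *+ ell k' + v1) & hb X k' (w *+ ell k' + v2)]]
  else X.

Section Sparse.
Variables (X : set (Zd d)) (n : nat).
Hypothesis hbn : forall w, ~ hb X n w.

Definition floorz (l : nat) w : Zd d := \row_i (w 0%R i %/ l%:Z)%Z.

Lemma floorz_coord l w i : (0 < l)%N -> (0 <= w 0 i - floorz l w 0 i *+ l < l%:Z)%R.
Proof.
move=> l0; rewrite mxE; move: (w 0 i) => a.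
have := divz_eq a l%:Z; have := ltz_pmod a (_ : 0 < l%:Z); have := modz_ge0 a (_ : l%:Z != 0).
rewrite -mulr_natr natz; move: (a %/ _)%Z (a %% _)%Z => q r.
have -> : (l%:Z != 0) by rewrite eqz_nat -lt0n.
by rewrite ltz_nat l0 => /(_ erefl) h1 /(_ erefl) h2 h3; rewrite h3 addrAC subrr add0r h1.
Qed.

(* A seed of level k is a box that carries a tree of depth k although the box of
   level k.+1 around it carries none, so all seeds near it are within distance 16. *)
Definition isolated_seed k : set (Zd d) := [set w | hb X k w /\ ~ hb X k.+1 (floorz (ell k) w)].

Lemma isolated_sep k w w' : isolated_seed k w -> isolated_seed k w' -> (linf_dist w w' < ell k)%N ->
  (linf_dist w w' < 16)%N.
Proof.
move=> [hw nw] [hw' _] close; rewrite ltnNge; apply/negP => far; apply: nw.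
have l0 : (0 < ell k)%N by rewrite expn_gt0.
(* [w'] may lie in a block adjacent to that of [w]; the offset bound [2 * ell k] in [hb]
   accommodates it. *)
pose q := floorz (ell k) w; exists (w - q *+ ell k), (w' - q *+ ell k).
rewrite ![_ + (_ - _)]addrC !subrK; split=> //.
- apply/linf_leP => i; have h := floorz_coord w i l0; rewrite !mxE mulmxnE.
  exact: rem_bound0 h.
- apply/linf_leP => i; have h := floorz_coord w i l0; rewrite !mxE mulmxnE.
  exact: rem_bound1 h (leq_ltn_trans (linf_coord w w' i) close).
- by rewrite linf_distD.
Qed.

(** A common representative for all seeds of a cluster: [choose] returns the same element for
    equivalent predicates and starting points that satisfy them. Without it two seeds of one cluster
    would give distinct centers close to each other. *)
Definition rep k w : Zd d := choose (fun w' => `[< isolated_seed k w' /\ (linf_dist w w' < 16)%N >]) w.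

Lemma repP k w : isolated_seed k w -> isolated_seed k (rep k w) /\ (linf_dist w (rep k w) < 16)%N.
Proof.
move=> iw; apply/asboolP; apply: (@chooseP _ (fun w' => `[< isolated_seed k w' /\ (linf_dist w w' < 16)%N >])).
by apply/asboolP; rewrite linf_dist0.
Qed.

(** Being within 16 is transitive among seeds: two such distances add up to less than 32, below
    [ell k], and [isolated_sep] improves this to less than 16. *)
Lemma rep_eq k w w' : isolated_seed k w -> isolated_seed k w' -> (linf_dist w w' < 16)%N -> rep k w = rep k w'.
Proof.
move=> iw iw' ww'; have e64 := ell_ge k.
rewrite /rep; set P := fun _ => _; set P' := fun _ => _.
have PP' : P =1 P'.
  move=> u; apply/asboolP/asboolP => -[iu h]; split=> //.
    apply: (isolated_sep iw' iu); have := linf_triangle w w' u; rewrite (linf_distC w' w).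
    by move: ww' h e64; clear; lia.
  apply: (isolated_sep iw iu); have := linf_triangle w' w u; move: ww' h e64; clear; lia.
rewrite (eq_choose PP' w); apply: choose_id; last by apply/asboolP; rewrite linf_dist0.
by rewrite -PP'; apply/asboolP; rewrite linf_dist0.
Qed.

Definition center k : set (Zd d) := [set z | exists2 w, isolated_seed k w & z = rep k w *+ scale k].

Lemma center_sep k z z' : center k z -> center k z' -> z <> z' -> (scale k.+1 <= linf_dist z z')%N.
Proof.
move=> [w iw ->] [w' iw' ->] ne; rewrite linf_mulrn scaleS leq_mul2r; apply/orP; right.
have [i1 h1] := repP iw; have [i2 h2] := repP iw'.
rewrite leqNgt; apply/negP => close; apply: ne; congr (_ *+ _).
have h3 := isolated_sep i1 i2 close; have e64 := ell_ge k.
apply: rep_eq => //; apply: (isolated_sep iw iw').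
have := linf_triangle (rep k w) w w'; have := linf_triangle (rep k w') (rep k w) w'.
by rewrite (linf_distC (rep k w') w'); move: h1 h2 h3 e64; clear; lia.
Qed.

(** Otherwise the box of [x] would carry a tree at every level, climbing from 0 to [n] against
    [hbn]. The factor 18 is 2 for the rounding of [x] to its box plus 16 for the passage to the
    representative. *)
Lemma center_cover x : X x -> exists k z, [/\ (k < n)%N, center k z & (linf_dist z x <= 18 * scale k)%N].
Proof.
move=> Xx; apply: contrapT => nc.
have [w hw _] : exists2 w, hb X n w & (linf_dist (w *+ scale n) x <= 2 * scale n)%N.
  elim: {-2}n (leqnn n) => [|k IH] kn; first by exists x => //; rewrite scale0 mulr1n linf_dist0.
  have [w hw wx] := IH (ltnW kn).
  have l0 : (0 < ell k)%N by rewrite expn_gt0.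
  have s0 := scale_gt0 k.
  exists (floorz (ell k) w).
    apply: contrapT => nh; apply: nc; exists k, (rep k w *+ scale k).
    have iw : isolated_seed k w by [].
    have [i1 h1] := repP iw; split=> //; first by exists w.
    have := linf_triangle (w *+ scale k) (rep k w *+ scale k) x; rewrite linf_mulrn linf_distC.
    have : (linf_dist w (rep k w) * scale k <= 16 * scale k)%N by rewrite leq_mul2r ltnW ?orbT.
    by rewrite (linf_distC (rep k w)); move: wx; clear; lia.
  rewrite scaleS mulrnA.
  have := linf_triangle (w *+ scale k) (floorz (ell k) w *+ ell k *+ scale k) x.
  rewrite linf_mulrn => t; apply: leq_trans t _.
  have h : (linf_dist (floorz (ell k) w *+ ell k) w <= ell k)%N.
    apply/linf_leP => i; have := floorz_coord w i l0; rewrite mulmxnE.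
    exact: rem_bound2.
  have : (linf_dist (floorz (ell k) w *+ ell k) w * scale k <= ell k * scale k)%N by rewrite leq_mul2r h orbT.
  have : (64 * scale k <= ell k * scale k)%N by rewrite leq_mul2r ell_ge orbT.
  by move: wx; move: (ell k * scale k)%N (linf_dist _ _ * _)%N; clear; lia.
exact: hbn hw.
Qed.

End Sparse.

Definition children k w : seq (Zd d) := [seq w *+ ell k + v | v <- ball_seq 0 (2 * ell k)].

(** A finite enumeration of the possible leaf sets, free of [X], over which the union bound runs. *)
Fixpoint trees k w : seq (seq (Zd d)) :=
  if k is k'.+1 then
    flatten [seq flatten [seq [seq s1 ++ s2 | s1 <- trees k' c1, s2 <- trees k' c2]
                         | c2 <- [seq c2 <- children k' w | (16 <= linf_dist c1 c2)%N]]
            | c1 <- children k' w]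
  else [:: [:: w]].

Lemma treesSP k w s : s \in trees k.+1 w -> exists c1 c2 s1 s2,
  [/\ c1 \in children k w, c2 \in children k w, (16 <= linf_dist c1 c2)%N,
      s1 \in trees k c1 /\ s2 \in trees k c2 & s = s1 ++ s2].
Proof.
move=> /flatten_mapP[c1 c1c /flatten_mapP[c2]]; rewrite mem_filter => /andP[far c2c].
by move=> /allpairsP[[s1 s2] [/= t1 t2 ->]]; exists c1, c2, s1, s2.
Qed.

Lemma hb_tree X k w : hb X k w -> exists2 s, s \in trees k w & forall x, x \in s -> X x.
Proof.
elim: k w => [|k IH] w /=.
  by move=> Xw; exists [:: w]; rewrite ?mem_head// => x; rewrite inE => /eqP ->.
move=> [v1 [v2 [b1 b2 far h1 h2]]].
have [s1 t1 X1] := IH _ h1; have [s2 t2 X2] := IH _ h2.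
exists (s1 ++ s2); last by move=> x; rewrite mem_cat => /orP[/X1|/X2].
have mc v : (linf_dist 0 v <= 2 * ell k)%N -> w *+ ell k + v \in children k w.
  by move=> b; apply/mapP; exists v => //; rewrite mem_ball_seq.
apply/flatten_mapP; exists (w *+ ell k + v1); first exact: mc.
apply/flatten_mapP; exists (w *+ ell k + v2).
  rewrite mem_filter mc// andbT; apply: leq_trans far _; apply/linf_leP => i.
  apply: leq_trans _ (linf_coord _ _ i); rewrite !mxE.
  by move: ((w *+ _) 0 i) (v1 0 i) (v2 0 i) => a b c; clear; lia.
by apply/allpairsP; exists (s1, s2).
Qed.

Lemma tree_size k w s : s \in trees k w -> size s = (2 ^ k)%N.
Proof.
elim: k w s => [|k IH] w s; first by rewrite inE => /eqP ->.
move=> /treesSP[c1 [c2 [s1 [s2 [_ _ _ [/IH e1 /IH e2] ->]]]]].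
by rewrite size_cat e1 e2 expnS mul2n addnn.
Qed.

Lemma child_near k w c : c \in children k w -> (linf_dist (w *+ scale k.+1) (c *+ scale k) <= 2 * scale k.+1)%N.
Proof.
move=> /mapP[v]; rewrite mem_ball_seq => b ->.
rewrite scaleS mulrnA linf_mulrn mulnA leq_mul2r; apply/orP; right.
apply: leq_trans b; apply/linf_leP => i; apply: leq_trans _ (linf_coord _ _ i); rewrite !mxE.
by move: ((w *+ _) 0 i) (v 0 i) => a b; clear; lia.
Qed.

Lemma tree_near k w s x : s \in trees k w -> x \in s -> (linf_dist (w *+ scale k) x <= 3 * scale k)%N.
Proof.
elim: k w s => [|k IH] w s.
  by rewrite inE => /eqP ->; rewrite inE => /eqP ->; rewrite scale0 mulr1n linf_dist0.
have g : (3 * scale k <= scale k.+1)%N.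
  by rewrite scaleS leq_mul2r; apply/orP; right; apply: leq_trans (ell_ge k).
move=> /treesSP[c1 [c2 [s1 [s2 [h1 h2 _ [t1 t2] ->]]]]].
have key c t : c \in children k w -> t \in trees k c -> x \in t -> (linf_dist (w *+ scale k.+1) x <= 3 * scale k.+1)%N.
  move=> cc tc xt; have a := child_near cc; have b := IH _ _ tc xt.
  have := linf_triangle (c *+ scale k) (w *+ scale k.+1) x; move: a b g; clear; lia.
by rewrite mem_cat => /orP[h|h]; [exact: key h1 t1 h|exact: key h2 t2 h].
Qed.

Lemma leq_exp2r_any a b e : (a <= b)%N -> (a ^ e <= b ^ e)%N.
Proof. by case: e => [|e] h; rewrite ?expn0// leq_exp2r. Qed.

Lemma size_flatten_le (A B : eqType) (f : A -> seq B) (s : seq A) N :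
  (forall a : A, a \in s -> (size (f a) <= N)%N) -> (size (flatten (map f s)) <= size s * N)%N.
Proof.
elim: s => //= a s IH h; rewrite size_cat mulSn leq_add//; first by apply: h; exact: mem_head.
by apply: IH => y ys; apply: h; rewrite inE ys orbT.
Qed.

(* the factor [2 ^ (2 * d * (k + d + 16))] makes the recursive bound on the
   number of trees close up under squaring *)
Lemma size_trees k w :
  (size (trees k w) * 2 ^ (2 * d * (k + d + 16)) <= (2 ^ (2 * d * (d + 16))) ^ (2 ^ k))%N.
Proof.
elim: k w => [|k IH] w; first by rewrite add0n expn0 expn1 /= mul1n.
set a := (2 ^ (2 * d * (k + d + 16)))%N in IH.
set G := ((2 ^ _) ^ _)%N in IH; pose N := (G %/ a)%N.
have a0 : (0 < a)%N by rewrite expn_gt0.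
have IHN c : (size (trees k c) <= N)%N by rewrite leq_divRL.
have Na : (N * a <= G)%N by rewrite /N leq_divM.
have sc : (size (children k w) <= 2 ^ (d * (k + d + 15)))%N.
  rewrite size_map size_ball_seq [X in (_ <= 2 ^ X)%N]mulnC expnM.
  apply: leq_exp2r_any; rewrite /ell (_ : (k + d + 15 = (k + (d + 12)) + 3)%N); last by clear; lia.
  rewrite [in leqRHS]expnD; have : (0 < 2 ^ (k + (d + 12)))%N by rewrite expn_gt0.
  by move: (2 ^ (k + (d + 12)))%N => q; clear; lia.
have st : (size (trees k.+1 w) <= 2 ^ (d * (k + d + 15)) * (2 ^ (d * (k + d + 15)) * (N * N)))%N.
  apply: leq_trans (_ : size (children k w) * (2 ^ (d * (k + d + 15)) * (N * N)) <= _)%N; last first.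
    by rewrite leq_mul2r sc orbT.
  apply: size_flatten_le => c1 _.
  apply: leq_trans (_ : size (children k w) * (N * N) <= _)%N; last by rewrite leq_mul2r sc orbT.
  apply: leq_trans (_ : size [seq c2 <- children k w | (16 <= linf_dist c1 c2)%N] * (N * N) <= _)%N; last first.
    by rewrite leq_mul2r size_filter count_size orbT.
  by apply: size_flatten_le => c2 _; rewrite size_allpairs; apply: leq_mul; exact: IHN.
apply: leq_trans (_ : (N * a) * (N * a) <= _)%N; last first.
  have -> : ((2 ^ (2 * d * (d + 16))) ^ (2 ^ k.+1) = G * G)%N by rewrite /G -expnD addnn -mul2n -expnS.
  exact: leq_mul.
set b := (2 ^ (d * _))%N in st.
set e := (2 ^ _)%N.
have be : (b * b * e = a * a)%N.
  by rewrite /b /e /a -!expnD; congr (2 ^ _)%N; clear; lia.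
apply: leq_trans (_ : b * (b * (N * N)) * e <= _)%N; first by rewrite leq_mul2r st orbT.
have -> : (b * (b * (N * N)) * e = b * b * e * (N * N))%N by clear; lia.
by rewrite be; clear; lia.
Qed.

Lemma size_trees_le k w : (size (trees k w) <= (2 ^ (2 * d * (d + 16))) ^ (2 ^ k))%N.
Proof. by apply: leq_trans (size_trees k w); rewrite leq_pmulr// expn_gt0. Qed.

Section RowSum.
Variable R : realType.
Hypothesis d3 : (3 <= d)%N.
Local Notation gb := (@green_bound R d).

Lemma sqr_cancel (g x : R) m : x * m%:R = 1 -> g * (x * x) *+ m = g * x.
Proof. by move=> e; rewrite -[LHS]mulr_natr mulrA -mulrA e mulr1. Qed.

(** Leaves in the other half of a tree of depth [k.+1] are at distance at least [scale k >= 16 ^ k],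
    where the Green function is at most gb / 4^k. The 2^k of them contribute at most gb / 2^k, and
    these contributions form a geometric series. *)
Lemma tree_row_sum k w s y : s \in trees k w -> y \in s ->
  \sum_(z <- s) greenR y z <= gb * (3 - 2 * (2 ^ k)%:R^-1).
Proof.
have gb0 : 0 <= gb by exact: green_bound_ge0.
elim: k w s => [|k IH] w s.
  rewrite inE => /eqP ->; rewrite inE => /eqP ->; rewrite big_seq1 expn0 invr1 mulr1.
  rewrite (_ : 3 - 2 = 1); last by lra.
  by rewrite mulr1 greenR_le_max.
move=> /treesSP[c1 [c2 [s1 [s2 [h1 h2 far [t1 t2] ->]]]]].
have key a b ta tb : (16 <= linf_dist a b)%N -> ta \in trees k a -> tb \in trees k b -> y \in ta ->
    \sum_(z <- ta) greenR y z + \sum_(z <- tb) greenR y z <= gb * (3 - 2 * (2 ^ k.+1)%:R^-1).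
  move=> ab ha hb' ya; have i1 := IH _ _ ha ya.
  have p2 : 0 < (2 ^ k)%:R :> R by rewrite ltr0n expn_gt0.
  have bd z : z \in tb -> greenR y z <= gb * ((2 ^ k)%:R^-1 * (2 ^ k)%:R^-1).
    move=> zb; have n1 := tree_near ha ya; have n2 := tree_near hb' zb.
    have s0 := scale_gt0 k.
    have far' : (scale k <= linf_dist y z)%N.
      have := linf_triangle y (a *+ scale k) (b *+ scale k).
      have := linf_triangle z y (b *+ scale k); rewrite (linf_distC z) linf_mulrn.
      have : (16 * scale k <= linf_dist a b * scale k)%N by rewrite leq_mul2r ab orbT.
      by move: n1 n2; clear; lia.
    apply: le_trans (greenR_le_linf d3 s0 far') _; rewrite ler_wpM2l// -invfM lef_pV2 ?posrE ?mulr_gt0// ?sqrtr_gt0 ?ltr0n//.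
    have q0 : 0 <= (2 ^ k)%:R * (2 ^ k)%:R :> R by rewrite mulr_ge0// ltW.
    rewrite -(ger0_norm q0) -sqrtr_sqr ler_sqrt ?ler0n// -natrM -natrX ler_nat.
    by apply: leq_trans (scale_ge16 k); rewrite -expnMn -expnM mulnC expnM leqnn.
  have i2 : \sum_(z <- tb) greenR y z <= gb * (2 ^ k)%:R^-1.
    apply: le_trans (_ : \sum_(z <- tb) gb * ((2 ^ k)%:R^-1 * (2 ^ k)%:R^-1) <= _).
      by rewrite big_seq [leRHS]big_seq; apply: ler_sum => z; exact: bd.
    rewrite big_const_seq count_predT iter_addr_0 (tree_size hb').
    by rewrite sqr_cancel// mulVf// gt_eqF.
  apply: le_trans (lerD i1 i2) _; rewrite -mulrDr ler_wpM2l//.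
  rewrite expnS natrM invfM; lra.
rewrite big_cat mem_cat /= => /orP[y1|y2]; first exact: key far t1 t2 y1.
by rewrite addrC; apply: (key c2 c1) => //; rewrite linf_distC.
Qed.

End RowSum.

End Hierarchy.

(** * Linking in the absence of closed trees *)

Section Linking.
Context {d : nat}.
Hypothesis d1 : (1 < d)%N.
Implicit Types (x y z u v : Zd d) (S : set (Zd d)).

Definition esc (w : nat) S x : Prop := exists2 z, connected_in S x z & (w <= linf_dist x z)%N.

Definition near_hull (r : nat) x y v : Prop := exists2 v0, between x y v0 & (linf_dist v v0 <= r)%N.

Definition linking (N w : nat) S : Prop :=
  (forall x, (linf_dist 0 x <= 2 * N)%N -> exists2 y, esc w S y & (linf_dist x y <= w)%N) /\
  (forall x y, (linf_dist 0 x <= 2 * N)%N -> (linf_dist 0 y <= 2 * N)%N -> esc w S x -> esc w S y ->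
     exists p, [/\ path_in S x y p, (size p <= 4 * l1_dist x y + w)%N &
       forall v, v \in x :: p -> near_hull w x y v]).

(** Collects the costs of a link in units of L^d: [2 * 5 ^ d] for the two end pieces, at most
    [1736 * d] for the displacement of the end points and the detours, and 40 to dominate
    displacements from the hull and margins. *)
Definition width_const : nat := (2 * 5 ^ d + 1800 * d + 40)%N.
Definition width n : nat := (width_const * @scale d n ^ d)%N.

Lemma clampP (a b a' b' c : int) (r : nat) : (`|(a - a')%R| <= r)%N -> (`|(b - b')%R| <= r)%N ->
  ((a' <= c <= b') || (b' <= c <= a')) ->
  exists e : int, ((a <= e <= b) || (b <= e <= a)) && (`|(c - e)%R| <= r)%N.
Proof.
move=> h1 h2 h3; exists (Num.max (Num.min a b) (Num.min c (Num.max a b))).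
lia.
Qed.

Lemma between_near x y x' y' v r : (linf_dist x x' <= r)%N -> (linf_dist y y' <= r)%N -> between x' y' v ->
  exists2 v0, between x y v0 & (linf_dist v v0 <= r)%N.
Proof.
move=> xx yy b; have [f hf] := choice (fun i => clampP (leq_trans (linf_coord x x' i) xx)
  (leq_trans (linf_coord y y' i) yy) (b i)).
exists (\row_i f i) => [i|]; first by rewrite mxE; have /andP[] := hf i.
by apply/linf_leP => i; rewrite mxE; have /andP[] := hf i.
Qed.

Lemma between_linf x y v r : between x y v -> (linf_dist 0 x <= r)%N -> (linf_dist 0 y <= r)%N ->
  (linf_dist 0 v <= r)%N.
Proof.
move=> b hx hy; apply/linf_leP => i.
have := leq_trans (linf_coord 0 x i) hx; have := leq_trans (linf_coord 0 y i) hy; have := b i.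
by rewrite mxE; move: (x 0 i) (y 0 i) (v 0 i) => a c e; clear; lia.
Qed.

(** Inside the obstacles nothing is known about a path except that it can be made self-avoiding; its
    length is then at most the volume of the ball. This is why [width] is of order [scale n ^ d]. *)
Lemma shorten_path_in (S : set (Zd d)) x y p r : path_in S x y p ->
  (forall v, v \in x :: p -> (linf_dist x v <= r)%N) ->
  exists q, [/\ path_in S x y q, (forall v, v \in x :: q -> (linf_dist x v <= r)%N) &
    (size q <= (2 * r + 1) ^ d)%N].
Proof.
move=> [pp lp Sp] rp; case/shortenP: pp lp => q pq uq sub lq.
have sub' v : v \in x :: q -> v \in x :: p by rewrite !inE => /predU1P[->|/sub ->]; rewrite ?eqxx ?orbT.
exists q; split; [by split=> // v /sub' /Sp|by move=> v /sub' /rp|].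
apply: ltnW; rewrite -[(size q).+1]/(size (x :: q)) (_ : (2 * r + 1 = r.*2.+1)%N); last by clear; lia.
rewrite -(size_ball_seq x r); apply: uniq_leq_size => // v /sub' /rp.
by rewrite mem_ball_seq.
Qed.

Definition no_tree (N n : nat) : set (config d) := [set xi | forall w s,
  (linf_dist 0 w <= 7 * N)%N -> s \in trees n w -> ~~ all (fun x => ~~ xi x) s].

Lemma width_bounds n : let L := @scale d n in
  [/\ (L.+1 <= width n)%N, (40 * L <= width n)%N &
   (2 * (2 * L.+1 + 1) ^ d + 4 * d * L.+1 + 4 * (12 * d * 36) * L <= width n)%N].
Proof.
move=> L; have L0 : (0 < L)%N by exact: scale_gt0.
have Ld : (L <= L ^ d)%N by rewrite -{1}(expn1 L) leq_pexp2l// ltnW.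
have e5 : ((2 * L.+1 + 1) ^ d <= 5 ^ d * L ^ d)%N.
  by rewrite -expnMn; apply: leq_exp2r_any; move: L0; clear; lia.
have w40 : (40 * L <= width n)%N.
  by apply: leq_mul; [rewrite /width_const leq_addl|].
split=> //; first by move: w40 L0; clear; lia.
rewrite /width /width_const -/L; move: Ld e5 L0; move: (L ^ d)%N (5 ^ d)%N ((_ + 1) ^ d)%N => a b c.
by clear; nia.
Qed.

(** Outer sites are joined by [link_outer]. An escaping site reaches an outer site within [L.+1] by
    [escape_outer], so two escaping sites are joined through outer sites near them; conversely an
    outer site escapes because it is linked to an outer site about [2 * width n] away. *)
Lemma no_tree_linking N n (xi : config d) : (width n ^ 2 <= N)%N -> no_tree N n xi ->
  linking N (width n) (occupied xi).
Proof.
move=> wN nt; set L := @scale d n; have L0 : (0 < L)%N by exact: scale_gt0.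
have [w1 w2 w3] := width_bounds n; rewrite -/L in w1 w2 w3.
have wN' : (40 * width n <= N)%N.
  apply: leq_trans wN; rewrite expnS expn1 leq_mul2r; apply/orP; right.
  by apply: leq_trans w2; move: L0; clear; lia.
(* Closed sites far from the box are disregarded, so that trees need be excluded only at roots
   within [7 * N]; the links between outer sites built below stay within [4 * N]. *)
pose X : set (Zd d) := [set x | ~~ xi x /\ (linf_dist 0 x <= 4 * N)%N].
have hbn w : ~ hb X n w.
  move=> /hb_tree[s st sX].
  have [x xs] : exists x, x \in s.
    have := tree_size st; case: s {st sX} => [|x s _]; last by exists x; exact: mem_head.
    by move=> /esym/eqP; rewrite expn_eq0.
  have [_ bx] := sX x xs; have nx := tree_near st xs.
  have : (linf_dist 0 (w *+ L) <= 7 * N)%N.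
    have := linf_triangle x 0 (w *+ L); rewrite (linf_distC x).
    by move: bx nx wN' w2; rewrite -/L; clear; lia.
  rewrite -(mul0rn _ L) linf_mulrn => wL.
  have := nt w s _ st; rewrite (leq_trans _ wL) ?leq_pmulr// => /(_ erefl) /allP; apply=> y ys.
  by have [] := sX y ys.
have sep k z z' : (k < n)%N -> center X k z -> center X k z' -> z <> z' -> (@scale d k.+1 <= linf_dist z z')%N.
  by move=> _; exact: center_sep.
(* With T = 36 the clearance exceeds the radius [18 * scale k] within which [center_cover] places
   closed sites. *)
have lk := link_outer d1 (isT : 0 < 36)%N (@scale0 d) (@scale_grow d) sep.
have eo := escape_outer d1 (isT : 0 < 36)%N (@scale0 d) (@scale_grow d) sep.
have no := near_outer d1 (isT : 0 < 36)%N (@scale0 d) (@scale_grow d) sep.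
rewrite -/L in lk eo no.
set out := outer _ _ _ _ in lk eo no.
have good v : (linf_dist 0 v <= 4 * N)%N -> 
    (forall k z, (k < n)%N -> center X k z -> (36 * @scale d k < 2 * linf_dist z v)%N) -> xi v.
  move=> bv hv; apply: contrapT => /negP nv.
  have [k [z [kn cz zv]]] := center_cover hbn (conj nv bv : X v).
  by have := hv k z kn cz; move: zv; clear; lia.
have lk' x y : out x -> out y -> (linf_dist 0 x <= 3 * N)%N -> (linf_dist 0 y <= 3 * N)%N -> exists p,
  [/\ path_in (occupied xi) x y p, (size p <= 2 * l1_dist x y + 4 * (12 * d * 36) * L)%N &
   forall v, v \in x :: p -> exists2 v0, between x y v0 & (linf_dist v v0 <= 36 * L)%N].
  move=> ox oy bx by'; have [p [[p1 p2 p3] p4 p5]] := lk x y ox oy; exists p; split=> //.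
  split=> // v vp; apply: good => [|k z kn cz]; last exact: (p3 v vp).
  have [v0 b0 h0] := p5 v vp; have := between_linf b0 bx by'.
  by have := linf_triangle v0 0 v; rewrite (linf_distC v0 v); move: h0 w2 wN'; clear; lia.
have Lw : (L.+1 <= width n)%N by [].
split.
- move=> x bx; have [y oy xy] := no x; exists y; last exact: leq_trans xy Lw.
  pose i0 : 'I_d := Ordinal (ltnW d1).
  pose u := set_coord y i0 (y 0 i0 + (2 * width n)%N%:Z).
  have yu : linf_dist y u = (2 * width n)%N.
    apply/eqP; rewrite eqn_leq; apply/andP; split.
      apply/linf_leP => j; rewrite set_coordE; case: eqP => [->|_]; move: (y 0 _) => a; clear; lia.
    by apply: leq_trans (linf_coord _ _ i0); rewrite set_coordE eqxx; move: (y 0 _) => a; clear; lia.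
  have [v ov uv] := no u.
  have by' : (linf_dist 0 y <= 3 * N)%N.
    by have := linf_triangle x 0 y; move: bx xy Lw wN'; clear; lia.
  have bv : (linf_dist 0 v <= 3 * N)%N.
    have := linf_triangle x 0 y; have := linf_triangle y 0 u; have := linf_triangle u 0 v.
    by move: bx xy uv yu Lw wN'; clear; lia.
  have [p [hp _ _]] := lk' y v oy ov by' bv.
  exists v; first by exists p.
  have := linf_triangle v y u; rewrite (linf_distC v u) yu; move: uv Lw; clear; lia.
- move=> x y bx by' ex ey.
  have pre u : (linf_dist 0 u <= 2 * N)%N -> esc (width n) (occupied xi) u -> exists u' q,
      [/\ out u', (linf_dist u u' <= L.+1)%N, path_in (occupied xi) u u' q,
       (forall v, v \in u :: q -> (linf_dist u v <= L.+1)%N) & (size q <= (2 * L.+1 + 1) ^ d)%N].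
    move=> bu [z [p [p1 p2 p3]] uz].
    have [|q1 [q2 [e o h]]] := eo u p p1; first by rewrite p2; exact: leq_trans Lw uz.
    exists (last u q1).
    have pq : path_in (occupied xi) u (last u q1) q1.
      split=> //; first by move: p1; rewrite e cat_path => /andP[].
      by move=> v vq; apply: p3; rewrite e mem_cons_cat vq.
    have [q [a1 a2 a3]] := shorten_path_in pq h.
    by exists q; split=> //; apply: h; exact: mem_last.
  have [x' [p1 [ox xx px hx sx]]] := pre x bx ex; have [y' [p3 [oy yy py hy sy]]] := pre y by' ey.
  have [||p2 [pl sl hl]] := lk' x' y' ox oy.
  - by have := linf_triangle x 0 x'; move: bx xx w1 wN'; clear; lia.
  - by have := linf_triangle y 0 y'; move: by' yy w1 wN'; clear; lia.
  have pyb : path_in (occupied xi `&` [set v | (linf_dist y v <= L.+1)%N]) y y' p3.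
    by have [a1 a2 a3] := py; split=> // v vp; split; [exact: a3|exact: hy].
  have [p3' pyb' sy'] := path_in_rev pyb.
  have py' : path_in (occupied xi) y' y p3' by apply: path_in_sub pyb' => v [].
  have hy' v : v \in p3' -> (linf_dist y v <= L.+1)%N.
    by move=> vp; have [_ _ /(_ v)] := pyb'; rewrite inE vp orbT => /(_ erefl) [].
  exists (p1 ++ (p2 ++ p3')); split.
  + by apply: path_in_cat px _; apply: path_in_cat pl _.
  + rewrite !size_cat sy'.
    have t : (l1_dist x' y' <= l1_dist x y + 2 * (d * L.+1))%N.
      have := l1_triangle x x' y'; have := l1_triangle y x y'; rewrite (l1_distC x' x).
      have a1 : (l1_dist x x' <= d * L.+1)%N by apply: leq_trans (l1_le_linf _ _) _; rewrite leq_mul2l xx orbT.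
      have a2 : (l1_dist y y' <= d * L.+1)%N by apply: leq_trans (l1_le_linf _ _) _; rewrite leq_mul2l yy orbT.
      by move: a1 a2; clear; lia.
    rewrite -(mulnA 4 d L.+1) in w3.
    move: sx sy sl t w3; move: ((_ + 1) ^ d)%N (d * L.+1)%N (4 * (12 * d * 36) * L)%N => a b c.
    by clear; lia.
  + move=> v; rewrite mem_cons_cat mem_cat => /orP[vp|/orP[vp|vp]].
    * exists x; first by move=> i; move: (x 0 i) (y 0 i) => a b; clear; lia.
      by rewrite linf_distC; apply: leq_trans Lw; exact: hx.
    * have [|v0 b0 h0] := hl v; first by rewrite inE vp orbT.
      have [v1 b1 h1] := between_near xx yy b0; exists v1 => //.
      by have := linf_triangle v0 v v1; move: h0 h1 w2 L0; clear; lia.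
    * exists y; first by move=> i; move: (x 0 i) (y 0 i) => a b; clear; lia.
      by rewrite linf_distC; apply: leq_trans Lw; exact: hy'.
Qed.

End Linking.

(** * Probability of closed trees *)

Section TreeProbability.
Context {R : realType} {d : nat}.
Context {disp : measure_display} {Omega : measurableType disp}.
Context {P : probability Omega R} {phi : Zd d -> {RV P >-> R}}.
Hypothesis d3 : (3 <= d)%N.
Hypothesis hphi : is_GFF phi.

Local Notation kappa := (@gauss_mom2 R).
Local Notation gb := (@green_bound R d).
Local Notation Q h := (excursion_law phi h).

Definition closed_on (s : seq (Zd d)) : set (config d) := [set xi | all (fun x => ~~ xi x) s].

Lemma measurable_closed_on s : measurable (closed_on s).
Proof.
elim: s => [|x s IH]; first by rewrite (_ : closed_on _ = setT)//; apply/seteqP.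
have -> : closed_on (x :: s) = (~` [set xi : config d | xi x]) `&` closed_on s.
  apply/seteqP; split=> xi; rewrite /closed_on /=; first by move=> /andP[/negP ? ?].
  by move=> [/negP -> ->].
by apply: measurableI => //; apply: measurableC; exact: measurable_site.
Qed.

Lemma gb_gt0 : 0 < gb.
Proof. by apply: lt_le_trans (greenR_le_max d3 0 0); apply: lt_le_trans (greenR_diag d3 0). Qed.

(* On the event the sum of the field over the 2 ^ n leaves is at most 2 ^ n * h,
   while separation of the leaves keeps its variance of order 2 ^ n. *)
Lemma closed_tree_prob h n w s : h <= 0 -> s \in trees n w ->
  pr (Q h) (closed_on s) <= expR (- (2 ^ n)%:R * (h ^+ 2 * kappa / (6 * gb))).
Proof.
move=> h0 st; have g0 := gb_gt0; have k0 := @gauss_mom2_gt0 R.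
pose t : seq (Zd d * R) := [seq (x, 1) | x <- s].
have q0 : 0 < (2 ^ n)%:R :> R by rewrite ltr0n expn_gt0.
have V0 : 0 < (2 ^ n)%:R * (3 * gb) by apply: mulr_gt0 => //; apply: mulr_gt0.
have a0 : 0 <= - h * (2 ^ n)%:R by rewrite mulr_ge0// ?oppr_ge0// ltW.
have gV : gcov t t <= (2 ^ n)%:R * (3 * gb).
  rewrite /gcov big_map /=.
  apply: le_trans (_ : \sum_(y <- s) 3 * gb <= _); last first.
    by rewrite big_const_seq count_predT iter_addr_0 (tree_size st) -[leLHS]mulr_natl.
  rewrite big_seq [leRHS]big_seq; apply: ler_sum => y ys; rewrite big_map /=.
  under eq_bigr do rewrite !mul1r.
  have rs := @tree_row_sum d R d3 n w s y st ys.
  apply: le_trans rs _; rewrite mulrC (ler_wpM2r (ltW g0))//.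
  by rewrite gerBl mulr_ge0// invr_ge0.
have := lc_tail d3 hphi V0 gV a0.
rewrite (_ : _ / _ = - (2 ^ n)%:R * (h ^+ 2 * kappa / (6 * gb))); last first.
  by field; rewrite !gt_eqF.
move=> le1; rewrite -lee_fin -prE; last exact: measurable_closed_on.
apply: le_trans le1; rewrite excursion_lawE; apply: le_measure; rewrite ?inE.
- by apply: exc_pre; exact: measurable_closed_on.
- rewrite -[X in measurable X]setTI.
  exact: (measurable_fun_le measurableT (measurable_lc t) (measurable_cst _)).
- move=> w0 /allP hs; rewrite /= /lc /lincomb big_map /=.
  apply: le_trans (_ : \sum_(x <- s) h <= _).
    rewrite big_seq [leRHS]big_seq; apply: ler_sum => x xs; rewrite mul1r.
    by have := hs x xs; rewrite /excursion -ltNge => /ltW.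
  by rewrite big_const_seq count_predT iter_addr_0 (tree_size st) mulNr opprK mulr_natr.
Qed.

Lemma no_treeC N n : ~` no_tree N n = \big[setU/set0]_(w <- ball_seq 0 (7 * N))
  \big[setU/set0]_(s <- trees n w) closed_on s.
Proof.
rewrite -bigcup_seq; under eq_bigcupr do rewrite -bigcup_seq.
apply/seteqP; split=> xi.
  rewrite /no_tree /= => /existsNP[w /existsNP[s /not_implyP[wN /not_implyP[st /negP]]]].
  rewrite negbK => h; exists w; first by rewrite /= mem_ball_seq.
  by exists s.
move=> [w /=]; rewrite mem_ball_seq => wN [s /= st hs] nt.
by have := nt w s wN st; rewrite hs.
Qed.

Lemma measurable_no_tree N n : measurable (no_tree N n : set (config d)).
Proof.
rewrite -[X in measurable X]setCK; apply: measurableC; rewrite no_treeC.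
by apply: bigsetU_measurable => w _; apply: bigsetU_measurable => s _; exact: measurable_closed_on.
Qed.

Lemma no_tree_prob h N n : h <= 0 -> pr (Q h) (~` no_tree N n) <=
  (14 * N).+1%:R ^+ d * ((2 ^ (2 * d * (d + 16)))%:R * expR (- (h ^+ 2 * kappa / (6 * gb)))) ^+ (2 ^ n).
Proof.
move=> h0; rewrite no_treeC.
have mU w : measurable (\big[setU/set0]_(s <- trees n w) closed_on s : set (config d)).
  by apply: bigsetU_measurable => s _; exact: measurable_closed_on.
apply: le_trans (pr_bigcup_le _ _ mU) _.
set E := expR _; set G := (2 ^ _)%N.
apply: le_trans (_ : \sum_(w <- ball_seq (0 : Zd d) (7 * N)) (G%:R * E) ^+ (2 ^ n) <= _); last first.
  rewrite big_const_seq count_predT iter_addr_0 size_ball_seq -[leLHS]mulr_natl natrX.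
  by rewrite (_ : (7 * N).*2.+1 = (14 * N).+1)//; clear; lia.
apply: ler_sum => w _; apply: le_trans (pr_bigcup_le _ _ measurable_closed_on) _.
apply: le_trans (_ : \sum_(s <- trees n w) E ^+ (2 ^ n) <= _).
  rewrite big_seq [leRHS]big_seq; apply: ler_sum => s st.
  apply: le_trans (closed_tree_prob h0 st) _.
  by rewrite /E -expRM_natl mulNr mulrN.
rewrite big_const_seq count_predT iter_addr_0 -[leLHS]mulr_natl exprMn -natrX ler_wpM2r ?exprn_ge0 ?expR_ge0//.
by rewrite ler_nat; exact: size_trees_le.
Qed.

End TreeProbability.

(** * Choice of the depth and of the level *)

Section LinkingTheorem.
Context {R : realType}.

(** 2^n is the fifth power of exp (n ln 2 / 5), hence at least (n ln 2 / 5)^5, one degree more than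
    required. *)
Lemma exp2_beats_poly (B : R) (c : nat) : exists n1 : nat, forall n, (n1 <= n)%N ->
  B * (n + c)%:R ^+ 4 <= (2 ^ n)%:R.
Proof.
have l2 : 0 < ln 2 :> R by apply: ln_gt0; lra.
pose a : R := ln 2 / 5; have a0 : 0 < a by rewrite divr_gt0.
exists (maxn c (Num.truncn (16 * `|B| / a ^+ 5)).+1) => n; rewrite geq_max => /andP[cn bn].
have n0 : 0 <= n%:R :> R by [].
have e1 : (n%:R * a) ^+ 5 <= (2 ^ n)%:R.
  rewrite natrX -[2 in leRHS]lnK ?posrE// -expRM_natl.
  rewrite (_ : n%:R * ln 2 = 5%:R * (n%:R * a)); last by rewrite /a; field.
  have na0 : 0 <= n%:R * a by rewrite mulr_ge0// ltW.
  rewrite expRM_natl lerXn2r ?nnegrE ?expR_ge0 ?na0//.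
  by apply: le_trans (expR_ge1Dx _); rewrite lerDr.
apply: le_trans e1; apply: le_trans (_ : `|B| * (16 * n%:R ^+ 4) <= _).
  have nc0 : 0 <= (n + c)%:R :> R by [].
  apply: le_trans (_ : `|B| * (n + c)%:R ^+ 4 <= _); first by rewrite ler_wpM2r ?exprn_ge0// ler_norm.
  rewrite ler_wpM2l// (_ : 16 = 2 ^+ 4 :> R); last by ring.
  by rewrite -exprMn lerXn2r ?nnegrE ?mulr_ge0// -natrM ler_nat mul2n -addnn leq_add2l.
have b1 : 16 * `|B| <= n%:R * a ^+ 5.
  rewrite -ler_pdivrMr ?exprn_gt0//; apply: le_trans (ltW (truncnS_gt _)) _.
  by rewrite ler_nat.
have n4 : 0 <= n%:R ^+ 4 :> R by rewrite exprn_ge0.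
rewrite exprMn [n%:R ^+ 5]exprS; move: n4 b1; move: (n%:R ^+ 4) (a ^+ 5) => p q; nra.
Qed.

Variable d : nat.
Hypothesis d3 : (3 <= d)%N.
Let d1 : (1 < d)%N. Proof. exact: ltnW. Qed.

Lemma scale_le n : (@scale d n.+1 <= 2 ^ (n.+1 * (n + (d + 12))))%N.
Proof.
elim: n => [|n IH]; first by rewrite scaleS scale0 muln1 mul1n.
rewrite scaleS; apply: leq_trans (leq_mul (leqnn _) IH) _.
by rewrite /ell -expnD leq_exp2l//; clear; nia.
Qed.

Lemma width_gt0 n : (0 < @width d n)%N.
Proof. by have [h _ _] := width_bounds d1 n; apply: leq_trans h. Qed.

Lemma width_ge_const n : (20 * d + 40 <= @width d n)%N.
Proof.
apply: leq_trans (_ : @width_const d <= _)%N; last by rewrite /width leq_pmulr// expn_gt0 scale_gt0.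
by rewrite /width_const; clear; lia.
Qed.

Lemma width_ge n : (n <= @width d n)%N.
Proof.
have [h _ _] := width_bounds d1 n; apply: leq_trans h; apply: leqW.
by apply: leq_trans (scale_ge16 n); apply: ltnW; exact: ltn_expl.
Qed.

Lemma width_level (n1 : nat) : exists lev : nat -> nat, forall N, (@width d n1 ^ 2 <= N)%N ->
  [/\ (n1 <= lev N)%N, (@width d (lev N) ^ 2 <= N)%N & (N < @width d (lev N).+1 ^ 2)%N].
Proof.
have h N : exists n, (@width d n1 ^ 2 <= N)%N ->
    [/\ (n1 <= n)%N, (@width d n ^ 2 <= N)%N & (N < @width d n.+1 ^ 2)%N].
  have [hN|hN] := leqP (@width d n1 ^ 2) N; last by exists 0%N.
  have ex : exists n, (@width d n ^ 2 <= N)%N by exists n1.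
  have bd n : (@width d n ^ 2 <= N)%N -> (n <= N)%N.
    move=> hn; apply: leq_trans (width_ge n) (leq_trans _ hn).
    by rewrite expnS expn1 leq_pmulr// width_gt0.
  case: (ex_maxnP ex bd) => n hn mx; exists n => _; split=> //; first exact: mx.
  by rewrite ltnNge; apply/negP => /mx; rewrite ltnn.
by have [f hf] := choice h; exists f.
Qed.

(** Scales are 2^O(n^2), so [N < width n.+1 ^ 2] gives ln N <= A q^2 with q linear in n. Both (ln
    N)^2 and the entropy d ln (14N + 1) are then O(q^4), dominated by 2^n. *)
Lemma width_numeric : exists n1 : nat, forall n N, (n1 <= n)%N -> (0 < N)%N -> (N < @width d n.+1 ^ 2)%N ->
  (14 * N).+1%:R ^+ d * expR (- (2 ^ n)%:R) <= expR (- (ln N%:R) ^+ 2) :> R.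
Proof.
pose A : R := 2 * (ln (@width_const d)%:R + d%:R).
have wc1 : (1 <= @width_const d)%N by rewrite /width_const; clear; lia.
have lw0 : 0 <= ln (@width_const d)%:R :> R by rewrite ln_ge0// (ler_nat R 1).
have A0 : 0 <= A by rewrite mulr_ge0// addr_ge0.
pose B := A ^+ 2 + d%:R * 15 + d%:R * A.
have [n1 hn1] := exp2_beats_poly B (d + 12); exists n1 => n N nn N0 Nw.
have NR : 1 <= N%:R :> R by rewrite (ler_nat R 1).
have NR0 : 0 < N%:R :> R by rewrite ltr0n.
set q : R := (n + (d + 12))%:R.
have q1 : 1 <= q by rewrite (ler_nat R 1); clear; lia.
have ln2 : ln 2 <= 1 :> R.
  rewrite -[leRHS](@expRK R) ler_ln ?posrE ?expR_gt0//.
  by have := @expR_ge1Dx R 1; lra.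
have lnq : ln N%:R <= A * q ^+ 2.
  apply: le_trans (_ : ln ((@width d n.+1) ^ 2)%:R <= _).
    by rewrite ler_ln ?posrE ?ltr0n ?expn_gt0 ?width_gt0// ler_nat ltnW.
  have s0 : 0 < (@scale d n.+1)%:R :> R by rewrite ltr0n scale_gt0.
  have lsc : ln (@scale d n.+1)%:R <= q ^+ 2.
    apply: le_trans (_ : ln ((2 ^ (n.+1 * (n + (d + 12))))%:R) <= _).
      by rewrite ler_ln ?posrE ?ltr0n ?expn_gt0 ?scale_gt0 ?ler_nat ?scale_le.
    rewrite natrX lnXn// -[_ *+ _]mulr_natl natrM -/q.
    have nq : n.+1%:R <= q by rewrite ler_nat; clear; lia.
    have l20 : 0 <= ln 2 :> R by apply: ln_ge0; lra.
    have q0 : 0 <= q by lra.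
    rewrite -[leRHS]mulr1 expr2; apply: ler_pM => //; first by rewrite mulr_ge0.
    by rewrite ler_wpM2r.
  rewrite natrX lnXn ?ltr0n ?width_gt0// /width natrM natrX lnM ?posrE ?exprn_gt0 ?ltr0n ?scale_gt0//.
  rewrite lnXn// -[_ *+ d]mulr_natl -[_ *+ 2]mulr_natl /A -mulrA ler_wpM2l//.
  have q2 : 1 <= q ^+ 2 by rewrite expr_ge1//; lra.
  by rewrite mulrDl lerD// ?ler_wpM2l// ler_peMr.
have l0 : 0 <= ln N%:R :> R by rewrite ln_ge0.
have l15 : ln (14 * N).+1%:R <= 15 + ln N%:R :> R.
  have := @ln_sublinear R 15 (ltr0n _ 15).
  have : ln (14 * N).+1%:R <= ln (15 * N%:R) :> R.
    by rewrite ler_ln ?posrE ?ltr0n ?mulr_gt0// -natrM ler_nat; clear -N0; lia.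
  by rewrite lnM ?posrE//; lra.
have p0 : 0 < (14 * N).+1%:R :> R by rewrite ltr0n.
rewrite -[X in X ^+ d]lnK ?posrE// -expRM_natl -expRD ler_expR.
have := hn1 n nn; rewrite -/q /B {hn1 B}.
have d0 : 0 <= d%:R :> R by [].
have q2 : 1 <= q ^+ 2 by rewrite expr_ge1//; lra.
have -> : q ^+ 4 = q ^+ 2 * q ^+ 2 by ring.
move: l0 l15 lnq q2 d0 A0; clearbody A q; move: (ln N%:R) (ln (14 * N).+1%:R) (q ^+ 2) (d%:R) => a b r c.
move=> l0 l15 lnq q2 d0 A0 big; move: A l0 l15 lnq q2 d0 A0 big => A' l0 l15 lnq q2 d0 A0 big.
have h1 : a ^+ 2 <= A' ^+ 2 * (r * r) by nra.
have h2 : c * b <= c * 15 * (r * r) + c * A' * (r * r).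
  have : b <= 15 * (r * r) + A' * (r * r) by nra.
  nra.
nra.
Qed.

(** The events [E N] live on configurations and are fixed before the field: the level enters only
    through the probability bound, uniform over [h <= h1]. *)
Theorem linking_theorem : exists (h1 : R) (N0 : nat) (w : nat -> nat) (E : nat -> set (config d)),
  [/\ h1 <= 0,
   forall N, measurable (E N),
   forall N, (N0 <= N)%N -> [/\ (20 * d + 40 <= w N)%N, (w N ^ 2 <= N)%N &
      forall xi, E N xi -> linking N (w N) (occupied xi)] &
   forall (disp : measure_display) (Omega : measurableType disp) (P : probability Omega R)
     (phi : Zd d -> {RV P >-> R}), is_GFF phi -> forall h N, h <= h1 -> (N0 <= N)%N ->
     pr (excursion_law phi h) (~` E N) <= expR (- (ln N%:R) ^+ 2)].
Proof.
have [n1 hn1] := width_numeric; have [lev hlev] := width_level n1.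
have g0 : 0 < @green_bound R d by exact: gb_gt0.
have k0 := @gauss_mom2_gt0 R.
set G : nat := (2 ^ (2 * d * (d + 16)))%N.
have G0 : 0 < G%:R :> R by rewrite ltr0n expn_gt0.
have lG : 0 <= ln G%:R :> R by rewrite ln_ge0// (ler_nat R 1) expn_gt0.
(* Makes t^2 kappa / (6 gb) at least ln G + 1, so that the entropy [G] per leaf is beaten with a
   factor exp (-1) to spare. The summand 1 gives t >= 1, hence t^2 >= t. *)
pose t : R := 1 + (ln G%:R + 1) * (6 * @green_bound R d) / @gauss_mom2 R.
have t1 : 1 <= t.
  rewrite lerDl; apply: divr_ge0; last exact: ltW.
  by apply: mulr_ge0; [rewrite addr_ge0|apply: mulr_ge0 => //; exact: ltW].
exists (- t), (@width d n1 ^ 2)%N, (fun N => @width d (lev N)), (fun N => no_tree N (lev N)); split.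
- by rewrite oppr_le0; apply: le_trans t1.
- by move=> N; exact: measurable_no_tree.
- move=> N /hlev[l1 l2 l3]; split=> //; first exact: width_ge_const.
  by move=> xi; apply: no_tree_linking => //; exact: ltnW.
move=> disp Omega P phi hphi h N ht /hlev[l1 l2 l3].
have h0 : h <= 0 by lra.
have N0 : (0 < N)%N by apply: leq_trans l2; rewrite expn_gt0 width_gt0.
apply: le_trans (no_tree_prob d3 hphi N (lev N) h0) _.
apply: le_trans (hn1 _ N l1 N0 l3); rewrite ler_wpM2l ?exprn_ge0//.
have -> : expR (- (2 ^ lev N)%:R) = expR (- 1) ^+ (2 ^ lev N) :> R by rewrite -expRM_natl mulrN1.
rewrite lerXn2r ?nnegrE ?expR_ge0 ?mulr_ge0 ?expR_ge0//.
rewrite -/G -[X in X * _]lnK ?posrE// -expRD ler_expR.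
have : (ln G%:R + 1) <= h ^+ 2 * @gauss_mom2 R / (6 * @green_bound R d).
  have gb6 : 0 < 6 * @green_bound R d by apply: mulr_gt0.
  rewrite (ler_pdivlMr _ _ gb6) -(ler_pdivrMr _ _ k0).
  have : t <= h ^+ 2 by move: t1 ht; clear; nra.
  by rewrite /t; lra.
lra.
Qed.

End LinkingTheorem.

(** * Measurability of path events *)

Section MeasurableFormulas.
Context {disp : measure_display} {T : measurableType disp}.

Lemma measurable_prop (p : Prop) : measurable [set _ : T | p].
Proof.
have [hp|hp] := pselect p.
  by rewrite (_ : [set _ | _] = setT)//; apply/seteqP; split.
by rewrite (_ : [set _ | _] = set0)//; apply/seteqP; split.
Qed.

(** Sites, integers and lattice paths form countable types, so events written with quantifiers over
    them are measurable by this lemma and its companions. *)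
Lemma measurable_ex (I : countType) (F : I -> T -> Prop) :
  (forall i, measurable [set t | F i t]) -> measurable [set t | exists i, F i t].
Proof.
move=> mF; pose G n := if @unpickle I n is Some i then [set t | F i t] else set0.
rewrite (_ : [set t | _] = \bigcup_n G n).
  by apply: bigcup_measurable => n _; rewrite /G; case: unpickle.
apply/seteqP; split=> t /=.
  by move=> [i h]; exists (pickle i) => //; rewrite /G pickleK.
by move=> [n _]; rewrite /G; case: unpickle => // i h; exists i.
Qed.

Lemma measurable_not (F : T -> Prop) : measurable [set t | F t] -> measurable [set t | ~ F t].
Proof. exact: measurableC. Qed.

Lemma measurable_all (I : countType) (F : I -> T -> Prop) :
  (forall i, measurable [set t | F i t]) -> measurable [set t | forall i, F i t].
Proof.
move=> mF; rewrite (_ : [set t | _] = ~` [set t | exists i, ~ F i t]).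
  by apply: measurableC; apply: measurable_ex => i; exact: measurable_not.
apply/seteqP; split=> t /= h; first by move=> [i]; apply.
by move=> i; apply: contrapT => n; apply: h; exists i.
Qed.

Lemma measurable_and (F G : T -> Prop) : measurable [set t | F t] -> measurable [set t | G t] ->
  measurable [set t | F t /\ G t].
Proof. exact: measurableI. Qed.

Lemma measurable_imp (F G : T -> Prop) : measurable [set t | F t] -> measurable [set t | G t] ->
  measurable [set t | F t -> G t].
Proof.
move=> mF mG; rewrite (_ : [set t | _] = ~` [set t | F t] `|` [set t | G t]).
  by apply: measurableU => //; exact: measurableC.
apply/seteqP; split=> t /=; last by case.
by have [f h|f _] := pselect (F t); [right; exact: h|left].
Qed.

End MeasurableFormulas.

Section PathEvents.
Context {d : nat}.
Implicit Types (x y z u v : Zd d) (S B : set (Zd d)).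

Lemma connected_sym S x y : connected_in S x y -> connected_in S y x.
Proof. by move=> [p /path_in_rev[q hq _]]; exists q. Qed.

Lemma connected_trans S y x z : connected_in S x y -> connected_in S y z -> connected_in S x z.
Proof. by move=> [p hp] [q hq]; exists (p ++ q); exact: path_in_cat hp hq. Qed.

Lemma connected_refl S x : S x -> connected_in S x x.
Proof. by move=> Sx; exists [::]; split=> // z; rewrite inE => /eqP ->. Qed.

Lemma connected_site S x y : connected_in S x y -> S x.
Proof. by move=> [p [_ _ h]]; apply: h; exact: mem_head. Qed.

Lemma esc_site w S x : esc w S x -> S x.
Proof. by move=> [z /connected_site]. Qed.

Lemma finite_ball x n : finite_set [set y | (linf_dist x y <= n)%N].
Proof.
apply: (@sub_finite_set _ _ [set` ball_seq x n]); last exact: finite_seq.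
by move=> y /=; rewrite mem_ball_seq.
Qed.

Lemma infinite_partE S x : infinite_part S x <-> S x /\ forall n, esc n S x.
Proof.
split=> -[Sx h]; split=> //.
  move=> n; apply: contrapT => ne; apply: h.
  apply: (sub_finite_set _ (finite_ball x n)) => y xy; rewrite /= leqNgt; apply/negP => hy.
  by apply: ne; exists y => //; exact: ltnW.
move=> /finite_setP[n].
move=> fin.
have fs : finite_set (component S x) by exists n.
have /finite_seqP[s hs] := fs.
have [z xz zb] := h (\max_(y <- s) linf_dist x y).+1.
have : z \in s by have : component S x z by []; rewrite hs.
move=> zs; have : (linf_dist x z <= \max_(y <- s) linf_dist x y)%N by apply: leq_bigmax_seq.
by rewrite leqNgt zb.
Qed.

(** The diameter is a supremum of integers, so it reaches the real [r] only if some pair does. When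
    [r] is itself an integer m, distances below m are at most m - 1, which keeps the supremum away
    from [r]. *)
Lemma large_partE (R : realType) S (r : R) x : large_part S r x <->
  S x /\ exists y z, [/\ connected_in S x y, connected_in S x z & r <= (l1_dist y z)%:R].
Proof.
split=> -[Sx h]; split=> //; last first.
  have [y [z [xy xz hr]]] := h; apply: le_trans (_ : ((l1_dist y z)%:R%:E <= _)%E); first by rewrite lee_fin.
  by apply: ereal_sup_ubound; exists y, z.
apply: contrapT => ne.
have lt y z : connected_in S x y -> connected_in S x z -> ((l1_dist y z)%:R < r).
  by move=> xy xz; rewrite ltNge; apply/negP => hr; apply: ne; exists y, z.
have r0 : 0 < r by have := lt x x (connected_refl Sx) (connected_refl Sx); rewrite l1_dist_id.
pose m := (Num.truncn r); have mr : m%:R <= r by rewrite truncn_le// ltW.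
have [e|e] := eqVneq (m%:R) r.
  have : (l1_diam R (component S x) <= (m%:R - 1)%:E)%E.
    apply: ge_ereal_sup => _ [y [z [xy xz ->]]]; rewrite lee_fin.
    have := lt y z xy xz; rewrite -e ltr_nat => h'; rewrite lerBrDr natr1 ler_nat//.
  by move=> h'; have := le_trans h h'; rewrite lee_fin -e; lra.
have : (l1_diam R (component S x) <= m%:R%:E)%E.
  apply: ge_ereal_sup => _ [y [z [xy xz ->]]]; rewrite lee_fin ler_nat.
  rewrite leqNgt; apply/negP => h'; have := lt y z xy xz; rewrite ltNge => /negP; apply.
  by apply: le_trans (ltW (truncnS_gt _)) _; rewrite ler_nat.
move=> h'; have := le_trans h h'; rewrite lee_fin => h2; move: e; rewrite eq_le mr h2//.
Qed.

Lemma graph_distE (R : realType) S x y (r : R) :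
  (graph_dist R S x y <= r%:E)%E <-> exists2 p, path_in S x y p & (size p)%:R <= r.
Proof.
split; last first.
  move=> [p hp pr]; apply: le_trans (_ : ((size p)%:R%:E <= _)%E); last by rewrite lee_fin.
  by apply: ereal_inf_lbound; exists p.
move=> h; apply: contrapT => ne.
have lt p : path_in S x y p -> r < (size p)%:R.
  by move=> hp; rewrite ltNge; apply/negP => hr; apply: ne; exists p.
have : ((Num.truncn r).+1%:R%:E <= graph_dist R S x y)%E \/ r < 0.
  have [r0|r0] := leP 0 r; [left|by right].
  apply: le_ereal_inf_tmp => _ [p hp ->]; rewrite lee_fin ler_nat.
  by rewrite ltnNge; apply/negP => h'; have := lt p hp; rewrite ltNge => /negP; apply;
    apply: le_trans (_ : (Num.truncn r)%:R <= _); [rewrite ler_nat|rewrite truncn_le].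
case=> [h'|r0].
  by have := le_trans h' h; rewrite lee_fin leNgt truncnS_gt.
have : (0%:E <= graph_dist R S x y)%E by apply: le_ereal_inf_tmp => _ [p hp ->]; rewrite lee_fin.
by move=> h'; have := le_trans h' h; rewrite lee_fin leNgt r0.
Qed.

Implicit Types xi : config d.

Lemma path_in_shift z xi x y p : path_in (occupied (Defs.shift z xi)) x y p <->
  path_in (occupied xi) (x + z) (y + z) [seq v + z | v <- p].
Proof.
have pe : path adj (x + z) [seq v + z | v <- p] = path adj x p.
  by elim: p x => //= v p IH x; rewrite adjD IH.
have le : last (x + z) [seq v + z | v <- p] = last x p + z.
  by elim: p x {pe} => //= v p IH x; rewrite IH.
have ae v : (v \in x :: p) = (v + z \in x + z :: [seq u + z | u <- p]).
  by rewrite !inE (mem_map (@addIr _ z)) (inj_eq (@addIr _ z)).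
have me v : v \in x + z :: [seq u + z | u <- p] -> exists2 u, u \in x :: p & v = u + z.
  rewrite inE => /predU1P[->|/mapP[u up ->]]; first by exists x; rewrite ?mem_head.
  by exists u; rewrite // inE up orbT.
split=> -[h1 h2 h3]; split.
- by rewrite pe.
- by rewrite le h2.
- by move=> v /me[u up ->]; exact: h3.
- by rewrite -pe.
- by apply: (addIr z); rewrite -h2 le.
- by move=> v; rewrite ae => /h3.
Qed.

Lemma path_in_unshift z xi x y p : path_in (occupied xi) (x + z) (y + z) p ->
  exists2 q, path_in (occupied (Defs.shift z xi)) x y q & size q = size p.
Proof.
move=> h; exists [seq v - z | v <- p]; last by rewrite size_map.
apply/path_in_shift; rewrite -map_comp (_ : map _ p = p)//.
by rewrite -[RHS]map_id; apply: eq_map => v /=; rewrite subrK.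
Qed.

Lemma conn_shift z xi x y : connected_in (occupied (Defs.shift z xi)) x y <->
  connected_in (occupied xi) (x + z) (y + z).
Proof.
split; first by move=> [p /path_in_shift h]; eexists; exact: h.
by move=> [p /path_in_unshift[q h _]]; exists q.
Qed.

Lemma esc_shift z xi w x : esc w (occupied (Defs.shift z xi)) x <-> esc w (occupied xi) (x + z).
Proof.
split.
  by move=> [y /conn_shift h1 h2]; exists (y + z) => //; rewrite linf_distD.
move=> [y h1 h2]; exists (y - z); first by apply/conn_shift; rewrite subrK.
by rewrite -(linf_distD _ _ z) subrK.
Qed.

Lemma infinite_shift z xi x : infinite_part (occupied (Defs.shift z xi)) x <->
  infinite_part (occupied xi) (x + z).
Proof.
split=> /infinite_partE[h1 h2]; apply/infinite_partE; split=> // n; exact/esc_shift.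
Qed.

Lemma measurable_occ x : measurable [set xi : config d | xi x].
Proof. exact: measurable_site. Qed.

Lemma measurable_path_in B x y p : measurable [set xi : config d | path_in (occupied xi `&` B) x y p].
Proof.
rewrite (_ : [set xi | _] = [set xi : config d | (path adj x p /\ last x p = y) /\
    forall z : Zd d, z \in x :: p -> (xi z /\ B z)]).
  apply: measurable_and; first exact: measurable_prop.
  apply: measurable_all => z; apply: measurable_imp; first exact: measurable_prop.
  by apply: measurable_and; [exact: measurable_occ|exact: measurable_prop].
by apply/seteqP; split=> xi /=; [move=> [h1 h2 h3]|move=> [[h1 h2] h3]].
Qed.

Lemma measurable_conn B x y : measurable [set xi : config d | connected_in (occupied xi `&` B) x y].
Proof. by apply: measurable_ex => p; exact: measurable_path_in. Qed.

Lemma measurable_path x y p : measurable [set xi : config d | path_in (occupied xi) x y p].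
Proof.
by have := measurable_path_in setT x y p; under eq_set do rewrite setIT.
Qed.

Lemma measurable_connT x y : measurable [set xi : config d | connected_in (occupied xi) x y].
Proof. by apply: measurable_ex => p; exact: measurable_path. Qed.

Lemma measurable_esc w x : measurable [set xi : config d | esc w (occupied xi) x].
Proof.
rewrite (_ : [set xi | _] = [set xi : config d | exists z, connected_in (occupied xi) x z /\
    (w <= linf_dist x z)%N]); last first.
  by apply/seteqP; split=> xi; [move=> [z ? ?]; exists z|move=> [z [? ?]]; exists z].
apply: measurable_ex => z; apply: measurable_and; [exact: measurable_connT|exact: measurable_prop].
Qed.

Lemma measurable_infinite_part x : measurable [set xi : config d | infinite_part (occupied xi) x].
Proof.
rewrite (_ : [set xi | _] = [set xi : config d | xi x /\ forall n, esc n (occupied xi) x]).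
  by apply: measurable_and; [exact: measurable_occ|apply: measurable_all => n; exact: measurable_esc].
by apply/seteqP; split=> xi /= /infinite_partE.
Qed.

Lemma measurable_large_part (R : realType) (r : R) x :
  measurable [set xi : config d | large_part (occupied xi) r x].
Proof.
rewrite (_ : [set xi | _] = [set xi : config d | xi x /\ exists y z, connected_in (occupied xi) x y /\
   (connected_in (occupied xi) x z /\ r <= (l1_dist y z)%:R)]); last first.
  apply/seteqP; split=> xi /=.
    by move=> /large_partE[? [y [z [? ? ?]]]]; split=> //; exists y, z.
  by move=> [? [y [z [? [? ?]]]]]; apply/large_partE; split=> //; exists y, z.
apply: measurable_and; first exact: measurable_occ.
apply: measurable_ex => y; apply: measurable_ex => z.
by do ![apply: measurable_and]; [exact: measurable_connT|exact: measurable_connT|exact: measurable_prop].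
Qed.

Lemma measurable_graph_dist (R : realType) (r : R) x y :
  measurable [set xi : config d | (graph_dist R (occupied xi) x y <= r%:E)%E].
Proof.
rewrite (_ : [set xi | _] = [set xi : config d | exists p, path_in (occupied xi) x y p /\ (size p)%:R <= r]).
  apply: measurable_ex => p; apply: measurable_and; [exact: measurable_path|exact: measurable_prop].
apply/seteqP; split=> xi /=; first by move=> /graph_distE[p ? ?]; exists p.
by move=> [p [? ?]]; apply/graph_distE; exists p.
Qed.

End PathEvents.

(** * Consequences of linking *)

Section LinkingConsequences.
Context {d : nat}.
Hypothesis d3 : (3 <= d)%N.
Implicit Types (x y z u v : Zd d) (S B : set (Zd d)).

(** The two inequalities together give 20 d w <= N, which turns an l1-diameter N/10 into escape to
    distance [w], and 40 w <= N, which absorbs the boundary displacements. *)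
Definition wide (w N : nat) : Prop := (20 * d + 40 <= w)%N /\ (w ^ 2 <= N)%N.

Lemma wide_le w N : wide w N -> (40 * w <= N)%N /\ (20 * d * w <= N)%N.
Proof.
move=> [h1 h2]; split; apply: leq_trans h2; rewrite expnS expn1 leq_mul2r; apply/orP; right;
  by apply: leq_trans h1; clear; lia.
Qed.

Definition axis (c : int) : Zd d := \row_(i < d) (if i == 0%N :> nat then c else 0).

Lemma linf_axis c : linf_dist 0 (axis c) = `|c|%N.
Proof.
apply/eqP; rewrite eqn_leq; apply/andP; split.
  by apply/linf_leP => i; rewrite !mxE; case: ifP => _; move: c; clear; lia.
have i0 : 'I_d := Ordinal (ltnW (ltnW d3)).
have -> : `|c|%N = `|(0%R : Zd d) 0%R (Ordinal (ltnW (ltnW d3))) - axis c 0%R (Ordinal (ltnW (ltnW d3)))|%N.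
  by rewrite !mxE /=; move: c; clear; lia.
exact: linf_coord.
Qed.

Lemma far_axis x (n : nat) : exists y, linf_dist 0 y = n /\ (n <= linf_dist x y)%N.
Proof.
have [h|h] := leqP n (linf_dist x (axis n%:Z)); first by exists (axis n%:Z); rewrite linf_axis.
exists (axis (- n%:Z)); rewrite linf_axis; split; first by clear; lia.
have i0 := Ordinal (ltnW (ltnW d3)).
have c1 := linf_coord x (axis n%:Z) (Ordinal (ltnW (ltnW d3))).
have c2 := linf_coord x (axis (- n%:Z)) (Ordinal (ltnW (ltnW d3))).
apply: leq_trans c2; have := leq_ltn_trans c1 h; rewrite !mxE /=.
by move: (x 0 _) => a; clear; lia.
Qed.

(** Bootstraps escape to distance [w] into escape to distance [N]: some escaping site lies within
    [w] of a point of the sphere of radius [2 * N - w] on the side away from [x], and linking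
    connects [x] to it. *)
Lemma linking_far N w S x : wide w N -> linking N w S -> (linf_dist 0 x <= 2 * N)%N -> esc w S x ->
  exists2 y, connected_in S x y & (N <= linf_dist x y)%N.
Proof.
move=> wN [la lb] bx ex; have [w40 _] := wide_le wN.
have [u [u0 ux]] := far_axis x (2 * N - w).
have [|y ey uy] := la u; first by rewrite u0 leq_subr.
have [|p [pp _ _]] := lb x y bx _ ex ey.
  by have := linf_triangle u 0 y; rewrite u0; move: uy w40; clear; lia.
exists y; first by exists p.
have := linf_triangle y x u; rewrite (linf_distC y u); move: ux uy w40 wN.1; clear; lia.
Qed.

Lemma linking_point N w S : wide w N -> linking N w S -> exists2 x, (linf_dist 0 x <= w)%N & esc w S x.
Proof. by move=> wN [la _]; have [|x ex h] := la 0; [rewrite linf_dist0|exists x]. Qed.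

Lemma linking_large (R : realType) N w S : wide w N -> linking N w S ->
  large_part S (N%:R : R) `&` box 0 (N%:R : R) !=set0.
Proof.
move=> wN lk; have [x xw ex] := linking_point wN lk; have [w40 _] := wide_le wN.
have [|y xy far] := linking_far wN lk _ ex; first by move: xw w40; clear; lia.
exists x; split; last by apply/box_nat; move: xw w40; clear; lia.
apply/large_partE; split; first exact: esc_site ex.
exists x, y; split=> //; first by apply: connected_refl; exact: esc_site ex.
by rewrite ler_nat; apply: leq_trans far (linf_le_l1 _ _).
Qed.

Lemma large_esc (R : realType) N w S (r : R) x : wide w N -> N%:R / 10 <= r -> large_part S r x -> esc w S x.
Proof.
move=> wN Nr /large_partE[Sx [y [z [xy xz hr]]]]; have [_ wd] := wide_le wN.
have h : (N <= 10 * l1_dist y z)%N.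
  by rewrite -(ler_nat R) natrM; lra.
have h2 : (l1_dist y z <= d * (linf_dist x y + linf_dist x z))%N.
  apply: leq_trans (l1_le_linf _ _) _; rewrite leq_mul2l (linf_distC x y) linf_triangle orbT//.
have [g|g] := leqP (linf_dist x y) (linf_dist x z); [exists z|exists y] => //.
  have : (20 * d * w <= 20 * d * linf_dist x z)%N by move: h h2 wd g; clear; nia.
  by rewrite leq_pmul2l// muln_gt0 (ltnW (ltnW d3)).
have : (20 * d * w <= 20 * d * linf_dist x y)%N by move: h h2 wd g; clear; nia.
by rewrite leq_pmul2l// muln_gt0 (ltnW (ltnW d3)).
Qed.

Lemma linking_connected (R : realType) N w S : wide w N -> linking N w S -> forall x y,
  (large_part S (N%:R / 10 : R) `&` box 0 (N%:R : R)) x ->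
  (large_part S (N%:R / 10 : R) `&` box 0 (N%:R : R)) y ->
  connected_in (S `&` box 0 (2 * N%:R : R)) x y.
Proof.
move=> wN [_ lb] x y [lx /box_nat bx] [ly /box_nat by']; have [w40 _] := wide_le wN.
have ex := large_esc wN (lexx _) lx; have ey := large_esc wN (lexx _) ly.
have [||p [[p1 p2 p3] _ hp]] := lb x y _ _ ex ey; [by move: bx; clear; lia|by move: by'; clear; lia|].
exists p; split=> // v vp; split; first exact: p3.
rewrite -natrM; apply/box_nat; have [v0 b h] := hp v vp.
have := between_linf b bx by'; have := linf_triangle v0 0 v; rewrite (linf_distC v0).
by move: h w40; clear; lia.
Qed.

Lemma linking_dist (R : realType) N w S (r : R) x y : wide w N -> linking N w S -> 
  N%:R / 10 <= r -> large_part S r x -> large_part S r y -> (linf_dist 0 x <= N)%N -> (linf_dist 0 y <= N)%N ->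
  exists2 p, path_in S x y p & (size p <= (8 * d + 1) * N)%N.
Proof.
move=> wN [_ lb] Nr lx ly bx by'; have [w40 _] := wide_le wN.
have ex := large_esc wN Nr lx; have ey := large_esc wN Nr ly.
have [||p [pp sp _]] := lb x y _ _ ex ey; [by move: bx; clear; lia|by move: by'; clear; lia|].
exists p => //; apply: leq_trans sp _.
have h : (l1_dist x y <= d * (2 * N))%N.
  apply: leq_trans (l1_le_linf _ _) _; rewrite leq_mul2l; apply/orP; right.
  by have := linf_triangle 0 x y; rewrite (linf_distC x 0); move: bx by'; clear; lia.
by move: h w40; clear; nia.
Qed.

(** At each scale [linking_far] reaches a distance that exceeds the width of the next scale, so the
    escape propagates through all scales [2 ^ j * N]. *)
Lemma linking_infinite (N : nat) (w : nat -> nat) S x :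
  (forall j, wide (w j) (2 ^ j * N) /\ linking (2 ^ j * N) (w j) S) ->
  (linf_dist 0 x <= 2 * N)%N -> esc (w 0) S x -> infinite_part S x.
Proof.
move=> hj bx ex; have N0 : (0 < N)%N.
  by have [[h1 h2] _] := hj 0%N; rewrite mul1n in h2; apply: leq_trans h2; rewrite expn_gt0; move: h1; clear; lia.
have bj j : (linf_dist 0 x <= 2 * (2 ^ j * N))%N.
  by apply: leq_trans bx _; rewrite leq_mul2l leq_pmull// expn_gt0.
have key j : esc (w j) S x.
  elim: j => // j IH; have [wj lj] := hj j; have [y xy far] := linking_far wj lj (bj j) IH.
  exists y => //; apply: leq_trans far; have [h _] := wide_le (hj j.+1).1.
  by move: h; rewrite expnS; clear; lia.
apply/infinite_partE; split; first exact: esc_site ex.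
move=> n; have [wj lj] := hj n; have [y xy far] := linking_far wj lj (bj n) (key n).
exists y => //; apply: leq_trans far; apply: leq_trans (ltnW (ltn_expl n (isT : 1 < 2)%N)) _.
by rewrite leq_pmulr.
Qed.

(** Cut the path at its first site at distance at least [w]: since steps are unit, that site is at
    distance [w], and only the ball of radius [w] is inspected. *)
Lemma esc_local w (xi xi' : config d) x : (forall v, (linf_dist x v <= w)%N -> xi v = xi' v) ->
  esc w (occupied xi) x -> esc w (occupied xi') x.
Proof.
move=> e [z [p [p1 p2 p3]] far].
have hp : has (fun v => (w <= linf_dist x v)%N) (x :: p).
  by apply/hasP; exists z => //; rewrite -p2; exact: mem_last.
have [q1 [v [q2 [ep wv nq]]]] := split_first hp.
have nq' u : u \in q1 -> (linf_dist x u < w)%N.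
  by move=> uq; rewrite ltnNge; apply/negP => h; move/hasP: nq; apply; exists u.
case: q1 ep nq nq' => [|a q1] [ex ep] nq nq'.
  exists x; last by move: wv; rewrite -ex.
  by apply: connected_refl; rewrite /occupied /= -e ?linf_dist0//; apply: p3; exact: mem_head.
rewrite -ex in nq'; exists v => //; exists (rcons q1 v); split.
- by move: p1; rewrite ep -cat_rcons cat_path => /andP[].
- by rewrite last_rcons.
move=> u; rewrite -rcons_cons mem_rcons inE => /predU1P[->|uq].
  rewrite /occupied /= -e; first by apply: p3; rewrite ep mem_cons_cat mem_head orbT.
  have vl : adj (last x q1) v by move: p1; rewrite ep cat_path /= => /and3P[].
  apply: leq_trans (linf_triangle (last x q1) x v) _.
  apply: leq_trans (leq_add (leqnn _) (adj_linf vl)) _; rewrite addn1.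
  exact: nq' (mem_last _ _).
rewrite /occupied /= -e; first by apply: p3; rewrite ep mem_cons_cat uq.
exact: ltnW (nq' _ uq).
Qed.

End LinkingConsequences.

(** * Conditions S1 and S2 and the chemical distance *)

Section QuantitativeConditions.
Context {R : realType} {d : nat}.
Context {disp : measure_display} {Omega : measurableType disp}.
Context {P : probability Omega R} {phi : Zd d -> {RV P >-> R}}.
Hypothesis d3 : (3 <= d)%N.
Hypothesis hphi : is_GFF phi.
Variables (h1 : R) (N0 : nat) (w : nat -> nat) (E : nat -> set (config d)).
Local Notation Q h := (excursion_law phi h).
Hypothesis mE : forall N, measurable (E N).
Hypothesis wE : forall N, (N0 <= N)%N -> wide (d := d) (w N) N.
Hypothesis lE : forall N xi, (N0 <= N)%N -> E N xi -> linking N (w N) (occupied xi).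
Hypothesis pE : forall h N, h <= h1 -> (N0 <= N)%N -> pr (Q h) (~` E N) <= expR (- (ln N%:R) ^+ 2).

Lemma pE_ge h N (A : set (config d)) : h <= h1 -> (N0 <= N)%N -> measurable A -> E N `<=` A ->
  ((1 - expR (- (ln N%:R) ^+ 2))%:E <= Q h A)%E.
Proof.
move=> hh NN mA EA; rewrite prE// lee_fin; have := pE hh NN; rewrite prC//.
have := pr_le (Q h) (mE N) mA EA; lra.
Qed.

Lemma gff_S1 (h_star u_bar : R) : (forall u, u_bar < u -> h_star - u + 1 <= h1) ->
  S1 u_bar%:E +oo (fun u => Q (h_star - u + 1))
    (fun _ N => if (N0 <= N)%N then (ln N%:R) ^+ 2 else 0) (fun=> 1).
Proof.
move=> hu; split.
  move=> u _; split=> //; exists N0%:R => N; rewrite ler_nat => NN; rewrite NN.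
  have [e|N1] := posnP N; first by rewrite e ln0// (_ : 1 + 1 = 2%:R :> R)// powR_mulrn.
  by rewrite (_ : 1 + 1 = 2%:R :> R)// powR_mulrn// ln_ge0// (ler_nat R 1).
move=> u N /andP[]; rewrite lte_fin => /hu hh _ N1.
have mI x : measurable [set xi : config d | (large_part (occupied xi) (N%:R : R) `&` box 0 (N%:R : R)) x].
  by apply: measurable_and; [exact: measurable_large_part|exact: measurable_prop].
have mI' x : measurable [set xi : config d | (large_part (occupied xi) (N%:R / 10 : R) `&` box 0 (N%:R : R)) x].
  by apply: measurable_and; [exact: measurable_large_part|exact: measurable_prop].
have m1 : measurable [set xi : config d | large_part (occupied xi) (N%:R : R) `&` box 0 (N%:R : R) !=set0].
  exact: measurable_ex.
have m2 : measurable [set xi : config d | let S := occupied xi in forall x y,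
            (large_part S (N%:R / 10 : R) `&` box 0 (N%:R : R)) x ->
            (large_part S (N%:R / 10 : R) `&` box 0 (N%:R : R)) y ->
            connected_in (S `&` box 0 (2 * N%:R : R)) x y].
  apply: measurable_all => x; apply: measurable_all => y.
  by apply: measurable_imp => //; apply: measurable_imp => //; exact: measurable_conn.
(* Below [N0] the function [f_S] is 0, and the bounds only ask for a nonnegative probability. *)
have [NN|NN] := leqP N0 N; last first.
  by rewrite oppr0 expR0 subrr; split; exact: measure_ge0.
split; apply: pE_ge => // xi Exi.
  exact: linking_large d3 _ _ _ _ (wE NN) (lE NN Exi).
exact: linking_connected d3 _ _ _ _ (wE NN) (lE NN Exi).
Qed.

Lemma gff_chemical h : h <= h1 -> chemical_distance_bound (Q h) 1.
Proof.
move=> hh; pose lN := ln N0.+2%:R : R.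
have lN0 : 0 <= lN by rewrite ln_ge0// (ler_nat R 1).
(* The constant 1/2 absorbs the rounding of [r] to [N] through (ln N + 1)^2 / 2 <= (ln N)^2 + 1;
   [C0] makes the bound trivial when [N < N0]; [8 * d + 1] is the constant of [linking_dist]. *)
pose c : R := 2^-1; pose C0 : R := expR (1 + lN ^+ 2); pose C : R := C0 + (8 * d + 1)%:R.
have C00 : 0 <= C0 by exact: expR_ge0.
exists c, C; split; first by rewrite invr_gt0.
move=> r r1; have lr0 : 0 <= ln r by rewrite ln_ge0.
rewrite (_ : 1 + 1 = 2%:R :> R)// powR_mulrn//.
pose N := Num.truncn r; have r0 : 0 <= r by lra.
have Nr : N%:R <= r by rewrite truncn_le.
have rN : r < N.+1%:R by exact: truncnS_gt.
have N1 : (1 <= N)%N by rewrite -ltnS -(ltr_nat R); apply: le_lt_trans rN.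
have mS : measurable [set xi : config d | let S := occupied xi in forall x y,
   (large_part S r `&` box 0 r) x -> (large_part S r `&` box 0 r) y -> (graph_dist R S x y <= (C * r)%:E)%E].
  have mI x : measurable [set xi : config d | (large_part (occupied xi) r `&` box 0 r) x].
    by apply: measurable_and; [exact: measurable_large_part|exact: measurable_prop].
  apply: measurable_all => x; apply: measurable_all => y.
  by apply: measurable_imp => //; apply: measurable_imp => //; exact: measurable_graph_dist.
have e0 : 0 <= expR (- c * ln r ^+ 2) by exact: expR_ge0.
have [NN|NN] := leqP N0 N; last first.
  apply: le_trans (measure_ge0 _ _); rewrite lee_fin subr_le0.
  apply: le_trans (_ : C0 * expR (- c * ln r ^+ 2) <= _); last by rewrite ler_wpM2r// lerDl.
  rewrite /C0 -expRD -[leLHS](@expR0 R) ler_expR.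
  have : ln r <= lN.
    rewrite ler_ln ?posrE ?ltr0n//; last by lra.
    by apply: le_trans (ltW rN) _; rewrite ler_nat; move: NN; clear; lia.
  rewrite /c; nra.
have EA : E N `<=` [set xi : config d | let S := occupied xi in forall x y,
   (large_part S r `&` box 0 r) x -> (large_part S r `&` box 0 r) y -> (graph_dist R S x y <= (C * r)%:E)%E].
  move=> xi Exi S x y [lx bx] [ly by'].
  have b (v : Zd d) : box 0 r v -> (linf_dist 0 v <= N)%N.
    rewrite /box /= floor_ge_int -pmulrn => vr.
    by rewrite -ltnS -(ltr_nat R); apply: le_lt_trans vr rN.
  have [|p pp sp] := linking_dist (r := r) d3 (wE NN) (lE NN Exi) _ lx ly (b x bx) (b y by').
    by lra.
  apply/graph_distE; exists p => //; apply: le_trans (_ : ((8 * d + 1) * N)%:R <= _).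
    by rewrite ler_nat.
  rewrite natrM; apply: ler_pM => //; by rewrite lerDr.
apply: le_trans (pE_ge hh NN mS EA); rewrite lee_fin lerD2l lerN2.
apply: le_trans (_ : C0 * expR (- c * ln r ^+ 2) <= _); last by rewrite ler_wpM2r// lerDl.
rewrite /C0 -expRD ler_expR.
have NR1 : 1 <= N%:R :> R by rewrite (ler_nat R 1).
have lN1 : 0 <= ln N%:R :> R by rewrite ln_ge0.
have : ln r <= ln N%:R + 1.
  apply: le_trans (_ : ln (N%:R * expR 1) <= _); last by rewrite lnM ?posrE ?expR_gt0 ?expRK//; lra.
  rewrite ler_ln ?posrE; [|lra|by rewrite mulr_gt0 ?expR_gt0//; lra].
  have := @expR_ge1Dx R 1; have := ltW rN; rewrite -natr1; nra.
move=> lr1; have s1 : ln r ^+ 2 <= (ln N%:R + 1) ^+ 2 by rewrite lerXn2r ?nnegrE ?addr_ge0.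
have s2 := sqr_ge0 (ln N%:R - 1 : R); have s3 := sqr_ge0 lN.
by rewrite /c; move: s1 s2 s3; rewrite sqrrB sqrrD expr1n; lra.
Qed.

Definition good_from k : set (config d) := [set xi | forall j, (k <= j)%N -> E (2 ^ j)%N xi].

Lemma measurable_good_from k : measurable (good_from k).
Proof. by apply: measurable_all => j; apply: measurable_imp; [exact: measurable_prop|exact: mE]. Qed.

(** Once ln (2^k) >= 2, exp (- (ln (2^k))^2) is at most 4^-k. The rate 4 rather than 2 is what makes
    passage times integrable, since these are of order 2^k on [good_from k]. *)
Lemma good_from_prob_quarter : exists k0 : nat, forall k, (k0 <= k)%N -> (N0 <= 2 ^ k)%N /\
  forall h, h <= h1 -> pr (Q h) (~` good_from k) <= 2 / 4 ^+ k.
Proof.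
have l2 : 0 < ln 2 :> R by apply: ln_gt0; lra.
pose k0 := maxn N0 (Num.truncn (2 / ln 2 : R)).+1.
have big k : (k0 <= k)%N -> (N0 <= 2 ^ k)%N /\ 2 <= ln (2 ^ k)%:R :> R.
  rewrite geq_max => /andP[a b]; split; first by apply: leq_trans a (ltnW (ltn_expl _ _)).
  rewrite natrX lnXn// -[ln 2 *+ k]mulr_natl -(ler_pdivrMr _ _ l2).
  by apply: le_trans (ltW (truncnS_gt _)) _; rewrite ler_nat.
have one k h : (k0 <= k)%N -> h <= h1 -> pr (Q h) (~` E (2 ^ k)%N) <= (4 ^+ k)^-1.
  move=> /big[a b] hh; apply: le_trans (pE hh a) _.
  have p0 : 0 < (2 ^ k)%:R :> R by rewrite ltr0n expn_gt0.
  apply: le_trans (_ : expR (- (ln (2 ^ k)%:R + ln (2 ^ k)%:R)) <= _); first by rewrite ler_expR; nra.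
  rewrite expRN expRD lnK ?posrE// natrX -exprMn (_ : 2 * 2 = 4 :> R)//.
  by rewrite -natrM.
exists k0 => k kk; split; first by have [] := big k kk.
move=> h hh; pose U n := \big[setU/set0]_(i < n) (~` E (2 ^ (k + i))%N).
have mU n : measurable (U n) by apply: bigsetU_measurable => i _; apply: measurableC.
have -> : ~` good_from k = \bigcup_n U n.
  apply/seteqP; split=> xi /=.
    move=> /existsNP[j /not_implyP[kj nE]]; exists (j - k).+1 => //.
    by rewrite /U big_ord_recr /=; right; rewrite subnKC.
  move=> [n _]; rewrite /U -(bigcup_mkord n (fun i => ~` E (2 ^ (k + i))%N)) => -[i _ nE] gf; apply: nE; apply: gf; exact: leq_addr.
have := @pr_cvg_ndecr _ _ _ (Q h) U mU.
have nd : nondecreasing_seq U.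
  move=> i j ij; apply/subsetPset.
  by apply: (@subset_bigsetU _ (fun a => ~` E (2 ^ (k + a))%N)).
move=> /(_ nd) cU.
have bd n : pr (Q h) (U n) <= 2 / 4 ^+ k.
  have p0 : 0 < 4 ^+ k :> R by rewrite exprn_gt0.
  suff : pr (Q h) (U n) <= (2 - 2 / 4 ^+ n) / 4 ^+ k.
    move=> h'; apply: le_trans h' _; rewrite ler_pM2r ?invr_gt0// gerBl divr_ge0// exprn_ge0//.
  elim: n => [|n IH]; first by rewrite /U big_ord0 pr_set0 expr0 divr1 subrr mul0r.
  rewrite /U big_ord_recr /=; apply: le_trans (prU_le _ (mU n) _) _; first exact: measurableC.
  apply: le_trans (lerD IH (one (k + n)%N h _ hh)) _; first by apply: leq_trans kk (leq_addr _ _).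
  rewrite exprD exprS !invfM; have q0 : 0 < (4 ^+ n)^-1 :> R by rewrite invr_gt0 exprn_gt0.
  have p1 : 0 < (4 ^+ k)^-1 :> R by rewrite invr_gt0.
  nra.
rewrite -(cvg_lim _ cU)//; apply: limr_le; first by apply/cvg_ex; eexists; exact: cU.
exact: nearW.
Qed.

Lemma good_from_prob : exists k0 : nat, forall k, (k0 <= k)%N -> (N0 <= 2 ^ k)%N /\
  forall h, h <= h1 -> pr (Q h) (~` good_from k) <= 2 / 2 ^+ k.
Proof.
have [k0 hk] := good_from_prob_quarter; exists k0 => k /hk[Nk pk]; split=> // h /pk le1.
apply: le_trans le1 _; rewrite ler_pM2l// lef_pV2 ?posrE ?exprn_gt0//.
by apply: lerXn2r; rewrite ?nnegrE//; lra.
Qed.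

Lemma good_from_wide k j xi : (N0 <= 2 ^ k)%N -> (k <= j)%N -> good_from k xi ->
  wide (d := d) (w (2 ^ j)) (2 ^ j) /\ linking (2 ^ j) (w (2 ^ j)) (occupied xi).
Proof.
move=> Nk kj gf; have Nj : (N0 <= 2 ^ j)%N by apply: leq_trans Nk _; rewrite leq_exp2l.
by split; [exact: wE|apply: lE => //; exact: gf].
Qed.

Lemma good_from_infinite k x xi : (N0 <= 2 ^ k)%N -> good_from k xi ->
  (linf_dist 0 x <= 2 * 2 ^ k)%N -> esc (w (2 ^ k)) (occupied xi) x -> infinite_part (occupied xi) x.
Proof.
move=> Nk gf bx ex; apply: (@linking_infinite _ d3 (2 ^ k) (fun j => w (2 ^ j * 2 ^ k))) bx _ => //.
- move=> j; rewrite -expnD; apply: good_from_wide gf => //; exact: leq_addl.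
- by rewrite mul1n.
Qed.

Definition inf0 : set (config d) := [set xi | infinite_part (occupied xi) 0].

(** [good_from k] has probability at least 1/2 and forces an infinite cluster to meet a fixed box;
    some site of the box thus has positive probability to be in it, and by stationarity so has the
    origin. *)
Lemma inf_pos h : h <= h1 -> 0 < pr (Q h) inf0.
Proof.
move=> hh; have [k0 hk] := good_from_prob.
pose k := maxn k0 2; have [Nk pk] := hk k (leq_maxl _ _).
have mI x := measurable_infinite_part x : measurable [set xi : config d | infinite_part (occupied xi) x].
have g : 2^-1 <= pr (Q h) (good_from k).
  have := pk h hh; rewrite prC; last exact: measurable_good_from.
  have : 2 / 2 ^+ k <= 2^-1 :> R.
    have : 2 ^+ 2 <= 2 ^+ k :> R by rewrite ler_eXn2l// ?leq_maxr//; lra.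
    have p0 : 0 < 2 ^+ k :> R by rewrite exprn_gt0.
    by rewrite ler_pdivrMr//; lra.
  lra.
have sub : good_from k `<=` \big[setU/set0]_(x <- ball_seq 0 (2 * 2 ^ k)) [set xi : config d | infinite_part (occupied xi) x].
  move=> xi gf; have [wk lk] := good_from_wide Nk (leqnn k) gf.
  have [x bx ex] := linking_point wk lk; have [w40 _] := wide_le wk.
  have bx' : (linf_dist 0 x <= 2 * 2 ^ k)%N by move: bx w40; clear; lia.
  rewrite -bigcup_seq; exists x; first by rewrite /= mem_ball_seq.
  exact: good_from_infinite gf _ ex.
have mU : measurable (\big[setU/set0]_(x <- ball_seq 0 (2 * 2 ^ k)) [set xi : config d | infinite_part (occupied xi) x]).
  exact: bigsetU_measurable.
have le1 := le_trans (pr_le (Q h) (measurable_good_from k) mU sub) (pr_bigcup_le _ _ mI).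
have eqx x : pr (Q h) [set xi : config d | infinite_part (occupied xi) x] = pr (Q h) inf0.
  have -> : [set xi : config d | infinite_part (occupied xi) x] = Defs.shift x @^-1` inf0.
    apply/seteqP; split=> xi; rewrite /inf0 /= => hx; first by apply/infinite_shift; rewrite add0r.
    by move/infinite_shift: hx; rewrite add0r.
  by rewrite /pr excursion_shift//; exact: mI.
rewrite lt_neqAle pr_ge0 andbT; apply/negP => /eqP e.
move: le1; rewrite big1 => [|x _]; last by rewrite eqx -e.
by move: g; lra.
Qed.

(** Escape to a finite distance is a local event, and on [good_from k] it implies connection to
    infinity. The error is uniform over [h <= h1], so continuity of [eta] follows as for a uniform
    limit. *)
Lemma inf_approx h k : h <= h1 -> (N0 <= 2 ^ k)%N ->
  `|pr (Q h) inf0 - pr (Q h) [set xi : config d | esc (w (2 ^ k)) (occupied xi) 0]| <= pr (Q h) (~` good_from k).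
Proof.
move=> hh Nk; have mE0 := measurable_esc (w (2 ^ k)) (0 : Zd d).
have mI0 : measurable inf0 by exact: measurable_infinite_part.
have mG := measurable_good_from k.
have s1 : inf0 `<=` [set xi : config d | esc (w (2 ^ k)) (occupied xi) 0].
  by move=> xi /infinite_partE[_]; exact.
have s2 : [set xi : config d | esc (w (2 ^ k)) (occupied xi) 0] `<=` inf0 `|` ~` good_from k.
  move=> xi ex; have [gf|gf] := pselect (good_from k xi); last by right.
  by left; apply: good_from_infinite gf _ ex => //; rewrite linf_dist0.
have := pr_le (Q h) mI0 mE0 s1.
have := le_trans (pr_le (Q h) mE0 (measurableU _ _ mI0 (measurableC mG)) s2) (prU_le _ mI0 (measurableC mG)).
by rewrite ler_norml; move=> a b; apply/andP; split; lra.
Qed.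

Lemma local_level (A : set (config d)) (s : seq (Zd d)) (delta h h' : R) : measurable A ->
  (forall xi xi' : config d, (forall v, v \in s -> xi v = xi' v) -> A xi -> A xi') ->
  `|h - h'| <= delta ->
  `|pr (Q h) A - pr (Q h') A| <= pr P (\big[setU/set0]_(x <- s) [set w | `|phi x w - h| <= delta]).
Proof.
move=> mA lA hd; set N := \big[setU/set0]_(x <- s) _.
have mN : measurable N.
  apply: bigsetU_measurable => x _.
  have mAb : measurable_fun setT (fun w => `|phi x w - h|).
    by apply: measurableT_comp => //; apply: measurable_funB => //; exact: measurable_funPT.
  by rewrite -[X in measurable X]setTI; exact: (measurable_fun_le measurableT mAb (measurable_cst _)).
have agree w0 : ~ N w0 -> forall v, v \in s -> excursion phi h w0 v = excursion phi h' w0 v.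
  move=> nN v vs; have : ~ (`|phi v w0 - h| <= delta).
    by move=> hv; apply: nN; rewrite /N -bigcup_seq; exists v.
  move=> /negP; rewrite -ltNge => hv; rewrite /excursion.
  move: hd hv; rewrite ler_norml => /andP[a b]; rewrite real_lter_normr ?num_real//.
  by case/orP => hv; apply/idP/idP; lra.
have mQ l : measurable (excursion phi l @^-1` A) by exact: exc_pre.
have half l l' : (forall w0, ~ N w0 -> forall v, v \in s -> excursion phi l w0 v = excursion phi l' w0 v) ->
    pr (Q l) A <= pr (Q l') A + pr P N.
  move=> ag; apply: le_trans (_ : pr P ((excursion phi l' @^-1` A) `|` N) <= _); last exact: prU_le.
  rewrite -[leLHS]/(pr P (excursion phi l @^-1` A)); apply: pr_le => //; first exact: measurableU.
  move=> w0 hw; have [nw|nw] := pselect (N w0); [by right|left].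
  by apply: lA hw => v vs; exact: ag.
have a1 := half h h' agree; have a2 : pr (Q h') A <= pr (Q h) A + pr P N.
  by apply: half => w0 nw v vs; rewrite agree.
by rewrite ler_norml; apply/andP; split; lra.
Qed.

Lemma inf_continuous h : h < h1 -> forall e : R, 0 < e -> exists2 delta, 0 < delta &
  forall h', `|h - h'| <= delta -> `|pr (Q h) inf0 - pr (Q h') inf0| <= e.
Proof.
move=> hh e e0; have [k0 hk] := good_from_prob.
pose k := maxn k0 (Num.truncn (8 / e)).+1; have [Nk pk] := hk k (leq_maxl _ _).
have small : 2 / 2 ^+ k <= e / 4 :> R.
  have p0 : 0 < 2 ^+ k :> R by rewrite exprn_gt0.
  have : 8 / e <= 2 ^+ k.
    apply: le_trans (ltW (truncnS_gt _)) _; rewrite -natrX ler_nat.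
    by apply: leq_trans (leq_maxr k0 _) (ltnW (ltn_expl _ _)).
  rewrite ler_pdivrMr// ler_pdivrMr//; nra.
pose s := ball_seq (0 : Zd d) (w (2 ^ k)).
have e4 : 0 < e / 4 by lra.
have [dl dl0 hdl] := level_cont d3 hphi h s e4.
(* The second term keeps [h'] in the range where the approximation is uniform. *)
exists (Num.min dl (h1 - h)); first by rewrite lt_min dl0 subr_gt0.
move=> h' hd; have hdl' : `|h - h'| <= dl by apply: le_trans hd _; rewrite ge_min lexx.
have hh' : h' <= h1.
  have : `|h - h'| <= h1 - h by apply: le_trans hd _; rewrite ge_min lexx orbT.
  by rewrite ler_norml => /andP[]; lra.
have mE0 := measurable_esc (w (2 ^ k)) (0 : Zd d).
have loc : forall xi xi' : config d, (forall v, v \in s -> xi v = xi' v) ->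
    esc (w (2 ^ k)) (occupied xi) 0 -> esc (w (2 ^ k)) (occupied xi') 0.
  by move=> xi xi' ag; apply: esc_local => v hv; apply: ag; rewrite mem_ball_seq.
have b1 := local_level mE0 loc hdl'.
have b2 := le_trans (inf_approx (ltW hh) Nk) (pk h (ltW hh)).
have b3 := le_trans (inf_approx hh' Nk) (pk h' hh').
move: b1 b2 b3; set a := pr (Q h) inf0; set b := pr (Q h') inf0; set a' := pr (Q h) _; set b' := pr (Q h') _.
rewrite !ler_norml => /andP[? ?] /andP[? ?] /andP[? ?]; apply/andP; split; lra.
Qed.

Lemma gff_S2 (h_star u_bar : R) : (forall u, u_bar < u -> h_star - u + 1 < h1) ->
  S2 u_bar%:E +oo (fun u => Q (h_star - u + 1)).
Proof.
move=> hu; split.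
  by move=> u /andP[]; rewrite lte_fin => /hu hh _; exact/inf_pos/ltW.
apply: continuous_in_subspaceT => u /set_mem/andP[]; rewrite lte_fin => /hu hh _.
apply/cvgrPdist_le => e e0; have [dl dl0 hdl] := inf_continuous hh e0.
near=> u'; apply: hdl.
rewrite (_ : _ - _ = u' - u); last by ring.
rewrite distrC; near: u'; exact: cvgr_dist_le.
Unshelve. all: by end_near.
Qed.

End QuantitativeConditions.

(** * Subadditive ergodic bounds *)

Section Greedy.
Context {R : realType}.

(* Cover [0, M) greedily from the left by blocks [i, i + n) on which F is
   small, stepping by one where no such block of length at most N starts. *)
Lemma greedy (F : nat -> nat -> R) (g : nat -> R) (lam : R) (N : nat) (bad : nat -> bool) :
  0 <= lam -> (forall i, 0 <= g i) -> (forall i, F i i <= 0) ->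
  (forall i j k, (i <= j <= k)%N -> F i k <= F i j + F j k) ->
  (forall i, F i i.+1 <= g i) ->
  (forall i, ~~ bad i -> exists n, [/\ (0 < n)%N, (n <= N)%N & F i (i + n)%N <= lam * n%:R]) ->
  forall M, F 0 M <= lam * M%:R + \sum_(0 <= j < M) (bad j)%:R * g j + \sum_(0 <= j < M) (M <= j + N)%N%:R * g j.
Proof.
move=> lam0 g0 F0 sub Fg hgood M.
have key m : forall i, (i <= M)%N -> (M - i <= m)%N ->
  F i M <= lam * (M - i)%:R + \sum_(i <= j < M) (bad j)%:R * g j + \sum_(i <= j < M ) (M <= j + N)%N%:R * g j.
  elim: m => [|m IH] i iM im.
    have -> : i = M by apply/eqP; rewrite eqn_leq iM -subn_eq0 -leqn0.
    by rewrite subnn mulr0 !big_geq// !addr0.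
  have [e|] := eqVneq i M; first by rewrite e subnn mulr0 !big_geq// !addr0.
  move=> ne; have iM' : (i < M)%N by rewrite ltn_neqAle ne.
  have mono k : (i <= k <= M)%N -> 
      \sum_(k <= j < M) (bad j)%:R * g j + \sum_(k <= j < M ) (M <= j + N)%N%:R * g j <=
      \sum_(i <= j < M) (bad j)%:R * g j + \sum_(i <= j < M ) (M <= j + N)%N%:R * g j.
    move=> /andP[ik kM]; apply: lerD; rewrite [leRHS](big_cat_nat ik kM)/= lerDr.
      by apply: sumr_ge0 => j _; rewrite mulr_ge0.
    by apply: sumr_ge0 => j _; rewrite mulr_ge0.
  have step : (bad i \/ (M <= i + N)%N) -> F i M <= lam * (M - i)%:R + \sum_(i <= j < M) (bad j)%:R * g j +
      \sum_(i <= j < M ) (M <= j + N)%N%:R * g j.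
    move=> hb; have h := IH i.+1 iM' _.
    have {}h : F i.+1 M <= lam * (M - i.+1)%:R + \sum_(i.+1 <= j < M) (bad j)%:R * g j + \sum_(i.+1 <= j < M ) (M <= j + N)%N%:R * g j.
      by apply: h; move: im iM'; clear; lia.
    apply: le_trans (sub i i.+1 M _) _; first by rewrite leqnSn.
    apply: le_trans (lerD (Fg i) h) _.
    rewrite [X in _ <= _ + X + _](big_ltn iM') [X in _ <= _ + X](big_ltn iM').
    have l1 : lam * (M - i.+1)%:R <= lam * (M - i)%:R.
      by rewrite ler_wpM2l// ler_nat; clear; lia.
    have gi := g0 i; have b0 : 0 <= (bad i)%:R * g i by rewrite mulr_ge0.
    have c0 : 0 <= (M <= i + N)%N%:R * g i by rewrite mulr_ge0.
    by case: hb b0 c0 => ->; rewrite mul1r => b0 c0; move: l1; lra.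
  have [lM|Ml] := leqP M (i + N); first by apply: step; right.
  have [bi|gi] := boolP (bad i); first by apply: step; left.
  have [n [n0 nN Fn]] := hgood i gi.
  have inM : (i + n <= M)%N by move: nN Ml; clear; lia.
  have h := IH (i + n)%N inM _.
  have {}h : F (i + n)%N M <= lam * (M - (i + n))%:R + \sum_(i + n <= j < M) (bad j)%:R * g j + \sum_(i + n <= j < M ) (M <= j + N)%N%:R * g j.
    by apply: h; move: im n0; clear; lia.
  apply: le_trans (sub i (i + n)%N M _) _; first by rewrite leq_addr inM.
  apply: le_trans (lerD Fn h) _.
  have := mono (i + n)%N; rewrite leq_addr inM => /(_ erefl).
  have -> : (M - i)%:R = n%:R + (M - (i + n))%:R :> R by rewrite -natrD; congr (_%:R); move: inM; clear; lia.
  by rewrite mulrDr; lra.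
by have := key M 0%N (leq0n M); rewrite !subn0; apply.
Qed.
End Greedy.

Section ErgodicSums.
Context {R : realType} {disp : measure_display} {T : measurableType disp}.
Variable Q : probability T R.
Implicit Types (f g : T -> R) (A : set T).

Definition Ex f : R := fine (\int[Q]_x (f x)%:E).
Definition integ f : Prop := Q.-integrable setT (EFin \o f).

Lemma ExE f : integ f -> (\int[Q]_x (f x)%:E)%E = (Ex f)%:E.
Proof. by move=> fi; rewrite fineK//; exact: integrable_fin_num. Qed.

Lemma integ_meas f : integ f -> measurable_fun setT f.
Proof. by move=> /measurable_int /measurable_EFinP. Qed.

Lemma integD f g : integ f -> integ g -> integ (fun x => f x + g x).
Proof.
move=> fi gi; rewrite /integ (_ : _ \o _ = (EFin \o f) \+ (EFin \o g))%E; first exact: integrableD.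
by apply/funext => x /=; rewrite EFinD.
Qed.

Lemma ExD f g : integ f -> integ g -> Ex (fun x => f x + g x) = Ex f + Ex g.
Proof.
move=> fi gi; apply: EFin_inj; rewrite -ExE; last exact: integD.
by under eq_integral do rewrite EFinD; rewrite integralD// !ExE.
Qed.

Lemma integZ c f : integ f -> integ (fun x => c * f x).
Proof.
move=> fi; rewrite /integ (_ : _ \o _ = (fun x => c%:E * (EFin \o f) x))%E; last first.
  by apply/funext => x /=; rewrite EFinM.
exact: integrableZl.
Qed.

Lemma ExZ c f : integ f -> Ex (fun x => c * f x) = c * Ex f.
Proof.
move=> fi; apply: EFin_inj; rewrite -ExE; last exact: integZ.
by under eq_integral do rewrite EFinM; rewrite integralZl// ExE.
Qed.

Lemma integ_cst c : integ (fun=> c).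
Proof.
by apply: (@integrable_bounded _ _ _ Q (fun=> c) `|c|) => //; exact: measurable_cst.
Qed.

Lemma Ex_cst c : Ex (fun=> c) = c.
Proof.
rewrite /Ex integral_cst//; have /= -> := @probability_setT _ _ _ Q.
by rewrite mule1.
Qed.

Lemma Ex_le f g : integ f -> integ g -> (forall x, f x <= g x) -> Ex f <= Ex g.
Proof.
by move=> fi gi fg; rewrite -lee_fin -!ExE//; apply: le_integral => // x _; rewrite lee_fin.
Qed.

Lemma integ_le f g : measurable_fun setT f -> integ g -> (forall x, 0 <= f x <= g x) -> integ f.
Proof.
move=> mf gi fg; apply: (le_integrable measurableT _ _ gi); first exact/measurable_EFinP.
move=> x _ /=; have /andP[f0 fgx] := fg x; rewrite lee_fin !ger0_norm//; exact: le_trans fgx.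
Qed.

Lemma integ_sum (F : nat -> T -> R) n : (forall i, integ (F i)) -> integ (fun x => \sum_(0 <= i < n) F i x).
Proof.
move=> Fi; elim: n => [|n IH].
  by under eq_fun do rewrite big_geq//; exact: integ_cst.
by under eq_fun do rewrite big_nat_recr//=; exact: integD.
Qed.

Lemma Ex_sum (F : nat -> T -> R) n : (forall i, integ (F i)) ->
  Ex (fun x => \sum_(0 <= i < n) F i x) = \sum_(0 <= i < n) Ex (F i).
Proof.
move=> Fi; elim: n => [|n IH].
  by rewrite big_geq//; under eq_fun do rewrite big_geq//; exact: Ex_cst.
rewrite big_nat_recr//= -IH -ExD//; last exact: integ_sum.
by congr Ex; apply/funext => x; rewrite big_nat_recr.
Qed.

Definition ind A x : R := `[< A x >]%:R.

Lemma measurable_ind A : measurable A -> measurable_fun setT (ind A).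
Proof.
move=> mA; rewrite (_ : ind A = \1_A); first exact: measurable_indic.
by apply/funext => x; rewrite indicE /ind; congr (_%:R); apply/asboolP/idP => [/mem_set|/set_mem].
Qed.

Lemma integ_ind A : measurable A -> integ (ind A).
Proof.
move=> mA; apply: (integ_le (measurable_ind mA) (integ_cst 1)) => x.
by rewrite /ind; case: asboolP; rewrite ?lexx ?ler01.
Qed.

Lemma Ex_ind A : measurable A -> Ex (ind A) = pr Q A.
Proof.
move=> mA; rewrite /Ex /pr; congr fine.
rewrite (_ : ind A = \1_A); first by rewrite integral_indic// setIT.
by apply/funext => x; rewrite indicE /ind; congr (_%:R); apply/asboolP/idP => [/mem_set|/set_mem].
Qed.

Section Transformation.
Variable Tm : T -> T.
Hypothesis mT : measurable_fun setT Tm.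
Hypothesis pT : forall A, measurable A -> Q (Tm @^-1` A) = Q A.

Lemma preT A : measurable A -> measurable (Tm @^-1` A).
Proof. by move=> mA; rewrite -[X in measurable X]setTI; exact: mT. Qed.

Lemma int_T f : measurable_fun setT f -> (forall x, 0 <= f x) ->
  (\int[Q]_x (f (Tm x))%:E = \int[Q]_x (f x)%:E)%E.
Proof.
move=> mf f0.
transitivity (\int[pushforward Q Tm]_x (f x)%:E)%E.
  symmetry; apply: (etrans (ge0_integral_pushforward mT Q measurableT _ _)) => //.
  - exact/measurable_EFinP.
  - by move=> x _; rewrite lee_fin.
by apply: eq_measure_integral => A mA _; exact: pT.
Qed.

Lemma integ_T f : integ f -> (forall x, 0 <= f x) -> integ (fun x => f (Tm x)).
Proof.
move=> fi f0; have mf := integ_meas fi; apply/integrableP; split.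
  by apply/measurable_EFinP; exact: measurableT_comp.
under eq_integral do rewrite /= ger0_norm//.
by rewrite (int_T mf f0) ExE// ltry.
Qed.

Lemma Ex_T f : integ f -> (forall x, 0 <= f x) -> Ex (fun x => f (Tm x)) = Ex f.
Proof. by move=> fi f0; rewrite /Ex (int_T (integ_meas fi) f0). Qed.

Lemma iterT_meas n : measurable_fun setT (iter n Tm).
Proof. by elim: n => [|n IH]; [exact: measurable_id|exact: measurableT_comp]. Qed.

Lemma iterT_pres n A : measurable A -> Q (iter n Tm @^-1` A) = Q A.
Proof.
elim: n A => // n IH A mA; rewrite -[RHS](pT mA) -(IH (Tm @^-1` A))//; exact: preT.
Qed.

Lemma integ_iterT f n : integ f -> (forall x, 0 <= f x) ->
  integ (fun x => f (iter n Tm x)) /\ Ex (fun x => f (iter n Tm x)) = Ex f.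
Proof.
move=> fi f0; elim: n => // n [IH1 IH2]; split.
  under eq_fun do rewrite iterSr; exact: (integ_T IH1).
by under eq_fun do rewrite iterSr; rewrite (Ex_T IH1).
Qed.

Definition ergodic_map := forall G, measurable G -> Tm @^-1` G = G -> pr Q G = 0 \/ pr Q G = 1.
Hypothesis eT : ergodic_map.

(** By stationarity [C] has the probability of the decreasing intersection of its preimages, which
    is exactly invariant. *)
Lemma sub_invariant C : measurable C -> Tm @^-1` C `<=` C -> pr Q C = 0 \/ pr Q C = 1.
Proof.
move=> mC sC; pose D n := iter n Tm @^-1` C.
have mD n : measurable (D n).
  by rewrite -[X in measurable X]setTI; apply: iterT_meas.
have -> : pr Q C = pr Q (\bigcap_n D n).
  have nD : nonincreasing_seq D.
    apply/nonincreasing_seqP => n; apply/subsetPset => x; rewrite /D /= -iterS iterSr => h.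
    by apply: sC; rewrite /preimage /= -iterS iterSr.
  have := @pr_cvg_nincr _ _ _ Q D mD nD; rewrite (_ : (fun n => _) = fun=> pr Q C); last first.
    by apply/funext => n; rewrite /pr iterT_pres.
  by move=> /cvg_lim <- //; rewrite lim_cst.
apply: eT; first exact: bigcap_measurable.
apply/seteqP; split=> x h n _; last by have := h n.+1 I; rewrite /D /= -iterSr.
case: n => [|n]; last by have := h n I; rewrite /D /= -iterSr.
by apply: sC; exact: (h 0%N I).
Qed.

Section Subadditive.
Variables (f : nat -> T -> R) (g1 : T -> R).
Hypothesis fi : forall n, integ (f n).
Hypothesis f0 : forall x, f 0%N x <= 0.
Hypothesis fsub : forall n m x, f (n + m)%N x <= f n x + f m (iter n Tm x).
Hypothesis g1i : integ g1.
Hypothesis g1_ge0 : forall x, 0 <= g1 x.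
Hypothesis fg1 : forall x, f 1%N x <= g1 x.

Definition small lam N : set T := [set x | exists n, [/\ (0 < n)%N, (n <= N)%N & f n x <= lam * n%:R]].

Lemma measurable_small lam N : measurable (small lam N).
Proof.
rewrite (_ : small lam N = \bigcup_(n in [set n | (0 < n <= N)%N]) [set x | f n x <= lam * n%:R]).
  apply: bigcup_measurable => n _; rewrite -[X in measurable X]setTI.
  exact: (measurable_fun_le measurableT (integ_meas (fi n)) (measurable_cst _)).
apply/seteqP; split=> x; first by move=> [n [h1 h2 h3]]; exists n => //=; rewrite h1.
by move=> [n /= /andP[h1 h2] h3]; exists n.
Qed.

Lemma count_last M N : \sum_(0 <= j < M) (M <= j + N)%N%:R <= N%:R :> R.
Proof.
rewrite (big_cat_nat (n := (M - N)%N))//= ?leq_subr// big_nat big1 ?add0r; last first.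
  move=> j /andP[_ jM]; rewrite leqNgt (_ : (j + N < M)%N)//; move: jM; clear; lia.
apply: le_trans (_ : \sum_(M - N <= j < M) 1 <= _).
  by apply: ler_sum => j _; case: (_ <= _)%N.
by rewrite sumr_const_nat -[leLHS]mulr_natl mulr1 ler_nat; clear; lia.
Qed.

(** Take the mean of the greedy covering bound on [0, M), divide by M and let M grow: bad starting
    points cost the mean of [g1] off [small], and the contribution of the last [N] steps
    disappears. *)
Lemma small_bound lam mu N : 0 <= lam -> (forall n, (0 < n)%N -> mu * n%:R <= Ex (f n)) ->
  mu <= lam + Ex (fun x => ind (~` small lam N) x * g1 x).
Proof.
move=> lam0 hmu; set h := fun x => _.
have h0 x : 0 <= h x by rewrite mulr_ge0.
have mS := measurable_small lam N.
have hi : integ h.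
  apply: (integ_le _ g1i) => [|x].
    by apply: measurable_funM; [exact/measurable_ind/measurableC|exact: integ_meas].
  by rewrite h0 /= /h /ind; case: asboolP => _; rewrite ?mul1r ?mul0r.
pose c := Ex g1.
have c0 : 0 <= c by apply: fine_ge0; apply: integral_ge0 => x _; rewrite lee_fin.
have key M : (0 < M)%N -> mu * M%:R <= lam * M%:R + M%:R * Ex h + N%:R * c.
  move=> M0; apply: le_trans (hmu M M0) _.
  pose rhs x := lam * M%:R + \sum_(0 <= j < M) h (iter j Tm x) +
                \sum_(0 <= j < M) (M <= j + N)%N%:R * g1 (iter j Tm x).
  have i1 j : integ (fun x => h (iter j Tm x)) by have [] := integ_iterT j hi h0.
  have i2 j : integ (fun x => g1 (iter j Tm x)) by have [] := integ_iterT j g1i g1_ge0.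
  have i3 j : integ (fun x => (M <= j + N)%N%:R * g1 (iter j Tm x)) by exact: integZ.
  have i12 := integD (integ_cst (lam * M%:R)) (integ_sum M i1).
  have ir : integ rhs by exact: integD i12 (integ_sum M i3).
  have fr x : f M x <= rhs x.
    pose F i j := f (j - i)%N (iter i Tm x).
    have := @greedy R F (fun j => g1 (iter j Tm x)) lam N (fun j => `[< (~` small lam N) (iter j Tm x) >]) lam0.
    have F1 : (forall i, 0 <= g1 (iter i Tm x)) by [].
    have F2 i : F i i <= 0 by rewrite /F subnn.
    have F3 i j k : (i <= j <= k)%N -> F i k <= F i j + F j k.
      move=> /andP[ij jk]; rewrite /F; have := fsub (j - i) (k - j) (iter i Tm x).
      by rewrite -iterD subnK// (_ : (j - i + (k - j) = k - i)%N)//; move: ij jk; clear; lia.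
    have F4 i : F i i.+1 <= g1 (iter i Tm x) by rewrite /F subSnn.
    move=> /(_ F1 F2 F3 F4) hg; have := hg _ M; rewrite /F subn0 /=; apply => i.
    move=> /asboolPn/contrapT[n [n0 nN fn]]; exists n; split=> //.
    by rewrite addKn.
  apply: le_trans (Ex_le (fi M) ir fr) _.
  rewrite /rhs ExD//; last exact: integ_sum.
  rewrite ExD//; [|exact: integ_cst|exact: integ_sum].
  rewrite Ex_cst !Ex_sum// lerD//.
    rewrite lerD2l; under eq_bigr do rewrite (integ_iterT _ hi h0).2.
    by rewrite sumr_const_nat subn0 mulr_natl.
  under eq_bigr do rewrite (ExZ _ (i2 _)) (integ_iterT _ g1i g1_ge0).2.
  by rewrite -mulr_suml ler_wpM2r// count_last.
apply/ler_addgt0Pl => e e0; pose M := (Num.truncn (N%:R * c / e)).+1.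
have M0 : 0 < M%:R :> R by rewrite ltr0n.
have hM : N%:R * c / e <= M%:R by apply: ltW; exact: truncnS_gt.
rewrite (ler_pdivrMr _ _ e0) in hM.
by rewrite -(ler_pM2r M0); have := key M isT; move: hM; lra.
Qed.

(** As [N] grows the exceptional sets shrink to a null set, and dominated convergence removes the
    error term of [small_bound]. *)
Lemma small_full_le lam mu : 0 <= lam -> (forall n, (0 < n)%N -> mu * n%:R <= Ex (f n)) ->
  pr Q (\bigcup_N small lam N) = 1 -> mu <= lam.
Proof.
move=> lam0 hmu p1; pose h N x := ind (~` small lam N) x * g1 x.
have mU : measurable (\bigcup_N small lam N) by apply: bigcup_measurable => N _; exact: measurable_small.
have mh N : measurable_fun setT (EFin \o h N).
  apply/measurable_EFinP; apply: measurable_funM; last exact: integ_meas.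
  by apply: measurable_ind; apply: measurableC; exact: measurable_small.
have ae0 : \forall x \ae Q, setT x -> (EFin \o h N) x @[N --> \oo] --> (cst 0%E : T -> \bar R) x.
  exists (~` \bigcup_N small lam N); split; first exact: measurableC.
    by rewrite (prE Q (measurableC mU)) prC// p1 subrr.
  move=> x /= hx hU; apply: hx => _; have [N _ sN] := hU.
  apply: cvg_near_cst; exists N => // n /= Nn; rewrite /h /ind.
  rewrite (_ : `[< _ >] = false) ?mul0r//; apply/asboolPn => /= hn; apply: hn.
  by have [m [m1 m2 m3]] := sN; exists m; split=> //; exact: leq_trans Nn.
have [|_ _] := dominated_convergence measurableT mh (measurable_cst _) ae0 g1i.
  apply: aeW => x N _ /=; rewrite lee_fin ger0_norm /h /ind; case: asboolP => _; rewrite ?mul1r ?mul0r//.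
rewrite integral0 => cv.
have cvR : (fun N => Ex (h N)) @ \oo --> (0 : R) by apply: fine_cvg; exact: cv.
have cc : (fun N => lam + Ex (h N)) @ \oo --> lam + 0 by apply: cvgD => //; exact: cvg_cst.
have : mu <= limn (fun N => lam + Ex (h N)).
  apply: limr_ge; first by apply/cvg_ex; eexists; exact: cc.
  by apply: nearW => N; exact: small_bound.
by rewrite (cvg_lim _ cc)// addr0.
Qed.

End Subadditive.

Lemma inv_small (e : R) : 0 < e -> exists j : nat, j.+1%:R^-1 < e.
Proof.
move=> e0; exists (Num.truncn e^-1); rewrite -[ltRHS]invrK ltf_pV2 ?posrE ?invr_gt0//.
exact: truncnS_gt.
Qed.

Definition full A := measurable A /\ pr Q A = 1.

Lemma full_all (I : countType) (F : I -> T -> Prop) :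
  (forall i, full [set x | F i x]) -> full [set x | forall i, F i x].
Proof.
move=> hF; pose G n := if @unpickle I n is Some i then ~` [set x | F i x] else set0.
have mG n : measurable (G n).
  by rewrite /G; case: unpickle => // i; apply: measurableC; have [] := hF i.
have G0 n : pr Q (G n) = 0.
  rewrite /G; case: unpickle => [i|]; last exact: pr_set0.
  by have [mF F1] := hF i; rewrite prC// F1 subrr.
have eU : [set x | forall i, F i x] = ~` \bigcup_n G n.
  apply/seteqP; split=> x /=; first by move=> h [n _]; rewrite /G; case: unpickle => // i; apply.
  move=> h i; apply: contrapT => nF; apply: h; exists (pickle i) => //.
  by rewrite /G pickleK.
have mU : measurable (\bigcup_n G n) by exact: bigcup_measurable.
split; rewrite eU; first exact: measurableC.
rewrite prC// (_ : pr Q (\bigcup_n G n) = 0) ?subr0//.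
pose U n := \big[setU/set0]_(i < n) G i.
have UE : \bigcup_n G n = \bigcup_n U n.
  apply/seteqP; split=> x [n _ h]; first by exists n.+1 => //; rewrite /U big_ord_recr; right.
  by move: h; rewrite /U -bigcup_mkord => -[i _ h]; exists i.
have mUn n : measurable (U n) by exact: bigsetU_measurable.
have nd : nondecreasing_seq U by move=> i j ij; apply/subsetPset; apply: (@subset_bigsetU _ G).
have cU := @pr_cvg_ndecr _ _ _ Q U mUn nd.
have U0 n : pr Q (U n) = 0.
  elim: n => [|n IH]; first by rewrite /U big_ord0 pr_set0.
  apply/eqP; rewrite eq_le pr_ge0 andbT /U big_ord_recr /=.
  by apply: le_trans (prU_le Q (mUn n) (mG n)) _; rewrite IH G0 addr0.
rewrite UE -(cvg_lim _ cU)// (_ : (fun n => pr Q (U n)) = fun=> 0) ?lim_cst//.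
by apply/funext.
Qed.

Lemma fullI A B : full A -> full B -> full (A `&` B).
Proof.
move=> [mA A1] [mB B1]; split; first exact: measurableI.
have := prDI Q mA mB; rewrite A1 => e; apply/eqP; rewrite eq_le (pr_le1 Q (measurableI _ _ mA mB)) /=.
have := pr_le Q (measurableI _ _ mA (measurableC mB)) (measurableC mB) (@subIsetr _ A (~` B)).
by rewrite prC// B1 subrr; lra.
Qed.

Lemma full_nonempty A : full A -> A !=set0.
Proof.
move=> [_ A1]; apply/set0P/negP => /eqP e; move: A1; rewrite e pr_set0 => /eqP.
by rewrite eq_sym oner_eq0.
Qed.

Lemma eq_leR (a b : R) : a = b -> b <= a. Proof. by move=> ->. Qed.

(** [C] is the event that the lower limit of f n x / n is at most [lam < mu]. Subadditivity makes it
    sub-invariant, so it is null or full by ergodicity; if full, [small_full_le] at a level still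
    below [mu] is contradicted. *)
Theorem kingman_lower (f : nat -> T -> R) (mu eps : R) :
  (forall n, integ (f n)) -> (forall n x, 0 <= f n x) -> (forall x, f 0%N x <= 0) ->
  (forall n m x, f (n + m)%N x <= f n x + f m (iter n Tm x)) ->
  (forall n, (0 < n)%N -> mu * n%:R <= Ex (f n)) -> 0 < eps ->
  full [set x | exists k, forall n, (k <= n)%N -> (mu - eps) * n%:R <= f n x].
Proof.
move=> fi f_ge0 f0 fsub hmu eps0; set G := [set x | _]; set lam := mu - eps in G *.
have mf n r : measurable [set x | f n x <= r].
  by rewrite -[X in measurable X]setTI; exact: (measurable_fun_le measurableT (integ_meas (fi n)) (measurable_cst _)).
have mf' n r : measurable [set x | r <= f n x].
  by rewrite -[X in measurable X]setTI; exact: (measurable_fun_le measurableT (measurable_cst _) (integ_meas (fi n))).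
have mG : measurable G.
  rewrite (_ : G = \bigcup_k \bigcap_(n in [set n | (k <= n)%N]) [set x | lam * n%:R <= f n x]).
    by apply: bigcup_measurable => k _; apply: bigcap_measurable; [by exists k => /=|move=> n _; exact: mf'].
  by apply/seteqP; split=> x [k h]; exists k => // n kn; exact: h.
split; first exact: mG.
have [lam0|lam0] := ltP lam 0.
  rewrite (_ : G = setT) ?pr_set0 ?pr_setT//; apply/seteqP; split=> // x _; exists 0%N => n _.
  by apply: le_trans (f_ge0 n x); rewrite mulr_le0_ge0// ltW.
pose C : set T := \bigcap_j \bigcap_k \bigcup_(n in [set n | (k <= n)%N]) [set x | f n x <= (lam + j.+1%:R^-1) * n%:R].
have mC : measurable C.
  apply: bigcapT_measurable => j; apply: bigcapT_measurable => k.
  by apply: bigcup_measurable => n _; exact: mf.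
have sC : Tm @^-1` C `<=` C.
  (* Half of the slack 1/(j + 1) is spent on the event at [Tm x]; the other half absorbs the term
     [f 1 x], once [n] is large. *)
  move=> x Cx j _ k _; pose j' := (2 * j.+1).-1.
  have j'E : j'.+1%:R^-1 = j.+1%:R^-1 / 2 :> R.
    by rewrite /j' prednK ?muln_gt0// natrM invfM mulrC.
  have q0 : 0 < j.+1%:R^-1 :> R by rewrite invr_gt0.
  set q := j.+1%:R^-1 in j'E q0 *.
  pose k' := maxn k (Num.truncn (f 1%N x / (q / 2))).+1.
  have [n /= kn hn] := Cx j' I k' I.
  exists n.+1; first by rewrite /= leqW// (leq_trans (leq_maxl _ _) kn).
  have f1n : f 1%N x <= n%:R * (q / 2).
    rewrite -ler_pdivrMr ?divr_gt0//; apply: le_trans (ltW (truncnS_gt _)) _.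
    by rewrite ler_nat (leq_trans (leq_maxr _ _) kn).
  rewrite /=; have := fsub 1%N n x; rewrite add1n /= -natr1 => h; apply: le_trans h _.
  by move: hn; rewrite j'E; nra.
have [C0|C1] := sub_invariant mC sC; last first.
  have [j hj] := inv_small eps0.
  have lj0 : 0 <= lam + j.+1%:R^-1 by rewrite addr_ge0// invr_ge0.
  have := @small_full_le f (f 1%N) fi f0 fsub (fi 1%N) (f_ge0 1%N) (fun x => lexx _) (lam + j.+1%:R^-1) mu lj0 hmu.
  have -> : pr Q (\bigcup_N small f (lam + j.+1%:R^-1) N) = 1; last first.
    by move=> /(_ erefl); rewrite /lam; move: hj; move: (j.+1%:R^-1) => q; lra.
  apply/eqP; rewrite eq_le; have mU : measurable (\bigcup_N small f (lam + j.+1%:R^-1) N).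
    by apply: bigcup_measurable => N _; exact: measurable_small.
  rewrite (pr_le1 Q mU) /=; apply: (le_trans (eq_leR C1)); apply: pr_le => // x Cx.
  have [n /= n1 hn] := Cx j I 1%N I; exists n => //; exists n; split=> //.
apply/eqP; rewrite eq_le pr_le1//= -[leLHS]subr0 -C0 -prC//; apply: pr_le => //; first exact: measurableC.
move=> x nC; apply: contrapT => nG; apply: nC => j _ k _; apply: contrapT => h.
apply: nG; exists k => n kn; rewrite leNgt; apply/negP => hn; apply: h; exists n => //=.
apply: le_trans (ltW hn) _; rewrite ler_wpM2r// lerDl invr_ge0//.
Qed.

(** The same dichotomy for the upper limit. If the averages almost surely came infinitely often near
    [lam], the additive process [(lam - q) * n - S n], whose mean is positive since [q < eps], would
    be nonpositive at some time almost surely, against [small_full_le]. *)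
Theorem birkhoff_upper (f : T -> R) (eps : R) : integ f -> (forall x, 0 <= f x) -> 0 < eps ->
  full [set x | exists k, forall n, (k <= n)%N ->
    \sum_(0 <= i < n) f (iter i Tm x) <= (Ex f + eps) * n%:R].
Proof.
move=> fi f_ge0 eps0; set G := [set x | _]; set lam := Ex f + eps in G *.
pose S n x := \sum_(0 <= i < n) f (iter i Tm x).
have f_i j : integ (fun x => f (iter j Tm x)) by have [] := integ_iterT j fi f_ge0.
have Si n : integ (S n) by exact: integ_sum.
have Ef0 : 0 <= Ex f by apply: fine_ge0; apply: integral_ge0 => x _; rewrite lee_fin.
have mS n r : measurable [set x | r <= S n x].
  by rewrite -[X in measurable X]setTI; exact: (measurable_fun_le measurableT (measurable_cst _) (integ_meas (Si n))).
have mS' n r : measurable [set x | S n x <= r].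
  by rewrite -[X in measurable X]setTI; exact: (measurable_fun_le measurableT (integ_meas (Si n)) (measurable_cst _)).
have mG : measurable G.
  rewrite (_ : G = \bigcup_k \bigcap_(n in [set n | (k <= n)%N]) [set x | S n x <= lam * n%:R]).
    by apply: bigcup_measurable => k _; apply: bigcap_measurable; [by exists k => /=|move=> n _; exact: mS'].
  by apply/seteqP; split=> x [k h]; exists k => // n kn; exact: h.
split; first exact: mG.
pose C : set T := \bigcap_j \bigcap_k \bigcup_(n in [set n | (k <= n)%N]) [set x | (lam - j.+1%:R^-1) * n%:R <= S n x].
have mC : measurable C.
  apply: bigcapT_measurable => j; apply: bigcapT_measurable => k.
  by apply: bigcup_measurable => n _; exact: mS.
have SS n x : S n.+1 x = f x + S n (Tm x).
  by rewrite /S big_nat_recl//=; congr (_ + _); apply: eq_bigr => i _; rewrite -iterSr.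
have sC : Tm @^-1` C `<=` C.
  move=> x Cx j _ k _; pose j' := (2 * j.+1).-1.
  have j'E : j'.+1%:R^-1 = j.+1%:R^-1 / 2 :> R.
    by rewrite /j' prednK ?muln_gt0// natrM invfM mulrC.
  have q0 : 0 < j.+1%:R^-1 :> R by rewrite invr_gt0.
  set q := j.+1%:R^-1 in j'E q0 *.
  pose k' := maxn k (Num.truncn (`|lam - q| / (q / 2))).+1.
  have [n /= kn hn] := Cx j' I k' I.
  exists n.+1; first by rewrite /= leqW// (leq_trans (leq_maxl _ _) kn).
  have f1n : `|lam - q| <= n%:R * (q / 2).
    rewrite -ler_pdivrMr ?divr_gt0//; apply: le_trans (ltW (truncnS_gt _)) _.
    by rewrite ler_nat (leq_trans (leq_maxr _ _) kn).
  rewrite /= SS; apply: le_trans (_ : S n (Tm x) <= _); last by rewrite lerDr.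
  apply: le_trans hn; rewrite j'E -natr1.
  have := ler_norm (lam - q); nra.
have [C0|C1] := sub_invariant mC sC; last first.
  have [j hj] := inv_small eps0; set q := j.+1%:R^-1 in hj.
  have q0 : 0 < q by rewrite invr_gt0.
  have lq0 : 0 <= lam - q by rewrite /lam; lra.
  pose F n x := (lam - q) * n%:R + (-1) * S n x.
  have Fi n : integ (F n) by exact: integD (integ_cst _) (integZ _ (Si n)).
  have F0 x : F 0%N x <= 0 by rewrite /F /S big_geq// !mulr0 addr0.
  have Fsub n m x : F (n + m)%N x <= F n x + F m (iter n Tm x).
    rewrite /F natrD (_ : S (n + m)%N x = S n x + S m (iter n Tm x)); first by lra.
    rewrite /S (big_cat_nat (n := n))//= ?leq_addr//; congr (_ + _).
    by rewrite -[X in \sum_(X <= _ < _) _]add0n big_addn addKn; apply: eq_bigr => i _; rewrite iterD.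
  have F1 x : F 1%N x <= lam - q.
    by rewrite /F /S big_nat1 /= mulr1; have := f_ge0 x; lra.
  have hmu n : (0 < n)%N -> (lam - q - Ex f) * n%:R <= Ex (F n).
    move=> _; rewrite /F (ExD (integ_cst _) (integZ _ (Si n))) Ex_cst ExZ// /S Ex_sum//.
    under eq_bigr do rewrite (integ_iterT _ fi f_ge0).2.
    by rewrite sumr_const_nat subn0 -[_ *+ n]mulr_natr; lra.
  have := @small_full_le F (fun=> lam - q) Fi F0 Fsub (integ_cst _) (fun=> lq0) F1 0 _ (lexx 0) hmu.
  have -> : pr Q (\bigcup_N small F 0 N) = 1; last by move=> /(_ erefl); rewrite /lam; lra.
  apply/eqP; rewrite eq_le; have mU : measurable (\bigcup_N small F 0 N).
    by apply: bigcup_measurable => N _; exact: measurable_small.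
  rewrite (pr_le1 Q mU) /=; apply: (le_trans (eq_leR C1)); apply: pr_le => // x Cx.
  have [n /= n1 hn] := Cx j I 1%N I; exists n => //; exists n; split=> //.
  by rewrite mul0r /F; move: hn; rewrite -/q; lra.
apply/eqP; rewrite eq_le pr_le1//= -[leLHS]subr0 -C0 -prC//; apply: pr_le => //; first exact: measurableC.
move=> x nC; apply: contrapT => nG; apply: nC => j _ k _; apply: contrapT => h.
apply: nG; exists k => n kn; rewrite leNgt; apply/negP => hn; apply: h; exists n => //=.
apply: le_trans (ltW hn); rewrite ler_wpM2r// gerBl invr_ge0//.
Qed.

End Transformation.
End ErgodicSums.

(** * The limit shape *)

Section ShapeSet.
Context {R : realType} {d : nat}.
Variable mu : Zd d -> R.
Hypothesis mu_sub : forall x y, mu (x + y) <= mu x + mu y.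
Hypothesis mu_hom : forall x n, mu (x *+ n) = n%:R * mu x.
Hypothesis mu_lo : forall x, (linf_dist 0 x)%:R <= mu x.
Hypothesis mu_hi : forall x, mu x <= 4 * (l1_dist 0 x)%:R.
Implicit Types (x y z u : Zd d).

Local Notation co x i := ((x 0 i)%:~R : R).

(** The unit ball of the norm on the real space that extends [mu], given as the closure of the
    points [s * z] with [z] in the lattice and [s * mu z <= 1]; the extension itself is not
    constructed. *)
Definition shape : set 'rV[R]_d := [set v | forall delta : R, 0 < delta -> exists s z,
  [/\ 0 <= s, s * mu z <= 1 & forall i, `|v 0 i - s * co z i| <= delta]].

Lemma mu_ge0 x : 0 <= mu x.
Proof. by apply: le_trans (mu_lo x). Qed.

Lemma co_le x i : `|co x i| <= (linf_dist 0 x)%:R.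
Proof.
rewrite -intr_norm -abszE -pmulrn ler_nat; have := linf_coord 0 x i; rewrite mxE.
by move: (x 0 i) => a; clear; lia.
Qed.

Lemma l1_real x (B : R) : (forall i, `|co x i| <= B) -> (l1_dist 0 x)%:R <= d%:R * B.
Proof.
move=> h; rewrite /l1_dist natr_sum; apply: le_trans (_ : \sum_(i < d) B <= _).
  apply: ler_sum => i _; apply: le_trans (h i); rewrite mxE sub0r abszN.
  by rewrite -intr_norm -abszE -pmulrn.
by rewrite sumr_const card_ord -[leLHS]mulr_natl.
Qed.

Lemma trunc_approx (a : R) (K : nat) : 0 <= a -> (0 < K)%N ->
  (Num.truncn (K%:R * a))%:R <= K%:R * a /\ `|K%:R * a - (Num.truncn (K%:R * a))%:R| <= 1.
Proof.
move=> a0 K0; have Ka0 : 0 <= K%:R * a by rewrite mulr_ge0.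
have h1 : (Num.truncn (K%:R * a))%:R <= K%:R * a by rewrite truncn_le.
have := truncnS_gt (K%:R * a); rewrite -natr1 => h2; split=> //.
by rewrite ger0_norm; lra.
Qed.

Lemma big_nat_gt (a : R) : exists2 K : nat, (0 < K)%N & a <= K%:R.
Proof. by exists (Num.truncn a).+1 => //; apply: ltW; exact: truncnS_gt. Qed.

(** The combination is approximated by the lattice point [z *+ p + z' *+ q] divided by a large [K],
    with [p] and [q] the integer parts of [K * a] and [K * b]; subadditivity and homogeneity bound
    its [mu]. *)
Lemma shape_combine (v v' : 'rV[R]_d) (t : R) : 0 <= t <= 1 -> shape v -> shape v' ->
  shape (t *: v + (1 - t) *: v').
Proof.
move=> /andP[t0 t1] hv hv' delta d0.
have [s [z [s0 sz vz]]] := hv (delta / 2) (divr_gt0 d0 (ltr0n _ 2)).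
have [s' [z' [s'0 sz' vz']]] := hv' (delta / 2) (divr_gt0 d0 (ltr0n _ 2)).
pose a := t * s; pose b := (1 - t) * s'.
have a0 : 0 <= a by rewrite mulr_ge0.
have b0 : 0 <= b by rewrite mulr_ge0// subr_ge0.
have ab : a * mu z + b * mu z' <= 1 by rewrite /a /b; nra.
set B := (linf_dist 0 z)%:R + (linf_dist 0 z')%:R : R.
have [K K0 hK] := big_nat_gt (2 * B / delta).
have KR : 0 < K%:R :> R by rewrite ltr0n.
have [p1 p2] := trunc_approx a0 K0; have [q1 q2] := trunc_approx b0 K0.
set p := Num.truncn (K%:R * a) in p1 p2; set q := Num.truncn (K%:R * b) in q1 q2.
exists K%:R^-1, (z *+ p + z' *+ q); split; first by rewrite invr_ge0.
  rewrite -(ler_pM2l KR) mulrA divff ?gt_eqF// mul1r mulr1.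
  apply: le_trans (mu_sub _ _) _; rewrite !mu_hom.
  have h1 : p%:R * mu z <= K%:R * a * mu z by rewrite ler_wpM2r// mu_ge0.
  have h2 : q%:R * mu z' <= K%:R * b * mu z' by rewrite ler_wpM2r// mu_ge0.
  have : K%:R * (a * mu z + b * mu z') <= K%:R * 1 by rewrite ler_wpM2l// ltW.
  lra.
move=> i; rewrite !mxE !mulmxnE -![z 0 i *+ _]mulr_natr -![z' 0 i *+ _]mulr_natr.
rewrite rmorphD !rmorphM /= !natz -!pmulrn.
have c1 := co_le z i; have c2 := co_le z' i; have w1 := vz i; have w2 := vz' i.
set A := co z i in c1 w1 *; set A' := co z' i in c2 w2 *.
set V := v 0 i in w1 *; set V' := v' 0 i in w2 *.
have -> : t * V + (1 - t) * V' - K%:R^-1 * (A * p%:R + A' * q%:R) =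
    t * (V - s * A) + (1 - t) * (V' - s' * A') +
    K%:R^-1 * (A * (K%:R * a - p%:R) + A' * (K%:R * b - q%:R)).
  by rewrite /a /b; field; rewrite gt_eqF.
have n1 : `|A * (K%:R * a - p%:R) + A' * (K%:R * b - q%:R)| <= B.
  apply: le_trans (ler_normD _ _) _; rewrite !normrM /B; apply: lerD.
    by rewrite -[leRHS]mulr1; apply: ler_pM.
  by rewrite -[leRHS]mulr1; apply: ler_pM.
have n2 : `|K%:R^-1 * (A * (K%:R * a - p%:R) + A' * (K%:R * b - q%:R))| <= delta / 2.
  rewrite normrM gtr0_norm ?invr_gt0// mulrC ler_pdivrMr//; apply: le_trans n1 _.
  by move: hK; rewrite ler_pdivrMr//; lra.
apply: le_trans (ler_normD _ _) _; apply: le_trans (lerD (ler_normD _ _) n2) _.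
rewrite !normrM (ger0_norm t0) (_ : `|1 - t| = 1 - t); last by rewrite ger0_norm// subr_ge0.
have g1 : t * `|V - s * A| <= t * (delta / 2) by rewrite ler_wpM2l.
have g2 : (1 - t) * `|V' - s' * A'| <= (1 - t) * (delta / 2) by rewrite ler_wpM2l// subr_ge0.
move: g1 g2; move: `|_| `|_| => X Y; lra.
Qed.

Lemma shape_convex : convex_set shape.
Proof.
move=> v v' t /set_mem hv /set_mem hv'; apply/mem_set.
have := @shape_combine v v' t%:num _ hv hv'; apply.
by rewrite ge0 le1.
Qed.

Lemma shape_bounded v i : shape v -> v 0 i \in `[-2, 2].
Proof.
move=> /(_ 1 ltr01)[s [z [s0 sz hz]]].
have := hz i; have c := co_le z i; have m := mu_lo z.
have : `|s * co z i| <= 1.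
  by rewrite normrM (ger0_norm s0); apply: le_trans sz; apply: ler_wpM2l => //; exact: le_trans m.
by rewrite in_itv /= !ler_norml => /andP[? ?] /andP[? ?]; apply/andP; split; lra.
Qed.

Lemma shape_closed : closed shape.
Proof.
move=> v cl delta d0.
have d2 : 0 < delta / 2 by lra.
have [v' [sv' [_ bv']]] := cl (ball v (delta / 2)) (nbhsx_ballx _ _ d2).
have [s [z [s0 sz hz]]] := sv' _ d2; exists s, z; split=> // i.
have := bv' 0 i; rewrite /ball /= => h; have hi := hz i.
have -> : v 0 i - s * co z i = (v 0 i - v' 0 i) + (v' 0 i - s * co z i) by ring.
by apply: le_trans (ler_normD _ _) _; move: (ltW h) hi; lra.
Qed.

Lemma shape_compact : compact shape.
Proof.
have cB := @rV_compact _ d (fun=> [set` `[-2, 2 : R]]) (fun i => @segment_compact R (-2) 2).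
apply: (subclosed_compact shape_closed cB) => v hv i /=.
by have := shape_bounded i hv; rewrite (_ : ord0 = 0)//; exact: val_inj.
Qed.

Lemma mu_dilate (t : R) x : 0 < t -> mu x <= t -> dilate t shape x.
Proof.
move=> t0 xt; exists (t^-1 *: map_mx intr x); last by rewrite scalerA divff ?gt_eqF// scale1r.
move=> delta d0; exists t^-1, x; split; first by rewrite invr_ge0 ltW.
  by rewrite mulrC ler_pdivrMr// mul1r.
by move=> i; rewrite !mxE subrr normr0 ltW.
Qed.

(** Converse of [mu_dilate], where the closure has to be undone: [x *+ K] differs from a multiple
    [z *+ p] by a vector of coordinates at most [K * (t * delta) + B], whose [mu] is controlled
    through the l1 norm and is small compared with [K]. *)
Lemma dilate_mu (t : R) x : 0 <= t -> dilate t shape x -> mu x <= t.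
Proof.
move=> t0 [v sv xv]; apply/ler_addgt0Pr => e e0.
have D0 : 0 < 8 * (d%:R + 1) * (t + 1) :> R by rewrite !mulr_gt0 ?ltr_wpDl.
pose delta := e / (8 * (d%:R + 1) * (t + 1)).
have dl0 : 0 < delta by rewrite divr_gt0.
have [s [z [s0 sz hz]]] := sv _ dl0.
pose a := t * s; have a0 : 0 <= a by rewrite mulr_ge0.
set B := (linf_dist 0 z)%:R : R.
have [K K0 hK] := big_nat_gt (8 * d%:R * B / e).
have KR : 0 < K%:R :> R by rewrite ltr0n.
have [p1 p2] := trunc_approx a0 K0; set p := Num.truncn _ in p1 p2.
pose u := x *+ K - z *+ p.
have ub i : `|co u i| <= K%:R * (t * delta) + B.
  have -> : co u i = K%:R * (co x i - a * co z i) + (K%:R * a - p%:R) * co z i.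
    rewrite /u !mxE !mulmxnE -[x 0 i *+ _]mulr_natr -[z 0 i *+ _]mulr_natr.
    rewrite rmorphB !rmorphM /= !natz -!pmulrn; ring.
  have xi : co x i = t * v 0 i by have := congr1 (fun M : 'rV[R]_d => M 0 i) xv; rewrite !mxE.
  apply: le_trans (ler_normD _ _) _; rewrite !normrM (gtr0_norm KR); apply: lerD.
    rewrite ler_pM2l// xi /a -mulrA -mulrBr normrM (ger0_norm t0) ler_wpM2l//.
  by rewrite -[leRHS]mul1r; apply: ler_pM => //; exact: co_le.
have Kx : K%:R * mu x <= p%:R * mu z + 4 * (d%:R * (K%:R * (t * delta) + B)).
  rewrite -!mu_hom; apply: le_trans (_ : mu (z *+ p + u) <= _).
    by rewrite /u addrC subrK.
  apply: le_trans (mu_sub _ _) _; rewrite lerD2l; apply: le_trans (mu_hi u) _.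
  by rewrite ler_wpM2l//; exact: l1_real.
have h1 : p%:R * mu z <= K%:R * t.
  apply: le_trans (_ : K%:R * a * mu z <= _); first by rewrite ler_wpM2r// mu_ge0.
  by rewrite /a -!mulrA ler_pM2l// ler_piMr.
have h2 : 4 * (d%:R * (t * delta)) <= e / 2.
  have dE : delta * (8 * (d%:R + 1) * (t + 1)) = e by rewrite /delta divfK// gt_eqF.
  have : 0 <= delta * d%:R by rewrite mulr_ge0// ltW.
  have : 0 <= delta * t by rewrite mulr_ge0// ltW.
  rewrite -dE; nra.
have h3 : 4 * (d%:R * B) <= K%:R * (e / 2).
  by move: hK; rewrite ler_pdivrMr//; lra.
rewrite -(ler_pM2l KR); apply: le_trans Kx _.
have : K%:R * (4 * (d%:R * (t * delta))) <= K%:R * (e / 2) by rewrite ler_pM2l.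
move: h1 h3; rewrite !mulrDr; lra.
Qed.

Section UniformConvergence.
Variables (dist : Zd d -> Zd d -> nat) (W : nat -> nat) (k0 : nat).
Hypothesis tri : forall x y z, (dist x z <= dist x y + dist y z)%N.
Hypothesis dsym : forall x y, dist x y = dist y x.
Hypothesis Wsq : forall j, (k0 <= j)%N -> (W j ^ 2 <= 2 ^ j)%N.
Hypothesis Lip : forall j x y, (k0 <= j)%N -> (linf_dist 0 x <= 2 ^ j)%N -> (linf_dist 0 y <= 2 ^ j)%N ->
  (dist x y <= 4 * l1_dist x y + (8 * d + 1) * W j)%N.
Hypothesis conv : forall z (e : R), 0 < e -> exists n0 : nat, forall n, (n0 <= n)%N ->
  `|(dist 0 (z *+ n))%:R - mu z * n%:R| <= e * n%:R.

Lemma mu_lip x y : `|mu x - mu y| <= 4 * (l1_dist x y)%:R.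
Proof.
have half a b : mu a - mu b <= 4 * (l1_dist a b)%:R.
  rewrite lerBlDr; apply: le_trans (_ : mu ((a - b) + b) <= _); first by rewrite subrK.
  apply: le_trans (mu_sub _ _) _; rewrite lerD2r; apply: le_trans (mu_hi _) _.
  by rewrite -(l1_distD _ _ b) subrK add0r l1_distC.
have h1 := half x y; have h2 := half y x; rewrite l1_distC in h2.
by rewrite ler_norml; apply/andP; split; lra.
Qed.

Lemma floorz_near (m : nat) x : (0 < m)%N -> (linf_dist x (floorz m x *+ m) <= m)%N.
Proof.
move=> m0; apply/linf_leP => i; have := floorz_coord x i m0; rewrite mulmxnE.
by move: (x 0 i) (floorz m x 0 i *+ m) => a b; clear; lia.
Qed.

Lemma pow2_between (n : nat) : (0 < n)%N -> exists j, (n <= 2 ^ j)%N /\ (2 ^ j <= 2 * n)%N.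
Proof.
move=> n0; have ex : exists j, (n <= 2 ^ j)%N by exists n; apply: ltnW; exact: ltn_expl.
case: (ex_minnP ex) => j hj mn; exists j; split=> //.
case: j hj mn => [|j] hj mn; first by rewrite expn0; move: n0; clear; lia.
rewrite expnS leq_mul2l /=; rewrite leqNgt; apply/negP => h.
by have := mn j (ltnW h); rewrite ltnn.
Qed.

(** Compactness of directions. A far point [x] is within m, about |x| / K, of [z *+ m] with [z] in a
    fixed finite box, where convergence is uniform once m >= m0. The Lipschitz bounds on [dist] and
    [mu] cost O(m), below delta |x| when K >= A / delta; near points are covered by the constant
    [c]. *)
Lemma uniform_conv (delta : R) : 0 < delta -> exists n : nat, forall x,
  `|(dist 0 x)%:R - mu x| <= delta * (linf_dist 0 x)%:R + n%:R.
Proof.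
move=> d0; pose A : R := 1 + (4 * d + (8 * d + 1) + 4 * d)%:R.
have A0 : 0 < A by rewrite ltr_wpDr.
have [K K0 hK] := big_nat_gt (A / delta).
have KR : 0 < K%:R :> R by rewrite ltr0n.
have [f hf] := choice (fun z => conv z ltr01).
pose s := ball_seq (0 : Zd d) (2 * K + 1).
pose m0 := (\sum_(z <- s) f z + 16 * K + 2 ^ k0 + 1)%N.
have fm z : z \in s -> (f z <= m0)%N.
  by move=> zs; rewrite /m0 (big_rem z zs) /=; clear; lia.
have [c hc] : exists c : nat, forall x, (linf_dist 0 x <= K * m0)%N -> `|(dist 0 x)%:R - mu x| <= c%:R.
  pose g x := (Num.truncn `|(dist 0 x)%:R - mu x|).+1.
  exists (\sum_(x <- ball_seq (0 : Zd d) (K * m0)) g x)%N => x hx.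
  have xs : x \in ball_seq (0 : Zd d) (K * m0) by rewrite mem_ball_seq.
  apply: le_trans (_ : (g x)%:R <= _); first by apply: ltW; exact: truncnS_gt.
  by rewrite ler_nat (big_rem x xs) /= leq_addr.
exists c => x; have [hx|hx] := leqP (linf_dist 0 x) (K * m0).
  by apply: le_trans (hc x hx) _; rewrite lerDr mulr_ge0// ltW.
pose m := (linf_dist 0 x %/ K)%N; pose z := floorz m x.
have mm0 : (m0 <= m)%N by rewrite leq_divRL// mulnC ltnW.
have m_0 : (0 < m)%N by apply: leq_trans mm0; rewrite /m0 addn1.
have Km : (K * m <= linf_dist 0 x)%N by rewrite mulnC leq_divM.
have Km2 : (linf_dist 0 x <= 2 * (K * m))%N.
  have := ltn_ceil (linf_dist 0 x) K0; rewrite -/m mulSn; move: m_0 K0; clear; nia.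
have xz := floorz_near x m_0; rewrite -/z in xz.
have zmb : (linf_dist 0 (z *+ m) <= 2 * (K * m) + m)%N.
  by have := linf_triangle x 0 (z *+ m); move: xz Km2; clear; lia.
have zs : z \in s.
  rewrite mem_ball_seq; rewrite -(mul0rn _ m) linf_mulrn in zmb.
  by move: zmb m_0; move: (linf_dist 0 z) => l; clear; nia.
have pos : (0 < 2 * (K * m) + m)%N by rewrite addn_gt0 m_0 orbT.
have [j [j1 j2]] := pow2_between pos.
have kj : (k0 <= j)%N.
  rewrite -(@leq_exp2l 2)//; apply: leq_trans j1; move: mm0; rewrite /m0; clear; nia.
have Wm : (W j <= m)%N.
  rewrite -(@leq_exp2r _ _ 2)//; apply: leq_trans (Wsq kj) _; apply: leq_trans j2 _.
  have : (16 * K + 1 <= m)%N by move: mm0; rewrite /m0; clear; lia.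
  by rewrite expnS expn1; move: K0; clear; nia.
have l1 : (l1_dist x (z *+ m) <= d * m)%N by apply: leq_trans (l1_le_linf _ _) _; rewrite leq_mul2l xz orbT.
have lip1 : (dist x (z *+ m) <= 4 * l1_dist x (z *+ m) + (8 * d + 1) * W j)%N.
  apply: Lip => //; last exact: leq_trans j1.
  by apply: leq_trans Km2 (leq_trans (leq_addr _ _) j1).
have lip2 : (dist x (z *+ m) <= (4 * d + (8 * d + 1)) * m)%N by move: lip1 l1 Wm; clear; nia.
have t1 := tri 0 (z *+ m) x; have t2 := tri 0 x (z *+ m); rewrite (dsym (z *+ m) x) in t1.
have cz := hf z m (leq_trans (fm z zs) mm0); rewrite mul1r in cz.
have ml := mu_lip x (z *+ m); rewrite mu_hom in ml.
have l1R : (l1_dist x (z *+ m))%:R <= (d * m)%:R :> R by rewrite ler_nat.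
have tot : `|(dist 0 x)%:R - mu x| <= A * m%:R.
  rewrite -(ler_nat R) natrD in t1; rewrite -(ler_nat R) natrD in t2.
  rewrite -(ler_nat R) in lip2.
  rewrite /A mulrDl mul1r -natrM; move: lip2 l1R t1 t2 cz ml.
  have -> : ((4 * d + (8 * d + 1) + 4 * d) * m = (4 * d + (8 * d + 1)) * m + 4 * (d * m))%N by clear; lia.
  rewrite [in X in _ -> X]natrD [(4 * (d * m))%:R]natrM.
  rewrite !ler_norml => lip l1b s1 s2 /andP[c1 c2] /andP[m1 m2].
  by apply/andP; split; lra.
apply: le_trans tot _; apply: le_trans (_ : delta * (linf_dist 0 x)%:R <= _); last by rewrite lerDl.
apply: le_trans (_ : delta * (K * m)%:R <= _); last by rewrite ler_wpM2l ?ler_nat// ltW.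
rewrite natrM mulrA ler_wpM2r//; move: hK; rewrite ler_pdivrMr// mulrC; lra.
Qed.

End UniformConvergence.
End ShapeSet.

(** * Passage times *)

Section NearestInfinite.
Context {d : nat}.
Implicit Types (x y z a b : Zd d) (xi : config d).

Local Notation inf_at xi := (infinite_part (occupied xi)).

(* Ties are broken through an enumeration of the offsets a - x, which makes the
   choice of the nearest site covariant under shifts. *)
Definition is_near xi x a : Prop := inf_at xi a /\ forall b, inf_at xi b ->
  (linf_dist x a < linf_dist x b)%N \/
  (linf_dist x a = linf_dist x b /\ (pickle (a - x)%R <= pickle (b - x)%R)%N).

Lemma near_uniq xi x a b : is_near xi x a -> is_near xi x b -> a = b.
Proof.
move=> [ia ha] [ib hb]; have [h1|[h1 p1]] := ha b ib; have [h2|[h2 p2]] := hb a ia.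
- by move: h1 h2; clear; lia.
- by move: h1 h2; clear; lia.
- by move: h1 h2; clear; lia.
have e : pickle (a - x) = pickle (b - x) by apply/eqP; rewrite eqn_leq p1 p2.
by apply: (addIr (- x)); apply: (pcan_inj pickleK e).
Qed.

Lemma near_exists xi x : (exists b, inf_at xi b) -> exists a, is_near xi x a.
Proof.
move=> [b0 ib0].
have ex1 : exists n, `[< exists2 b, inf_at xi b & linf_dist x b = n >].
  by exists (linf_dist x b0); apply/asboolP; exists b0.
case: (ex_minnP ex1) => n /asboolP[b1 ib1 e1] mn.
have ex2 : exists m, `[< exists b, [/\ inf_at xi b, linf_dist x b = n & pickle (b - x) = m] >].
  by exists (pickle (b1 - x)); apply/asboolP; exists b1.
case: (ex_minnP ex2) => m /asboolP[a [ia ea pa]] mm.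
exists a; split=> // b ib; have h : (n <= linf_dist x b)%N by apply: mn; apply/asboolP; exists b.
move: h; rewrite leq_eqVlt => /predU1P[e|h]; [right|by left; rewrite ea].
by rewrite ea -e; split=> //; rewrite pa; apply: mm; apply/asboolP; exists b.
Qed.

Lemma near_self xi x : inf_at xi x -> is_near xi x x.
Proof.
move=> ix; split=> // b ib; rewrite linf_dist0.
have [h|h] := posnP (linf_dist x b); last by left.
by right; rewrite h; split=> //; rewrite (linf_eq0 h).
Qed.

Lemma near_shift z xi x a : is_near (Defs.shift z xi) x a <-> is_near xi (x + z) (a + z).
Proof.
have e b : b + z - (x + z) = b - x by rewrite opprD addrACA subrr addr0.
split=> -[ia h]; split; try by apply/infinite_shift.
  move=> b ib; have := h (b - z); rewrite linf_distD e -{1}(linf_distD x (b - z) z) -{1}(linf_distD x (b - z) z) subrK.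
  rewrite (_ : b - z - x = b - (x + z)); last by rewrite opprD addrA addrAC.
  by apply; apply/infinite_shift; rewrite subrK.
move=> b /infinite_shift ib; have := h _ ib; by rewrite !linf_distD !e.
Qed.

Definition regular xi : Prop := (exists a, inf_at xi a) /\
  forall a b, inf_at xi a -> inf_at xi b -> connected_in (occupied xi) a b.

Lemma regular_shift z xi : regular (Defs.shift z xi) <-> regular xi.
Proof.
split=> -[[a ia] h]; split.
- by exists (a + z); apply/infinite_shift.
- move=> b c ib ic; have := h (b - z) (c - z).
  by rewrite conn_shift !subrK; apply; apply/infinite_shift; rewrite subrK.
- by exists (a - z); apply/infinite_shift; rewrite subrK.
- by move=> b c /infinite_shift ib /infinite_shift ic; apply/conn_shift; exact: h.
Qed.

Definition dist_le xi x y (k : nat) : Prop := exists a b p,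
  [/\ is_near xi x a, is_near xi y b, path_in (occupied xi) a b p & (size p <= k)%N].

Lemma dist_le_shift z xi x y k : dist_le (Defs.shift z xi) x y k <-> dist_le xi (x + z) (y + z) k.
Proof.
split.
  move=> [a [b [p [/near_shift na /near_shift nb /path_in_shift hp sp]]]].
  by exists (a + z), (b + z), [seq v + z | v <- p]; rewrite size_map.
move=> [a [b [p [na nb hp sp]]]].
exists (a - z), (b - z).
have : path_in (occupied xi) (a - z + z) (b - z + z) p by rewrite !subrK.
move=> /path_in_unshift[q hq sq]; exists q; split=> //; last by rewrite sq.
- by apply/near_shift; rewrite subrK.
- by apply/near_shift; rewrite subrK.
Qed.

Lemma Dst_spec xi x y : exists n, (regular xi -> dist_le xi x y n /\ forall k, dist_le xi x y k -> (n <= k)%N) /\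
  (~ regular xi -> n = 0%N).
Proof.
have [rg|nr] := pselect (regular xi); last by exists 0%N.
have [a na] := near_exists x rg.1; have [b nb] := near_exists y rg.1.
have [p hp] := rg.2 a b na.1 nb.1.
have ex : exists k, `[< dist_le xi x y k >] by exists (size p); apply/asboolP; exists a, b, p.
case: (ex_minnP ex) => n /asboolP hn mn; exists n; split=> // _; split=> // k hk.
by apply: mn; apply/asboolP.
Qed.

(* The chemical distance between the infinite-cluster sites nearest to x and y, and
   0 unless there is exactly one infinite cluster. *)
Definition Dst xi x y : nat := projT1 (cid (Dst_spec xi x y)).

Lemma DstP xi x y k : regular xi -> (Dst xi x y <= k)%N <-> dist_le xi x y k.
Proof.
move=> rg; rewrite /Dst; case: cid => n /= [h _]; have [h1 h2] := h rg; split; last exact: h2.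
by move=> nk; have [a [b [p [? ? ? sp]]]] := h1; exists a, b, p; split=> //; exact: leq_trans nk.
Qed.

Lemma Dst0 xi x y : ~ regular xi -> Dst xi x y = 0%N.
Proof. by move=> nr; rewrite /Dst; case: cid => n /= [_]; apply. Qed.

Lemma Dst_path xi x y : regular xi -> dist_le xi x y (Dst xi x y).
Proof. by move=> rg; apply/DstP. Qed.

Lemma Dst_shift z xi x y : Dst (Defs.shift z xi) x y = Dst xi (x + z) (y + z).
Proof.
have [rg|nr] := pselect (regular xi); last by rewrite !Dst0// => /regular_shift.
have rg' : regular (Defs.shift z xi) by apply/regular_shift.
apply/eqP; rewrite eqn_leq; apply/andP; split.
  by apply/(DstP _ _ _ rg')/dist_le_shift/DstP.
by apply/(DstP _ _ _ rg)/dist_le_shift/DstP.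
Qed.

Lemma Dst_triangle xi x y z : (Dst xi x z <= Dst xi x y + Dst xi y z)%N.
Proof.
have [rg|nr] := pselect (regular xi); last by rewrite !Dst0.
have [a [b [p [na nb hp sp]]]] := Dst_path x y rg.
have [b' [c [q [nb' nc hq sq]]]] := Dst_path y z rg.
rewrite -(near_uniq nb nb') in hq; apply/DstP => //; exists a, c, (p ++ q); split=> //.
  exact: path_in_cat hp hq.
by rewrite size_cat leq_add.
Qed.

Lemma Dst_sym xi x y : Dst xi x y = Dst xi y x.
Proof.
have half u v : (Dst xi u v <= Dst xi v u)%N.
  have [rg|nr] := pselect (regular xi); last by rewrite !Dst0.
  have [a [b [p [na nb /path_in_rev[q hq sq] sp]]]] := Dst_path v u rg.
  by apply/DstP => //; exists b, a, q; rewrite sq.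
by apply/eqP; rewrite eqn_leq !half.
Qed.

Lemma Dst_refl xi x : Dst xi x x = 0%N.
Proof.
have [rg|nr] := pselect (regular xi); last by rewrite Dst0.
have [a na] := near_exists x rg.1; apply/eqP; rewrite -leqn0; apply/DstP => //.
exists a, a, [::]; split=> //; split=> // v; rewrite inE => /eqP ->.
by have [/infinite_partE[]] := na.
Qed.

Lemma Dst_inf (R : realType) xi x y (r : R) : regular xi -> inf_at xi x -> inf_at xi y ->
  (graph_dist R (occupied xi) x y <= r%:E)%E <-> (Dst xi x y)%:R <= r.
Proof.
move=> rg ix iy; rewrite graph_distE; split.
  move=> [p hp pr]; apply: le_trans pr; rewrite ler_nat; apply/DstP => //.
  by exists x, y, p; split=> //; exact: near_self.
move=> h; have [a [b [p [na nb hp sp]]]] := Dst_path x y rg.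
rewrite (near_uniq na (near_self ix)) (near_uniq nb (near_self iy)) in hp.
by exists p => //; apply: le_trans h; rewrite ler_nat.
Qed.

Lemma path_l1 S x y p : path_in S x y p -> (l1_dist x y <= size p)%N.
Proof.
move=> [pp <- _]; elim: p x pp => [|v p IH] x /=; first by rewrite l1_dist_id.
move=> /andP[/eqP xv pp]; apply: leq_trans (l1_triangle v x _) _.
by rewrite xv add1n ltnS; exact: IH.
Qed.

Lemma measurable_near x a : measurable [set xi : config d | is_near xi x a].
Proof.
apply: measurable_and; first exact: measurable_infinite_part.
apply: measurable_all => b; apply: measurable_imp; first exact: measurable_infinite_part.
exact: measurable_prop.
Qed.

Lemma measurable_regular : measurable [set xi : config d | regular xi].
Proof.
apply: measurable_and; first by apply: measurable_ex => a; exact: measurable_infinite_part.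
apply: measurable_all => a; apply: measurable_all => b.
do 2![apply: measurable_imp; first exact: measurable_infinite_part].
exact: measurable_connT.
Qed.

Lemma measurable_dist_le x y k : measurable [set xi : config d | dist_le xi x y k].
Proof.
rewrite (_ : [set xi | _] = [set xi : config d | exists a b p, is_near xi x a /\ (is_near xi y b /\
  (path_in (occupied xi) a b p /\ (size p <= k)%N))]); last first.
  apply/seteqP; split=> xi /=; first by move=> [a [b [p [? ? ? ?]]]]; exists a, b, p.
  by move=> [a [b [p [? [? [? ?]]]]]]; exists a, b, p.
apply: measurable_ex => a; apply: measurable_ex => b; apply: measurable_ex => p.
apply: measurable_and; first exact: measurable_near.
apply: measurable_and; first exact: measurable_near.
apply: measurable_and; first exact: measurable_path.
exact: measurable_prop.
Qed.

Lemma measurable_Dst_le x y k : measurable [set xi : config d | (Dst xi x y <= k)%N].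
Proof.
rewrite (_ : [set xi | _] = [set xi : config d | regular xi -> dist_le xi x y k]).
  by apply: measurable_imp; [exact: measurable_regular|exact: measurable_dist_le].
apply/seteqP; split=> xi /=; first by move=> h rg; apply/DstP.
by move=> h; have [rg|nr] := pselect (regular xi); [apply/DstP => //; exact: h|rewrite Dst0].
Qed.

Lemma measurable_natfun (T : Type) (B : set T) (g : nat -> T) (f : config d -> nat) :
  (forall k, measurable [set xi : config d | (f xi <= k)%N]) -> measurable [set xi | B (g (f xi))].
Proof.
move=> mf; rewrite (_ : [set xi | _] = [set xi | exists k, ((f xi <= k)%N /\ forall j, (j < k)%N -> ~ (f xi <= j)%N) /\ B (g k)]).
  apply: measurable_ex => k; apply: measurable_and; last exact: measurable_prop.
  apply: measurable_and => //; apply: measurable_all => j; apply: measurable_imp; first exact: measurable_prop.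
  exact: measurable_not.
apply/seteqP; split=> xi /=.
  move=> h; exists (f xi); split=> //; split=> // j jk; apply/negP; by rewrite -ltnNge.
move=> [k [[h1 h2] h3]]; rewrite (_ : f xi = k)//; apply/eqP; rewrite eqn_leq h1 leqNgt.
by apply/negP => h; exact: (h2 _ h).
Qed.

Lemma measurable_Dst (R : realType) x y : measurable_fun setT (fun xi : config d => (Dst xi x y)%:R : R).
Proof.
move=> _ B mB; rewrite setTI; apply: (@measurable_natfun R B (fun n => n%:R) (fun xi => Dst xi x y)) => k.
exact: measurable_Dst_le.
Qed.

End NearestInfinite.

Section PassageTimes.
Context {R : realType} {d : nat}.
Context {disp : measure_display} {Omega : measurableType disp}.
Context {P : probability Omega R} {phi : Zd d -> {RV P >-> R}}.
Hypothesis d3 : (3 <= d)%N.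
Hypothesis hphi : is_GFF phi.
Variables (h1 : R) (N0 : nat) (w : nat -> nat) (E : nat -> set (config d)).
Local Notation Q h := (excursion_law phi h).
Hypothesis mE : forall N, measurable (E N).
Hypothesis wE : forall N, (N0 <= N)%N -> wide (d := d) (w N) N.
Hypothesis lE : forall N xi, (N0 <= N)%N -> E N xi -> linking N (w N) (occupied xi).
Hypothesis pE : forall h N, h <= h1 -> (N0 <= N)%N -> pr (Q h) (~` E N) <= expR (- (ln N%:R) ^+ 2).
Implicit Types (x y z a b : Zd d) (xi : config d).

Local Notation gf := (good_from E).
Local Notation inf_at xi := (infinite_part (occupied xi)).

Lemma good_from_le k j xi : (k <= j)%N -> gf k xi -> gf j xi.
Proof. by move=> kj h i ji; apply: h; exact: leq_trans ji. Qed.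

Section Good.
Variables (k : nat) (xi : config d).
Hypothesis Nk : (N0 <= 2 ^ k)%N.
Hypothesis gk : gf k xi.

Lemma N0_pow j : (k <= j)%N -> (N0 <= 2 ^ j)%N.
Proof. by move=> kj; apply: leq_trans Nk _; rewrite leq_exp2l. Qed.

(** A site escaping to [w (2 ^ j)] exists within that distance of [x] and lies in an infinite
    cluster, so the nearest such site is no farther. *)
Lemma good_near j x : (k <= j)%N -> (linf_dist 0 x <= 2 ^ j)%N ->
  exists a, [/\ is_near xi x a, (linf_dist x a <= w (2 ^ j))%N, esc (w (2 ^ j)) (occupied xi) a &
    (linf_dist 0 a <= 2 * 2 ^ j)%N].
Proof.
move=> kj bx; have [wj lj] := good_from_wide wE lE Nk kj gk; have [w40 _] := wide_le wj.
have [|b eb xb] := lj.1 x; first by move: bx; clear; lia.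
have bb : (linf_dist 0 b <= 2 * 2 ^ j)%N.
  by have := linf_triangle x 0 b; move: bx xb w40; clear; lia.
have ib : inf_at xi b.
  exact: (good_from_infinite d3 wE lE (N0_pow kj) (good_from_le kj gk) bb eb).
have [a na] := near_exists x (ex_intro _ b ib); exists a; split=> //.
- by have [h|[-> _]] := na.2 b ib => //; apply: leq_trans (ltnW h) xb.
- by have /infinite_partE[_ e] := na.1; exact: e.
have ax : (linf_dist x a <= w (2 ^ j))%N.
  by have [h|[-> _]] := na.2 b ib => //; apply: leq_trans (ltnW h) xb.
by have := linf_triangle x 0 a; move: ax bx w40; clear; lia.
Qed.

Lemma good_regular : regular xi.
Proof.
split.
  have b0 : (linf_dist (0 : Zd d) 0 <= 2 ^ k)%N by rewrite linf_dist0.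
  by have [a [[ia _] _ _ _]] := good_near (leqnn k) b0; exists a.
move=> a b ia ib; pose j := (k + linf_dist 0 a + linf_dist 0 b)%N.
have kj : (k <= j)%N by rewrite /j -addnA leq_addr.
have jj : (j <= 2 ^ j)%N by apply: ltnW; exact: ltn_expl.
have [wj lj] := good_from_wide wE lE Nk kj gk.
have [/infinite_partE[_ ea] /infinite_partE[_ eb]] := (ia, ib).
have [||p [hp _ _]] := lj.2 a b _ _ (ea _) (eb _); last by exists p.
- by apply: leq_trans (_ : j <= _)%N; [rewrite /j; clear; lia|move: jj; clear; lia].
- by apply: leq_trans (_ : j <= _)%N; [rewrite /j; clear; lia|move: jj; clear; lia].
Qed.

(** Each end point moves by at most [d * w] in l1; with the factor 4 and the additive [w] of linking
    this gives [8 * d + 1]. *)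
Lemma good_lip j x y : (k <= j)%N -> (linf_dist 0 x <= 2 ^ j)%N -> (linf_dist 0 y <= 2 ^ j)%N ->
  (Dst xi x y <= 4 * l1_dist x y + (8 * d + 1) * w (2 ^ j))%N.
Proof.
move=> kj bx by'; have [a [na xa ea ba]] := good_near kj bx; have [b [nb yb eb bb]] := good_near kj by'.
have [wj lj] := good_from_wide wE lE Nk kj gk.
have [p [hp sp _]] := lj.2 a b ba bb ea eb.
apply/(DstP _ _ _ good_regular); exists a, b, p; split=> //; apply: leq_trans sp _.
have t1 := l1_triangle x a b; have t2 := l1_triangle y x b; rewrite (l1_distC a x) in t1.
have c1 : (l1_dist x a <= d * w (2 ^ j))%N by apply: leq_trans (l1_le_linf _ _) _; rewrite leq_mul2l xa orbT.
have c2 : (l1_dist y b <= d * w (2 ^ j))%N by apply: leq_trans (l1_le_linf _ _) _; rewrite leq_mul2l yb orbT.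
by move: t1 t2 c1 c2; rewrite mulnDl mul1n -mulnA; move: (d * _)%N => q; clear; lia.
Qed.

Lemma good_lower j x y : (k <= j)%N -> (linf_dist 0 x <= 2 ^ j)%N -> (linf_dist 0 y <= 2 ^ j)%N ->
  (linf_dist x y <= Dst xi x y + 2 * w (2 ^ j))%N.
Proof.
move=> kj bx by'; have [a [na xa _ _]] := good_near kj bx; have [b [nb yb _ _]] := good_near kj by'.
have [a' [b' [p [na' nb' hp sp]]]] := Dst_path x y good_regular.
rewrite (near_uniq na' na) (near_uniq nb' nb) in hp.
have l := leq_trans (linf_le_l1 a b) (path_l1 hp).
have t1 := linf_triangle a x y; have t2 := linf_triangle b a y; rewrite (linf_distC b) in t2.
by move: t1 t2 xa yb l sp; clear; lia.
Qed.

End Good.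

Lemma wide_pow j : (N0 <= 2 ^ j)%N -> (40 * w (2 ^ j) <= 2 ^ j)%N /\ (w (2 ^ j) ^ 2 <= 2 ^ j)%N.
Proof. by move=> Nj; have wj := wE Nj; split; [have [] := wide_le wj|have [] := wj]. Qed.

Section FixedLevel.
Variable h : R.
Hypothesis hh : h <= h1.
Local Notation q := (Q h).

Lemma excursion_ergodic z : z != 0 -> forall G, measurable G -> Defs.shift z @^-1` G = G ->
  pr q G = 0 \/ pr q G = 1.
Proof.
move=> z0 G mG iG.
have inv z' G' : measurable G' -> q (Defs.shift z' @^-1` G') = q G' by exact: excursion_shift.
have mix s t := @orthant_mixing R d _ _ P phi d3 hphi h s t z z0.
by have [h0|h0] := ergodic_of_mixing inv mix mG iG; [left|right]; rewrite /pr h0.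
Qed.

Lemma iter_shift z n : iter n (Defs.shift z : config d -> config d) = Defs.shift (z *+ n).
Proof.
apply/funext => xi; apply/funext => x; elim: n x => [|n IH] x; first by rewrite /Defs.shift mulr0n addr0.
by rewrite iterS /Defs.shift -/(iter n _) IH /Defs.shift mulrS addrA.
Qed.

Definition passage z (xi : config d) : R := (Dst xi 0 z)%:R.

Lemma measurable_passage z : measurable_fun setT (passage z).
Proof. exact: measurable_Dst. Qed.

Lemma passage_le k z xi : (N0 <= 2 ^ k)%N -> gf k xi -> (linf_dist 0 z <= 2 ^ k)%N ->
  passage z xi <= (12 * d + 1)%:R * 2 ^+ k.
Proof.
move=> Nk gk bz; have [w40 _] := wide_pow Nk.
have b0 : (linf_dist (0 : Zd d) 0 <= 2 ^ k)%N by rewrite linf_dist0.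
have lip := good_lip Nk gk (leqnn k) b0 bz.
have l1 : (l1_dist 0 z <= d * 2 ^ k)%N by apply: leq_trans (l1_le_linf _ _) _; rewrite leq_mul2l bz orbT.
rewrite /passage -natrX -natrM ler_nat; move: lip l1 w40; move: (2 ^ k)%N (w _) => a b; clear; nia.
Qed.

Lemma growth_tail_bound (C : R) k i : 0 <= C ->
  C * 2 ^+ (k + i).+1 * (2 / 4 ^+ (k + i)) <= 8 * C / 2 ^+ i.
Proof.
move=> C0.
have e4 : 4 ^+ (k + i) = 2 ^+ (k + i) * 2 ^+ (k + i) :> R.
  by rewrite -exprMn; congr (_ ^+ _); rewrite -natrM.
have p2 : 1 <= 2 ^+ k :> R by rewrite exprn_ege1// (ler_nat R 1 2).
have p3 : 0 < 2 ^+ i :> R by rewrite exprn_gt0.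
have p4 : 0 < 2 ^+ k :> R by rewrite exprn_gt0.
rewrite e4 exprS exprD.
have -> : C * (2 * (2 ^+ k * 2 ^+ i)) * (2 / (2 ^+ k * 2 ^+ i * (2 ^+ k * 2 ^+ i))) =
   4 * C / 2 ^+ i / 2 ^+ k by field; rewrite !gt_eqF.
have x0 : 0 <= C / 2 ^+ i by rewrite divr_ge0// ltW.
rewrite (ler_pdivrMr _ _ p4) -(mulrA 4) -(mulrA 8).
by move: x0 p2; move: (C / 2 ^+ i) (2 ^+ k) => x y x0 y1; have := mulr_ge0 x0 (le_trans ler01 y1); have := ler_wpM2l x0 y1; lra.
Qed.

(** Dominated by [b] plus a series: when the first good index is [k1 + i.+1], the passage time is at
    most [c i], of order 2^(k1 + i), on an event [A i] of probability of order 4^-(k1 + i). The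
    series of means is geometric. *)
Lemma passage_integ z : integ q (passage z).
Proof.
have [k0 hk] := good_from_prob_quarter mE pE.
pose k1 := maxn k0 (linf_dist 0 z).
have kk i : (k0 <= k1 + i)%N by apply: leq_trans (leq_maxl _ _) (leq_addr _ _).
have zk i : (linf_dist 0 z <= 2 ^ (k1 + i))%N.
  by apply: leq_trans (leq_maxr k0 _) _; apply: leq_trans (leq_addr i _) (ltnW (ltn_expl _ _)).
have [C C1 pl] : exists2 C : R, 1 <= C & forall k xi, (N0 <= 2 ^ k)%N -> gf k xi ->
    (linf_dist 0 z <= 2 ^ k)%N -> passage z xi <= C * 2 ^+ k.
  exists (12 * d + 1)%:R; first by rewrite (ler_nat R 1) addn1.
  by move=> k xi; exact: passage_le.
have C0 : 0 <= C by apply: le_trans C1.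
pose c i : R := C * 2 ^+ (k1 + i).+1.
have c0 i : 0 <= c i by rewrite mulr_ge0// exprn_ge0.
pose A i : set (config d) := ~` gf (k1 + i).
have mA i : measurable (A i) by apply: measurableC; exact: measurable_good_from.
pose b : R := C * 2 ^+ k1.
have b0 : 0 <= b by rewrite mulr_ge0// exprn_ge0.
pose F i (xi : config d) : R := c i * ind (A i) xi.
have F0 i xi : 0 <= F i xi by rewrite mulr_ge0.
have mF i : measurable_fun setT (F i).
  by apply: measurable_funM; [exact: measurable_cst|exact: measurable_ind].
have IF i : (\int[q]_xi (F i xi)%:E <= (8 * C / 2 ^+ i)%:E)%E.
  rewrite (ExE (integZ _ (integ_ind q (mA i)))) lee_fin (ExZ _ (integ_ind q (mA i))) Ex_ind//.
  have [_ p] := hk _ (kk i); have {}p := p h hh.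
  apply: le_trans (_ : c i * (2 / 4 ^+ (k1 + i)) <= _); first by rewrite ler_wpM2l.
  exact: growth_tail_bound.
have bound xi : ((passage z xi)%:E <= b%:E + \sum_(0 <= i <oo) (F i xi)%:E)%E.
  have S0 : (0 <= \sum_(0 <= i <oo) (F i xi)%:E)%E.
    by apply: nneseries_ge0 => i _ _; rewrite lee_fin.
  have term i : ((F i xi)%:E <= \sum_(0 <= i <oo) (F i xi)%:E)%E.
    apply: le_trans (_ : (\sum_(0 <= j < i.+1) (F j xi)%:E <= _)%E); last first.
      by apply: nneseries_lim_ge => j _ _; rewrite lee_fin.
    rewrite big_nat_recr//= leeDr// sume_ge0// => j _; by rewrite lee_fin.
  have [g|ng] := pselect (gf k1 xi).
    apply: le_trans (_ : (b%:E <= _)%E); last by rewrite leeDl.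
    rewrite lee_fin; have [Nk _] := hk _ (kk 0%N); rewrite addn0 in Nk.
    by apply: pl => //; have := zk 0%N; rewrite addn0.
  have [i [Ai pi]] : exists i, A i xi /\ passage z xi <= c i.
    have [[j gj]|no] := pselect (exists j, gf (k1 + j) xi).
      have ex : exists j, `[< gf (k1 + j) xi >] by exists j; apply/asboolP.
      case: (ex_minnP ex) => m /asboolP gm mm.
      case: m gm mm => [|m] gm mm; first by rewrite addn0 in gm.
      exists m; split; first by move=> gm'; have := mm m (asboolT gm'); rewrite ltnn.
      have [Nk _] := hk _ (kk m.+1); have := pl _ _ Nk gm (zk m.+1).
      by rewrite /c -addnS.
    (* No index from [k1] on is good. This is a null event, but domination is wanted at every point:
       all [A m] hold here, and some [c m] exceeds the passage time. *)
    have pz0 : 0 <= passage z xi by [].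
    pose m := Num.truncn (passage z xi); exists m; split; first by move=> gm; apply: no; exists m.
    apply: le_trans (ltW (truncnS_gt _)) _; rewrite -/m /c.
    apply: le_trans (_ : 1 * 2 ^+ m.+1 <= _).
      by rewrite mul1r -natrX ler_nat; apply: ltnW; exact: ltn_expl.
    apply: ler_pM => //.
    by rewrite -!natrX ler_nat leq_exp2l// ltnS leq_addl.
  apply: le_trans (_ : ((F i xi)%:E <= _)%E).
    by rewrite lee_fin /F /ind asboolT// mulr1.
  by apply: le_trans (term i) _; rewrite leeDr// lee_fin.
apply/integrableP; split; first by apply/measurable_EFinP; exact: measurable_passage.
under eq_integral do rewrite /= ger0_norm//.
have mS : measurable_fun setT (fun xi : config d => \sum_(0 <= i <oo) (F i xi)%:E)%E.
  apply: (@ge0_emeasurable_sum _ _ _ _ (fun i xi => (F i xi)%:E) xpredT).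
    by move=> i xi _ _; rewrite lee_fin.
  by move=> i _; apply/measurable_EFinP.
apply: le_lt_trans (_ : (\int[q]_xi (b%:E + \sum_(0 <= i <oo) (F i xi)%:E) < +oo)%E).
  apply: ge0_le_integral => //.
  - by move=> xi _; rewrite lee_fin.
  - by apply/measurable_EFinP; exact: measurable_passage.
  - by apply: emeasurable_funD => //; exact: measurable_cst.
rewrite ge0_integralD//; last by move=> xi _; apply: nneseries_ge0 => i _ _; rewrite lee_fin.
rewrite integral_cst//; have /= -> := @probability_setT _ _ _ q; rewrite mule1.
rewrite integral_nneseries//; last first.
  - by move=> i xi _; rewrite lee_fin.
  - by move=> i; apply/measurable_EFinP.
apply: lte_add_pinfty; first exact: ltry.
apply: le_lt_trans (ltry (16 * C)); apply: lime_le.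
  by apply: is_cvg_nneseries => i _ _; apply: integral_ge0 => xi _; rewrite lee_fin.
apply: nearW => n; apply: le_trans (_ : (\sum_(0 <= i < n) (8 * C / 2 ^+ i)%:E <= _)%E).
  by apply: lee_sum => i _; exact: IF.
rewrite sumEFin lee_fin.
suff : \sum_(0 <= i < n) (8 * C / 2 ^+ i) <= 16 * C - 16 * C / 2 ^+ n.
  have : 0 <= 16 * C / 2 ^+ n by rewrite divr_ge0 ?exprn_ge0// mulr_ge0.
  lra.
elim: n => [|n IH]; first by rewrite big_geq// expr0 divr1 subrr.
rewrite big_nat_recr//= exprS invfM; move: IH; lra.
Qed.

End FixedLevel.
End PassageTimes.

(** * Time constants and the shape theorem *)

Section TimeConstant.
Context {R : realType} {V : zmodType}.
Variable e : V -> R.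
Hypothesis e_ge0 : forall x, 0 <= e x.
Hypothesis e_sub : forall x y, e (x + y) <= e x + e y.
Hypothesis e_0 : e 0 = 0.

(** Infimum form of the limit of e (z *+ n) / n for a subadditive sequence; its two defining
    properties, [tc_le] and [tc_adh], suffice without passing to the limit. *)
Definition time_constant z : R := inf [set r | exists2 n, (0 < n)%N & r = e (z *+ n) / n%:R].
Local Notation mu := time_constant.

Let rates_inf z : has_inf [set r | exists2 n, (0 < n)%N & r = e (z *+ n) / n%:R].
Proof.
split; first by exists (e (z *+ 1) / 1%:R), 1%N.
by exists 0 => _ [n _ ->]; rewrite divr_ge0.
Qed.

Lemma tc_le z n : (0 < n)%N -> mu z * n%:R <= e (z *+ n).
Proof.
move=> n0; rewrite -ler_pdivlMr ?ltr0n//; apply: ge_inf; first by have [] := rates_inf z.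
by exists n.
Qed.

Lemma tc_adh z eps : 0 < eps -> exists2 n, (0 < n)%N & e (z *+ n) <= (mu z + eps) * n%:R.
Proof.
move=> eps0; have [_ [n n0 ->] h] := inf_adherent eps0 (rates_inf z).
by exists n => //; rewrite -ler_pdivrMr ?ltr0n// ltW.
Qed.

Lemma tc_ge0 z : 0 <= mu z.
Proof. by apply: lb_le_inf; [have [] := rates_inf z|move=> _ [n _ ->]; rewrite divr_ge0]. Qed.

Lemma e_muln z n : e (z *+ n) <= n%:R * e z.
Proof.
elim: n => [|n IH]; first by rewrite mulr0n e_0 mul0r.
by rewrite mulrS; apply: le_trans (e_sub _ _) _; rewrite -natr1 mulrDl mul1r addrC lerD2r.
Qed.

Lemma tc_sub x y : mu (x + y) <= mu x + mu y.
Proof.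
apply/ler_addgt0Pr => eps eps0; have e2 : 0 < eps / 2 by rewrite divr_gt0.
have [n n0 hn] := tc_adh x e2; have [m m0 hm] := tc_adh y e2.
have N0 : 0 < (n * m)%:R :> R by rewrite ltr0n muln_gt0 n0.
rewrite -(ler_pM2r N0); apply: le_trans (tc_le _ _) _; first by rewrite muln_gt0 n0.
rewrite mulrnDl; apply: le_trans (e_sub _ _) _.
have hx : e (x *+ (n * m)) <= m%:R * ((mu x + eps / 2) * n%:R).
  by rewrite mulrnA; apply: le_trans (e_muln _ _) _; rewrite ler_wpM2l.
have hy : e (y *+ (n * m)) <= n%:R * ((mu y + eps / 2) * m%:R).
  by rewrite mulnC mulrnA; apply: le_trans (e_muln _ _) _; rewrite ler_wpM2l.
apply: le_trans (lerD hx hy) _; rewrite natrM le_eqVlt; apply/orP; left; apply/eqP; by field.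
Qed.

Lemma tc_hom x m : mu (x *+ m) = m%:R * mu x.
Proof.
apply/eqP; rewrite eq_le; apply/andP; split; apply/ler_addgt0Pr => eps eps0.
  have em : 0 < eps / m.+1%:R by rewrite divr_gt0.
  have [n n0 hn] := tc_adh x em; have N0 : 0 < n%:R :> R by rewrite ltr0n.
  rewrite -(ler_pM2r N0); apply: le_trans (tc_le _ n0) _.
  rewrite -mulrnA mulnC mulrnA; apply: le_trans (e_muln _ _) _.
  apply: le_trans (ler_wpM2l _ hn) _ => //; rewrite mulrA ler_wpM2r// mulrDr lerD2l.
  by rewrite mulrCA ger_pMr// ler_pdivrMr// mul1r ler_nat.
have [n n0 hn] := tc_adh (x *+ m) eps0; have N0 : 0 < n%:R :> R by rewrite ltr0n.
rewrite -(ler_pM2r N0); apply: le_trans hn; have [->|m0] := posnP m.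
  by rewrite mul0r mul0r.
by rewrite -mulrnA mulrAC mulrC -natrM tc_le// muln_gt0 m0.
Qed.

End TimeConstant.

Lemma four_terms_le (R : realFieldType) (u b t : R) : b <= t -> u + t + t + (b + t) <= u + 4 * t.
Proof. lra. Qed.

Lemma l1_mulrn d (z : Zd d) n : (l1_dist 0 (z *+ n) = n * l1_dist 0 z)%N.
Proof.
rewrite /l1_dist big_distrr /=; apply: eq_bigr => i _.
by rewrite !mxE !sub0r mulmxnE; move: (z 0 i) => u; lia.
Qed.

Lemma inner_radius_bound (R : realFieldType) (eps r l m n : R) : 0 < eps -> eps < 1 -> 0 < r ->
  l <= m -> m <= (1 - eps) * r -> n <= eps / 4 * r -> m + (eps / 4 * l + n) <= r.
Proof.
move=> e0 e1 r0 lm mr nr.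
have h1 : eps / 4 * l <= eps / 4 * r.
  have e4 : 0 <= eps / 4 by rewrite divr_ge0 ?ltW.
  by apply: ler_wpM2l => //; apply: le_trans lm _; apply: le_trans mr _; rewrite ler_piMl ?ltW//; lra.
have h2 := mulr_gt0 e0 r0; nra.
Qed.

Lemma outer_radius_bound (R : realFieldType) (eps r l m n D : R) : 0 < eps -> eps < 1 -> 0 < r ->
  l <= m -> m - (eps / 4 * l + n) <= D -> D <= r -> n <= eps / 4 * r -> m <= (1 + eps) * r.
Proof.
move=> e0 e1 r0 lm h1 h2 h3.
have h4 : eps / 4 * l <= eps / 4 * m by apply: ler_wpM2l => //; rewrite divr_ge0// ltW.
have h5 : (1 - eps / 4) * m <= (1 + eps / 4) * r by nra.
have h6 : (1 + eps / 4) * r <= (1 - eps / 4) * ((1 + eps) * r) by have := mulr_gt0 e0 r0; nra.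
have p : 0 < 1 - eps / 4 by lra.
by rewrite -(ler_pM2l p); apply: le_trans h5 h6.
Qed.

Section Asymptotics.
Context {R : realType} {d : nat}.
Hypothesis d3 : (3 <= d)%N.
Variables (N0 : nat) (w : nat -> nat) (E : nat -> set (config d)).
Hypothesis wE : forall N, (N0 <= N)%N -> wide (d := d) (w N) N.
Hypothesis lE : forall N xi, (N0 <= N)%N -> E N xi -> linking N (w N) (occupied xi).
Implicit Types (x y z : Zd d) (xi : config d).

(** From w^2 <= 2^j: either w is at most a constant, or c w >= 1 and then w <= c w^2 <= c 2^j. *)
Lemma w_small k (c : R) : (N0 <= 2 ^ k)%N -> 0 < c ->
  exists j0, forall j, (j0 <= j)%N -> (k <= j)%N -> (w (2 ^ j))%:R <= c * 2 ^+ j.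
Proof.
move=> Nk c0; pose K := (Num.truncn (c^-1)).+1; pose L := (Num.truncn (K%:R / c)).+1.
have cK : c^-1 < K%:R by exact: truncnS_gt.
have KL : K%:R / c < L%:R by exact: truncnS_gt.
exists L => j Lj kj; have [_ w2] := wide_pow wE (N0_pow Nk kj).
have [wK|Kw] := leqP (w (2 ^ j)) K.
  apply: le_trans (_ : K%:R <= _); first by rewrite ler_nat.
  rewrite mulrC -ler_pdivrMr//; apply: le_trans (ltW KL) _.
  by rewrite -natrX ler_nat; apply: leq_trans Lj (ltnW (ltn_expl _ _)).
have h1 : 1 <= c * (w (2 ^ j))%:R.
  rewrite -ler_pdivrMl// mulr1; apply: le_trans (ltW cK) _; by rewrite ler_nat ltnW.
have h2 : (w (2 ^ j))%:R * (w (2 ^ j))%:R <= 2 ^+ j :> R.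
  by rewrite -natrX -natrM ler_nat mulnn.
apply: le_trans (ler_wpM2l (ltW c0) h2); rewrite mulrA.
by apply: le_trans (ler_wpM2r _ h1) => //; rewrite mul1r.
Qed.

Lemma good_asymp k xi (c : R) : (N0 <= 2 ^ k)%N -> good_from E k xi -> 0 < c ->
  exists n0, forall n x y, (n0 <= n)%N -> (linf_dist 0 x <= n)%N -> (linf_dist 0 y <= n)%N ->
    (Dst xi x y)%:R <= 4 * (l1_dist x y)%:R + c * n%:R /\
    (linf_dist x y)%:R <= (Dst xi x y)%:R + c * n%:R.
Proof.
move=> Nk gk c0; pose c' := c / (2 * (8 * d + 2)%:R).
have q0 : 0 < (8 * d + 2)%:R :> R by rewrite ltr0n addn2.
have c'0 : 0 < c' by rewrite divr_gt0// mulr_gt0.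
have [j0 hj] := w_small Nk c'0.
exists (2 ^ (j0 + k)).+1 => n x y nn bx by'.
have n0 : (0 < n)%N by apply: leq_trans nn.
have [j [nj jn]] := pow2_between n0.
have jk : (j0 + k <= j)%N by rewrite -(@leq_exp2l 2)//; apply: leq_trans nj; exact: ltnW.
have kj : (k <= j)%N by apply: leq_trans jk; exact: leq_addl.
have wj : (8 * d + 2)%:R * (w (2 ^ j))%:R <= c * n%:R.
  apply: le_trans (ler_wpM2l (ltW q0) (hj j _ kj)) _; first by apply: leq_trans jk; exact: leq_addr.
  have qf (Q u : R) : 0 < Q -> Q * (c / (2 * Q) * u) = c * (u / 2).
    by move=> Q0; field; rewrite gt_eqF.
  rewrite /c' (qf _ _ q0).
  by rewrite ler_pM2l// ler_pdivrMr// mulrC -natrX -natrM ler_nat.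
have bx' := leq_trans bx nj; have by2 := leq_trans by' nj.
have lip := good_lip d3 wE lE Nk gk kj bx' by2; have low := good_lower d3 wE lE Nk gk kj bx' by2.
have l1 : (Dst xi x y <= 4 * l1_dist x y + (8 * d + 2) * w (2 ^ j))%N.
  by apply: leq_trans lip _; rewrite leq_add2l leq_mul2r leq_add2l orbT.
have l2 : (linf_dist x y <= Dst xi x y + (8 * d + 2) * w (2 ^ j))%N.
  by apply: leq_trans low _; rewrite leq_add2l leq_mul2r leq_addl orbT.
split; first by apply: le_trans (_ : (4 * l1_dist x y + (8 * d + 2) * w (2 ^ j))%:R <= _);
  [rewrite ler_nat|rewrite natrD !natrM lerD2l].
by apply: le_trans (_ : (Dst xi x y + (8 * d + 2) * w (2 ^ j))%:R <= _);
  [rewrite ler_nat|rewrite natrD natrM lerD2l].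
Qed.

End Asymptotics.

(** * Typical configurations and the shape theorem *)

Section Shape.
Context {R : realType} {d : nat}.
Context {disp : measure_display} {Omega : measurableType disp}.
Context {P : probability Omega R} {phi : Zd d -> {RV P >-> R}}.
Hypothesis d3 : (3 <= d)%N.
Hypothesis hphi : is_GFF phi.
Variables (h1 : R) (N0 : nat) (w : nat -> nat) (E : nat -> set (config d)).
Local Notation Q h := (excursion_law phi h).
Hypothesis mE : forall N, measurable (E N).
Hypothesis wE : forall N, (N0 <= N)%N -> wide (d := d) (w N) N.
Hypothesis lE : forall N xi, (N0 <= N)%N -> E N xi -> linking N (w N) (occupied xi).
Hypothesis pE : forall h N, h <= h1 -> (N0 <= N)%N -> pr (Q h) (~` E N) <= expR (- (ln N%:R) ^+ 2).
Variable h : R.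
Hypothesis hh : h <= h1.
Local Notation q := (Q h).
Implicit Types (x y z a b : Zd d) (xi : config d).

Let Psg z : config d -> R := passage z.
Let pint z : integ q (Psg z) := passage_integ d3 mE wE lE pE hh z.
Let pge0 z xi : 0 <= Psg z xi. Proof. by []. Qed.
Let inv z G : measurable G -> q (Defs.shift z @^-1` G) = q G.
Proof. exact: excursion_shift. Qed.
Let mS z := @measurable_shift d z.

Definition mean_passage z : R := Ex q (passage z).
Local Notation e := mean_passage.
Local Notation mu := (time_constant e).

Let PsgD x y xi : Psg (x + y) xi <= Psg x xi + Psg y (Defs.shift x xi).
Proof.
rewrite /Psg /passage Dst_shift add0r -natrD ler_nat (addrC y); exact: Dst_triangle.
Qed.

Lemma mean_passage_ge0 z : 0 <= e z.
Proof. by apply: fine_ge0; apply: integral_ge0 => xi _; rewrite lee_fin. Qed.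

Lemma mean_passage_sub x y : e (x + y) <= e x + e y.
Proof.
have it := integ_T (mS x) (@inv x) (pint y) (@pge0 y).
rewrite -[e y](Ex_T (mS x) (@inv x) (pint y) (@pge0 y)) -(ExD (pint x) it).
by apply: Ex_le => //; exact: integD.
Qed.

Lemma mean_passage0 : e 0 = 0.
Proof.
rewrite /e /Ex (eq_integral (fun=> 0%E)) ?integral0// => xi _.
by rewrite /passage Dst_refl.
Qed.

Let mu_ge0 := tc_ge0 mean_passage_ge0.
Let mu_sub := tc_sub mean_passage_ge0 mean_passage_sub mean_passage0.
Let mu_hom := tc_hom mean_passage_ge0 mean_passage_sub mean_passage0.

Lemma full_prop (A : Prop) (B : set (config d)) : (A -> full q B) -> full q [set xi | A -> B xi].
Proof.
have [a|na] := pselect A => hB.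
  by rewrite (_ : [set xi | _] = B); [exact: hB|apply/seteqP; split=> xi /=; [apply|]].
rewrite (_ : [set xi | _] = setT); first by split; [exact: measurableT|exact: pr_setT].
by apply/seteqP; split=> // xi _ /na.
Qed.

Lemma mulrn_neq0 z n : z != 0 -> (0 < n)%N -> z *+ n != 0.
Proof.
move=> z0 n0; apply: contra_neq z0 => e.
have := l1_mulrn z n; rewrite e l1_dist_id => /esym/eqP; rewrite muln_eq0 gtn_eqF//= => /eqP h0.
by apply/esym/linf_eq0/eqP; have := linf_le_l1 0 z; rewrite h0 leqn0.
Qed.

Lemma full_good : full q [set xi | exists k, (N0 <= 2 ^ k)%N /\ good_from E k xi].
Proof.
set G := [set xi | _].
have mG : measurable G.
  apply: measurable_ex => k; apply: measurable_and; [exact: measurable_prop|exact: measurable_good_from].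
split=> //; have := prC q mG; suff : pr q (~` G) <= 0.
  by have := pr_ge0 q (~` G); move: (pr q G) (pr q _) => a b; lra.
apply/ler_addgt0Pr => eps eps0; rewrite add0r.
have [k0 hk] := good_from_prob_quarter mE pE; have e2 : 0 < eps / 2 by rewrite divr_gt0.
have [j hj] := inv_small e2.
have [Nk pk] := hk (maxn k0 j) (leq_maxl _ _).
apply: le_trans (_ : pr q (~` good_from E (maxn k0 j)) <= _).
  apply: pr_le; [exact: measurableC|apply: measurableC; exact: measurable_good_from|].
  by move=> xi ng gk; apply: ng; exists (maxn k0 j).
apply: le_trans (pk h hh) _; rewrite -ler_pdivlMl// mulrC.
apply: le_trans (ltW hj); rewrite lef_pV2 ?posrE ?ltr0n ?exprn_gt0//.
rewrite -natrX ler_nat; apply: leq_trans (ltn_expl (maxn k0 j) (isT : (1 < 4)%N)).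
by rewrite ltnS leq_maxr.
Qed.

Lemma full_lower z (j : nat) : z != 0 ->
  full q [set xi | exists k, forall n, (k <= n)%N -> (mu z - j.+1%:R^-1) * n%:R <= Psg (z *+ n) xi].
Proof.
move=> z0; have er : ergodic_map q (Defs.shift z).
  by move=> G mG iG; exact: (excursion_ergodic d3 hphi h z0 mG iG).
have eps0 : 0 < j.+1%:R^-1 :> R by rewrite invr_gt0.
apply: (@kingman_lower _ _ _ q _ (mS z) (@inv z) er (fun n => Psg (z *+ n)) (mu z) _) => //.
- by move=> xi; rewrite /Psg /passage mulr0n Dst_refl.
- by move=> n m xi; rewrite iter_shift mulrnDr; exact: PsgD.
- by move=> n n0; exact: (tc_le mean_passage_ge0).
Qed.

(** The passage time is at most the sum over consecutive segments [z *+ m], to which the ergodic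
    theorem for the shift by [z *+ m] applies: every nonzero shift is ergodic, not only that by
    [z]. *)
Lemma full_upper z m (j : nat) : z != 0 -> (0 < m)%N ->
  full q [set xi | exists k, forall n, (k <= n)%N ->
    Psg (z *+ (m * n)) xi <= (e (z *+ m) + j.+1%:R^-1) * n%:R].
Proof.
move=> z0 m0; have zm := mulrn_neq0 z0 m0.
have er : ergodic_map q (Defs.shift (z *+ m)).
  by move=> G mG iG; exact: (excursion_ergodic d3 hphi h zm mG iG).
have eps0 : 0 < j.+1%:R^-1 :> R by rewrite invr_gt0.
have [mB B1] := birkhoff_upper (mS (z *+ m)) (@inv (z *+ m)) er (pint (z *+ m)) (@pge0 _) eps0.
set A := [set xi | _].
have mA : measurable A.
  apply: measurable_ex => k; apply: measurable_all => n; apply: measurable_imp; first exact: measurable_prop.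
  by rewrite -[X in measurable X]setTI;
    exact: (measurable_fun_le measurableT (integ_meas (pint _)) (measurable_cst _)).
have tel n xi : Psg (z *+ (m * n)) xi <= \sum_(0 <= i < n) Psg (z *+ m) (iter i (Defs.shift (z *+ m)) xi).
  elim: n => [|n IH]; first by rewrite big_geq// muln0 mulr0n /Psg /passage Dst_refl.
  rewrite big_nat_recr//= mulnS addnC mulrnDr; apply: le_trans (PsgD _ _ _) _.
  by rewrite iter_shift -mulrnA lerD2r.
split=> //; apply/eqP; rewrite eq_le (pr_le1 q mA) /= -B1; apply: pr_le => // xi [k hk].
by exists k => n kn; apply: le_trans (hk n kn); exact: tel.
Qed.

(** Gathers the almost sure statements for all directions, block lengths and precisions, which are
    countably many; the convergence arguments that follow are deterministic on it. *)
Definition typical : set (config d) :=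
  [set xi | exists k, (N0 <= 2 ^ k)%N /\ good_from E k xi] `&`
  ([set xi | forall z (j : nat), z != 0 ->
     exists k, forall n, (k <= n)%N -> (mu z - j.+1%:R^-1) * n%:R <= Psg (z *+ n) xi] `&`
   [set xi | forall z (m j : nat), z != 0 /\ (0 < m)%N -> exists k, forall n, (k <= n)%N ->
     Psg (z *+ (m * n)) xi <= (e (z *+ m) + j.+1%:R^-1) * n%:R]).

Lemma full_typical : full q typical.
Proof.
apply: fullI; first exact: full_good.
apply: fullI.
  apply: full_all => z; apply: full_all => j; apply: full_prop => z0; exact: full_lower.
apply: full_all => z; apply: full_all => m; apply: full_all => j; apply: full_prop => -[z0 m0].
exact: full_upper.
Qed.

Lemma typical_asymp xi z (c : R) : typical xi -> 0 < c ->
  exists n0, forall n i k, (n0 <= n)%N -> (i <= n)%N -> (k <= n)%N ->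
    (Dst xi (z *+ i) (z *+ k))%:R <= 4 * (l1_dist (z *+ i) (z *+ k))%:R + c * n%:R /\
    (linf_dist (z *+ i) (z *+ k))%:R <= (Dst xi (z *+ i) (z *+ k))%:R + c * n%:R.
Proof.
move=> [[k0 [Nk gk]] _] c0; pose L := (linf_dist 0 z).+1.
have L0 : 0 < L%:R :> R by rewrite ltr0n.
have [n0 hn] := good_asymp d3 wE lE Nk gk (divr_gt0 c0 L0).
exists n0 => n i k nn iN kN.
have nL : (n0 <= n * L)%N by apply: leq_trans nn _; rewrite leq_pmulr.
have b j : (j <= n)%N -> (linf_dist 0 (z *+ j) <= n * L)%N.
  move=> jn; have := linf_mulrn 0 z j; rewrite mul0rn => ->.
  by rewrite mulnC leq_mul.
have := hn _ _ _ nL (b i iN) (b k kN).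
by rewrite natrM (_ : c / L%:R * (n%:R * L%:R) = c * n%:R)//; field; rewrite gt_eqF.
Qed.

(** The lower bound is the subadditive one in the direction [z]. For the upper bound, [m] is chosen
    with [e (z *+ m)] near [mu z * m], the ergodic average is taken along multiples of [m], and the
    remainder of [n] modulo [m] is covered by the Lipschitz bound. Four errors [eps / 4] add up. *)
Lemma typical_conv xi : typical xi -> forall z (eps : R), 0 < eps -> exists n0 : nat, forall n, (n0 <= n)%N ->
  `|(Dst xi 0 (z *+ n))%:R - mu z * n%:R| <= eps * n%:R.
Proof.
move=> tx z eps eps0; have [z0|z0] := eqVneq z 0.
  exists 0%N => n _; rewrite z0 mul0rn Dst_refl.
  have := mu_hom 0 0; rewrite mul0rn mul0r => ->.
  by rewrite mul0r subrr normr0 mulr_ge0// ltW.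
have e4 : 0 < eps / 4 by rewrite divr_gt0.
have [j hj] := inv_small e4; have [m m0 hm] := tc_adh mean_passage_ge0 z e4.
have [n1 as1] := typical_asymp z tx e4.
have [_ [/(_ z j z0)[k1 lo] /(_ z m j (conj z0 m0))[k2 up]]] := tx.
pose B : R := 4 * (m * l1_dist 0 z)%:R; pose n2 := (Num.truncn (B / (eps / 4))).+1.
have Bn2 : B / (eps / 4) < n2%:R by exact: truncnS_gt.
exists (n1 + k1 + m * k2 + n2)%N => n nn.
have n1n : (n1 <= n)%N by move: nn; clear; lia.
have k1n : (k1 <= n)%N by move: nn; clear; lia.
have k2n : (m * k2 <= n)%N by move: nn; clear; lia.
have n2n : (n2 <= n)%N by move: nn; clear; lia.
have N0' : 0 <= n%:R :> R by [].
have low := lo n k1n; rewrite ler_distl; apply/andP; split.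
  apply: le_trans low; rewrite -mulrBl ler_wpM2r// lerB//.
  by apply: le_trans (ltW hj) _; rewrite ler_piMr ?(ltW eps0)// invf_le1// (ler_nat R 1 4).
pose Q := (n %/ m)%N; pose r := (n %% m)%N.
have nE : n = (m * Q + r)%N by rewrite mulnC -divn_eq.
have rm : (r <= m)%N by rewrite ltnW// ltn_mod.
have mQ : (m * Q <= n)%N by rewrite [X in (_ <= X)%N]nE leq_addr.
have Qk : (k2 <= Q)%N by rewrite leq_divRL// mulnC.
have hup := up Q Qk.
have [has _] := as1 n (m * Q)%N n n1n mQ (leqnn n).
have l1E : (l1_dist (z *+ (m * Q)) (z *+ n) <= m * l1_dist 0 z)%N.
  rewrite [X in l1_dist _ (z *+ X)]nE addnC mulrnDr -{1}(add0r (z *+ (m * Q))) l1_distD l1_mulrn.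
  by rewrite leq_mul2r rm orbT.
have tri : (Dst xi 0 (z *+ n))%:R <= Psg (z *+ (m * Q)) xi + (Dst xi (z *+ (m * Q)) (z *+ n))%:R :> R.
  by rewrite -natrD ler_nat; exact: Dst_triangle.
have hB : 4 * (l1_dist (z *+ (m * Q)) (z *+ n))%:R <= eps / 4 * n%:R :> R.
  apply: le_trans (_ : B <= _); first by rewrite ler_wpM2l// ler_nat.
  by rewrite mulrC -ler_pdivrMr//; apply: le_trans (ltW Bn2) _; rewrite ler_nat.
have QN : Q%:R <= n%:R :> R by rewrite ler_nat; exact: leq_div.
have mQN : m%:R * Q%:R <= n%:R :> R by rewrite -natrM ler_nat.
have Q0 : 0 <= Q%:R :> R by [].
have hup2 : Psg (z *+ (m * Q)) xi <= (mu z + eps / 4) * n%:R + eps / 4 * n%:R.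
  apply: le_trans hup _; rewrite mulrDl; apply: lerD; last first.
    by apply: ler_pM => //; exact: ltW.
  apply: le_trans (ler_wpM2r Q0 hm) _; rewrite -mulrA ler_wpM2l//.
  by apply: addr_ge0; [exact: mu_ge0|exact: ltW].
apply: le_trans tri _; apply: le_trans (lerD hup2 has) _.
move: hB; rewrite [(mu z + _) * _]mulrDl.
move: (4 * (l1_dist _ _)%:R) (mu z * n%:R) => b u hB.
by rewrite (_ : eps * n%:R = 4 * (eps / 4 * n%:R)); [exact: four_terms_le|field].
Qed.

Lemma typical_point : exists xi, typical xi.
Proof. exact: (full_nonempty full_typical). Qed.

(** [mu] is deterministic, so one typical configuration is enough to transfer to it the asymptotic
    bounds on passage times. *)
Lemma tc_lo z : (linf_dist 0 z)%:R <= mu z.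
Proof.
have [xi tx] := typical_point; apply/ler_addgt0Pr => eps eps0.
have e2 : 0 < eps / 2 by rewrite divr_gt0.
have [n1 as1] := typical_asymp z tx e2; have [n2 cv] := typical_conv tx z e2.
pose n := (n1 + n2).+1; have n0 : 0 < n%:R :> R by rewrite ltr0n.
have n1n : (n1 <= n)%N by rewrite /n; clear; lia.
have n2n : (n2 <= n)%N by rewrite /n; clear; lia.
have := cv n n2n; rewrite ler_distl => /andP[_ h1'].
have [_ h2] := as1 n 0%N n n1n (leq0n _) (leqnn _); rewrite mulr0n in h2.
have := linf_mulrn 0 z n; rewrite mul0rn => lE'; rewrite lE' natrM in h2.
rewrite -(ler_pM2r n0) mulrDl; apply: le_trans h2 _.
by rewrite (_ : eps * n%:R = eps / 2 * n%:R + eps / 2 * n%:R) ?addrA ?lerD2r//; field.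
Qed.

Lemma tc_hi z : mu z <= 4 * (l1_dist 0 z)%:R.
Proof.
have [xi tx] := typical_point; apply/ler_addgt0Pr => eps eps0.
have e2 : 0 < eps / 2 by rewrite divr_gt0.
have [n1 as1] := typical_asymp z tx e2; have [n2 cv] := typical_conv tx z e2.
pose n := (n1 + n2).+1; have n0 : 0 < n%:R :> R by rewrite ltr0n.
have n1n : (n1 <= n)%N by rewrite /n; clear; lia.
have n2n : (n2 <= n)%N by rewrite /n; clear; lia.
have := cv n n2n; rewrite ler_distl => /andP[h1' _].
have [h2 _] := as1 n 0%N n n1n (leq0n _) (leqnn _); rewrite mulr0n l1_mulrn natrM in h2.
rewrite -(ler_pM2r n0) mulrDl -(mulrA 4) (mulrC _%:R n%:R).
rewrite (_ : eps * n%:R = eps / 2 * n%:R + eps / 2 * n%:R); last by field.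
rewrite addrA -lerBlDr; apply: le_trans h2; by rewrite mulrC (mulrC n%:R).
Qed.

Lemma typical_uniform xi (delta : R) : typical xi -> 0 < delta -> exists n : nat, forall x,
  `|(Dst xi 0 x)%:R - mu x| <= delta * (linf_dist 0 x)%:R + n%:R.
Proof.
move=> tx; have [[k [Nk gk]] _] := tx.
apply: (@uniform_conv _ _ mu mu_sub mu_hom tc_hi (Dst xi) (fun j => w (2 ^ j)) k).
- by move=> x y z; exact: Dst_triangle.
- by move=> x y; exact: Dst_sym.
- by move=> j kj; have [] := wide_pow wE (N0_pow Nk kj).
- by move=> j x y; exact: (good_lip d3 wE lE Nk gk).
- exact: typical_conv.
Qed.

Definition uniform_at (delta : R) n : set (config d) := [set xi | regular xi /\
  forall x, `|(Dst xi 0 x)%:R - mu x| <= delta * (linf_dist 0 x)%:R + n%:R].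

Lemma measurable_uniform_at delta n : measurable (uniform_at delta n).
Proof.
apply: measurable_and; first exact: measurable_regular.
apply: measurable_all => x.
apply: (@measurable_natfun _ R [set r | `|r - mu x| <= delta * (linf_dist 0 x)%:R + n%:R] (fun n => n%:R)
  (fun xi => Dst xi 0 x)) => k.
exact: measurable_Dst_le.
Qed.

(** [Rt] is [K * n.+1] for the first [n] at which the uniform bound holds, and [+oo] if there is
    none. With [K] positive, the successor makes it positive and so forces [r > 0] in the shape
    theorem. *)
Lemma uniform_time delta (K : R) : exists Rt : config d -> \bar R,
  [/\ measurable_fun setT Rt, forall xi, (exists n, uniform_at delta n xi) -> Rt xi \is a fin_num &
    forall xi r, (Rt xi <= r%:E)%E -> exists n, uniform_at delta n xi /\ K * n.+1%:R <= r].
Proof.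
pose first n xi := uniform_at delta n xi /\ forall j, (j < n)%N -> ~ uniform_at delta j xi.
have mf n : measurable (first n).
  apply: measurable_and; first exact: measurable_uniform_at.
  apply: measurable_all => j; apply: measurable_imp; first exact: measurable_prop.
  by apply: measurable_not; exact: measurable_uniform_at.
have spec xi : exists v : \bar R, (exists2 n, first n xi & v = (K * n.+1%:R)%:E) \/
    ((forall n, ~ uniform_at delta n xi) /\ v = +oo%E).
  have [[n0 un0]|no] := pselect (exists n, uniform_at delta n xi); last first.
    by exists +oo%E; right; split=> // n un; apply: no; exists n.
  have ex : exists n, `[< uniform_at delta n xi >] by exists n0; apply/asboolP.
  case: (ex_minnP ex) => n /asboolP un mn; exists (K * n.+1%:R)%:E; left; exists n => //.
  by split=> // j jn uj; have := mn j (asboolT uj); rewrite leqNgt jn.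
pose Rt xi := projT1 (cid (spec xi)).
have RtP xi : (exists2 n, first n xi & Rt xi = (K * n.+1%:R)%:E) \/
    ((forall n, ~ uniform_at delta n xi) /\ Rt xi = +oo%E) by rewrite /Rt; case: cid.
have fu n m xi : first n xi -> first m xi -> n = m.
  move=> [un hn] [um hm]; have [nm|mn|//] := ltngtP n m; first by have := hm _ nm un.
  by have := hn _ mn um.
exists Rt; split.
- move=> _ B mB; rewrite setTI.
  rewrite (_ : Rt @^-1` B = [set xi | exists n, first n xi /\ B (K * n.+1%:R)%:E] `|`
      [set xi | (forall n, ~ uniform_at delta n xi) /\ B +oo%E]).
    apply: measurableU.
      by apply: measurable_ex => n; apply: measurable_and; [exact: mf|exact: measurable_prop].
    apply: measurable_and; last exact: measurable_prop.
    by apply: measurable_all => n; apply: measurable_not; exact: measurable_uniform_at.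
  apply/seteqP; split=> xi /=.
    by have [[n fn ->]|[no ->]] := RtP xi; [left; exists n|right].
  have [[n fn ->]|[no ->]] := RtP xi => -[[m [fm Bm]]|[no' Bo]] //.
  + by rewrite (fu _ _ _ fn fm).
  + by case: (no' n); have [] := fn.
  + by case: (no m); have [] := fm.
- by move=> xi [n un]; have [[m _ ->]//|[no _]] := RtP xi; case: (no n).
- move=> xi r; have [[n [un _] ->]|[_ ->]] := RtP xi; last by rewrite leye_eq.
  by rewrite lee_fin => h'; exists n.
Qed.

Lemma inf_conn xi a b : infinite_part (occupied xi) a -> connected_in (occupied xi) a b ->
  infinite_part (occupied xi) b.
Proof.
move=> [Sa ia] [p hp]; split.
  by have [_ lp h'] := hp; apply: h'; rewrite -lp mem_last.
have e : component (occupied xi) b = component (occupied xi) a.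
  apply/seteqP; split=> c /= h'; first by apply: connected_trans h'; exists p.
  by apply: connected_trans h'; apply: connected_sym; exists p.
by rewrite e.
Qed.

Theorem gff_shape : shape_theorem q.
Proof.
exists (shape mu); split.
- exact: (shape_convex mu_sub mu_hom tc_lo).
- exact: (shape_compact tc_lo).
move=> eps /andP[eps0 eps1]; pose dl := eps / 4.
have dl0 : 0 < dl by rewrite divr_gt0.
(* With [K = 4 / eps], [Rt <= r] gives [n <= eps / 4 * r], so the error at [x] is at most [eps / 4]
   times the sum of its linf norm and [r]. *)
have [Rt [mR fR hR]] := uniform_time dl (4 / eps).
exists Rt; split=> //.
- have mI : measurable (@inf0 d) by exact: measurable_infinite_part.
  have mF : measurable [set xi | Rt xi \is a fin_num].
    rewrite (_ : [set xi | _] = [set xi | exists n, uniform_at dl n xi]).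
      by apply: measurable_ex => n; exact: measurable_uniform_at.
    apply/seteqP; split=> xi /=; last exact: fR.
    by move=> hf; have [|n [un _]] := hR xi (fine (Rt xi)); [rewrite fineK|exists n].
  have full1 : pr q [set xi | Rt xi \is a fin_num] = 1.
    apply/eqP; rewrite eq_le (pr_le1 q mF) /= -full_typical.2; apply: pr_le => //; first by case: full_typical.
    move=> xi tx; apply: fR; have [n hn] := typical_uniform tx dl0; exists n; split=> //.
    by have [[k [Nk gk]] _] := tx; exact: (good_regular d3 wE lE Nk gk).
  rewrite /cond_prob -/(pr q _) -/(pr q _) -/inf0.
  have -> : pr q ([set xi | Rt xi \is a fin_num] `&` inf0) = pr q inf0.
    rewrite setIC (prDI q mI mF) (_ : pr q (inf0 `&` ~` _) = 0) ?addr0//.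
    apply/eqP; rewrite eq_le pr_ge0 andbT.
    apply: le_trans (pr_le q (measurableI _ _ mI (measurableC mF)) (measurableC mF) (@subIsetr _ _ _)) _.
    by rewrite prC// full1 subrr.
  by rewrite mulfV// gt_eqF// (inf_pos d3 hphi mE wE lE pE hh).
move=> xi r i0 /hR[n [[rg un] nr]] S.
have r0 : 0 < r by apply: lt_le_trans nr; rewrite mulr_gt0// divr_gt0.
have nr' : n%:R <= dl * r.
  apply: le_trans (_ : n.+1%:R <= _); first by rewrite ler_nat.
  by rewrite -ler_pdivrMl// /dl invf_div.
have lo := tc_lo; split.
  move=> x [ix dx]; split; first by have [] := ix.
  apply/(Dst_inf _ rg i0 ix).
  have t0 : 0 <= (1 - eps) * r by rewrite mulr_ge0 ?subr_ge0 ?ltW.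
  have mx := dilate_mu mu_sub mu_hom tc_lo tc_hi t0 dx.
  have := un x; rewrite ler_distl => /andP[_ h2]; apply: le_trans h2 _.
  exact: (inner_radius_bound eps0 eps1 r0 (lo x) mx nr').
move=> x [Sx gx].
have [p hp _] : exists2 p, path_in S 0 x p & (size p)%:R <= r by apply/graph_distE.
have ix : infinite_part (occupied xi) x by apply: (inf_conn i0); exists p.
split=> //; apply: mu_dilate; first by rewrite mulr_gt0// addr_gt0.
move/(Dst_inf _ rg i0 ix) : gx => gx.
have := un x; rewrite ler_distl => /andP[h2 _].
exact: (outer_radius_bound eps0 eps1 r0 (lo x) h2 gx nr').
Qed.

End Shape.

(** * Choice of the parameter range *)

Theorem theorem2p7 (R : realType) (d : nat) (hd : (3 <= d)%N)
    (disp : measure_display) (Omega : measurableType disp)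
    (P : probability Omega R) (phi : Zd d -> {RV P >-> R}) (hphi : is_GFF phi)
    (h_star : R) (hstar : is_perc_threshold phi h_star) :
  let h (u : R) := h_star - u + 1 in
  let Pr (u : R) := excursion_law phi (h u) in
  exists u_bar : R, 1 <= u_bar /\
    [/\ P1 u_bar%:E +oo Pr, P2 u_bar%:E +oo Pr, P3 u_bar%:E +oo Pr,
        S2 u_bar%:E +oo Pr &
        exists (f_S : R -> nat -> R) (Delta_S : R -> R),
          S1 u_bar%:E +oo Pr f_S Delta_S /\
          exists2 h_bar : R, h_bar <= h_star &
            forall h0 : R, h0 < h_bar ->
              [/\ exists2 u, u_bar < u & h u = h0 /\
                    chemical_distance_bound (excursion_law phi h0) (Delta_S u) &
                  shape_theorem (excursion_law phi h0)]].
Proof.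
move=> h Pr; have [h1 [N0 [w [E [h1_le0 mE link prE]]]]] := @linking_theorem R d hd.
have wE N : (N0 <= N)%N -> wide (d := d) (w N) N by move=> NN; have [] := link N NN.
have lE N xi : (N0 <= N)%N -> E N xi -> linking N (w N) (occupied xi).
  by move=> NN; have [_ _] := link N NN; apply.
have pE := prE disp Omega P phi hphi.
(* Solves [h u_bar = h1]: beyond [u_bar] the level is strictly below [h1], with room on both sides
   for the continuity in S2. The bound [1 <= u_bar], which P3 relies on, comes from
   [h1 <= 0 <= h_star]. *)
have [hs0 _ _] := hstar; pose u_bar := h_star + 1 - h1.
have u1 : 1 <= u_bar by rewrite /u_bar; move: hs0 h1_le0; lra.
have hlt u : u_bar < u -> h u < h1 by rewrite /u_bar /h; lra.
have hle u : u_bar < u -> h u <= h1 by move=> /hlt/ltW.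
exists u_bar; split=> //; split.
- exact: gff_P1.
- exact: gff_P2.
- exact: (gff_P3 hd hphi h_star u1).
- exact: (gff_S2 hd hphi mE wE lE pE hlt).
exists (fun _ N => if (N0 <= N)%N then (ln N%:R) ^+ 2 else 0), (fun=> 1).
split; first exact: (gff_S1 hd mE wE lE pE hle).
exists h1; first by apply: le_trans hs0.
move=> h0 h01; have h0' := ltW h01; split; last exact: (gff_shape hd hphi mE wE lE pE h0').
exists (h_star + 1 - h0); first by rewrite /u_bar; move: h01; lra.
by split; [rewrite /h; ring|exact: (gff_chemical hd mE wE lE pE h0')].
Qed.
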